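(* Consider the linear model $\mathbf y=\mathbf X\boldsymbol\beta_0+\boldsymbol\varepsilon$ and the RANK procedure with estimated precision matrix $\widehat{\boldsymbol\Omega}$, reduced model $\widetilde{\mathcal S}$ with $|\widetilde{\mathcal S}|\le K_n$, and Lasso coefficient difference statistics, as described in the context. Assume that: (i) the components of $\boldsymbol\varepsilon$ are i.i.d. with a sub-Gaussian distribution; (ii) $\{n/(\log p)\}^{1/2}\min_{j\in\mathcal S_0}|\beta_{0,j}|\to\infty$ as $n\to\infty$; (iii) $\boldsymbol\Omega_0$ is $L_p$-sparse, i.e. each row has at most $L_p$ nonzero entries, for some diverging $L_p$, and all the eigenvalues of $\boldsymbol\Omega_0$ are bounded away from $0$ and $\infty$; (iv) $\mathbb P\{\widehat{\boldsymbol\Omega}\in\mathcal A\}=1-O(p^{-c_2})$ for some constant $c_2>0$, where $\mathcal A$ is the set of $p\times p$ precision matrices $\boldsymbol\Omega$ that are $L_p'$-sparse and satisfy $\|\boldsymbol\Omega-\boldsymbol\Omega_0\|_2\le C_2a_n$, with $C_2>0$ a constant, $a_n\to0$, and $L_p'$ a positive integer diverging with $n$; (v) the smallest eigenvalue of $2\,\mathrm{diag}(\mathbf s)-\mathrm{diag}(\mathbf s)\boldsymbol\Omega_0\,\mathrm{diag}(\mathbf s)$ is positive and bounded away from $0$; (vi) $\big|\{j:|\beta_{0,j}|\gg[sn^{-1}(\log p)]^{1/2}\}\big|\ge cs$ for some constant $c\in((qs)^{-1},1)$; (vii) $\lambda=C_3\{(\log p)/n\}^{1/2}$ with $C_3>0$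 some constant. If $[(L_p+L_p')^{1/2}+K_n^{1/2}]a_n=o(1)$ and $s\{a_n+(K_n+L_p')[n^{-1}(\log p)]^{1/2}\}=o(1)$, then RANK with estimated precision matrix $\widehat{\boldsymbol\Omega}$ and reduced model $\widetilde{\mathcal S}$ has asymptotic power one, i.e. $\mathbb E\big[|\widehat{\mathcal S}\cap\mathcal S_0|/|\mathcal S_0|\big]\to1$ as $n\to\infty$.
   Context: Asymptotics. $n\to\infty$; $p,s,K_n,L_p,L_p',a_n,\boldsymbol\beta_0,\boldsymbol\Omega_0,\mathbf s$ may depend on $n$; constants do not. $K_n$ are positive integers diverging with $n$. For a set of the form $\{j:|\beta_{0,j}|\gg r_n\}$, the relation $\gg$ means that the ratio $|\beta_{0,j}|/r_n$ diverges (uniformly over the set) as $n\to\infty$. ''With asymptotic probability one'' means with probability tending to $1$. $\|\cdot\|_2$ on matrices is the spectral norm. A matrix is $m$-sparse if each row has at most $m$ nonzero entries. Matrices $\boldsymbol\Omega$ are symmetric positive definite. Model. $\mathbf X\in\mathbb R^{n\times p}$ has i.i.d. rows $N(\mathbf 0,\boldsymbol\Sigma_0)$, $\boldsymbol\Sigma_0=\boldsymbol\Omega_0^{-1}$ with unit diagonal, $\boldsymbol\Omega_0$ unknown; $\boldsymbol\varepsilon$ is independent of $\mathbf X$; $\mathcal S_0=\mathrm{supp}(\boldsymbol\beta_0)$ and $s=|\mathcal S_0|$ (a number, distinct from the vector $\mathbf s$). $\mathbf s\in\mathbb R^p$ is fixed with nonnegative components and $\boldsymbol\Sigma_0-2^{-1}\mathrm{diag}(\mathbf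 s)$ positive definite. $q\in(0,1)$ is the target FDR level. RANK. Split the data randomly into two independent folds $(\mathbf X^{(k)},\mathbf y^{(k)})$, $k=1,2$, each of size $n/2$. From the first fold compute an estimate $\widehat{\boldsymbol\Omega}$ of $\boldsymbol\Omega_0$ and a reduced model $\widetilde{\mathcal S}\subset\{1,\dots,p\}$. On the second fold construct the knockoff matrix $\widehat{\mathbf X}\in\mathbb R^{(n/2)\times p}$ whose rows are generated independently (using fresh Gaussian noise independent of the data) from $$\widehat{\mathbf x}_i\mid\mathbf x_i^{(2)}\sim N\big((\mathbf I_p-\mathrm{diag}(\mathbf s)\widehat{\boldsymbol\Omega})\mathbf x_i^{(2)},\ 2\,\mathrm{diag}(\mathbf s)-\mathrm{diag}(\mathbf s)\widehat{\boldsymbol\Omega}\,\mathrm{diag}(\mathbf s)\big).$$ Let $\widetilde{\mathcal S}_1=\{1\le j\le 2p:j\notin\widetilde{\mathcal S}\text{ and }j-p\notin\widetilde{\mathcal S}\}$ and $$\widehat{\boldsymbol\beta}(\lambda;\widehat{\boldsymbol\Omega},\widetilde{\mathcal S})=\arg\min_{\mathbf b\in\mathbb R^{2p}:\ \mathbf b_{\widetilde{\mathcal S}_1}=\mathbf 0}\big\{n^{-1}\|\mathbf y^{(2)}-[\mathbf X^{(2)},\widehat{\mathbf X}]\mathbf b\|_2^2+\lambda\|\mathbf b\|_1\big\},$$ $\widehat W_j=|\widehat\beta_j(\lambda;\widehat{\boldsymbol\Omega},\widetilde{\mathcal S})|-|\widehat\beta_{p+j}(\lambda;\widehat{\boldsymbol\Omega},\widetilde{\mathcal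 S})|$ for $1\le j\le p$ (so $\widehat W_j=0$ for $j\notin\widetilde{\mathcal S}$). With $\mathcal W=\{|\widehat W_j|\}\setminus\{0\}$, $T=\min\{t\in\mathcal W:(1+|\{j:\widehat W_j\le-t\}|)/|\{j:\widehat W_j\ge t\}|\le q\}$ ($T=+\infty$ if empty) and $\widehat{\mathcal S}=\{j:\widehat W_j\ge T\}$. Standing assumptions. (1) Throughout, one conditions on the event $\{\widetilde{\mathcal S}\supset\mathcal S_0\}$ (the power is relative to the reduced model). (2) With asymptotic probability one, for all valid constructions of the knockoff variables there are no ties in the magnitude of nonzero knockoff statistics and no ties in the magnitude of nonzero components of the Lasso solution, uniformly over all $\boldsymbol\Omega\in\mathcal A$ (used in place of $\widehat{\boldsymbol\Omega}$) and all $\mathcal S$ with $|\mathcal S|\le K_n$ (used in place of $\widetilde{\mathcal S}$). *)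

(* Defs.v *)
From HB Require Import structures.
From mathcomp Require Import all_boot all_order all_algebra perm.
From mathcomp Require Import all_classical all_reals all_analysis.

Set Implicit Arguments.
Unset Strict Implicit.
Unset Printing Implicit Defensive.
Import Order.TTheory GRing.Theory Num.Theory.
Import numFieldNormedType.Exports.

Local Open Scope classical_set_scope.
Local Open Scope ring_scope.

Section MatrixNotions.
Context {R : realType}.

Definition norm1 n (v : 'cV[R]_n) : R := \sum_i `|v i 0|.
Definition norm2 n (v : 'cV[R]_n) : R := Num.sqrt (\sum_i v i 0 ^+ 2).

Definition spectral_norm m n (A : 'M[R]_(m, n)) : R :=
  sup [set norm2 (A *m v) | v in [set v : 'cV[R]_n | norm2 v <= 1]].

Definition posdef n (A : 'M[R]_n) : Prop :=
  A^T = A /\ forall v : 'cV[R]_n, v != 0 -> 0 < (v^T *m A *m v) 0 0.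

Definition possemidef n (A : 'M[R]_n) : Prop :=
  A^T = A /\ forall v : 'cV[R]_n, 0 <= (v^T *m A *m v) 0 0.

Definition row_sparse (L m n : nat) (A : 'M[R]_(m, n)) : Prop :=
  forall i, (#|[set j | A i j != 0%R]%SET| <= L)%N.

Definition supp n (v : 'cV[R]_n) : {set 'I_n} := [set i | v i 0 != 0]%SET.

Definition precision_nbhd p (Omega0 : 'M[R]_p) (L : nat) (r : R)
    : set 'M[R]_p :=
  [set Omega | [/\ posdef Omega, row_sparse L Omega &
                   spectral_norm (Omega - Omega0) <= r]].

End MatrixNotions.

Section RandomMatrices.
Context {R : realType} {d : measure_display} {T : measurableType d}.
Variable P : probability T R.

Definition sigma_mx m n (X : T -> 'M[R]_(m, n)) : set (set T) :=
  <<s [set A | exists i j, exists2 B : set R,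
         measurable B & A = (fun w => X w i j) @^-1` B] >>.

Definition sigma_fin (F : finType) (S : T -> F) : set (set T) :=
  [set A | exists B : {set F}, A = [set w | S w \in B]].

Definition random_mx m n (X : T -> 'M[R]_(m, n)) : Prop :=
  forall i j, measurable_fun [set: T] (fun w => X w i j).

Definition mutually_independent (I : finType) (F : I -> set (set T)) : Prop :=
  forall (J : {set I}) (E : I -> set T),
    (forall i, i \in J -> F i (E i)) ->
    P (\bigcap_(i in [set` J]) E i) = (\prod_(i in J) P (E i))%E.

Definition independent_seq (s : seq (set (set T))) : Prop :=
  mutually_independent (fun i : 'I_(size s) => nth set0 s i).

(* x ~ N(0, Sigma) for a positive definite Sigma: every nontrivial linear form
   is univariate normal.  The second argument of normal_prob is a standard
   deviation; u = 0 is left out because normal_prob m 0 is not a Dirac mass. *)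
Definition centered_normal p (Sigma : 'M[R]_p) (x : T -> 'rV[R]_p) : Prop :=
  forall u : 'cV[R]_p, u != 0 -> forall B : set R, measurable B ->
    P ((fun w => (x w *m u) 0 0) @^-1` B)
    = normal_prob 0 (Num.sqrt ((u^T *m Sigma *m u) 0 0)) B.

Definition iid_normal_rows m p (Sigma : 'M[R]_p) (X : T -> 'M[R]_(m, p))
    : Prop :=
  [/\ random_mx X,
      mutually_independent (fun i : 'I_m => sigma_mx (fun w => row i (X w))) &
      forall i, centered_normal Sigma (fun w => row i (X w))].

Definition iid_components n (e : T -> 'cV[R]_n) : Prop :=
  [/\ random_mx e,
      mutually_independent (fun i : 'I_n => sigma_mx (fun w => row i (e w))) &
      forall i j (B : set R), measurable B ->
        P ((fun w => e w i 0) @^-1` B) = P ((fun w => e w j 0) @^-1` B)].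

Definition sub_gaussian (kappa : R) (x : T -> R) : Prop :=
  forall t : R, 0 <= t ->
    (P [set w | (t <= `|x w|)%R] <= (2 * expR (- (t ^+ 2 / kappa ^+ 2)))%:E)%E.

Definition uniform_fin (F : finType) (S : T -> F) : Prop :=
  forall x : F, measurable [set w | S w = x] /\
    P [set w | S w = x] = ((#|F|%:R)^-1)%:E.

(* Meaningful only when P E is nonzero. *)
Definition cond_prob (E A : set T) : R := fine (P (A `&` E)) / fine (P E).
Definition cond_expect (E : set T) (f : T -> R) : R :=
  (\int[P]_(w in E) f w)%R / fine (P E).

End RandomMatrices.

(* The sample consists of m + m observations.  The random split is encoded by a
   permutation of the observations: the first m permuted ones form the first
   fold, the last m the second fold. *)
Section Procedure.
Context {R : realType}.

Definition fold1 m k (pi : 'S_(m + m)) (A : 'M[R]_(m + m, k)) : 'M[R]_(m, k) :=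
  rowsub (fun i : 'I_m => pi (lshift m i)) A.
Definition fold2 m k (pi : 'S_(m + m)) (A : 'M[R]_(m + m, k)) : 'M[R]_(m, k) :=
  rowsub (fun i : 'I_m => pi (rshift m i)) A.

Definition knockoff_cov p (s : 'rV[R]_p) (Omega : 'M[R]_p) : 'M[R]_p :=
  2 *: diag_mx s - diag_mx s *m Omega *m diag_mx s.

(* If z has i.i.d. N(0, 1) entries, the row z *m B Omega has covariance
   (B Omega)^T *m B Omega.  Nothing is required of B when the target covariance
   is not positive semidefinite, i.e. when the conditional normal law defining
   the knockoffs does not exist. *)
Definition valid_construction p (s : 'rV[R]_p) (B : 'M[R]_p -> 'M[R]_p)
    : Prop :=
  forall Omega, possemidef (knockoff_cov s Omega) ->
    (B Omega)^T *m B Omega = knockoff_cov s Omega.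

Definition knockoff m p (s : 'rV[R]_p) (B : 'M[R]_p -> 'M[R]_p)
    (Omega : 'M[R]_p) (X Z : 'M[R]_(m, p)) : 'M[R]_(m, p) :=
  X *m (1%:M - diag_mx s *m Omega)^T + Z *m B Omega.

Definition lasso_obj m k (n : nat) (lambda : R) (y : 'cV[R]_m)
    (D : 'M[R]_(m, k)) (b : 'cV[R]_k) : R :=
  n%:R^-1 * norm2 (y - D *m b) ^+ 2 + lambda * norm1 b.

Definition lasso_feasible p (S : {set 'I_p}) (b : 'cV[R]_(p + p)) : Prop :=
  forall j, j \notin S -> b (lshift p j) 0 = 0 /\ b (rshift p j) 0 = 0.

(* b minimizes the Lasso objective for the second fold (X, y) of a sample of
   size m + m; the residual sum of squares is scaled by the full size m + m. *)
Definition is_lasso m p (lambda : R) (S : {set 'I_p}) (X Xk : 'M[R]_(m, p))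
    (y : 'cV[R]_m) (b : 'cV[R]_(p + p)) : Prop :=
  lasso_feasible S b /\
  forall b', lasso_feasible S b' ->
    lasso_obj (m + m) lambda y (row_mx X Xk) b
    <= lasso_obj (m + m) lambda y (row_mx X Xk) b'.

Definition lcd_stat p (b : 'cV[R]_(p + p)) : 'cV[R]_p :=
  \col_j (`|b (lshift p j) 0| - `|b (rshift p j) 0|).

Definition no_ties k (v : 'cV[R]_k) : Prop :=
  forall i j, i != j -> v i 0 != 0 -> `|v i 0| != `|v j 0|.

(* The ratio is +oo when its denominator is 0, hence the first conjunct. *)
Definition fdr_ratio_le p (q : R) (W : 'cV[R]_p) (t : R) : bool :=
  (0 < #|[set j | (t <= W j 0)%R]%SET|)%N &&
  ((1 + #|[set j | W j 0 <= - t]%SET|%:R) / #|[set j | t <= W j 0]%SET|%:R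
     <= q).

Definition knockoff_threshold p (q : R) (W : 'cV[R]_p) : \bar R :=
  \big[Order.min/+oo%E]_(j | (W j 0 != 0) && fdr_ratio_le q W `|W j 0|)
     (`|W j 0|)%:E.

Definition knockoff_select p (q : R) (W : 'cV[R]_p) : {set 'I_p} :=
  [set j | (knockoff_threshold q W <= (W j 0)%:E)%E]%SET.

Definition tpp p (S S0 : {set 'I_p}) : R := #|S :&: S0|%:R / #|S0|%:R.

End Procedure.

(* Main.v *)
Require Import Defs.
From HB Require Import structures.
From mathcomp Require Import all_boot all_order all_algebra perm.
From mathcomp Require Import all_classical all_reals all_analysis.
From mathcomp Require Import measurable_realfun ring lra zify.

Set Implicit Arguments.
Unset Strict Implicit.
Unset Printing Implicit Defensive.
Import Order.TTheory GRing.Theory Num.Theory.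
Import numFieldNormedType.Exports.

Local Open Scope classical_set_scope.
Local Open Scope ring_scope.

(* Conditionally on the first fold, on the noise and on the split, the second-fold
   design [X, Xk] is V A, where V has i.i.d. N(0, 1) entries and A is a fixed matrix
   whose singular values are bounded above and below, because Omegahat is close to
   Omega0.  Hence the Gram matrix of the columns kept by the reduced model is well
   conditioned with high probability.

   Let u be the (nearly) optimal Lasso solution for the response eps alone, with no
   signal, computed by finitely many proximal gradient steps.  As a function of V
   it is odd, and Lipschitz on the event that the Gram matrix is well conditioned;
   Gaussian concentration makes every coordinate of u small compared with
   min_j |beta_j|, whatever the noise vector is, as long as |eps|^2 / n is bounded
   by a slowly diverging sequence.  Comparing the variational inequalities of u and
   of the Lasso solution b gives |b - beta - u|_2 = O(lambda sqrt s).  Since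
   lambda = o(min_j |beta_j|), only o(s) coordinates of b - beta exceed a quarter of
   min_j |beta_j|.  So, with t half of min_j |beta_j|, all but o(s) of the signals
   have a statistic above t and only o(s) indices have a statistic below -t; as q s
   stays above 1 by a constant factor, the knockoff threshold is at most t. *)

(** * Product measures and property (tau) *)

(** Two obstacles shape the proof. The conditioning event E1 merely has positive probability,
    possibly tending to 0, so every failure bound must carry the factor P(E1); this is achieved by
    exact independence of the second fold from the event, for the whitened design as well as for the
    noise. Proximal iterates stand for the exact null Lasso because oddness, measurability and a
    Lipschitz constant uniform in the number of steps follow by induction; oddness also dispenses
    with computing a mean. With kap = sqrt(n / log p) min_j |beta_j|, the noise is cut at |eps|^2 /
    n <= kap: this fails with probability O(1 / kap), while the Gaussian exponent for u is still of
    order kap log p. *)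

Section ProductProbability.
Context {R : realType} {d1 d2 : measure_display}
  {T1 : measurableType d1} {T2 : measurableType d2}.
Variables (P : probability T1 R) (Q : probability T2 R).

Definition prod_prob : set (T1 * T2) -> \bar R := (P \x Q)%E.

HB.instance Definition _ := Measure.on prod_prob.

Let prod_prob_setT : prod_prob setT = 1%E.
Proof.
rewrite /prod_prob -setXTT product_measure1E//.
by rewrite -[RHS]mule1; congr (_ * _)%E; exact: probability_setT.
Qed.

HB.instance Definition _ :=
  Measure_isProbability.Build _ _ _ prod_prob prod_prob_setT.

End ProductProbability.

(** * Finite powers of a probability measure *)

Section TupleProbability.
Context {R : realType} {d : measure_display} {T : measurableType d}.
Local Open Scope ereal_scope.

Definition tcons n (z : T * n.-tuple T) : n.+1.-tuple T := [tuple of z.1 :: z.2].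

Lemma measurable_tcons n : measurable_fun setT (@tcons n).
Proof. exact: measurable_cons. Qed.

HB.instance Definition _ n :=
  isMeasurableFun.Build _ _ _ _ (@tcons n) (@measurable_tcons n).

(** A pushforward of a binary product at each stage, so that Tonelli peels off one coordinate at a
    time; the tensorization of property (tau) follows this recursion. *)
Fixpoint prodN (P : probability T R) n : probability (n.-tuple T) R :=
  if n is k.+1 then distribution (prod_prob P (prodN P k)) (@tcons k)
  else dirac [tuple].

Lemma integral_prodNS (P : probability T R) n (f : n.+1.-tuple T -> \bar R) :
  measurable_fun [set: n.+1.-tuple T] f -> (forall t, 0 <= f t) ->
  \int[prodN P n.+1]_t f t = \int[P]_x \int[prodN P n]_t f (tcons (x, t)).
Proof.
move=> mf f0; rewrite ge0_integral_distribution//.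
rewrite /prod_prob fubini_tonelli1//.
  by apply: measurableT_comp => //; exact: measurable_tcons.
by move=> z; exact: f0.
Qed.

Lemma integral_prodN0 (P : probability T R) (f : 0.-tuple T -> \bar R) :
  measurable_fun [set: 0.-tuple T] f -> (forall t, 0 <= f t) ->
  \int[prodN P 0]_t f t = f [tuple].
Proof. by move=> mf f0; rewrite integral_dirac// diracT mul1e. Qed.

Lemma emeasurable_prod d' (U : measurableType d') (I : Type) (r : seq I)
    (h : I -> U -> \bar R) :
  (forall i, measurable_fun setT (h i)) ->
  measurable_fun setT (fun t : U => \prod_(i <- r) h i t).
Proof.
move=> mh; elim: r => [|i r IH].
  by under eq_fun do rewrite big_nil; exact: measurable_cst.
by under eq_fun do rewrite big_cons; exact: emeasurable_funM.
Qed.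

Lemma tnth_tcons0 n (z : T * n.-tuple T) : tnth (tcons z) ord0 = z.1.
Proof. by []. Qed.

Lemma tnth_tconsS n (z : T * n.-tuple T) i :
  tnth (tcons z) (lift ord0 i) = tnth z.2 i.
Proof. by rewrite /tcons tnthS. Qed.

Lemma integral_prodN_prod (P : probability T R) n (h : 'I_n -> T -> \bar R) :
  (forall i, measurable_fun setT (h i)) -> (forall i x, 0 <= h i x) ->
  \int[prodN P n]_t (\prod_(i < n) h i (tnth t i)) =
  \prod_(i < n) \int[P]_x h i x.
Proof.
elim: n h => [|n IH] h mh h0.
  rewrite integral_prodN0 ?big_ord0//.
    by under eq_fun do rewrite big_ord0; exact: measurable_cst.
  by move=> t; rewrite big_ord0.
have mp k (g : 'I_k -> T -> \bar R) : (forall i, measurable_fun setT (g i)) ->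
    measurable_fun [set: k.-tuple T] (fun t : k.-tuple T => \prod_(i < k) g i (tnth t i)).
  move=> mg; apply: emeasurable_prod => i.
  by apply: measurableT_comp => //; exact: measurable_tnth.
have pos k (g : 'I_k -> T -> \bar R) (t : k.-tuple T) : (forall i x, 0 <= g i x) ->
    0 <= \prod_(i < k) g i (tnth t i).
  by move=> g0; apply: prode_ge0.
rewrite integral_prodNS//; [|exact: mp|by move=> t; exact: pos].
transitivity (\int[P]_x (h ord0 x * \prod_(i < n) \int[P]_y h (lift ord0 i) y)).
  apply: eq_integral => x _.
  rewrite -(IH (fun i => h (lift ord0 i)))// -ge0_integralZl//.
  - apply: eq_integral => t _; rewrite big_ord_recl tnth_tcons0 /=; congr (_ * _).
    by apply: eq_bigr => i _; rewrite tnth_tconsS.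
  - exact: (mp n (fun i => h (lift ord0 i))).
  - by move=> t _; exact: (pos n (fun i => h (lift ord0 i))).
rewrite ge0_integralZr//= ?big_ord_recl//.
by apply: prode_ge0 => i _; apply: integral_ge0.
Qed.

Definition boxes (G : set (set T)) n : set (set (n.-tuple T)) :=
  [set A | exists2 E : 'I_n -> set T, (forall i, G (E i)) &
                                      A = [set t | forall i, E i (tnth t i)]].

Lemma setI_closed_boxes G n : setI_closed G -> setI_closed (@boxes G n).
Proof.
move=> GI _ _ [E GE ->] [F GF ->]; exists (fun i => E i `&` F i).
  by move=> i; exact: GI.
by apply/seteqP; split=> t /= => [[Et Ft] i|EFt]; [|split=> i; have [] := EFt i].
Qed.

Lemma boxesT (G : set (set T)) n : G setT -> @boxes G n setT.
Proof. by move=> GT; exists (fun=> setT) => //; apply/seteqP; split. Qed.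

Lemma measurable_box n (E : 'I_n -> set T) :
  (forall i, measurable (E i)) -> measurable [set t | forall i, E i (tnth t i)].
Proof.
move=> mE; rewrite (_ : [set _ | _] =
    \big[setI/setT]_(i < n) ((fun t : n.-tuple T => tnth t i) @^-1` E i)).
  apply: bigsetI_measurable => i _; rewrite -[X in measurable X]setTI.
  by apply: measurable_tnth.
rewrite -bigcap_seq.
apply/seteqP; split => t /=; first by move=> Et i _; exact: Et.
by move=> Et i; apply: Et; rewrite /= mem_index_enum.
Qed.

Lemma measurable_boxes (G : set (set T)) n : G setT -> measurable = <<s G >> ->
  @measurable _ (n.-tuple T) = <<s @boxes G n >>.
Proof.
move=> GT mG; apply/seteqP; split.
  apply: smallest_sub; first exact: smallest_sigma_algebra.
  move=> A; rewrite -bigcup_seq /= => -[i _ [B mB <-]].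
  rewrite setTI.
  have := mB; rewrite mG.
  (* Good-sets argument: [D] is a sigma-algebra, and it contains [G] because a cylinder over a set
     of [G] is a box, the other sides being [setT]. *)
  pose D := [set B : set T | <<s @boxes G n >> ((fun t => tnth t i) @^-1` B)].
  move=> /(_ D); apply; split; last first.
    move=> C GC; apply: sub_sigma_algebra.
    exists (fun j => if j == i then C else setT).
      by move=> j; case: ifP.
    apply/seteqP; split=> t /=; first by move=> Ct j; case: eqP => [->|].
    by move/(_ i); rewrite eqxx.
  have [h0 hD hU] := @smallest_sigma_algebra _ setT (@boxes G n).
  split.
  - by rewrite /D /= preimage_set0.
  - move=> C; rewrite /D /= => hC.
    by have := hD _ hC; rewrite !setTD preimage_setC.
  - by move=> F hF; rewrite /D /= preimage_bigcup; exact: hU.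
apply: smallest_sub; first exact: sigma_algebra_measurable.
move=> _ [E GE ->]; apply: measurable_box => i; rewrite mG.
exact: sub_sigma_algebra.
Qed.

Lemma prodN_box (P : probability T R) n (E : 'I_n -> set T) :
  (forall i, measurable (E i)) ->
  prodN P n [set t | forall i, E i (tnth t i)] = \prod_(i < n) P (E i).
Proof.
move=> mE.
transitivity (\int[prodN P n]_t (\prod_(i < n) (\1_(E i) (tnth t i))%:E)).
  rewrite -[LHS]mul1e -integral_cst; last exact: measurable_box.
  rewrite integral_mkcond; apply: eq_integral => t _.
  rewrite patchE; case: ifPn => [|] Et.
    rewrite big1// => i _; rewrite indicE mem_set//.
    by move: Et; rewrite inE; exact.
  have [i Ei] : exists i, ~ E i (tnth t i).
    by apply/not_existsP => H; move/negP: Et; apply; rewrite inE => i; apply: contrapT; exact: H.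
  by rewrite (bigD1 i)//= indicE memNset// mul0e.
rewrite (integral_prodN_prod P (h := fun i x => (\1_(E i) x)%:E)) //.
  by apply: eq_bigr => i _; rewrite integral_indic// setIT.
by move=> i; apply/measurable_EFinP; exact: measurable_indic.
Qed.

(** The factor [r] serves for the law of a vector restricted to an event of probability [r]:
    independence of that event from the vector is then an identity on boxes. *)
Lemma prodN_unique (P : probability T R) n (G : set (set T)) (r : R)
    (mu : {measure set (n.-tuple T) -> \bar R}) :
  G setT -> setI_closed G -> measurable = <<s G >> -> (0 <= r)%R ->
  (forall E : 'I_n -> set T, (forall i, G (E i)) ->
     mu [set t | forall i, E i (tnth t i)] = r%:E * \prod_(i < n) P (E i)) ->
  forall A, measurable A -> mu A = r%:E * prodN P n A.
Proof.
move=> GT GI mG r0 muE A mA.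
have GM B : G B -> measurable B by rewrite mG; exact: sub_sigma_algebra.
have H B : boxes G B -> mu B = mscale (NngNum r0) (prodN P n) B.
  move=> [E GE ->]; rewrite muE// /mscale /= prodN_box// => i.
  exact/GM/GE.
rewrite (@measure_unique _ R (n.-tuple T) (@boxes G n) (fun=> setT)
  (measurable_boxes n GT mG) (setI_closed_boxes GI) _ _ mu
   (mscale (NngNum r0) (prodN P n)) H)//.
- by move=> _; exact: boxesT.
- by rewrite bigcup_const.
- move=> _; rewrite H; last exact: boxesT.
  by rewrite /mscale/= probability_setT mule1 ltry.
Qed.

End TupleProbability.

Section ComparisonSets.
Context {R : realType} {d : measure_display} {T : measurableType d}.

Lemma measurable_set_lt (f g : T -> R) : measurable_fun setT f ->
  measurable_fun setT g -> measurable [set x | f x < g x].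
Proof.
move=> mf mg; have := measurable_fun_ltr mf mg.
move=> /(_ measurableT [set true]); rewrite setTI; exact.
Qed.

Lemma measurable_set_le (f g : T -> R) : measurable_fun setT f ->
  measurable_fun setT g -> measurable [set x | f x <= g x].
Proof.
move=> mf mg; have := measurable_fun_ler mf mg.
move=> /(_ measurableT [set true]); rewrite setTI; exact.
Qed.

End ComparisonSets.

Section TauProperty.
Context {R : realType} {d : measure_display} {T : measurableType d}.
Local Open Scope ereal_scope.

(* Maurey's property (tau) for the cost [c], in a two-function form that
   tensorizes.  For the standard normal law the cost is [(x + y)^2 / 4] rather than
   [(x - y)^2 / 4], the law being symmetric: the concentration of an odd function
   then follows directly, also when it is Lipschitz on a subset only. *)
Definition tau_property (P : probability T R) (c : T -> T -> R) : Prop :=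
  forall u w : T -> \bar R, measurable_fun setT u -> measurable_fun setT w ->
    (forall x, 0 <= u x) -> (forall x, 0 <= w x) ->
    (forall x y, u x * w y <= (expR (c x y))%:E) ->
    \int[P]_x u x * \int[P]_x w x <= 1.

End TauProperty.

Section TauTensor.
Context {R : realType} {d : measure_display} {T : measurableType d}.
Local Open Scope ereal_scope.

(** Integrating out the tail turns [u] and [w] into functions of the head, to which the
    one-dimensional property applies: for fixed heads x and y, the inductive property for exp(- c x
    y) u(x, .) and w(y, .) is exactly the pointwise hypothesis that it asks for. *)
Lemma tau_property_prodN (P : probability T R) (c : T -> T -> R) n :
  tau_property P c ->
  tau_property (prodN P n) (fun s t => \sum_(i < n) c (tnth s i) (tnth t i))%R.
Proof.
move=> tauP; elim: n => [|n IH] u w mu mw u0 w0 uw.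
  rewrite !integral_prodN0//; have := uw [tuple] [tuple].
  by rewrite big_ord0 expR0.
rewrite !integral_prodNS//.
have mcons (f : n.+1.-tuple T -> \bar R) : measurable_fun [set: n.+1.-tuple T] f ->
    measurable_fun setT (f \o @tcons _ T n).
  by move=> mf; apply: measurableT_comp => //; exact: measurable_tcons.
have mpair (f : n.+1.-tuple T -> \bar R) x : measurable_fun [set: n.+1.-tuple T] f ->
    measurable_fun [set: n.-tuple T] (fun t => f (tcons (x, t))).
  move=> mf; apply: (measurableT_comp (mcons _ mf)); exact: pair1_measurable.
apply: tauP => [||x|y|x y].
- exact: (measurable_fun_fubini_tonelli_F (m2 := prodN P n) (u \o @tcons _ T n) (mcons _ mu) (fun z => u0 _)).
- exact: (measurable_fun_fubini_tonelli_F (m2 := prodN P n) (w \o @tcons _ T n) (mcons _ mw) (fun z => w0 _)).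
- by apply: integral_ge0.
- by apply: integral_ge0.
set e := expR (c x y).
have e0 : (0 < e)%R by exact: expR_gt0.
have : (e^-1)%:E * (\int[prodN P n]_t u (tcons (x, t))) *
     \int[prodN P n]_t w (tcons (y, t)) <= 1.
  have -> : (e^-1)%:E * (\int[prodN P n]_t u (tcons (x, t))) =
      \int[prodN P n]_t ((e^-1)%:E * u (tcons (x, t))).
    rewrite ge0_integralZl//; first exact: mpair.
    by rewrite lee_fin invr_ge0 ltW.
  apply: IH.
  - by apply: emeasurable_funM => //; exact: mpair.
  - exact: mpair.
  - by move=> t; rewrite mule_ge0// lee_fin invr_ge0 ltW.
  - by move=> t.
  - move=> s t; have := uw (tcons (x, s)) (tcons (y, t)).
    rewrite big_ord_recl !tnth_tcons0 expRD -/e => H.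
    rewrite -muleA muleC lee_pdivrMr// -EFinM mulrC.
    apply: (le_trans H); rewrite lee_fin ler_wpM2l ?(ltW e0)//.
    rewrite ler_expR; apply: ler_sum => i _.
    by rewrite !tnth_tconsS.
by rewrite -muleA muleC lee_pdivrMr// mul1e.
Qed.

End TauTensor.

(** * Prekopa-Leindler inequality on the line for a Gaussian bound *)

Section Tau1D.
Context {R : realType}.
Notation mu := (@lebesgue_measure R).
Notation GR := (measurableTypeR R).
Local Open Scope ereal_scope.

Lemma layer_cake (f : R -> R) : measurable_fun setT f -> (forall x, 0 <= f x)%R ->
  \int[mu]_x (f x)%:E = \int[mu]_(t in `]0%R, +oo[) mu [set x | (t < f x)%R].
Proof.
move=> mf f0.
pose g (z : GR * GR) : \bar R := (\1_[set z : GR * GR | (0 < z.2 < f z.1)%R] z)%:E.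
have mg : measurable_fun setT g.
  apply/measurable_EFinP; apply: measurable_indic.
  rewrite (_ : [set _ | _] = [set z : GR * GR | (0 < z.2)%R] `&` [set z : GR * GR | (z.2 < f z.1)%R]); last first.
    by apply/seteqP; split => z /=; [move/andP|move=> [-> ->]].
  apply: measurableI; apply: measurable_set_lt => //.
  by apply: measurableT_comp => //; exact: measurable_fst.
have g0 z : 0 <= g z by rewrite lee_fin.
transitivity (\int[mu]_x \int[mu]_t g (x, t)).
  apply: eq_integral => x _.
  transitivity (\int[mu]_t (\1_(`]0%R, f x[) t)%:E).
    rewrite integral_indic//= setIT.
    transitivity (@lebesgue_measure R `]0%R, f x[%classic); last by [].
    rewrite lebesgue_measure_itv/= lte_fin oppr0 adde0.
    by case: ltP (f0 x) => // fx0 fx0'; congr EFin; apply/eqP; rewrite eq_le fx0 fx0'.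
  by apply: eq_integral => t _; rewrite /g; congr (_%:E); rewrite !indicE;
    congr (_ %:R); apply/idP/idP; rewrite !inE /= in_itv.
rewrite (fubini_tonelli g)//.
rewrite [RHS]integral_mkcond; apply: eq_integral => t _.
rewrite patchE; case: ifPn => t0.
  rewrite -[in RHS](setIT [set x | _]) -integral_indic//; last exact: measurable_set_lt.
  apply: eq_integral => x _; rewrite /g; congr (_%:E); rewrite !indicE.
  have {}t0 : (0 < t)%R by move: t0; rewrite inE /= in_itv /= andbT.
  rewrite (_ : ((x, t) \in _) = (x \in [set x | (t < f x)%R]))//.
  by apply/idP/idP; rewrite !inE /= t0.
apply: integral0_eq => x _; rewrite /g indicE memNset//=.
by move: t0; rewrite notin_setE/= in_itv/= andbT => /negP /negbTE ->.
Qed.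

Lemma lebesgue_le_itv (A : set R) (a b : R) : measurable A -> (a <= b)%R ->
  (forall x, A x -> (a <= x <= b)%R) -> mu A <= (b - a)%:E.
Proof.
move=> mA ab Aab.
have -> : (b - a)%:E = mu `[a, b]%classic.
  rewrite lebesgue_measure_itv/= lte_fin; case: ltP => // ba.
  by congr EFin; apply/eqP; rewrite subr_eq0 eq_le ab ba.
apply: le_measure; rewrite ?inE//.
Qed.

(** One-dimensional Brunn-Minkowski for A and -B: A lies in [inf A, sup A] and B in
    [sup A - r, inf A + r], and the two lengths add up to 2 r. *)
Lemma lebesgue_le_diffset (A B : set R) (r : R) : measurable A -> measurable B ->
  A !=set0 -> B !=set0 -> (forall x y, A x -> B y -> (`|x - y| <= r)%R) ->
  mu A + mu B <= (2 * r)%:E.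
Proof.
move=> mA mB [x0 Ax0] [y0 By0] AB.
have hA : has_sup A.
  split; first by exists x0.
  by exists (y0 + r)%R => x Ax; have := AB _ _ Ax By0; rewrite ler_norml => /andP[]; lra.
have hiA : has_inf A.
  split; first by exists x0.
  by exists (y0 - r)%R => x Ax; have := AB _ _ Ax By0; rewrite ler_norml => /andP[]; lra.
have A1 x : A x -> (inf A <= x <= sup A)%R.
  by move=> Ax; rewrite (ge_inf hiA.2)//= (ub_le_sup hA.2).
have B1 y : B y -> (sup A - r <= y <= inf A + r)%R.
  move=> By; apply/andP; split.
    rewrite lerBlDr; apply: ge_sup; first by exists x0.
    by move=> x Ax; have := AB _ _ Ax By; rewrite ler_norml => /andP[]; lra.
  rewrite -lerBlDr; apply: lb_le_inf; first by exists x0.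
  by move=> x Ax; have := AB _ _ Ax By; rewrite ler_norml => /andP[]; lra.
have -> : (2 * r)%:E = (sup A - inf A)%:E + ((inf A + r) - (sup A - r))%:E.
  by rewrite -EFinD; congr EFin; lra.
apply: leeD; apply: lebesgue_le_itv => //.
- by have := A1 _ Ax0; lra.
- by have := B1 _ By0; lra.
Qed.

(** With h(z) = C exp(- z^2 / 2), the hypothesis says f(x) g(y) <= h((x - y) / 2)^2. If f(x) and
    g(y) exceed t, so does h((x - y) / 2); hence the level sets of f and g have total length at most
    twice that of h, and integration over t concludes. The normalization of both suprema to 1 makes
    the two level sets nonempty for the same t, as Brunn-Minkowski requires. *)
Lemma prekopa_leindler_gauss (f g : R -> R) (C : R) :
  measurable_fun setT f -> measurable_fun setT g ->
  (forall x, 0 <= f x <= 1)%R -> (forall x, 0 <= g x <= 1)%R ->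
  (forall t, t < 1 -> exists x, t < f x)%R ->
  (forall t, t < 1 -> exists x, t < g x)%R ->
  (0 < C)%R ->
  (forall x y, f x * g y <= C ^+ 2 * expR (- ((x - y) ^+ 2 / 4)))%R ->
  \int[mu]_x (f x)%:E + \int[mu]_x (g x)%:E <=
  2%:E * \int[mu]_x (C * expR (- (x ^+ 2 / 2)))%:E.
Proof.
move=> mf mg f01 g01 fsup gsup C0 fg.
have mlev (h : R -> R) : measurable_fun setT h ->
   measurable_fun setT (fun t : R => mu [set x | (t < h x)%R]).
  move=> mh.
  have mS : measurable [set z : GR * GR | (z.1 < h z.2)%R].
    by apply: measurable_set_lt => //; apply: measurableT_comp => //.
  have := measurable_fun_xsection mu mS.
  congr (measurable_fun _ _); apply/funext => t /=; congr (mu _).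
  by apply/seteqP; split => x; rewrite /xsection /= inE.
have mh : measurable_fun setT (fun x : R => C * expR (- (x ^+ 2 / 2)))%R.
  apply: measurable_funM => //; apply: measurableT_comp => //.
  by apply: measurableT_comp => //; apply: measurable_funM => //; apply: measurable_funX.
rewrite !layer_cake//; last 3 first.
- by move=> x; rewrite mulr_ge0 ?expR_ge0// ltW.
- by move=> x; case/andP: (g01 x).
- by move=> x; case/andP: (f01 x).
rewrite -ge0_integralD//; last 2 first.
- exact: measurable_funTS (mlev _ mf).
- exact: measurable_funTS (mlev _ mg).
rewrite -ge0_integralZl//; last exact: measurable_funTS (mlev _ mh).
apply: ge0_le_integral => //.
- by move=> t _; apply: adde_ge0.
- apply: emeasurable_funD; exact: measurable_funTS (mlev _ _).
- apply: emeasurable_funM => //; exact: measurable_funTS (mlev _ _).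
move=> t; rewrite /= in_itv/= andbT => t0.
have [t1|t1] := leP 1%R t.
  rewrite (_ : [set x | (t < f x)%R] = set0); last first.
    by apply/seteqP; split => // x /=; case/andP: (f01 x) => _ /le_trans/(_ t1); rewrite leNgt => /negP.
  rewrite (_ : [set x | (t < g x)%R] = set0); last first.
    by apply/seteqP; split => // x /=; case/andP: (g01 x) => _ /le_trans/(_ t1); rewrite leNgt => /negP.
  by rewrite !measure0 add0e mule_ge0.
have lt_h x y : (t < f x -> t < g y -> t ^+ 2 < C ^+ 2 * expR (- ((x - y) ^+ 2 / 4)))%R.
  move=> tf tg; apply: lt_le_trans (fg x y).
  by rewrite expr2; apply: ltr_pM => //; exact: ltW.
have [[x0 tx0] [y0 ty0]] := (fsup _ t1, gsup _ t1).
(* Half-length of the interval on which C exp(- z^2 / 2) exceeds t. *)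
pose r : R := Num.sqrt (2 * ln (C / t)).
have hr2 z : (t < C * expR (- (z ^+ 2 / 2)))%R -> (z ^+ 2 < 2 * ln (C / t))%R.
  move=> H; have : (expR (z ^+ 2 / 2) < C / t)%R.
    rewrite ltr_pdivlMr// mulrC -ltr_pdivlMr ?expR_gt0//.
    by rewrite -expRN.
  rewrite -ltr_ln ?posrE ?expR_gt0 ?divr_gt0//.
  by rewrite expRK; lra.
have hr2' z : (z ^+ 2 < 2 * ln (C / t))%R -> (t < C * expR (- (z ^+ 2 / 2)))%R.
  move=> H; rewrite -ltr_pdivrMl//.
  rewrite -[X in (X < _)%R]lnK ?posrE ?mulr_gt0 ?invr_gt0//.
  rewrite ltr_expR.
  have -> : (C^-1 * t = (C / t)^-1)%R by rewrite invf_div mulrC.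
  by rewrite lnV ?posrE ?divr_gt0//; lra.
have hxy x y : (t < f x -> t < g y -> t < C * expR (- (((x - y) / 2) ^+ 2 / 2)))%R.
  move=> tf tg; have := lt_h _ _ tf tg.
  have -> : (C ^+ 2 * expR (- ((x - y) ^+ 2 / 4)) =
      (C * expR (- (((x - y) / 2) ^+ 2 / 2))) ^+ 2)%R.
    rewrite exprMn -[in RHS]expRM_natl; congr (_ * expR _)%R.
    by rewrite -mulr_natl; field.
  by rewrite ltr_pXn2r// ?nnegrE ?(ltW t0)// mulr_ge0 ?expR_ge0// ltW.
have r2pos : (0 <= 2 * ln (C / t))%R.
  by apply: ltW; apply: le_lt_trans (hr2 _ (hxy _ _ tx0 ty0)); exact: sqr_ge0.
have rsq : (r ^+ 2 = 2 * ln (C / t))%R by rewrite sqr_sqrtr.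
have -> : [set x | (t < C * expR (- (x ^+ 2 / 2)))%R] = `](- r)%R, r[%classic.
  apply/seteqP; split => z /=.
    move=> /hr2; rewrite -rsq in_itv/= -ltr_norml -real_normK ?num_real//.
    by rewrite ltr_pXn2r// ?nnegrE ?sqrtr_ge0.
  rewrite in_itv/= -ltr_norml => H; apply: hr2'; rewrite -rsq -real_normK ?num_real//.
  by rewrite ltr_pXn2r// ?nnegrE ?sqrtr_ge0.
rewrite lebesgue_measure_itv/= lte_fin.
have r0 : (0 < r)%R.
  rewrite sqrtr_gt0; apply: le_lt_trans (hr2 _ (hxy _ _ tx0 ty0)).
  exact: sqr_ge0.
rewrite (_ : (- r < r)%R); last by lra.
rewrite -EFinD -EFinM.
rewrite (_ : 2 * (r - - r) = 2 * (2 * r))%R; last by lra.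
apply: lebesgue_le_diffset.
- exact: measurable_set_lt.
- exact: measurable_set_lt.
- by exists x0.
- by exists y0.
- move=> x y /= tx ty; have := hr2 _ (hxy _ _ tx ty).
  rewrite -rsq -real_normK ?num_real// ltr_pXn2r// ?nnegrE ?sqrtr_ge0//.
  rewrite normrM [X in (_ * X)%R]ger0_norm ?invr_ge0// => /ltW.
  by rewrite ler_pdivrMr// mulrC.
Qed.

End Tau1D.

(** * Measures with a density, and property (tau) for the standard normal law *)

Section DensityMeasure.
Context {R : realType} {d : measure_display} {T : measurableType d}.
Variable mu : {measure set T -> \bar R}.
Local Open Scope ereal_scope.

(** The proofs [mg] and [g0] are arguments so that the measure structure can be attached to the term
    itself. *)
Definition density_measure (g : T -> \bar R) (mg : measurable_fun setT g)
  (g0 : forall x, 0 <= g x) (A : set T) : \bar R := \int[mu]_(x in A) g x.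

Variables (g : T -> \bar R) (mg : measurable_fun setT g) (g0 : forall x, 0 <= g x).

Let density_measure0 : density_measure mg g0 set0 = 0.
Proof. by rewrite /density_measure integral_set0. Qed.

Let density_measure_ge0 A : 0 <= density_measure mg g0 A.
Proof. by apply: integral_ge0. Qed.

Let density_measure_additive : semi_sigma_additive (density_measure mg g0).
Proof.
move=> F mF tF mUF.
rewrite /density_measure ge0_integral_bigcup//; last exact: measurable_funTS.
by apply: is_cvg_ereal_nneg_natsum_cond => n _ _; apply: integral_ge0.
Qed.

HB.instance Definition _ := isMeasure.Build _ _ _ (density_measure mg g0)
  density_measure0 density_measure_ge0 density_measure_additive.

Import HBNNSimple.

Let integral_density_nnsfun (h : {nnsfun T >-> R}) :
  \int[density_measure mg g0]_x (h x)%:E = \int[mu]_x ((h x)%:E * g x).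
Proof.
under [LHS]eq_integral do rewrite fimfunE -fsumEFin//.
rewrite [LHS]ge0_integral_fsum//; last 2 first.
  - by move=> r; exact/measurable_EFinP/measurableT_comp.
  - by move=> n x _; rewrite EFinM nnfun_muleindic_ge0.
under [RHS]eq_integral.
  move=> x xD; rewrite fimfunE -fsumEFin// ge0_mule_fsuml; last first.
    by move=> r; rewrite EFinM nnfun_muleindic_ge0.
  over.
rewrite [RHS]ge0_integral_fsum//; last 2 first.
  - move=> r; apply: emeasurable_funM => //; apply/measurable_EFinP.
    by apply/measurableT_comp => //.
  - by move=> n x _; rewrite mule_ge0// EFinM nnfun_muleindic_ge0.
apply: eq_fsbigr => r /[!inE] -[y _ <-].
have mA : measurable (h @^-1` [set h y]) by [].
transitivity ((h y)%:E * density_measure mg g0 (h @^-1` [set h y])).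
  under eq_integral do rewrite EFinM.
  rewrite ge0_integralZl//.
  - by rewrite integral_indic// setIT.
  - exact/measurable_EFinP.
  - by rewrite lee_fin.
under eq_integral do rewrite EFinM -muleA.
rewrite ge0_integralZl//.
- congr (_ * _); rewrite /density_measure integral_mkcond.
  apply: eq_integral => x _; rewrite patchE indicE.
  by case: (x \in _); rewrite ?mul1e ?mul0e.
- by apply: emeasurable_funM => //; exact/measurable_EFinP.
- by move=> x _; rewrite mule_ge0// lee_fin.
- by rewrite lee_fin.
Qed.

Lemma ge0_integral_density (f : T -> \bar R) :
  measurable_fun setT f -> (forall x, 0 <= f x) ->
  \int[density_measure mg g0]_x f x = \int[mu]_x (f x * g x).
Proof.
move=> mf f0; pose f_ := nnsfun_approx measurableT mf.
transitivity (limn (fun n => \int[density_measure mg g0]_x (f_ n x)%:E)).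
  rewrite -monotone_convergence//=.
  - by apply: eq_integral => x _; apply/esym/cvg_lim => //=; exact: cvg_nnsfun_approx.
  - by move=> n; exact/measurable_EFinP.
  - by move=> n x _; rewrite lee_fin.
  - by move=> x _ a b ab; rewrite lee_fin; exact/lefP/nd_nnsfun_approx.
under eq_fun do rewrite integral_density_nnsfun.
rewrite -monotone_convergence//=.
- apply: eq_integral => x _; apply/cvg_lim => //=.
  have [gx|gx] := boolP (g x \is a fin_num).
    by apply: cvgeZr => //; exact: cvg_nnsfun_approx.
  (* Multiplication by an infinite factor is not continuous, but the products are constantly 0 when
     f x = 0 and eventually infinite when f x > 0. *)
  have goo : g x = +oo.
    by move: gx; rewrite ge0_fin_numE// -leNgt leye_eq => /eqP.
  have nd_f : {homo (fun k => (f_ k x)%:E) : p q / (p <= q)%N >-> p <= q}.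
    by move=> p q pq; rewrite lee_fin; exact/lefP/nd_nnsfun_approx.
  have fsup : f x = ereal_sup (range (fun k => (f_ k x)%:E)).
    have <- := cvg_lim (@ereal_hausdorff R)
        (@cvg_nnsfun_approx _ _ _ _ measurableT _ mf (fun x _ => f0 x) x Logic.I).
    by have /ereal_nondecreasing_cvgn/(cvg_lim (@ereal_hausdorff R)) -> := nd_f.
  rewrite goo; have [fx0|fx0] := eqVneq (f x) 0.
    rewrite fx0 mul0e; apply: cvg_near_cst; apply: nearW => n.
    have : (f_ n x)%:E <= f x by rewrite fsup; apply: ereal_sup_ubound; exists n.
    rewrite fx0 lee_fin => h0; have -> : f_ n x = 0%R by apply/eqP; rewrite eq_le h0 fun_ge0.
    by rewrite mul0e.
  have {}fx0 : 0 < f x by rewrite lt_def fx0 f0.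
  rewrite gt0_muley//; apply: cvg_near_cst.
  move: fx0; rewrite fsup => /ereal_sup_gt [_ [N _ <-]] fN.
  exists N => // n /= Nn; rewrite gt0_muley//.
  by apply: (lt_le_trans fN); exact: nd_f.
- by move=> n; apply: emeasurable_funM => //; exact/measurable_EFinP.
- by move=> n x _; rewrite mule_ge0// lee_fin.
- by move=> x _ a b ab; apply: lee_wpmul2r => //; rewrite lee_fin; exact/lefP/nd_nnsfun_approx.
Qed.

End DensityMeasure.

Section TauNormal.
Context {R : realType}.
Notation mu := (@lebesgue_measure R).
Local Open Scope ereal_scope.

Lemma ge0_integral_normal_prob (m s : R) (f : R -> \bar R) :
  measurable_fun setT f -> (forall x, 0 <= f x) ->
  \int[normal_prob m s]_x f x = \int[mu]_x (f x * (normal_pdf m s x)%:E).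
Proof.
move=> mf f0.
have mp : measurable_fun setT (fun x : R => (normal_pdf m s x)%:E).
  by apply/measurable_EFinP; exact: measurable_normal_pdf.
have p0 x : 0 <= (normal_pdf m s x)%:E by rewrite lee_fin normal_pdf_ge0.
exact: (ge0_integral_density mu mp p0 mf f0).
Qed.

Let C : R := (Num.sqrt (pi *+ 2))^-1.

Let normal_pdf01 x : normal_pdf 0 1 x = (C * expR (- (x ^+ 2 / 2)))%R.
Proof.
rewrite normal_pdfE ?oner_eq0// /normal_peak /normal_fun subr0 expr1n mul1r.
by rewrite mulNr.
Qed.

(** Multiplying u and w by the normal density turns the hypothesis into f(x) g(y) <= C^2 exp(- (x -
    y)^2 / 4), because (x + y)^2 / 4 - x^2 / 2 - y^2 / 2 = - (x - y)^2 / 4. After division by the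
    suprema a and b, Prekopa-Leindler gives I / a + J / b <= 2 / sqrt(a b) for the two integrals,
    and the inequality of arithmetic and geometric means gives I J <= 1. *)
Let tau_normal_aux (u w : R -> \bar R) :
  measurable_fun setT u -> measurable_fun setT w ->
  (forall x, 0 <= u x) -> (forall x, 0 <= w x) ->
  (forall x y : R, u x * w y <= (expR ((x + y) ^+ 2 / 4)%R)%:E) ->
  \int[normal_prob 0 1]_x u x * \int[normal_prob 0 1]_x w x <= 1.
Proof.
move=> mu_ mw u0 w0 uw.
have [u00|] := pselect (forall x, u x = 0).
  by rewrite [X in X * _]integral0_eq ?mul0e.
move=> /existsNP[x0 /eqP ux0].
have [w00|] := pselect (forall x, w x = 0).
  by rewrite [X in _ * X]integral0_eq ?mule0.
move=> /existsNP[y0 /eqP wy0].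
have {}ux0 : 0 < u x0 by rewrite lt_def ux0 u0.
have {}wy0 : 0 < w y0 by rewrite lt_def wy0 w0.
have ufin x : u x \is a fin_num.
  rewrite ge0_fin_numE// ltNge leye_eq; apply/eqP => uoo.
  by have := uw x y0; rewrite uoo gt0_mulye// leye_eq.
have wfin x : w x \is a fin_num.
  rewrite ge0_fin_numE// ltNge leye_eq; apply/eqP => woo.
  by have := uw x0 x; rewrite woo gt0_muley// leye_eq.
have C0 : (0 < C)%R by rewrite invr_gt0 sqrtr_gt0 pmulrn_rgt0// pi_gt0.
pose f (x : R) := (fine (u x) * normal_pdf 0 1 x)%R.
pose g (x : R) := (fine (w x) * normal_pdf 0 1 x)%R.
have mf : measurable_fun setT f.
  apply: measurable_funM; last exact: measurable_normal_pdf.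
  by apply/measurable_EFinP; apply: eq_measurable_fun mu_ => x _ /=; rewrite fineK.
have mg : measurable_fun setT g.
  apply: measurable_funM; last exact: measurable_normal_pdf.
  by apply/measurable_EFinP; apply: eq_measurable_fun mw => x _ /=; rewrite fineK.
have fu x : u x * (normal_pdf 0 1 x)%:E = (f x)%:E by rewrite EFinM fineK.
have gw x : w x * (normal_pdf 0 1 x)%:E = (g x)%:E by rewrite EFinM fineK.
have pdf0 x : (0 < normal_pdf 0 1 x :> R)%R by rewrite normal_pdf01 mulr_gt0 ?expR_gt0.
have f0 x : (0 <= f x)%R by rewrite mulr_ge0 ?fine_ge0// ltW.
have g0 x : (0 <= g x)%R by rewrite mulr_ge0 ?fine_ge0// ltW.
have fg x y : (f x * g y <= C ^+ 2 * expR (- ((x - y) ^+ 2 / 4)))%R.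
  have : (fine (u x) * fine (w y) <= expR ((x + y) ^+ 2 / 4))%R.
    by rewrite -lee_fin EFinM !fineK.
  move=> H; rewrite /f /g mulrACA.
  apply: (@le_trans _ _ (expR ((x + y) ^+ 2 / 4) * (normal_pdf 0 1 x * normal_pdf 0 1 y)))%R.
    by rewrite ler_wpM2r// mulr_ge0// ltW.
  rewrite !normal_pdf01 mulrACA -expRD -expr2 mulrCA -expRD.
  rewrite ler_wpM2l ?sqr_ge0// ler_expR.
  by rewrite le_eqVlt; apply/orP; left; apply/eqP; field.
rewrite (ge0_integral_normal_prob 0 1 mu_ u0) (ge0_integral_normal_prob 0 1 mw w0).
under eq_integral do rewrite fu.
under [X in _ * X]eq_integral do rewrite gw.
have fx0 : (0 < f x0)%R by rewrite mulr_gt0// fine_gt0// ux0 ltey_eq ufin.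
have gy0 : (0 < g y0)%R by rewrite mulr_gt0// fine_gt0// wy0 ltey_eq wfin.
have fg2 x y : (f x * g y <= C ^+ 2)%R.
  apply: le_trans (fg x y) _; rewrite ler_piMr ?sqr_ge0// -expR0 ler_expR.
  by rewrite oppr_le0 divr_ge0 ?sqr_ge0.
have hf : has_sup (range f).
  split; first by exists (f x0), x0.
  by exists (C ^+ 2 / g y0)%R => _ [x _ <-]; rewrite ler_pdivlMr.
have hg : has_sup (range g).
  split; first by exists (g y0), y0.
  by exists (C ^+ 2 / f x0)%R => _ [x _ <-]; rewrite ler_pdivlMr// mulrC.
pose a := sup (range f); pose b := sup (range g).
have a0 : (0 < a)%R by apply: (lt_le_trans fx0); apply: ub_le_sup; [case: hf|exists x0].
have b0 : (0 < b)%R by apply: (lt_le_trans gy0); apply: ub_le_sup; [case: hg|exists y0].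
have ab0 : (0 < a * b)%R by rewrite mulr_gt0.
have sab0 : (0 < Num.sqrt (a * b))%R by rewrite sqrtr_gt0.
set sab := Num.sqrt (a * b) in sab0 *.
have sab2 : (sab ^+ 2 = a * b)%R by rewrite sqr_sqrtr// ltW.
have : \int[mu]_x (f x / a)%:E + \int[mu]_x (g x / b)%:E <= 2%:E * \int[mu]_x (C / sab * expR (- (x ^+ 2 / 2)))%:E.
  apply: prekopa_leindler_gauss.
  - exact: measurable_funM.
  - exact: measurable_funM.
  - move=> x; rewrite divr_ge0 ?(ltW a0)//= ler_pdivrMr// mul1r.
    by apply: ub_le_sup; [case: hf|exists x].
  - move=> x; rewrite divr_ge0 ?(ltW b0)//= ler_pdivrMr// mul1r.
    by apply: ub_le_sup; [case: hg|exists x].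
  - move=> t t1; have : (t * a < sup (range f))%R by rewrite gtr_pMl.
    by move=> /(sup_gt (hf.1)) [_ [x _ <-]] H; exists x; rewrite ltr_pdivlMr.
  - move=> t t1; have : (t * b < sup (range g))%R by rewrite gtr_pMl.
    by move=> /(sup_gt (hg.1)) [_ [x _ <-]] H; exists x; rewrite ltr_pdivlMr.
  - by rewrite divr_gt0.
  - move=> x y; have -> : ((C / sab) ^+ 2 = C ^+ 2 / (a * b))%R.
      by rewrite -sab2; field; rewrite gt_eqF.
    rewrite (_ : f x / a * (g y / b) = f x * g y / (a * b))%R; last by rewrite mulf_div.
    rewrite (mulrAC (C ^+ 2)%R).
    by apply: ler_wpM2r => //; rewrite invr_ge0 ltW.
have -> : \int[mu]_x (C / sab * expR (- (x ^+ 2 / 2)))%:E = (sab^-1)%:E.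
  under eq_integral do rewrite mulrAC -normal_pdf01 mulrC EFinM.
  rewrite ge0_integralZl//.
  - by rewrite integral_normal_pdf mule1.
  - by apply/measurable_EFinP; exact: measurable_normal_pdf.
  - by move=> x _; rewrite lee_fin normal_pdf_ge0.
  - by rewrite lee_fin invr_ge0 ltW.
have hI (h : R -> R) (k : R) : (0 < k)%R -> measurable_fun setT h -> (forall x, 0 <= h x)%R ->
    \int[mu]_x (h x / k)%:E = (k^-1)%:E * \int[mu]_x (h x)%:E.
  move=> k0 mh h0; rewrite -ge0_integralZl//.
  - by apply: eq_integral => x _; rewrite -EFinM mulrC.
  - exact/measurable_EFinP.
  - by move=> x _; rewrite lee_fin.
  - by rewrite lee_fin invr_ge0 ltW.
rewrite (hI f a)// (hI g b)//.
set I := \int[mu]_x (f x)%:E; set J := \int[mu]_x (g x)%:E => H.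
have I0 : 0 <= I by apply: integral_ge0 => x _; rewrite lee_fin.
have J0 : 0 <= J by apply: integral_ge0 => x _; rewrite lee_fin.
have Ifin : I \is a fin_num.
  rewrite ge0_fin_numE// ltNge leye_eq; apply/eqP => Ioo.
  move: H; rewrite Ioo gt0_muley ?lte_fin ?invr_gt0// addye ?leye_eq//.
  by apply/eqP => JN; move: J0; rewrite -(@lee_pmul2l _ (b^-1)%:E) ?JN ?mule0 ?lte_fin ?invr_gt0.
have Jfin : J \is a fin_num.
  rewrite ge0_fin_numE// ltNge leye_eq; apply/eqP => Joo.
  by move: H; rewrite Joo gt0_muley ?lte_fin ?invr_gt0// addey ?leye_eq// -(fineK Ifin).
move: H I0 J0; rewrite -(fineK Ifin) -(fineK Jfin) -!EFinM -EFinD !lee_fin.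
move: (fine I) (fine J) => i j H i0 j0.
have ip : (0 <= a^-1 * i)%R by rewrite mulr_ge0// invr_ge0 ltW.
have jp : (0 <= b^-1 * j)%R by rewrite mulr_ge0// invr_ge0 ltW.
have : ((a^-1 * i) * (b^-1 * j) <= (sab^-1) ^+ 2)%R.
  move: (a^-1 * i)%R (b^-1 * j)%R H ip jp => x y H x0' y0'.
  have : ((x + y) ^+ 2 <= (2 * sab^-1) ^+ 2)%R by rewrite ler_sqr ?nnegrE// ?addr_ge0// mulr_ge0// invr_ge0 ltW.
  by have := sqr_ge0 (x - y); rewrite !expr2; nra.
rewrite exprVn sab2 mulrACA -invfM -[X in (_ <= X)%R]mulr1.
by rewrite ler_pM2l// invr_gt0.
Qed.

Lemma tau_property_normal :
  tau_property (normal_prob 0 1 : probability _ R) (fun x y : R => (x + y) ^+ 2 / 4)%R.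
Proof. by move=> u w *; exact: tau_normal_aux. Qed.

End TauNormal.

(** * Cosine transforms and white vectors *)

Section NormalCharacteristic.
Context {R : realType}.
Notation mu := (@lebesgue_measure R).
Variable s : R.
Hypothesis s0 : 0 < s.

Let k : R := (2 * s ^+ 2)^-1.
Let k0 : 0 < k. Proof. by rewrite invr_gt0 mulr_gt0// exprn_gt0. Qed.
Let g (x : R) : R := normal_peak s * expR (- (x ^+ 2 * k)).

Lemma normal_pdf0E (x : R) :
  normal_pdf 0 s x = normal_peak s * expR (- (x ^+ 2 * (2 * s ^+ 2)^-1)).
Proof.
rewrite normal_pdfE ?gt_eqF// /normal_fun subr0 mulNr; congr (_ * expR (- (_ * _^-1))).
by rewrite mulr2n mulrDl mul1r.
Qed.

Let gE : normal_pdf 0 s = g. Proof. by apply/funext => x; exact: normal_pdf0E. Qed.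

Let g_ge0 x : 0 <= g x. Proof. by rewrite mulr_ge0 ?expR_ge0 ?normal_peak_ge0. Qed.

Let mg : measurable_fun setT g.
Proof. by rewrite -gE; exact: measurable_normal_pdf. Qed.

Let intg : mu.-integrable setT (EFin \o g).
Proof. by rewrite -gE; exact: integrable_normal_pdf. Qed.

(** Domination by a multiple of the normal density of deviation 2 s: the ratio of the two
    exponentials is exp(3 x^2 / (8 s^2)), and exp(z) >= 1 + z makes it absorb the factor |x|. *)
Let int_absg : mu.-integrable setT (EFin \o (fun x => `|x| * g x)).
Proof.
apply: (@le_integrable _ _ _ mu setT _ _ (EFin \o (fun x => 4 * s * normal_pdf 0 (2 * s) x))) => //.
- by apply/measurable_EFinP; apply: measurable_funM => //; exact: measurableT_comp.
- move=> x _ /=; rewrite lee_fin normrM normr_id (ger0_norm (g_ge0 x)).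
  rewrite [leRHS]ger0_norm; last by rewrite mulr_ge0 ?normal_pdf_ge0// mulr_ge0// ltW.
  rewrite normal_pdfE ?mulf_neq0 ?gt_eqF// /normal_fun subr0 /g.
  have -> : normal_peak (2 * s) = normal_peak s / 2.
    rewrite /normal_peak -invfM; congr (_^-1).
    rewrite (_ : (2 * s) ^+ 2 * pi *+ 2 = 2 ^+ 2 * (s ^+ 2 * pi *+ 2)); last by rewrite exprMn -mulrA mulrnAr.
    by rewrite sqrtrM ?sqr_ge0// sqrtr_sqr ger0_norm// mulrC.
  rewrite (_ : 4 * s * _ = normal_peak s * (2 * s * expR (- x ^+ 2 / ((2 * s) ^+ 2 *+ 2)))); last by field.
  rewrite mulrCA ler_wpM2l ?normal_peak_ge0//.
  have -> : - x ^+ 2 / ((2 * s) ^+ 2 *+ 2) = - (x ^+ 2 * k) + 3 * x ^+ 2 * k / 4.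
    by rewrite -mulr_natl /k; field; rewrite gt_eqF.
  rewrite expRD mulrA [leRHS]mulrAC ler_wpM2r ?expR_ge0//.
  apply: (@le_trans _ _ (2 * s * (1 + 3 * x ^+ 2 * k / 4))); last first.
    by rewrite ler_wpM2l ?mulr_ge0 ?(ltW s0)// expR_ge1Dx.
  rewrite -(ler_pM2l s0).
  have -> : s * (2 * s * (1 + 3 * x ^+ 2 * k / 4)) = 2 * s ^+ 2 + 3 / 4 * `|x| ^+ 2.
    by rewrite real_normK ?num_real// /k; field; rewrite gt_eqF.
  by have := sqr_ge0 (s - `|x| / 2); rewrite !expr2; have := normr_ge0 x; nra.
- have := integrableZl measurableT (4 * s) (@integrable_normal_pdf R 0 (2 * s)).
  by apply: eq_integrable => // x _.
Qed.

Let cos_bd (a b x : R) : `|cos (a * x + b)| <= 1.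
Proof. by rewrite ler_norml cos_geN1 cos_le1. Qed.

Let sin_bd (a b x : R) : `|sin (a * x + b)| <= 1.
Proof. by rewrite ler_norml sin_geN1 sin_le1. Qed.

Let mlin (a b : R) : measurable_fun setT (fun x : R => a * x + b).
Proof. by apply: measurable_funD => //; apply: measurable_funM. Qed.

Let mcos (a b : R) : measurable_fun setT (fun x : R => cos (a * x + b)).
Proof.
apply: (measurableT_comp (f := cos)) => //.
apply: continuous_measurable_fun; exact: continuous_cos.
Qed.

Let msin (a b : R) : measurable_fun setT (fun x : R => sin (a * x + b)).
Proof.
apply: (measurableT_comp (f := sin)) => //.
apply: continuous_measurable_fun; exact: continuous_sin.
Qed.

Let int_cos a b : mu.-integrable setT (EFin \o (fun x => cos (a * x + b) * g x)).
Proof.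
apply: (@le_integrable _ _ _ mu setT _ _ (EFin \o g)) => //.
- by apply/measurable_EFinP; apply: measurable_funM; [exact: mcos|exact: mg].
- move=> x _ /=; rewrite lee_fin normrM (ger0_norm (g_ge0 x)).
  by rewrite ler_piMl.
Qed.

Let int_xsin a b : mu.-integrable setT (EFin \o (fun x => x * sin (a * x + b) * g x)).
Proof.
apply: (@le_integrable _ _ _ mu setT _ _ (EFin \o (fun x => `|x| * g x))) => //.
- apply/measurable_EFinP; apply: measurable_funM; last exact: mg.
  by apply: measurable_funM => //; exact: msin.
- move=> x _ /=; rewrite lee_fin [leLHS]normrM (ger0_norm (g_ge0 x)).
  have -> : `| `|x| * g x| = `|x| * g x by rewrite ger0_norm// mulr_ge0.
  by apply: ler_wpM2r => //; rewrite normrM ler_piMr.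
Qed.

(** [H] is an antiderivative of [h] that vanishes at infinity, so the vanishing of the integral of
    [h] is Gaussian integration by parts: E[x sin(a x + b)] = s^2 a E[cos(a x + b)]. *)
Let H a b (x : R) : R := - s ^+ 2 * (sin (a * x + b) * g x).
Let h a b (x : R) : R := x * sin (a * x + b) * g x - s ^+ 2 * a * (cos (a * x + b) * g x).

Let scaleE (u v : R) : u *: (v : R^o) = u * v. Proof. by []. Qed.

Let dg x : is_derive (x : R) (1 : R) g (- (x / s ^+ 2) * g x).
Proof.
rewrite /g; apply: is_derive_eq.
rewrite !scaleE /k; field.
by rewrite gt_eqF.
Qed.

Let dH a b x : is_derive (x : R) (1 : R) (H a b) (h a b x).
Proof.
rewrite /H /h; apply: is_derive_eq.
rewrite !scaleE /g /k; field.
by rewrite gt_eqF.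
Qed.

Let H_bd a b x : `|H a b x| <= s ^+ 2 * g x.
Proof.
rewrite /H normrM normrN (ger0_norm (sqr_ge0 _)) ler_wpM2l ?sqr_ge0//.
by rewrite normrM (ger0_norm (g_ge0 x)) ler_piMl.
Qed.

Let g_bd (x : R) : 1 <= x ^+ 2 -> g x <= normal_peak s / k / x ^+ 2.
Proof.
move=> x1; have x20 : 0 < x ^+ 2 by apply: lt_le_trans x1.
rewrite /g -[_ / _ / _]mulrA ler_wpM2l ?normal_peak_ge0//.
rewrite expRN -div1r ler_pdivrMr ?expR_gt0//.
have -> : 1 = k^-1 / x ^+ 2 * (x ^+ 2 * k).
  by rewrite -mulrA mulKf ?gt_eqF// mulVf ?gt_eqF.
have kx : 0 <= k^-1 / x ^+ 2 by apply: mulr_ge0; rewrite ltW// invr_gt0.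
apply: ler_wpM2l => //; apply: le_trans (expR_ge1Dx _); rewrite lerDr; exact: ler01.
Qed.

Let integral_h a b : (\int[mu]_x (h a b x)%:E = 0)%E.
Proof.
have ih : mu.-integrable setT (EFin \o h a b).
  have := @integrableB _ _ _ mu setT measurableT (EFin \o _) (EFin \o _) (int_xsin a b)
    (integrableZl measurableT (s ^+ 2 * a) (int_cos a b)).
  by apply: eq_integrable => // x _ /=; rewrite EFinB EFinM.
(* Truncation to a compact interval, where the fundamental theorem of calculus applies; dominated
   convergence handles one side of the limit and the decay [g_bd] the other. *)
pose hn n x := (h a b x * \1_(`[- n.+1%:R, n.+1%:R]%classic) x).
have E n : (\int[mu]_x (hn n x)%:E = (H a b n.+1%:R - H a b (- n.+1%:R))%:E)%E.
  rewrite EFinB -(@continuous_FTC2 _ (h a b)).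
  - rewrite [RHS]integral_mkcond; apply: eq_integral => x _.
    by rewrite patchE /hn indicE; case: (x \in _); rewrite ?mulr1 ?mulr0.
  - by rewrite gtrN.
  - apply: continuous_subspaceT => x.
    have cg : {for x, continuous g}.
      by apply: differentiable_continuous; apply/derivable1_diffP; have [] := dg x.
    have cl : {for x, continuous (fun x : R => a * x + b)}.
      by apply: differentiable_continuous; apply/derivable1_diffP.
    have cc : {for x, continuous (fun x : R => cos (a * x + b))}.
      by apply: continuous_comp => //; exact: continuous_cos.
    have csn : {for x, continuous (fun x : R => sin (a * x + b))}.
      by apply: continuous_comp => //; exact: continuous_sin.
    apply: cvgB; first by apply: cvgM => //; apply: cvgM => //; exact: cvg_id.
    by apply: cvgM; [exact: cvg_cst|exact: cvgM].
  - split.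
    + by move=> x _; have [] := dH a b x.
    + by apply: cvg_at_right_filter; apply: differentiable_continuous; apply/derivable1_diffP; have [] := dH a b (- n.+1%:R).
    + by apply: cvg_at_left_filter; apply: differentiable_continuous; apply/derivable1_diffP; have [] := dH a b (n.+1%:R).
  - by move=> x _; rewrite derive1E; have [_ ->] := dH a b x.
have mh : measurable_fun setT (EFin \o h a b) by exact: measurable_int ih.
have cv : (\int[mu]_x (hn n x)%:E @[n --> \oo] --> \int[mu]_x (h a b x)%:E)%E.
  have [|||||_ _ +] := @dominated_convergence _ _ _ mu setT measurableT (fun n x => (hn n x)%:E) (EFin \o h a b)
    (fun x => `|(h a b x)%:E|%E).
  - move=> n; apply/measurable_EFinP; apply: measurable_funM.
      exact/measurable_EFinP.
    exact: measurable_indic.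
  - exact: mh.
  - apply: aeW => x _; apply: cvg_near_cst.
    near=> n; rewrite /hn indicE mem_set ?mulr1//= in_itv/= -ler_norml.
    by apply: ltW; rewrite -natr1; apply: ltr_wpDr => //; near: n; exact: nbhs_infty_gtr.
  - exact: integrable_abse.
  - apply: aeW => x n _; rewrite lee_fin /hn normrM ler_piMr// indicE.
    by case: (_ \in _); rewrite ?normr1 ?normr0.
  - by [].
apply: (cvg_unique (@ereal_hausdorff R) cv).
rewrite /= (_ : (fun n => _) = (fun n => (H a b n.+1%:R - H a b (- n.+1%:R))%:E)); last by apply/funext => n; exact: E.
apply: cvg_EFin; first by near=> n.
pose M := 2 * (s ^+ 2 * (normal_peak s / k)).
apply: (@squeeze_cvgr _ _ _ _ (fun n => - (M * n.+1%:R^-1)) (fun n => M * n.+1%:R^-1)).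
- near=> n; rewrite -ler_norml; apply: le_trans (ler_normB _ _) _.
  rewrite /M -mulrA mulr_natl mulr2n.
  have n1 : 1 <= n.+1%:R :> R by rewrite ler1n.
  have n2 : n.+1%:R <= n.+1%:R ^+ 2 :> R by rewrite expr2 ler_peMl.
  have B z : z ^+ 2 = n.+1%:R ^+ 2 -> `|H a b z| <= s ^+ 2 * (normal_peak s / k) / n.+1%:R.
    move=> z2; apply: le_trans (H_bd _ _ _) _; rewrite -mulrA ler_wpM2l ?sqr_ge0//.
    apply: le_trans (g_bd _) _; first by rewrite z2 (le_trans n1).
    rewrite z2 ler_wpM2l ?divr_ge0 ?normal_peak_ge0 ?(ltW k0)//.
    by rewrite lef_pV2 ?posrE ?exprn_gt0// ltr0n.
  by apply: lerD; apply: B => //; rewrite sqrrN.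
- rewrite -oppr0; apply: cvgN; rewrite -(mulr0 M); apply: cvgM; first exact: cvg_cst.
  exact: cvg_harmonic.
- rewrite -(mulr0 M); apply: cvgM; first exact: cvg_cst.
  exact: cvg_harmonic.
Unshelve. all: by end_near.
Qed.

Let F b (a : R) : R := (\int[mu]_x (cos (a * x + b) * g x))%R.

(** Differentiation under the integral, dominated by |x| g(x), followed by the integration by parts
    of [integral_h], yields a linear differential equation for the transform. *)
Let dF b a : is_derive (a : R) (1 : R) (F b) (- (s ^+ 2 * a) * F b a).
Proof.
pose f (a x : R) : R := cos (a * x + b) * g x.
have df (x y : R) : is_derive (x : R) (1 : R) (f ^~ y) (- (y * sin (x * y + b) * g y)).
  by rewrite /f; apply: is_derive_eq; rewrite !scaleE; ring.
have Ia : `]a - 1, a + 1[%classic a by rewrite /= in_itv/=; lra.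
have derf x y : `]a - 1, a + 1[%classic x -> [set: R] y -> derivable (f ^~ y) x 1.
  by move=> _ _; have [] := df x y.
have Gub x y : `]a - 1, a + 1[%classic x -> [set: R] y -> `|partial1of2 f x y| <= `|y| * g y.
  move=> _ _; rewrite partial1of2E; have [_ ->] := df x y.
  rewrite normrN [leLHS]normrM (ger0_norm (g_ge0 y)); apply: ler_wpM2r => //.
  by rewrite normrM ler_piMr.
have G0 y : 0 <= `|y| * g y by rewrite mulr_ge0.
have intf x : `]a - 1, a + 1[%classic x -> mu.-integrable setT (EFin \o f x).
  by move=> _; exact: int_cos.
split.
  exact: (derivable_under_integral measurableT Ia intf derf G0 int_absg Gub).
rewrite -derive1E (differentiation_under_integral measurableT Ia intf derf G0 int_absg Gub).
transitivity (- \int[mu]_x (x * sin (a * x + b) * g x)).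
  have intA := int_xsin a b; rewrite -mulN1r -RintegralZl//.
  apply: eq_Rintegral => x _; rewrite partial1of2E.
  by have [_ ->] := df a x; rewrite mulN1r.
rewrite mulNr; congr (- _).
have -> : s ^+ 2 * a * F b a = \int[mu]_x (s ^+ 2 * a * (cos (a * x + b) * g x)).
  by have intB := int_cos a b; rewrite RintegralZl.
have intA := int_xsin a b.
have intB : mu.-integrable setT (EFin \o (fun x => s ^+ 2 * a * (cos (a * x + b) * g x))).
  by have := integrableZl measurableT (s ^+ 2 * a) (int_cos a b); apply: eq_integrable.
apply/eqP; rewrite -subr_eq0 -RintegralB//.
have := integral_h a b; rewrite /Rintegral => E.
by rewrite [X in fine X](_ : _ = 0%E)// -[RHS]E; apply: eq_integral.
Qed.

(** The phase [b] lets the cosine play the role of the complex exponential: b = 0 and b = - pi / 2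
    give the real and imaginary parts of the characteristic function. *)
Lemma Rintegral_cos_normal (a b : R) :
  \int[mu]_x (cos (a * x + b) * normal_pdf 0 s x) =
  cos b * expR (- ((a * s) ^+ 2 / 2)).
Proof.
rewrite gE -/(F b a).
(* Integrating factor: by [dF] the derivative of [K] is zero. *)
pose K (a : R) : R := F b a * expR ((a * s) ^+ 2 / 2).
have dK x : is_derive (x : R) (1 : R) K 0.
  rewrite /K; have := dF b x => ?; apply: is_derive_eq.
  by rewrite !scaleE; field.
have KE : K a = K 0 by apply: is_derive_0_is_cst.
have F0 : F b 0 = cos b.
  rewrite /F.
  transitivity (\int[mu]_x (cos b * g x)).
    by apply: eq_Rintegral => x _; rewrite mul0r add0r.
  rewrite RintegralZl// /Rintegral -gE.
  by rewrite integral_normal_pdf mulr1.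
move: KE; rewrite /K F0 mul0r expr0n/= mul0r expR0 mulr1 => <-.
by rewrite -mulrA -expRD subrr expR0 mulr1.
Qed.

End NormalCharacteristic.

Section NormalCosIntegral.
Context {R : realType}.
Local Open Scope ereal_scope.

Lemma measurable_cos_affine (a b : R) : measurable_fun setT (fun x : R => cos (a * x + b)%R).
Proof.
apply: (measurableT_comp (f := cos)).
  by apply: continuous_measurable_fun; exact: continuous_cos.
by apply: measurable_funD => //; apply: measurable_funM.
Qed.

(** The shape 1 + beta cos with |beta| <= 1 keeps the integrand nonnegative, so that Tonelli and
    changes of measure apply without integrability side conditions. *)
Lemma integral_cos_normal (s a b beta : R) : (0 < s)%R -> (`|beta| <= 1)%R ->
  \int[normal_prob 0 s]_x (1 + beta * cos (a * x + b))%:E =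
  (1 + beta * (cos b * expR (- ((a * s) ^+ 2 / 2))))%:E.
Proof.
move=> s0 beta1.
have cos1 (z : R) : (0 <= 1 + beta * cos z)%R.
  have : (`|beta * cos z| <= 1)%R.
    by rewrite normrM mulr_ile1// ler_norml cos_geN1 cos_le1.
  by rewrite ler_norml; lra.
have mc : measurable_fun setT (fun x : R => 1 + beta * cos (a * x + b))%R.
  by apply: measurable_funD => //; apply: measurable_funM => //; exact: measurable_cos_affine.
rewrite ge0_integral_normal_prob//; [|exact/measurable_EFinP|by move=> x; rewrite lee_fin].
have ip := @integrable_normal_pdf R 0 s.
have ic : (@lebesgue_measure R).-integrable setT (EFin \o (fun x : R => cos (a * x + b) * normal_pdf 0 s x)%R).
  apply: le_integrable ip => //.
    apply/measurable_EFinP; apply: measurable_funM; first exact: measurable_cos_affine.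
    exact: measurable_normal_pdf.
  move=> x _ /=; rewrite lee_fin normrM ler_piMl// ler_norml cos_geN1 cos_le1//.
transitivity (\int[lebesgue_measure]_x ((normal_pdf 0 s x)%:E +
   beta%:E * (cos (a * x + b) * normal_pdf 0 s x)%:E)).
  by apply: eq_integral => x _; rewrite -!EFinM -EFinD; congr EFin; ring.
rewrite integralD//; last exact: integrableZl.
rewrite integralZl// integral_normal_pdf EFinD EFinM; congr (_ + _ * _).
rewrite -Rintegral_cos_normal// /Rintegral fineK//.
by have := integral_fune_fin_num measurableT ic.
Qed.

End NormalCosIntegral.

(** * Uniqueness of finite measures on the line from their cosine transforms *)

Section CosineUniqueness.
Context {R : realType}.
Notation GR := (measurableTypeR R).
Notation leb := (@lebesgue_measure R).
Local Open Scope ereal_scope.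

Let cos1 (z : R) : (0 <= 1 + cos z)%R.
Proof. by rewrite -lerBlDl sub0r cos_geN1. Qed.

Let mcos : measurable_fun setT (@cos R).
Proof. by apply: continuous_measurable_fun; exact: continuous_cos. Qed.

Lemma normal_pdfE2 (x s y : R) : (0 < s)%R ->
  normal_pdf x s y = (normal_peak s * expR (- (((x - y) / s) ^+ 2 / 2)))%R.
Proof.
move=> s0; rewrite normal_pdfE ?gt_eqF// /normal_fun; congr (_ * expR _)%R.
by rewrite -mulr_natl; field; rewrite gt_eqF.
Qed.

(** Comparison with the density of deviation 2 s: at distance z s from the centre the ratio of
    densities is 2 exp(- 3 z^2 / 8), which is at most 6 / z^2, and z >= d / s on B. *)
Lemma normal_tail (x s d : R) (B : set R) : (0 < s)%R -> (0 < d)%R -> measurable B ->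
  (forall y, B y -> d <= `|y - x|)%R ->
  normal_prob x s B <= (6 * (s / d) ^+ 2)%:E.
Proof.
move=> s0 d0 mB Bd.
have p2 : normal_peak (2 * s) = (normal_peak s / 2)%R.
  rewrite /normal_peak -invfM; congr (_^-1)%R.
  rewrite (_ : (2 * s) ^+ 2 * pi *+ 2 = 2 ^+ 2 * (s ^+ 2 * pi *+ 2))%R; last by rewrite exprMn -mulrA mulrnAr.
  by rewrite sqrtrM ?sqr_ge0// sqrtr_sqr ger0_norm// mulrC.
apply: (@le_trans _ _ (\int[leb]_(y in B) ((6 * (s / d) ^+ 2)%:E * (normal_pdf x (2 * s) y)%:E))).
  apply: ge0_le_integral => //.
  - by move=> y _; rewrite lee_fin normal_pdf_ge0.
  - apply/measurable_EFinP; apply: measurable_funTS; exact: measurable_normal_pdf.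
  - apply/measurable_EFinP; apply: measurable_funTS; apply: measurable_funM => //; exact: measurable_normal_pdf.
  move=> y By; rewrite -EFinM lee_fin !normal_pdfE2 ?mulr_gt0// p2.
  set z := ((x - y) / s)%R.
  have -> : ((x - y) / (2 * s) = z / 2)%R by rewrite /z; field; rewrite gt_eqF.
  have zd : ((d / s) ^+ 2 <= z ^+ 2)%R.
    rewrite -[leRHS]real_normK ?num_real// ler_sqr ?nnegrE ?divr_ge0 ?(ltW s0) ?(ltW d0)//.
    rewrite /z normrM [X in (_ <= _ * X)%R]gtr0_norm ?invr_gt0// ler_pM2r ?invr_gt0//.
    by rewrite distrC; exact: Bd.
  have z20 : (0 < z ^+ 2)%R by apply: lt_le_trans zd; rewrite exprn_gt0// divr_gt0.
  have -> : (6 * (s / d) ^+ 2 * (normal_peak s / 2 * expR (- ((z / 2) ^+ 2 / 2))) =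
     normal_peak s * (3 * (s / d) ^+ 2 * expR (- ((z / 2) ^+ 2 / 2))))%R by field; rewrite gt_eqF.
  rewrite ler_wpM2l ?normal_peak_ge0//.
  have -> : (- (z ^+ 2 / 2) = - (3 / 8 * z ^+ 2) + - ((z / 2) ^+ 2 / 2))%R by field.
  rewrite expRD ler_wpM2r ?expR_ge0//.
  apply: (@le_trans _ _ (3 / z ^+ 2)%R).
    rewrite expRN -div1r ler_pdivrMr ?expR_gt0// mulrAC ler_pdivlMr// mul1r.
    by have := expR_ge1Dx (3 / 8 * z ^+ 2)%R; lra.
  rewrite ler_pM2l//.
  have -> : ((s / d) ^+ 2 = ((d / s) ^+ 2)^-1)%R by rewrite -exprVn invf_div.
  by rewrite lef_pV2 ?posrE// exprn_gt0// divr_gt0.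
rewrite ge0_integralZl//; last 3 first.
- by apply/measurable_EFinP; apply: measurable_funTS; exact: measurable_normal_pdf.
- by move=> y _; rewrite lee_fin normal_pdf_ge0.
- by rewrite lee_fin mulr_ge0// sqr_ge0.
rewrite -[leRHS]mule1; apply: lee_wpmul2l; first by rewrite lee_fin mulr_ge0// sqr_ge0.
exact: (probability_le1 (normal_prob x (2 * s)) mB).
Qed.

Let mpdf2 (s : R) (A : set R) : (0 < s)%R -> measurable A ->
  measurable_fun setT (fun z : GR * GR => (normal_pdf z.1 s z.2 * \1_A z.2)%:E).
Proof.
move=> s0 mA; apply/measurable_EFinP; apply: measurable_funM; last first.
  by apply: measurableT_comp => //; exact: measurable_indic.
rewrite (_ : (fun _ => _) = (fun z : GR * GR => normal_peak s * expR (- (((z.1 - z.2) / s) ^+ 2 / 2)))%R).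
  apply: measurable_funM => //; apply: measurableT_comp => //.
  apply: measurableT_comp => //; apply: measurable_funM => //; apply: measurable_funX.
  by apply: measurable_funM => //; apply: measurable_funB => //.
by apply/funext => z; rewrite normal_pdfE2.
Qed.

Let normal_probE (x s : R) (A : set R) : 
  normal_prob x s A = \int[leb]_y (normal_pdf x s y * \1_A y)%:E.
Proof.
rewrite /normal_prob integral_mkcond; apply: eq_integral => y _.
by rewrite patchE indicE; case: (_ \in _); rewrite ?mulr1 ?mulr0.
Qed.

Let mnormal (s : R) (A : set R) : (0 < s)%R -> measurable A ->
  measurable_fun setT (fun x : R => normal_prob x s A).
Proof.
move=> s0 mA; under eq_fun do rewrite normal_probE.
apply: (measurable_fun_fubini_tonelli_F (m2 := leb)
  (fun z : GR * GR => (normal_pdf z.1 s z.2 * \1_A z.2)%:E)).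
  exact: mpdf2.
by move=> z; rewrite lee_fin mulr_ge0 ?normal_pdf_ge0// indicE.
Qed.

Section OneSide.
Variables (m1 m2 : {finite_measure set GR -> \bar R}).
Hypothesis m12 : forall a b : R, \int[m1]_x (1 + cos (a * x + b))%:E =
  \int[m2]_x (1 + cos (a * x + b))%:E.

Let massE : m1 setT = m2 setT.
Proof.
have := m12 0 (pi / 2).
under eq_integral do rewrite mul0r add0r cos_pihalf addr0.
under [RHS]eq_integral do rewrite mul0r add0r cos_pihalf addr0.
by rewrite !integral_cst// !mul1e.
Qed.

(** A Gaussian kernel is an average of cosines over a normal frequency z. After exchanging the
    integrals, only the cosine transform of [m] occurs; hence [m1] and [m2] have the same
    convolution with every normal law. *)
Let kernelE (m : {finite_measure set GR -> \bar R}) (t y : R) : (0 < t)%R ->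
  m setT + \int[m]_x (expR (- (((x - y) * t) ^+ 2 / 2)))%:E =
  \int[normal_prob 0 t]_z \int[m]_x (1 + cos (z * x + (- (z * y))))%:E.
Proof.
move=> t0.
have -> : m setT = \int[m]_x (1%:E) by rewrite integral_cst// mul1e.
rewrite -ge0_integralD//; last first.
  apply/measurable_EFinP; apply: measurableT_comp => //; apply: measurableT_comp => //.
  by apply: measurable_funM => //; apply: measurable_funX; apply: measurable_funM => //; exact: measurable_funB.
transitivity (\int[m]_x \int[normal_prob 0 t]_z (1 + cos (z * x + (- (z * y))))%:E).
  apply: eq_integral => x _.
  under [RHS]eq_integral => z _.
    rewrite (_ : 1 + cos (z * x - z * y) = 1 + 1 * cos ((x - y) * z + 0))%R; last first.
      by rewrite mul1r; congr (1 + cos _)%R; ring.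
    over.
  by rewrite integral_cos_normal ?normr1// cos0 !mul1r EFinD.
apply: (fubini_tonelli (m1 := m) (m2 := normal_prob 0 t) (fun w : GR * GR => (1 + cos (w.2 * w.1 + (- (w.2 * y))))%:E)).
  apply/measurable_EFinP; apply: measurable_funD => //; apply: (measurableT_comp (f := cos)) => //.
  by apply: measurable_funD; [apply: measurable_funM|apply: measurableT_comp => //; apply: measurable_funM].
by move=> w; rewrite lee_fin.
Qed.

Let gaussE (t y : R) : (0 < t)%R ->
  \int[m1]_x (expR (- (((x - y) * t) ^+ 2 / 2)))%:E =
  \int[m2]_x (expR (- (((x - y) * t) ^+ 2 / 2)))%:E.
Proof.
move=> t0; set I1 := LHS; set I2 := RHS.
have H : m1 setT + I1 = m1 setT + I2.
  by rewrite {2}massE !kernelE//; apply: eq_integral => z _; exact: m12.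
have fm : m1 setT \is a fin_num by rewrite fin_num_measure.
by move/(congr1 (fun z => z - m1 setT)): H; rewrite ![m1 setT + _]addeC !addeK.
Qed.

Let pdfE (s y : R) : (0 < s)%R ->
  \int[m1]_x (normal_pdf x s y)%:E = \int[m2]_x (normal_pdf x s y)%:E.
Proof.
move=> s0.
have H (m : {finite_measure set GR -> \bar R}) : \int[m]_x (normal_pdf x s y)%:E =
    (normal_peak s)%:E * \int[m]_x (expR (- (((x - y) * s^-1) ^+ 2 / 2)))%:E.
  rewrite -ge0_integralZl//.
  - by apply: eq_integral => x _; rewrite normal_pdfE2// EFinM.
  - apply/measurable_EFinP; apply: measurableT_comp => //; apply: measurableT_comp => //.
    by apply: measurable_funM => //; apply: measurable_funX; apply: measurable_funM => //; exact: measurable_funB.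
  - by rewrite lee_fin normal_peak_ge0.
by rewrite !H gaussE// invr_gt0.
Qed.

Let smoothE (s : R) (A : set R) : (0 < s)%R -> measurable A ->
  \int[m1]_x normal_prob x s A = \int[m2]_x normal_prob x s A.
Proof.
move=> s0 mA.
have H (m : {finite_measure set GR -> \bar R}) : \int[m]_x normal_prob x s A =
    \int[leb]_y ((\1_A y)%:E * \int[m]_x (normal_pdf x s y)%:E).
  under eq_integral do rewrite normal_probE.
  rewrite (fubini_tonelli (m1 := m) (m2 := leb) (fun z : GR * GR => (normal_pdf z.1 s z.2 * \1_A z.2)%:E))//=.
  - apply: eq_integral => y _; rewrite -ge0_integralZl//.
    + by apply: eq_integral => x _; rewrite mulrC EFinM.
    + have := measurable_fun_pair1 y (mpdf2 s0 measurableT).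
      by apply: eq_measurable_fun => x _ /=; rewrite indicE in_setT mulr1.
    + by move=> x _; rewrite lee_fin normal_pdf_ge0.
  - exact: mpdf2.
  - by move=> z; rewrite lee_fin mulr_ge0 ?normal_pdf_ge0// indicE.
by rewrite !H; apply: eq_integral => y _; rewrite pdfE.
Qed.

(** Sandwich by the smoothed half-line: for small s the normal mass of ]-oo, c[ around x, with c the
    midpoint of r and r', is close to 1 when x < r and close to 0 when x >= r'. *)
Let le_lt (r r' : R) : (r < r')%R -> m1 `]-oo, r[%classic <= m2 `]-oo, r'[%classic.
Proof.
move=> rr'; apply/lee_addgt0Pr => e e0.
pose c := ((r + r') / 2)%R; pose d := ((r' - r) / 2)%R.
have d0 : (0 < d)%R by rewrite /d; lra.
pose M := fine (m1 setT).
have M0 : (0 <= M)%R by rewrite fine_ge0.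
have ME : m1 setT = M%:E by rewrite fineK// fin_num_measure.
(* With eta the tail bound of [normal_tail], the sandwich loses eta M on each of its two sides. *)
have [s s0 sH] : exists2 s : R, (0 < s)%R & (6 * (s / d) ^+ 2 * (2 * (M + 1)) <= e)%R.
  exists (Num.sqrt (e / (12 * (M + 1))) * d)%R.
    by rewrite mulr_gt0// sqrtr_gt0 divr_gt0// mulr_gt0//; lra.
  have M1 : (0 < M + 1)%R by lra.
  rewrite mulfK ?gt_eqF// sqr_sqrtr; last by rewrite divr_ge0 ?(ltW e0)// mulr_ge0// ltW.
  by rewrite le_eqVlt; apply/orP; left; apply/eqP; field; rewrite gt_eqF.
set eta := (6 * (s / d) ^+ 2)%R in sH.
have eta0 : (0 <= eta)%R by rewrite mulr_ge0 ?sqr_ge0.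
set A : set R := `]-oo, c[%classic.
have mA : measurable A by exact: measurable_itv.
have lo x : (x < r)%R -> (1 - eta)%:E <= normal_prob x s A.
  move=> xr; have := @probability_setC _ _ _ (normal_prob x s) _ mA.
  move=> /= H; have : normal_prob x s (~` A) <= eta%:E.
    apply: normal_tail => //; first exact: measurableC.
    move=> y; rewrite /A /= in_itv/= => /negP; rewrite -leNgt => cy.
    by apply: le_trans (ler_norm _); rewrite /d; rewrite /c in cy; lra.
  rewrite H.
  have pf : normal_prob x s A \is a fin_num by rewrite fin_num_measure.
  by rewrite -(fineK pf) -EFinB !lee_fin; lra.
have hi x : (r' <= x)%R -> normal_prob x s A <= eta%:E.
  move=> xr; apply: normal_tail => //.
  move=> y; rewrite /A /= in_itv/= => cy; rewrite distrC.
  by apply: le_trans (ler_norm _); rewrite /d; rewrite /c in cy; lra.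
have L1 : (1 - eta)%:E * m1 `]-oo, r[%classic <= \int[m1]_x normal_prob x s A.
  apply: (@le_trans _ _ (\int[m1]_(x in `]-oo, r[%classic) normal_prob x s A)).
    have [h|h] := leP (1 - eta)%R 0%R.
      apply: (@le_trans _ _ 0); last by apply: integral_ge0.
      by apply: mule_le0_ge0.
    rewrite -integral_cst//; apply: ge0_le_integral => //.
    - by move=> x _; rewrite lee_fin ltW.
    - by apply: measurable_funTS; exact: mnormal.
  apply: ge0_subset_integral => //; exact: mnormal.
have L2 : \int[m2]_x normal_prob x s A <= m2 `]-oo, r'[%classic + eta%:E * m2 setT.
  apply: (@le_trans _ _ (\int[m2]_x ((\1_(`]-oo, r'[%classic) x)%:E + eta%:E))).
    apply: ge0_le_integral => //.
    - exact: mnormal.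
    - by apply: emeasurable_funD => //; apply/measurable_EFinP; exact: measurable_indic.
    - move=> x _; rewrite indicE; have [xr|xr] := ltP x r'.
        rewrite mem_set/= ?in_itv//=; apply: (@le_trans _ _ 1); first exact: probability_le1.
        by rewrite leeDl// lee_fin.
      by rewrite memNset/= ?in_itv/= ?add0e; [exact: hi|apply/negP; rewrite -leNgt].
  rewrite ge0_integralD//; last by apply/measurable_EFinP; exact: measurable_indic.
  by rewrite integral_indic// setIT integral_cst.
have fin1 : m1 `]-oo, r[%classic \is a fin_num by rewrite fin_num_measure.
have fin2 : m2 `]-oo, r'[%classic \is a fin_num by rewrite fin_num_measure.
have le1 : m1 `]-oo, r[%classic <= M%:E.
  by rewrite -ME; apply: le_measure; rewrite ?inE.
move: L1 L2 le1; rewrite smoothE// -massE ME => L1 L2.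
have := le_trans L1 L2.
rewrite -(fineK fin1) -(fineK fin2) -!EFinM -!EFinD !lee_fin.
by move: (fine _) (fine _) => u v; nra.
Qed.

Lemma cos_uniqueness_le (r : R) : m1 `]-oo, r[%classic <= m2 `]-oo, r[%classic.
Proof.
have E : `]-oo, r[%classic = \bigcup_n `]-oo, (r - n.+1%:R^-1)%R[%classic :> set R.
  apply/seteqP; split => x /=; rewrite in_itv/=.
    move=> xr; have xr' : (0 < r - x)%R by rewrite subr_gt0.
    have [N _ /(_ N (leqnn N))/= H] := near_infty_natSinv_lt (PosNum xr'); exists N => //=.
    by rewrite in_itv/= ltrBrDr -ltrBrDl.
  move=> [n _]; rewrite /= in_itv/= => /lt_le_trans; apply.
  by rewrite gerBl.
have cv : m1 `]-oo, (r - n.+1%:R^-1)%R[%classic @[n --> \oo] --> m1 `]-oo, r[%classic.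
  rewrite E; apply: nondecreasing_cvg_mu.
  - by move=> n; exact: measurable_itv.
  - by apply: bigcupT_measurable => n; exact: measurable_itv.
  - move=> a b ab; apply/subsetPset; apply: subset_itvl; rewrite bnd_simp lerD2l lerN2.
    by rewrite lef_pV2 ?posrE// ler_nat.
rewrite -(cvg_lim (@ereal_hausdorff R) cv); apply: lime_le.
  by apply/cvg_ex; eexists; exact: cv.
by near=> n; apply: le_lt; rewrite ltrBlDr ltrDl invr_gt0.
Unshelve. all: by end_near.
Qed.

End OneSide.

Lemma cos_uniqueness (m1 m2 : {finite_measure set GR -> \bar R}) :
  (forall a b : R, \int[m1]_x (1 + cos (a * x + b))%:E =
                   \int[m2]_x (1 + cos (a * x + b))%:E) ->
  forall A, measurable A -> m1 A = m2 A.
Proof.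
move=> m12.
have E r : m1 `]-oo, r[%classic = m2 `]-oo, r[%classic.
  by apply/eqP; rewrite eq_le !cos_uniqueness_le.
move=> A mA.
apply: (@measure_unique _ R GR (@RGenInftyO.G R) (fun n => `]-oo, n%:R[%classic)) => //.
- exact: RGenInftyO.measurableE.
- move=> _ _ [x ->] [y ->]; exists (Num.min x y); apply/seteqP; split => z /=.
    by rewrite !in_itv/= lt_min => -[-> ->].
  by rewrite !in_itv/= lt_min => /andP[].
- by move=> n; exists n%:R.
- apply/seteqP; split => // x _; have [N _ /(_ N (leqnn N)) H] := nbhs_infty_gtr x.
  by exists N => //=; rewrite in_itv.
- by move=> _ [r ->]; exact: E.
- by move=> k; rewrite ltey_eq fin_num_measure.
Qed.

End CosineUniqueness.

Section FiniteMeasureOf.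
Context {R : realType} {d : measure_display} {T : measurableType d}.
Local Open Scope ereal_scope.

(** A copy of [m] that mentions the proof of finiteness, to carry the structure of a finite
    measure. *)
Definition finite_measure_of (m : {measure set T -> \bar R})
  (mT : m setT < +oo) : set T -> \bar R := m.

Variables (m : {measure set T -> \bar R}) (mT : m setT < +oo).

HB.instance Definition _ := Measure.on (finite_measure_of mT).

Let fin_finite_measure_of : fin_num_fun (finite_measure_of mT).
Proof. exact: lty_fin_num_fun. Qed.

HB.instance Definition _ :=
  Measure_isFinite.Build _ _ _ (finite_measure_of mT) fin_finite_measure_of.

End FiniteMeasureOf.

Section ImageMeasure.
Context {R : realType} {d1 d2 : measure_display}
  {T1 : measurableType d1} {T2 : measurableType d2}.

Definition image_measure (m : {measure set T1 -> \bar R}) (f : T1 -> T2)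
  (mf : measurable_fun setT f) : set T2 -> \bar R := pushforward m f.

Variables (m : {measure set T1 -> \bar R}) (f : T1 -> T2).
Hypothesis mf : measurable_fun setT f.

Let image_measure0 : image_measure m mf set0 = 0%E.
Proof. by rewrite /image_measure /pushforward preimage_set0 measure0. Qed.

Let image_measure_ge0 A : (0 <= image_measure m mf A)%E.
Proof. exact: measure_ge0. Qed.

Let image_measure_additive : semi_sigma_additive (image_measure m mf).
Proof.
move=> F mF tF mUF; rewrite /image_measure /pushforward preimage_bigcup.
apply: measure_semi_sigma_additive.
- by move=> n; rewrite -[X in measurable X]setTI; exact: mf.
- apply/trivIsetP => /= i j _ _ ij; rewrite -preimage_setI.
  by move/trivIsetP : tF => /(_ _ _ _ _ ij) ->//; rewrite preimage_set0.
- by rewrite -preimage_bigcup -[X in measurable X]setTI; exact: mf.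
Qed.

HB.instance Definition _ := isMeasure.Build _ _ _ (image_measure m mf)
  image_measure0 image_measure_ge0 image_measure_additive.

Lemma ge0_integral_image_measure (g : T2 -> \bar R) :
  measurable_fun setT g -> (forall x, 0 <= g x)%E ->
  (\int[image_measure m mf]_x g x = \int[m]_x g (f x))%E.
Proof. by move=> mg g0; rewrite [LHS](ge0_integral_pushforward mf). Qed.

End ImageMeasure.

Section CosineUniquenessMeasure.
Context {R : realType}.
Notation GR := (measurableTypeR R).
Local Open Scope ereal_scope.

Lemma cos_uniqueness_measure (m1 m2 : {measure set GR -> \bar R}) :
  m1 setT < +oo -> m2 setT < +oo ->
  (forall a b : R, \int[m1]_x (1 + cos (a * x + b))%:E =
                   \int[m2]_x (1 + cos (a * x + b))%:E) ->
  forall A, measurable A -> m1 A = m2 A.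
Proof.
move=> f1 f2 m12.
exact: (@cos_uniqueness R (finite_measure_of f1) (finite_measure_of f2)).
Qed.

End CosineUniquenessMeasure.

(** * Linear forms and white Gaussian vectors *)

Section LinearFormModel.
Context {R : realType}.
Local Open Scope ereal_scope.
Notation gam := (normal_prob 0 1 : probability (measurableTypeR R) R).
Notation GR := (measurableTypeR R).

Definition lform k (a : 'I_k -> R) (t : k.-tuple GR) : R :=
  (\sum_(i < k) a i * tnth t i)%R.

Lemma measurable_lform k (a : 'I_k -> R) :
  measurable_fun [set: k.-tuple GR] (lform a).
Proof.
rewrite /lform; apply: (@measurable_sum _ _ _ _ _ _ (fun i (t : k.-tuple GR) => a i * tnth t i)%R) => i.
by apply: measurable_funM => //; exact: measurable_tnth.
Qed.

Lemma cos_ge0D (beta z : R) : (`|beta| <= 1)%R -> (0 <= 1 + beta * cos z)%R.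
Proof.
move=> b1; have : (`|beta * cos z| <= 1)%R.
  by rewrite normrM mulr_ile1// ler_norml cos_geN1 cos_le1.
by rewrite ler_norml; lra.
Qed.

Lemma measurable_cos : measurable_fun setT (@cos R).
Proof. by apply: continuous_measurable_fun; exact: continuous_cos. Qed.

(** The amplitude [beta] closes the induction: integrating out the tail multiplies the cosine by
    some e in [0, 1], and the integrand in the head has the same form with amplitude beta e. *)
Lemma integral_prodN_cos_lform k (a : 'I_k -> R) (c beta : R) : (`|beta| <= 1)%R ->
  \int[prodN gam k]_t (1 + beta * cos (lform a t + c))%:E =
  (1 + beta * (cos c * expR (- ((\sum_(i < k) a i ^+ 2) / 2))))%:E.
Proof.
have mc n (b : 'I_n -> R) (c' be : R) : measurable_fun [set: n.-tuple GR]
    (fun t => (1 + be * cos (lform b t + c'))%:E).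
  apply/measurable_EFinP; apply: measurable_funD => //; apply: measurable_funM => //.
  apply: (measurableT_comp measurable_cos).
  by apply: measurable_funD => //; exact: measurable_lform.
elim: k a c beta => [|k IH] a c beta b1.
  rewrite integral_prodN0//; last by move=> t; rewrite lee_fin cos_ge0D.
  by rewrite /lform !big_ord0 add0r mul0r oppr0 expR0 mulr1.
rewrite integral_prodNS//; last by move=> t; rewrite lee_fin cos_ge0D.
pose e := expR (- ((\sum_(i < k) a (lift ord0 i) ^+ 2) / 2)).
have e01 : (0 <= e <= 1)%R.
  rewrite expR_ge0 -expR0 ler_expR oppr_le0 divr_ge0// sumr_ge0// => i _.
  exact: sqr_ge0.
transitivity (\int[gam]_x (1 + (beta * e) * cos (a ord0 * x + c))%:E).
  apply: eq_integral => x _.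
  rewrite (_ : (1 + beta * e * cos (a ord0 * x + c))%:E = (1 + beta * (cos (a ord0 * x + c) * e))%:E); last first.
    by rewrite [(cos _ * e)%R]mulrC mulrA.
  rewrite -(IH (fun i => a (lift ord0 i)))//; apply: eq_integral => t _.
  do 4 congr (_ _); rewrite /lform big_ord_recl tnth_tcons0 /=.
  under eq_bigr do rewrite tnth_tconsS /=.
  by rewrite addrA [(a ord0 * x + _)%R]addrC.
rewrite integral_cos_normal//; last first.
  by case/andP: e01 => e0 e1; rewrite normrM (ger0_norm e0) mulr_ile1.
rewrite -mulrA; congr (1 + beta * _)%:E.
rewrite mulrCA /e -expRD big_ord_recl mulr1; congr (_ * expR _)%R.
by rewrite addrC; field.
Qed.

Lemma prodN_lform k (a : 'I_k -> R) (A : set R) : a != (fun=> 0%R) -> measurable A ->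
  prodN gam k [set t | A (lform a t)] =
  normal_prob 0 (Num.sqrt (\sum_(i < k) a i ^+ 2)) A.
Proof.
move=> a0 mA; set s := Num.sqrt _.
have s0 : (0 < s)%R.
  rewrite sqrtr_gt0 lt_neqAle sumr_ge0; last by move=> i _; exact: sqr_ge0.
  rewrite andbT eq_sym; apply: contra_neq a0 => /eqP.
  rewrite psumr_eq0; last by move=> i _; exact: sqr_ge0.
  move=> /allP H; apply/funext => i; apply/eqP.
  by have := H i (mem_index_enum i); rewrite sqrf_eq0.
have s2 : (s ^+ 2 = \sum_(i < k) a i ^+ 2)%R.
  by rewrite sqr_sqrtr// sumr_ge0// => i _; exact: sqr_ge0.
rewrite -[LHS]/(@image_measure _ _ _ _ GR (prodN gam k) _ (measurable_lform a) A).
apply: (@cos_uniqueness_measure R (@image_measure _ _ _ _ GR (prodN gam k) _ (measurable_lform a)) (normal_prob 0 s)) => //.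
- by rewrite /image_measure/= /pushforward preimage_setT probability_setT ltry.
- by rewrite [X in X < _](_ : _ = 1); [exact: ltry|exact: (probability_setT (normal_prob 0 s))].
move=> b c.
rewrite ge0_integral_image_measure; last 2 first.
- apply/measurable_EFinP; apply: measurable_funD => //; apply: (measurableT_comp measurable_cos).
  by apply: measurable_funD => //; apply: measurable_funM.
- by move=> x; rewrite lee_fin -[cos _]mul1r cos_ge0D ?normr1.
under [RHS]eq_integral do rewrite -[cos _]mul1r.
rewrite integral_cos_normal ?normr1//.
under eq_integral => t _.
  rewrite /= (_ : cos (b * lform a t + c) = 1 * cos (lform (fun i => b * a i) t + c))%R; last first.
    by rewrite mul1r /lform mulr_sumr; congr (cos (_ + _)); apply: eq_bigr => i _; rewrite mulrA.
  over.
rewrite integral_prodN_cos_lform ?normr1//.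
congr (1 + 1 * (_ * expR (- (_ / 2))))%:E.
by rewrite exprMn s2 mulr_sumr; apply: eq_bigr => i _; rewrite exprMn.
Qed.

End LinearFormModel.

Section WhiteVector.
Context {R : realType} {d : measure_display} {T : measurableType d}.
Notation GR := (measurableTypeR R).
Variables (P : probability T R) (k : nat) (xi : 'I_k -> T -> R).
Hypothesis mxi : forall i, measurable_fun setT (xi i).
Hypothesis white : forall u : 'I_k -> R, u != (fun=> 0%R) -> forall B : set R, measurable B ->
  P ((fun w => \sum_i u i * xi i w) @^-1` B) =
  normal_prob 0 (Num.sqrt (\sum_i u i ^+ 2)) B.
Local Open Scope ereal_scope.

Let lin (u : 'I_k -> R) (c : R) (w : T) : R := (\sum_i u i * xi i w + c)%R.

Let mlin u c : measurable_fun setT (lin u c).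
Proof.
apply: measurable_funD => //.
apply: (@measurable_sum _ _ _ _ _ _ (fun i w => u i * xi i w)%R) => i.
exact: measurable_funM.
Qed.

Let mcos1 u c : measurable_fun setT (fun w => (1 + cos (lin u c w))%:E).
Proof.
apply/measurable_EFinP; apply: measurable_funD => //.
exact: (measurableT_comp (@measurable_cos R)).
Qed.

Let cos1 (z : R) : (0 <= 1 + cos z)%R.
Proof. by rewrite -[cos z]mul1r cos_ge0D ?normr1. Qed.

Let phi (u : 'I_k -> R) (c : R) : R := (1 + cos c * expR (- ((\sum_i u i ^+ 2) / 2)))%R.

Let phi_ge0 u c : (0 <= phi u c)%R.
Proof.
rewrite /phi mulrC cos_ge0D// ger0_norm ?expR_ge0// -expR0 ler_expR oppr_le0.
by rewrite divr_ge0// sumr_ge0// => i _; exact: sqr_ge0.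
Qed.

Let claim0 u c : \int[P]_w (1 + cos (lin u c w))%:E = (phi u c)%:E.
Proof.
have [->|u0] := eqVneq u (fun=> 0%R).
  have E w : lin (fun=> 0%R) c w = c by rewrite /lin big1 ?add0r// => i _; rewrite mul0r.
  under eq_integral do rewrite E.
  rewrite integral_cst// [X in _ * X]probability_setT mule1 /phi big1 ?mul0r ?oppr0 ?expR0 ?mulr1//.
  by move=> i _; rewrite expr0n.
have s0 : (0 < Num.sqrt (\sum_i u i ^+ 2))%R.
  rewrite sqrtr_gt0 lt_neqAle sumr_ge0; last by move=> i _; exact: sqr_ge0.
  rewrite andbT eq_sym; apply: contra_neq u0 => /eqP.
  rewrite psumr_eq0; last by move=> i _; exact: sqr_ge0.
  move=> /allP H; apply/funext => i; apply/eqP.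
  by have := H i (mem_index_enum i); rewrite sqrf_eq0.
have mc : measurable_fun setT (fun x : R => (1 + cos (x + c))%:E).
  apply/measurable_EFinP; apply: measurable_funD => //; apply: (measurableT_comp (@measurable_cos R)).
  exact: measurable_funD.
transitivity (\int[@image_measure _ _ _ _ GR P _ (mlin u 0)]_x (1 + cos (x + c))%:E).
  rewrite ge0_integral_image_measure//.
  by apply: eq_integral => w _; rewrite /= /lin addr0.
transitivity (\int[normal_prob 0 (Num.sqrt (\sum_i u i ^+ 2))]_x (1 + 1 * cos (1 * x + c))%:E).
  under [RHS]eq_integral do rewrite !mul1r.
  apply: eq_measure_integral => A mA _; rewrite /= /image_measure /pushforward /=.
  rewrite -white//; congr (P _); apply/seteqP; split => w /=; rewrite /lin addr0//.
rewrite integral_cos_normal ?normr1// mul1r mul1r /phi sqr_sqrtr//.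
by rewrite sumr_ge0// => i _; exact: sqr_ge0.
Qed.

(** [D] is an event about the coordinates before [r]. The measure with density 1 + cos(lin u c) on
    [D], transported by [xi r], is identified with a multiple of N(0, 1) by its cosine transform;
    this transform reduces to the hypothesis on [D] because a product of cosines is a half sum of
    cosines of other linear forms. *)
Let step (D : set T) (kap : R) (r : 'I_k) (B : set R) : measurable D -> measurable B ->
  (0 <= kap)%R ->
  (forall u c, (forall i : 'I_k, (i < r)%N -> u i = 0%R) ->
     \int[P]_(w in D) (1 + cos (lin u c w))%:E = kap%:E * (phi u c)%:E) ->
  forall u c, (forall i : 'I_k, (i <= r)%N -> u i = 0%R) ->
     \int[P]_(w in D `&` xi r @^-1` B) (1 + cos (lin u c w))%:E =
     kap%:E * normal_prob 0 1 B * (phi u c)%:E.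
Proof.
move=> mD mB kap0 HD u c u0.
have kp0 : (0 <= kap * phi u c)%R by rewrite mulr_ge0.
pose g (w : T) : \bar R := (\1_D w * (1 + cos (lin u c w)))%:E.
have mg : measurable_fun setT g.
  apply/measurable_EFinP; apply: measurable_funM; first exact: measurable_indic.
  by apply/measurable_EFinP; exact: mcos1.
have g0 w : 0 <= g w by rewrite lee_fin mulr_ge0// indicE.
pose m1 := @image_measure _ _ _ _ GR (density_measure P mg g0) _ (mxi r).
pose m2 := mscale (NngNum kp0) (normal_prob 0 1 : {measure set GR -> \bar R}).
have intD (D' : set T) (h : T -> \bar R) : measurable D' -> \int[P]_(w in D') h w = \int[P]_w ((\1_D' w)%:E * h w).
  move=> mD'; rewrite integral_mkcond; apply: eq_integral => w _; rewrite patchE indicE.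
  by case: (_ \in _); rewrite ?mul1e ?mul0e.
have mB' : measurable (xi r @^-1` B) by rewrite -[X in measurable X]setTI; exact: mxi.
have -> : \int[P]_(w in D `&` xi r @^-1` B) (1 + cos (lin u c w))%:E = m1 B.
  rewrite /m1 /image_measure /pushforward /density_measure intD; last exact: measurableI.
  transitivity (\int[P]_w ((\1_(xi r @^-1` B) w)%:E * g w)); last by rewrite -intD.
  apply: eq_integral => w _; rewrite /g indicI /=.
  by rewrite -!EFinM; congr EFin; rewrite mulrCA mulrA.
have -> : kap%:E * normal_prob 0 1 B * (phi u c)%:E = m2 B.
  by rewrite /m2 /mscale /= EFinM muleAC.
(* The zero form with phase pi / 2 has cosine 0, so the hypothesis on [D] reads off its
   probability. *)
have kapE : P D = kap%:E.
  have := HD (fun=> 0%R) (pi / 2)%R (fun _ _ => erefl).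
  have E w : (1 + cos (lin (fun=> 0) (pi / 2) w) = 1)%R.
    by rewrite /lin big1 ?add0r ?cos_pihalf ?addr0// => i _; rewrite mul0r.
  under eq_integral do rewrite E.
  by rewrite integral_cst// mul1e /phi cos_pihalf mul0r addr0 mule1.
have m1T : m1 setT = (kap * phi u c)%:E.
  transitivity (\int[P]_w ((\1_D w)%:E * (1 + cos (lin u c w))%:E)).
    rewrite /m1 /image_measure /pushforward preimage_setT /density_measure.
    by apply: eq_integral => w _; rewrite /g EFinM.
  by rewrite -intD// HD// => i ir; apply: u0; exact: ltnW.
apply: (@cos_uniqueness_measure R m1 m2) => //.
- by rewrite [X in X < _](_ : _ = (kap * phi u c)%:E)// ltry.
- rewrite [X in X < _](_ : _ = (kap * phi u c)%:E) ?ltry//.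
  rewrite -[RHS]mule1 -[LHS]/((kap * phi u c)%:E * _); congr (_ * _).
  exact: (probability_setT (normal_prob 0 1)).
move=> a b.
have mcab : measurable_fun setT (fun x : R => (1 + cos (a * x + b))%:E).
  apply/measurable_EFinP; apply: measurable_funD => //; apply: (measurableT_comp (@measurable_cos R)).
  by apply: measurable_funD => //; apply: measurable_funM.
rewrite ge0_integral_mscale//.
rewrite ge0_integral_image_measure//.
rewrite ge0_integral_density//; last exact: (measurableT_comp mcab).
under [X in _ * X]eq_integral do rewrite -[cos _]mul1r.
rewrite integral_cos_normal ?normr1// mul1r mulr1.
(* For s = 1 and s = -1 these are the two forms produced by the product-to-sum formula. *)
pose v (s : R) : 'I_k -> R := fun i => (u i + s * (if i == r then a else 0))%R.
have linv s w : lin (v s) (c + s * b) w = (lin u c w + s * (a * xi r w + b))%R.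
  rewrite /lin /v; under eq_bigr do rewrite mulrDl.
  have S2 : (\sum_i s * (if i == r then a else 0) * xi i w = s * a * xi r w)%R.
    by rewrite (bigD1 r)//= eqxx big1 ?addr0// => i /negbTE ->; rewrite mulr0 mul0r.
  by rewrite big_split/= S2; ring.
have vs s : (s ^+ 2 = 1 -> \sum_i v s i ^+ 2 = \sum_i u i ^+ 2 + a ^+ 2)%R.
  move=> s2; rewrite [in LHS](bigD1 r)//= [in RHS](bigD1 r)//= /v eqxx u0// add0r exprMn s2 mul1r.
  rewrite expr0n/= add0r addrC; congr (_ + _)%R; apply: eq_bigr => i /negbTE ->.
  by rewrite mulr0 addr0.
have v0 s (i : 'I_k) : (i < r)%N -> v s i = 0%R.
  by move=> ir; rewrite /v u0 1?ltnW// (_ : (i == r) = false) ?mulr0 ?addr0//; apply/eqP => ir'; rewrite ir' ltnn in ir.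
pose w0 : 'I_k -> R := fun i => if i == r then a else 0%R.
have lin0 w : lin w0 b w = (a * xi r w + b)%R.
  rewrite /lin (bigD1 r)//= /w0 eqxx big1 ?addr0// => i /negbTE ->; by rewrite mul0r.
have w0s : (\sum_i w0 i ^+ 2 = a ^+ 2)%R.
  rewrite (bigD1 r)//= /w0 eqxx big1 ?addr0// => i /negbTE ->; by rewrite expr0n.
have w00 (i : 'I_k) : (i < r)%N -> w0 i = 0%R.
  by move=> ir; rewrite /w0 (_ : (i == r) = false)//; apply/eqP => ir'; rewrite ir' ltnn in ir.
have ul (i : 'I_k) : (i < r)%N -> u i = 0%R by move=> ir; apply: u0; exact: ltnW.
pose cc w := (cos (a * xi r w + b))%R.
pose I := \int[P]_(w in D) ((1 + cc w) * (1 + cos (lin u c w)))%:E.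
have mcc : measurable_fun setT cc.
  have -> : cc = (fun w => cos (lin w0 b w)) by apply/funext => w; rewrite lin0.
  exact: (measurableT_comp (@measurable_cos R)).
have mI : measurable_fun setT (fun w => ((1 + cc w) * (1 + cos (lin u c w)))%:E).
  apply/measurable_EFinP; apply: measurable_funM; first exact: measurable_funD.
  by apply/measurable_EFinP; exact: mcos1.
have half_ge0 : (0 <= 2^-1 :> R)%R by [].
(* Adding 2 keeps all terms nonnegative: (1 + X) (1 + Y) + 2 is (1 + X) + (1 + Y) plus the half sum
   of 1 + cos of the sum and 1 + cos of the difference. *)
have key : I + (2 * kap)%:E = (kap * (phi w0 b + phi u c + (2^-1 * phi (v 1) (c + 1 * b) + 2^-1 * phi (v (-1)) (c + (-1) * b))))%:E.
  have -> : (2 * kap)%:E = \int[P]_(w in D) (2%:E).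
    by rewrite EFinM -kapE -integral_cst.
  rewrite /I -ge0_integralD//; last 2 first.
  - by move=> w _; rewrite lee_fin mulr_ge0//; exact: cos1.
  - exact: measurable_funTS.
  transitivity (\int[P]_(w in D) (((1 + cos (lin w0 b w))%:E + (1 + cos (lin u c w))%:E) +
     ((2^-1)%:E * (1 + cos (lin (v 1) (c + 1 * b) w))%:E + (2^-1)%:E * (1 + cos (lin (v (-1)) (c + (-1) * b) w))%:E))).
    apply: eq_integral => w _; rewrite !linv lin0 -!EFinM -!EFinD; congr EFin.
    rewrite mul1r mulN1r cosD cosB /cc; set X := cos _; set Y := cos _; by field.
  have m1c z e : measurable_fun D (fun w => (1 + cos (lin z e w))%:E) by exact: measurable_funTS (mcos1 _ _).
  have c0 z e w : 0 <= (1 + cos (lin z e w))%:E by rewrite lee_fin.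
  have intDD (f1 f2 : T -> \bar R) : measurable_fun D f1 -> measurable_fun D f2 ->
      (forall w, 0 <= f1 w) -> (forall w, 0 <= f2 w) ->
      \int[P]_(w in D) (f1 w + f2 w) = \int[P]_(w in D) f1 w + \int[P]_(w in D) f2 w.
    by move=> mf1 mf2 f10 f20; rewrite ge0_integralD.
  have intZ z e : \int[P]_(w in D) ((2^-1)%:E * (1 + cos (lin z e w))%:E) =
      (2^-1)%:E * \int[P]_(w in D) (1 + cos (lin z e w))%:E.
    by rewrite ge0_integralZl.
  have s0 z e w : 0 <= (2^-1)%:E * (1 + cos (lin z e w))%:E by rewrite mule_ge0.
  have m2c z e : measurable_fun D (fun w => (2^-1)%:E * (1 + cos (lin z e w))%:E).
    exact: emeasurable_funM.
  rewrite intDD; [|exact: emeasurable_funD|exact: emeasurable_funD|by move=> w; exact: adde_ge0|by move=> w; exact: adde_ge0].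
  rewrite (intDD _ _ (m1c _ _) (m1c _ _) (c0 _ _) (c0 _ _)).
  rewrite (intDD _ _ (m2c _ _) (m2c _ _) (s0 _ _) (s0 _ _)) !intZ.
  rewrite (HD _ _ w00) (HD _ _ ul) (HD _ _ (v0 1%R)) (HD _ _ (v0 (-1)%R)).
  by rewrite -!EFinM -!EFinD; congr EFin; ring.
have -> : \int[P]_x ((1 + cos (a * xi r x + b))%:E * g x) = I.
  rewrite /I (intD D)//; apply: eq_integral => w _; rewrite /g -!EFinM; congr EFin.
  by rewrite mulrCA.
have If : I = (kap * (phi w0 b + phi u c + (2^-1 * phi (v 1) (c + 1 * b) + 2^-1 * phi (v (-1)) (c + (-1) * b))) - 2 * kap)%:E.
  by rewrite EFinB -key addeK.
rewrite If (_ : (NngNum kp0)%:num = (kap * phi u c)%R)// -EFinM; congr EFin; rewrite /phi w0s !vs ?expr1n ?sqrrN ?expr1n//.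
rewrite mul1r mulN1r cosD cosB.
have -> : (- ((\sum_i u i ^+ 2 + a ^+ 2) / 2) = - (\sum_i u i ^+ 2 / 2) + - (a ^+ 2 / 2))%R.
  by rewrite -mulr_suml; field.
rewrite expRD -mulr_suml; set E1 := expR _; set E2 := expR _.
by field.
Qed.

(** Cramer-Wold: the laws of the linear forms determine the joint law. The coordinates are
    constrained one at a time by [step], the transform of forms in the remaining coordinates
    factorizing over the constraints already imposed. *)
Lemma white_independent (I : 'I_k -> set R) : (forall i, measurable (I i)) ->
  P [set w | forall i, I i (xi i w)] = \prod_(i < k) normal_prob 0 1 (I i).
Proof.
move=> mI.
pose D r := [set w | forall i : 'I_k, (i < r)%N -> I i (xi i w)].
pose q r := (\prod_(i < k | (i < r)%N) fine (normal_prob 0 1 (I i)))%R.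
have mD r : measurable (D r).
  rewrite (_ : D r = \big[setI/setT]_(i < k) (if (i < r)%N then xi i @^-1` I i else setT)).
    apply: bigsetI_measurable => i _; case: ifP => // _.
    by rewrite -[X in measurable X]setTI; exact: mxi.
  rewrite -bigcap_seq; apply/seteqP; split => w /=.
    by move=> Dw i _; case: ifP => // ir; exact: Dw.
  by move=> Dw i ir; have := Dw i (mem_index_enum i); rewrite ir.
have q0 r : (0 <= q r)%R by apply: prodr_ge0 => i _; exact: fine_ge0.
have H r : (r <= k)%N -> forall u c, (forall i : 'I_k, (i < r)%N -> u i = 0%R) ->
     \int[P]_(w in D r) (1 + cos (lin u c w))%:E = (q r)%:E * (phi u c)%:E.
  elim: r => [_ u c _|r IH rk u c u0].
    rewrite /q big1 ?mul1e// (_ : D 0%N = setT) ?claim0//.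
    by apply/seteqP; split.
  pose ro := Ordinal rk.
  have -> : D r.+1 = D r `&` xi ro @^-1` I ro.
    apply/seteqP; split => w /=.
      by move=> Dw; split => [i ir|]; [apply: Dw; exact: ltnW|exact: Dw].
    move=> [Dw Iw] i; rewrite ltnS leq_eqVlt => /orP[/eqP ir|]; last exact: Dw.
    by rewrite (_ : i = ro)//; exact: val_inj.
  rewrite (@step _ (q r))//; last by move=> u' c' u'0; apply: IH => //; exact: ltnW.
  have -> : (q r.+1)%:E = (q r)%:E * normal_prob 0 1 (I ro).
    have -> : q r.+1 = (fine (normal_prob 0 1 (I ro)) * q r)%R.
      rewrite /q [LHS](bigD1 ro)//=; congr (_ * _)%R; apply: eq_bigl => i.
      rewrite ltnS leq_eqVlt (_ : (i == r :> nat) = (i == ro))//.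
      by case: (i =P ro) => [->|]; rewrite ?ltnn ?andbF ?andbT.
    have fN : normal_prob 0 1 (I ro) \is a fin_num.
      exact: (fin_num_measure (normal_prob 0 1) _ (mI ro)).
    by rewrite EFinM (fineK fN) muleC.
  by [].
have := H k (leqnn _) (fun=> 0%R) (pi / 2)%R (fun _ _ => erefl).
have E w : (1 + cos (lin (fun=> 0) (pi / 2) w) = 1)%R.
  by rewrite /lin big1 ?add0r ?cos_pihalf ?addr0// => i _; rewrite mul0r.
under eq_integral do rewrite E.
rewrite integral_cst// mul1e /phi cos_pihalf mul0r addr0 mule1.
rewrite (_ : D k = [set w | forall i, I i (xi i w)]); last first.
  by apply/seteqP; split => w /= Dw i; [apply: Dw|].
move=> ->; rewrite /q -prodEFin; under eq_bigl do rewrite ltn_ord.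
by apply: eq_bigr => i _; rewrite fineK//; exact: (fin_num_measure (normal_prob 0 1) _ (mI i)).
Qed.

End WhiteVector.

(** * Gaussian deviation inequalities *)

Section GaussianChaos.
Context {R : realType}.
Notation GR := (measurableTypeR R).
Notation gam := (normal_prob 0 1 : probability (measurableTypeR R) R).
Notation mu := (@lebesgue_measure R).
Local Open Scope ereal_scope.

Lemma normal_peakM (s c : R) : (0 < c)%R ->
  normal_peak (s * c) = (normal_peak s / c)%R.
Proof.
move=> c0; rewrite /normal_peak -invfM; congr (_^-1)%R.
rewrite (_ : (s * c) ^+ 2 * trigo.pi *+ 2 = c ^+ 2 * (s ^+ 2 * trigo.pi *+ 2))%R; last first.
  by rewrite exprMn -mulrA mulrCA mulrnAr.
by rewrite sqrtrM ?sqr_ge0// sqrtr_sqr ger0_norm ?(ltW c0)// mulrC.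
Qed.

(** Tilting: exp(t x^2) times the density of deviation s is 1 / r times the density of deviation s /
    r, where r^2 = 1 - 2 t s^2. *)
Lemma integral_normal_exp_sqr (s t : R) : (0 < s)%R -> (2 * t * s ^+ 2 < 1)%R ->
  \int[normal_prob 0 s]_x (expR (t * x ^+ 2))%:E =
  ((Num.sqrt (1 - 2 * t * s ^+ 2))^-1)%:E.
Proof.
move=> s0 ts1; set r := Num.sqrt _.
have r0 : (0 < r)%R by rewrite sqrtr_gt0 subr_gt0.
have r2 : (r ^+ 2 = 1 - 2 * t * s ^+ 2)%R by rewrite sqr_sqrtr// subr_ge0 ltW.
have mexp : measurable_fun setT (fun x : R => (expR (t * x ^+ 2))%:E).
  apply/measurable_EFinP; apply: measurableT_comp => //.
  by apply: measurable_funM => //; exact: measurable_funX.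
rewrite ge0_integral_normal_prob//.
have sr0 : (0 < s / r)%R by rewrite divr_gt0.
transitivity (\int[mu]_x ((r^-1)%:E * (normal_pdf 0 (s / r) x)%:E)).
  apply: eq_integral => x _; rewrite -!EFinM; congr EFin.
  rewrite !normal_pdfE2// normal_peakM ?invr_gt0// invrK.
  rewrite mulrCA -expRD [RHS]mulrA [(r^-1 * _)%R]mulrC mulfK ?gt_eqF//.
  congr (_ * expR _)%R.
  have -> : (((0 - x) / (s / r)) ^+ 2 = x ^+ 2 / s ^+ 2 * r ^+ 2)%R.
    by field; rewrite !gt_eqF.
  by rewrite r2; field; rewrite gt_eqF.
rewrite ge0_integralZl//; last 3 first.
- by apply/measurable_EFinP; exact: measurable_normal_pdf.
- by move=> x _; rewrite lee_fin normal_pdf_ge0.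
- by rewrite lee_fin invr_ge0 ltW.
by rewrite integral_normal_pdf ?mule1// gt_eqF.
Qed.

(** Also valid for negative [y], which serves the lower deviations. *)
Lemma invr_sqrt_le_expR (y : R) : (y <= 2^-1)%R ->
  ((Num.sqrt (1 - y))^-1 <= expR (y / 2 + y ^+ 2))%R.
Proof.
move=> y2; have y1 : (0 < 1 - y)%R by lra.
have H : ((1 - y)^-1 <= expR (y + 2 * y ^+ 2))%R.
  have -> : ((1 - y)^-1 = 1 + y / (1 - y))%R by field; rewrite gt_eqF.
  apply: (le_trans (expR_ge1Dx _)); rewrite ler_expR ler_pdivrMr//.
  have := sqr_ge0 y; nra.
rewrite -(ler_pXn2r (_ : 0 < 2)%N) ?nnegrE ?invr_ge0 ?expR_ge0//.
rewrite exprVn sqr_sqrtr ?(ltW y1)// -expRM_natl.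
by apply: (le_trans H); rewrite ler_expR le_eqVlt; apply/orP; left; apply/eqP; field.
Qed.

Lemma expR_markov d (T : measurableType d) (P : {measure set T -> \bar R}) (f : T -> R) (r : R) :
  measurable_fun setT f ->
  P [set x | (r <= f x)%R] <= (\int[P]_x (expR (f x))%:E) * (expR (- r))%:E.
Proof.
move=> mf; have me : measurable_fun setT (fun x => (expR (f x))%:E).
  by apply/measurable_EFinP; apply: measurableT_comp.
have mA : measurable [set x | (r <= f x)%R] by apply: measurable_set_le.
have -> : P [set x | (r <= f x)%R] = \int[P]_(x in [set x | (r <= f x)%R]) 1.
  by rewrite integral_cst// mul1e.
apply: (@le_trans _ _ (\int[P]_x ((expR (f x))%:E * (expR (- r))%:E))).
  rewrite integral_mkcond; apply: ge0_le_integral => //.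
  - by move=> x _; rewrite patchE; case: ifP.
  - by apply/(measurable_restrict _ mA); rewrite ?setTI.
  - exact: emeasurable_funM.
  move=> x _; rewrite patchE; case: ifPn => [|_]; last by rewrite -EFinM lee_fin mulr_ge0// expR_ge0.
  by rewrite inE/= => rf; rewrite -EFinM -expRD lee_fin -expR0 ler_expR subr_ge0.
by rewrite ge0_integralZr// ?lee_fin ?expR_ge0// => x _; rewrite lee_fin expR_ge0.
Qed.

(** With y = 2 t s2, the centring factor exp(- t s2) cancels the linear term of exp(y / 2 + y^2) and
    leaves exp(4 t^2 s2^2); the condition on |t| S ensures y <= 1 / 2. *)
Lemma integral_prodN_exp_lform k (a : 'I_k -> R) (S t : R) :
  (\sum_(i < k) a i ^+ 2 <= S)%R -> (`|t| * S <= 4^-1)%R ->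
  \int[prodN gam k]_x (expR (t * (lform a x ^+ 2 - \sum_(i < k) a i ^+ 2)))%:E <=
  (expR (4 * t ^+ 2 * S ^+ 2))%:E.
Proof.
set s2 := (\sum_(i < k) a i ^+ 2)%R => s2S tS.
have s20 : (0 <= s2)%R by rewrite sumr_ge0// => i _; exact: sqr_ge0.
have [a0|a0] := eqVneq a (fun=> 0%R).
  have E x : expR (t * (lform a x ^+ 2 - s2)) = 1%R.
    rewrite /lform /s2 a0 big1 ?expr0n/= => [|i _]; last by rewrite mul0r.
    by rewrite big1 ?subr0 ?mulr0 ?expR0// => i _; rewrite expr0n.
  under eq_integral do rewrite E.
  rewrite integral_cst// mul1e [X in X <= _]probability_setT lee_fin -expR0 ler_expR.
  by rewrite mulr_ge0 ?sqr_ge0// mulr_ge0 ?sqr_ge0.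
have s0 : (0 < s2)%R.
  rewrite lt_neqAle s20 andbT eq_sym; apply: contra_neq a0 => /eqP.
  rewrite psumr_eq0; last by move=> i _; exact: sqr_ge0.
  move=> /allP H; apply/funext => i; apply/eqP.
  by have := H i (mem_index_enum i); rewrite sqrf_eq0.
have ts : (t * s2 <= 4^-1)%R.
  apply: le_trans tS; apply: (@le_trans _ _ (`|t| * s2)%R).
    by rewrite ler_wpM2r// ler_norm.
  by rewrite ler_wpM2l.
have mf : measurable_fun setT (fun y : R => (expR (t * (y ^+ 2 - s2)))%:E).
  apply/measurable_EFinP; apply: measurableT_comp => //.
  by apply: measurable_funM => //; apply: measurable_funB => //; exact: measurable_funX.
have -> : \int[prodN gam k]_x (expR (t * (lform a x ^+ 2 - s2)))%:E =
    \int[normal_prob 0 (Num.sqrt s2)]_y (expR (t * (y ^+ 2 - s2)))%:E.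
  transitivity (\int[@image_measure _ _ _ _ GR (prodN gam k) _ (measurable_lform a)]_y
      (expR (t * (y ^+ 2 - s2)))%:E).
    by rewrite ge0_integral_image_measure// => y; rewrite lee_fin expR_ge0.
  apply: eq_measure_integral => A mA _.
  exact: prodN_lform.
have E y : (expR (t * (y ^+ 2 - s2)))%:E = (expR (- (t * s2)))%:E * (expR (t * y ^+ 2))%:E.
  by rewrite -EFinM -expRD mulrBr addrC.
under eq_integral do rewrite E.
have m2 : measurable_fun setT (fun x : R => (expR (t * x ^+ 2))%:E).
  apply/measurable_EFinP; apply: measurableT_comp => //.
  by apply: measurable_funM => //; exact: measurable_funX.
rewrite ge0_integralZl ?lee_fin ?expR_ge0//.
rewrite integral_normal_exp_sqr ?sqrtr_gt0// sqr_sqrtr//; last by lra.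
rewrite -EFinM lee_fin; apply: (le_trans (ler_wpM2l (expR_ge0 _) (invr_sqrt_le_expR (y := 2 * t * s2) _))).
  by lra.
rewrite -expRD ler_expR.
have : (s2 ^+ 2 <= S ^+ 2)%R by rewrite ler_pXn2r// nnegrE (le_trans s20).
have := sqr_ge0 t; nra.
Qed.

Lemma prode_le_expn m (h : 'I_m -> \bar R) (c : R) :
  (forall i, 0 <= h i) -> (forall i, h i <= c%:E) ->
  \prod_(i < m) h i <= (c ^+ m)%:E.
Proof.
elim: m h => [|m IH] h h0 hc; first by rewrite big_ord0 expr0.
rewrite big_ord_recl exprS EFinM lee_pmul//; last exact: IH.
by apply: prode_ge0 => i _.
Qed.

(* Both deviation directions at once: [e] is the sign. *)
Lemma prodN_gram_deviation k m (a : 'I_k -> R) (S delta e : R) :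
  (\sum_(i < k) a i ^+ 2 <= S)%R -> (0 < S)%R -> (0 <= delta <= S)%R -> (`|e| = 1)%R ->
  prodN (prodN gam k) m [set x | (m%:R * delta <=
     e * \sum_(i < m) (lform a (tnth x i) ^+ 2 - \sum_(i < k) a i ^+ 2))%R] <=
  (expR (- (m%:R * delta ^+ 2 / (16 * S ^+ 2))))%:E.
Proof.
set s2 := (\sum_(i < k) a i ^+ 2)%R => s2S S0 /andP[d0 dS] e1.
(* Minimizer of 4 t^2 S^2 - t delta, with value - delta^2 / (16 S^2); delta <= S gives t S <= 1 /
   8. *)
pose t := (delta / (8 * S ^+ 2))%R.
have t0 : (0 <= t)%R by rewrite divr_ge0// mulr_ge0// sqr_ge0.
have mq i : measurable_fun setT (fun x : m.-tuple (k.-tuple GR) => (lform a (tnth x i) ^+ 2 - s2)%R).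
  apply: measurable_funB => //; apply: measurable_funX.
  by apply: (measurableT_comp (measurable_lform a)); exact: measurable_tnth.
pose f (x : m.-tuple (k.-tuple GR)) := (\sum_(i < m) t * e * (lform a (tnth x i) ^+ 2 - s2))%R.
have mf : measurable_fun setT f.
  by apply: (@measurable_sum _ _ _ _ _ _ (fun i x => t * e * (lform a (tnth x i) ^+ 2 - s2))%R) => i; apply: measurable_funM.
apply: (@le_trans _ _ (prodN (prodN gam k) m [set x | (t * (m%:R * delta) <= f x)%R])).
  apply: le_measure; rewrite ?inE.
  - by apply: measurable_set_le => //; apply: measurable_funM => //; exact: measurable_sum.
  - exact: measurable_set_le.
  by move=> x /= H; rewrite /f -mulr_sumr -mulrA ler_wpM2l.
apply: (le_trans (expR_markov _ _ mf)).
have -> : \int[prodN (prodN gam k) m]_x (expR (f x))%:E =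
    \prod_(i < m) \int[prodN gam k]_x (expR (t * e * (lform a x ^+ 2 - s2)))%:E.
  rewrite -integral_prodN_prod.
  - by apply: eq_integral => x _; rewrite /f expR_sum prodEFin.
  - move=> _; apply/measurable_EFinP; apply: measurableT_comp => //.
    by apply: measurable_funM => //; apply: measurable_funB => //; apply: measurable_funX; exact: measurable_lform.
  - by move=> _ x; rewrite lee_fin expR_ge0.
have te2 : ((t * e) ^+ 2 = t ^+ 2)%R by rewrite exprMn -[(e ^+ 2)%R]real_normK ?num_real// e1 expr1n mulr1.
apply: (@le_trans _ _ ((expR (4 * t ^+ 2 * S ^+ 2)) ^+ m * expR (- (t * (m%:R * delta))))%:E).
  rewrite EFinM lee_wpmul2r ?lee_fin ?expR_ge0//.
  apply: prode_le_expn => [i|i]; first by apply: integral_ge0 => x _; rewrite lee_fin expR_ge0.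
  rewrite -te2; apply: integral_prodN_exp_lform => //.
  rewrite normrM e1 mulr1 ger0_norm// /t expr2.
  rewrite (_ : delta / (8 * (S * S)) * S = delta / S / 8)%R; last by field; rewrite gt_eqF.
  have : (delta / S <= 1)%R by rewrite ler_pdivrMr// mul1r.
  lra.
rewrite lee_fin -expRM_natl -expRD ler_expR /t le_eqVlt; apply/orP; left; apply/eqP.
by field; rewrite gt_eqF.
Qed.

(* [f x + f y] is [f x - f (- y)] for an odd [f]: the hypothesis says that [f]
   is odd and [L]-Lipschitz on the symmetric set [D]. *)
Lemma prodN_odd_lipschitz_deviation k m (D : set (m.-tuple (k.-tuple GR)))
    (f : m.-tuple (k.-tuple GR) -> R) (L r : R) :
  (0 <= r)%R -> measurable D -> measurable_fun setT f -> (0 < L)%R ->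
  (forall x y, D x -> D y -> f x + f y <= L *
     Num.sqrt (\sum_(i < m) \sum_(l < k)
       (tnth (tnth x i) l + tnth (tnth y i) l) ^+ 2))%R ->
  prodN (prodN gam k) m (D `&` [set x | (r <= f x)%R]) <=
  (expR (- (r ^+ 2 / (2 * L ^+ 2))))%:E.
Proof.
move=> r0 mD mf L0 fL; set Q := prodN (prodN gam k) m.
pose t := (r / L ^+ 2)%R.
have t0 : (0 <= t)%R by rewrite divr_ge0// sqr_ge0.
(* For w the Euclidean norm of x + y, completing the square gives t L w - 2 a <= w^2 / 4. The single
   function [u] can thus be used on both sides of property (tau), and the square of its integral is
   at most 1. *)
pose a := (t ^+ 2 * L ^+ 2 / 2)%R.
pose u x := (\1_D x * expR (t * f x - a))%:E.
have mu_ : measurable_fun setT u.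
  apply/measurable_EFinP; apply: measurable_funM; first exact: measurable_indic.
  by apply: measurableT_comp => //; apply: measurable_funB => //; exact: measurable_funM.
have u0 x : 0 <= u x by rewrite lee_fin mulr_ge0// expR_ge0.
have u1 : \int[Q]_x u x <= 1.
  have := tau_property_prodN (n := m) (tau_property_prodN (n := k) (tau_property_normal (R := R))).
  move=> /(_ u u mu_ mu_ u0 u0) H.
  have : \int[Q]_x u x * \int[Q]_x u x <= 1.
    apply: H => x y; rewrite /u !indicE.
    case: (boolP (x \in D)) => [|_]; last by rewrite mul0r mul0e lee_fin expR_ge0.
    rewrite inE => Dx; case: (boolP (y \in D)) => [|_]; last by rewrite mul0r mule0 lee_fin expR_ge0.
    rewrite inE => Dy; rewrite !mul1r -EFinM -expRD lee_fin ler_expR.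
    under eq_bigr do rewrite -mulr_suml.
    rewrite -mulr_suml; set q := (\sum_(i < m) _)%R.
    have q0 : (0 <= q)%R by apply: sumr_ge0 => i _; apply: sumr_ge0 => l _; exact: sqr_ge0.
    have := ler_wpM2l t0 (fL x y Dx Dy).
    rewrite -/q => H1; rewrite -[X in (_ <= X / 4)%R](sqr_sqrtr q0).
    move: H1; set w := Num.sqrt q; rewrite mulrDr => H1.
    have := sqr_ge0 (w / 2 - t * L)%R; rewrite /a; lra.
  have : 0 <= \int[Q]_x u x by apply: integral_ge0 => x _; exact: u0.
  move: (\int[Q]_x u x) => [v||]//=.
  by rewrite -EFinM !lee_fin => v0 vv; rewrite leNgt; apply/negP => v1; nra.
have mE : measurable (D `&` [set x | (r <= f x)%R]).
  by apply: measurableI => //; exact: measurable_set_le.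
have -> : Q (D `&` [set x | (r <= f x)%R]) = \int[Q]_(x in D `&` [set x | (r <= f x)%R]) 1.
  by rewrite integral_cst// mul1e.
apply: (@le_trans _ _ (\int[Q]_x (u x * (expR (- (r ^+ 2 / (2 * L ^+ 2))))%:E))).
  rewrite integral_mkcond; apply: ge0_le_integral => //.
  - by move=> x _; rewrite patchE; case: ifP.
  - by apply/(measurable_restrict _ mE); rewrite ?setTI.
  - exact: emeasurable_funM.
  move=> x _; rewrite patchE; case: ifPn => [|_]; last by rewrite mule_ge0// lee_fin expR_ge0.
  rewrite inE => -[Dx /= rf]; rewrite /u indicE mem_set// mul1r -EFinM -expRD lee_fin -[leLHS]expR0 ler_expR.
  have : (t * r <= t * f x)%R by rewrite ler_wpM2l.
  have : (a + r ^+ 2 / (2 * L ^+ 2) = t * r)%R.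
    by rewrite /a /t; field; rewrite gt_eqF.
  lra.
rewrite ge0_integralZr// ?lee_fin ?expR_ge0//.
by rewrite -[X in _ <= X]mul1e lee_wpmul2r// lee_fin expR_ge0.
Qed.

End GaussianChaos.

(** * Spectral bounds for the knockoff design *)

Section EuclideanVectors.
Context {R : realType}.

Definition dot n (u v : 'cV[R]_n) : R := (u^T *m v) 0 0.

Lemma dotE n (u v : 'cV[R]_n) : dot u v = \sum_i u i 0 * v i 0.
Proof. by rewrite /dot mxE; apply: eq_bigr => i _; rewrite mxE. Qed.

Lemma dotC n (u v : 'cV[R]_n) : dot u v = dot v u.
Proof. by rewrite !dotE; apply: eq_bigr => i _; rewrite mulrC. Qed.

Lemma dotDr n (u v w : 'cV[R]_n) : dot u (v + w) = dot u v + dot u w.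
Proof. by rewrite /dot mulmxDr mxE. Qed.

Lemma dotDl n (u v w : 'cV[R]_n) : dot (v + w) u = dot v u + dot w u.
Proof. by rewrite dotC dotDr !(dotC u). Qed.

Lemma dotZr n a (u v : 'cV[R]_n) : dot u (a *: v) = a * dot u v.
Proof. by rewrite /dot -scalemxAr mxE. Qed.

Lemma dotZl n a (u v : 'cV[R]_n) : dot (a *: u) v = a * dot u v.
Proof. by rewrite dotC dotZr dotC. Qed.

Lemma dotNr n (u v : 'cV[R]_n) : dot u (- v) = - dot u v.
Proof. by rewrite -scaleN1r dotZr mulN1r. Qed.

Lemma dotNl n (u v : 'cV[R]_n) : dot (- u) v = - dot u v.
Proof. by rewrite dotC dotNr dotC. Qed.

Lemma dotBr n (u v w : 'cV[R]_n) : dot u (v - w) = dot u v - dot u w.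
Proof. by rewrite dotDr dotNr. Qed.

Lemma dotBl n (u v w : 'cV[R]_n) : dot (v - w) u = dot v u - dot w u.
Proof. by rewrite dotDl dotNl. Qed.

Lemma dot0r n (u : 'cV[R]_n) : dot u 0 = 0.
Proof. by rewrite /dot mulmx0 mxE. Qed.

Lemma dot0l n (u : 'cV[R]_n) : dot 0 u = 0.
Proof. by rewrite dotC dot0r. Qed.

Lemma dot_mulmxl m n (A : 'M[R]_(m, n)) u v : dot (A *m u) v = dot u (A^T *m v).
Proof. by rewrite /dot trmx_mul mulmxA. Qed.

Lemma dot_mulmxr m n (A : 'M[R]_(m, n)) u v : dot v (A *m u) = dot (A^T *m v) u.
Proof. by rewrite dotC dot_mulmxl dotC. Qed.

Lemma quadform_dot n (A : 'M[R]_n) v : (v^T *m A *m v) 0 0 = dot v (A *m v).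
Proof. by rewrite /dot mulmxA. Qed.

Lemma dotvv n (v : 'cV[R]_n) : dot v v = norm2 v ^+ 2.
Proof.
rewrite dotE /norm2 sqr_sqrtr; last by apply: sumr_ge0 => i _; exact: sqr_ge0.
by apply: eq_bigr => i _; rewrite expr2.
Qed.

Lemma norm2_ge0 n (v : 'cV[R]_n) : 0 <= norm2 v.
Proof. exact: sqrtr_ge0. Qed.

Lemma dotvv_ge0 n (v : 'cV[R]_n) : 0 <= dot v v.
Proof. by rewrite dotvv sqr_ge0. Qed.

Lemma dotvv_eq0 n (v : 'cV[R]_n) : (dot v v == 0) = (v == 0).
Proof.
apply/idP/eqP => [|->]; last by rewrite dot0r.
rewrite dotE psumr_eq0; last by move=> i _; rewrite -expr2 sqr_ge0.
move=> /allP H; apply/matrixP => i j; rewrite !mxE ord1.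
by have := H i (mem_index_enum i); rewrite /= mulf_eq0 orbb => /eqP.
Qed.

Lemma dotvv_gt0 n (v : 'cV[R]_n) : v != 0 -> 0 < dot v v.
Proof. by move=> v0; rewrite lt_neqAle dotvv_ge0 andbT eq_sym dotvv_eq0. Qed.

Lemma dot_sqr_le n (u v : 'cV[R]_n) : dot u v ^+ 2 <= dot u u * dot v v.
Proof.
have [->|v0] := eqVneq v 0; first by rewrite !dot0r expr0n/= mulr0.
have vv := dotvv_gt0 v0.
have := dotvv_ge0 (dot v v *: u - dot u v *: v).
rewrite !(dotBl, dotBr, dotZl, dotZr) (dotC v u) => H.
have {}H : 0 <= dot v v * (dot u u * dot v v - dot u v ^+ 2).
  by move: H; set a := dot v v; set b := dot u v; set c := dot u u; nra.
by rewrite -subr_ge0 -(pmulr_rge0 _ vv).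
Qed.

Lemma dot_le_norm2 n (u v : 'cV[R]_n) : `|dot u v| <= norm2 u * norm2 v.
Proof.
rewrite -(@ler_pXn2r _ 2) ?nnegrE ?mulr_ge0 ?norm2_ge0//.
by rewrite real_normK ?num_real// exprMn -!dotvv dot_sqr_le.
Qed.

Lemma ler_norm2D n (u v : 'cV[R]_n) : norm2 (u + v) <= norm2 u + norm2 v.
Proof.
rewrite -(@ler_pXn2r _ 2) ?nnegrE ?addr_ge0 ?norm2_ge0//.
rewrite -dotvv dotDl !dotDr (dotC v u) !dotvv.
have := le_trans (ler_norm _) (dot_le_norm2 u v); nra.
Qed.

Lemma norm2Z n a (v : 'cV[R]_n) : norm2 (a *: v) = `|a| * norm2 v.
Proof.
rewrite /norm2 -sqrtr_sqr -sqrtrM ?sqr_ge0//; congr Num.sqrt.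
by rewrite mulr_sumr; apply: eq_bigr => i _; rewrite mxE exprMn.
Qed.

Lemma norm2N n (v : 'cV[R]_n) : norm2 (- v) = norm2 v.
Proof. by rewrite -scaleN1r norm2Z normrN1 mul1r. Qed.

Lemma ler_norm2B n (u v : 'cV[R]_n) : norm2 (u - v) <= norm2 u + norm2 v.
Proof. by rewrite -(norm2N v) ler_norm2D. Qed.

Lemma norm20 n : norm2 (0 : 'cV[R]_n) = 0.
Proof. by rewrite -(scale0r 0) norm2Z normr0 mul0r. Qed.

Lemma ler_norm2_dotvv n (v : 'cV[R]_n) c : 0 <= c -> (norm2 v <= c) = (dot v v <= c ^+ 2).
Proof. by move=> c0; rewrite dotvv ler_pXn2r// nnegrE norm2_ge0. Qed.

Definition frob m n (A : 'M[R]_(m, n)) : R := \sum_i \sum_j A i j ^+ 2.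

Lemma frob_ge0 m n (A : 'M[R]_(m, n)) : 0 <= frob A.
Proof. by apply: sumr_ge0 => i _; apply: sumr_ge0 => j _; exact: sqr_ge0. Qed.

Lemma dot_mulmx_le m n (A : 'M[R]_(m, n)) v :
  dot (A *m v) (A *m v) <= frob A * dot v v.
Proof.
rewrite dotE /frob mulr_suml; apply: ler_sum => i _.
have -> : (A *m v) i 0 = dot (\col_j A i j) v.
  by rewrite mxE dotE; apply: eq_bigr => j _; rewrite mxE.
rewrite -expr2; apply: (le_trans (dot_sqr_le _ _)); rewrite ler_wpM2r ?dotvv_ge0//.
by rewrite dotE; apply: ler_sum => j _; rewrite mxE expr2.
Qed.

Lemma norm2_mulmx_frob m n (A : 'M[R]_(m, n)) v :
  norm2 (A *m v) <= Num.sqrt (frob A) * norm2 v.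
Proof.
rewrite ler_norm2_dotvv ?mulr_ge0 ?norm2_ge0// exprMn sqr_sqrtr ?frob_ge0//.
by rewrite -dotvv dot_mulmx_le.
Qed.

Lemma spectral_norm_has_sup m n (A : 'M[R]_(m, n)) :
  has_sup [set norm2 (A *m v) | v in [set v : 'cV[R]_n | norm2 v <= 1]].
Proof.
split; first by exists (norm2 (A *m 0)); exists 0 => //=; rewrite norm20.
exists (Num.sqrt (frob A)) => _ [v /= v1 <-].
by apply: (le_trans (norm2_mulmx_frob _ _)); rewrite ler_piMr.
Qed.

Lemma norm2_mulmx_spectral m n (A : 'M[R]_(m, n)) v :
  norm2 (A *m v) <= spectral_norm A * norm2 v.
Proof.
have [->|v0] := eqVneq v 0; first by rewrite mulmx0 !norm20 mulr0.
have nv : 0 < norm2 v.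
  by rewrite lt_neqAle norm2_ge0 andbT eq_sym -(sqrf_eq0 (norm2 v)) -dotvv dotvv_eq0.
rewrite -ler_pdivrMr//.
have -> : norm2 (A *m v) / norm2 v = norm2 (A *m ((norm2 v)^-1 *: v)).
  by rewrite -scalemxAr norm2Z ger0_norm ?invr_ge0 ?norm2_ge0// mulrC.
apply: (ub_le_sup (spectral_norm_has_sup A).2); exists ((norm2 v)^-1 *: v) => //=.
by rewrite norm2Z ger0_norm ?invr_ge0 ?norm2_ge0// mulVf// gt_eqF.
Qed.

(** The second alternative does occur: in dimension n = 0 the hypothesis holds for negative r. *)
Lemma spectral_norm_le m n (A : 'M[R]_(m, n)) r :
  (forall v, norm2 (A *m v) <= r * norm2 v) -> spectral_norm A <= r \/ r < 0.
Proof.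
move=> H; have [r0|r0] := leP 0 r; last by right.
left; apply: ge_sup.
  by have [] := spectral_norm_has_sup A.
move=> _ [v /= v1 <-]; apply: (le_trans (H v)).
by rewrite ler_piMr.
Qed.

Lemma norm2_trmx_mulmx m n (A : 'M[R]_(m, n)) (M : R) : 0 <= M ->
  (forall v, norm2 (A *m v) <= M * norm2 v) ->
  forall u, norm2 (A^T *m u) <= M * norm2 u.
Proof.
move=> M0 AM u; set w := A^T *m u.
have [->|w0] := eqVneq w 0; first by rewrite norm20 mulr_ge0 ?norm2_ge0.
have nw : 0 < norm2 w.
  by rewrite lt_neqAle norm2_ge0 andbT eq_sym -(sqrf_eq0 (norm2 w)) -dotvv dotvv_eq0.
rewrite -(ler_pM2r nw) -expr2 -dotvv {1}/w -dot_mulmxr.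
apply: (le_trans (ler_norm _)); apply: (le_trans (dot_le_norm2 _ _)).
by rewrite [leRHS]mulrAC mulrC ler_wpM2r ?norm2_ge0// AM.
Qed.

End EuclideanVectors.

(** * Whitening and Rayleigh quotients *)

Section PositiveDefinite.
Context {R : realType}.

Lemma posdefE n (A : 'M[R]_n) :
  posdef A <-> A^T = A /\ forall v : 'cV[R]_n, v != 0 -> 0 < dot v (A *m v).
Proof.
by split=> -[AT H]; split=> // v v0; have := H v v0; rewrite quadform_dot.
Qed.

Lemma dot_col_mx m n (x y : 'cV[R]_m) (v w : 'cV[R]_n) :
  dot (col_mx x v) (col_mx y w) = dot x y + dot v w.
Proof. by rewrite /dot tr_col_mx mul_row_col mxE. Qed.

(* One step of Gaussian elimination: [W] is upper triangular. *)
Lemma posdef_whitening n (A : 'M[R]_n) : posdef A ->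
  exists2 W : 'M[R]_n, W \in unitmx & W^T *m A *m W = 1%:M.
Proof.
suff H : posdef A -> exists W : 'M[R]_n, W^T *m A *m W = 1%:M.
  by move=> /H[W WA]; exists W => //; have [] := mulmx1_unit WA.
elim: n A => [|n IH] A.
  by move=> _; exists 0; apply/matrixP => -[].
rewrite -[n.+1]/(1 + n)%N in A *.
move=> /posdefE[AT Apos].
pose a := A 0 0; pose b := ursubmx A; pose D := drsubmx A.
have bT : dlsubmx A = b^T by rewrite /b trmx_ursub AT.
have DT : D^T = D by rewrite /D trmx_drsub AT.
have aE : ulsubmx A = a%:M by rewrite [LHS]mx11_scalar !mxE; congr (A _ _)%:M; exact: val_inj.
have AE : A = block_mx a%:M b b^T D by rewrite -aE -bT submxK.
have qA (x : 'cV[R]_1) (v : 'cV[R]_n) : dot (col_mx x v) (A *m col_mx x v) =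
    a * dot x x + 2 * dot x (b *m v) + dot v (D *m v).
  rewrite AE mul_block_col dot_col_mx mul_scalar_mx !dotDr dotZr (dot_mulmxr b^T) trmxK.
  by rewrite (dotC (b *m v)); ring.
have a0 : 0 < a.
  have := Apos (col_mx 1%:M 0); rewrite qA mulmx0 !dot0r dot0l dotE big_ord1 !mxE/= mulr1.
  rewrite mulr0 !addr0 mulr1; apply; apply/eqP => /matrixP/(_ 0 0).
  by rewrite !mxE; case: splitP => // j _; rewrite !mxE ord1 eqxx => /eqP; rewrite oner_eq0.
(* Schur complement of the corner. Its form at v is the form of A at (- a^-1 b v, v), hence
   positive. *)
pose S := D - a^-1 *: (b^T *m b).
have ST : S^T = S by rewrite /S linearB/= linearZ/= trmx_mul trmxK DT.
have : posdef S.
  apply/posdefE; split => // v v0.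
  have := Apos (col_mx (- a^-1 *: (b *m v)) v); rewrite qA.
  rewrite !(dotZl, dotZr) /S mulmxBl dotBr -scalemxAl dotZr -mulmxA (dot_mulmxr b^T) trmxK.
  set B := dot (b *m v) _; set E := dot v _ => H.
  have -> : E - a^-1 * B = a * (- a^-1 * (- a^-1 * B)) + 2 * (- a^-1 * B) + E.
    by field; rewrite gt_eqF.
  apply: H; apply: contra_neq v0 => /eqP; rewrite col_mx_eq0 => /andP[_ /eqP->//].
move=> /IH[W WS].
pose c := Num.sqrt a; have c0 : 0 < c by rewrite sqrtr_gt0.
have cc : c * c = a by rewrite -expr2 sqr_sqrtr// ltW.
exists (block_mx (c^-1)%:M (- a^-1 *: (b *m W)) 0 W).
have ac : a * c^-1 = c by rewrite -cc mulfK ?gt_eqF.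
have AW : A *m block_mx (c^-1)%:M (- a^-1 *: (b *m W)) 0 W =
    block_mx c%:M 0 (c^-1 *: b^T) (S *m W).
  rewrite AE mulmx_block !mulmx0 !addr0 -scalar_mxM ac mul_mx_scalar; congr block_mx.
    by rewrite mul_scalar_mx scalerA mulrN mulfV ?gt_eqF// scaleN1r addNr.
  by rewrite -scalemxAr mulmxA /S mulmxBl -scalemxAl scaleNr addrC.
rewrite -mulmxA AW tr_block_mx tr_scalar_mx trmx0 linearZ/= trmx_mul mulmx_block.
rewrite !mul0mx !mulmx0 !addr0 !add0r mulmxA WS.
rewrite -scalar_mxM mulVf ?gt_eqF// -scalemxAl -scalemxAr mul_mx_scalar.
rewrite scalerA -scalerDl.
rewrite (_ : - a^-1 * c + c^-1 = 0) ?scale0r; last first.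
  by rewrite -cc; field; rewrite gt_eqF.
by rewrite -scalar_mx_block.
Qed.

(** Coercivity without compactness: for v = W u with W whitening, the form at v is |u|^2, while
    |v|^2 is at most the squared Frobenius norm of W times |u|^2. The added 1 keeps the constant
    meaningful when that norm is 0. *)
Lemma posdef_lower_bound n (A : 'M[R]_n) : posdef A ->
  exists2 c : R, 0 < c & forall v, c * dot v v <= dot v (A *m v).
Proof.
move=> /posdef_whitening[W Wu WA]; exists (frob W + 1)^-1.
  by rewrite invr_gt0 ltr_wpDl// frob_ge0.
move=> v; pose u := invmx W *m v.
have vE : v = W *m u by rewrite /u mulmxA mulmxV// mul1mx.
have -> : dot v (A *m v) = dot u u.
  by rewrite vE dot_mulmxl !mulmxA WA mul1mx.
rewrite mulrC ler_pdivrMr ?ltr_wpDl ?frob_ge0// vE.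
apply: (le_trans (dot_mulmx_le _ _)); rewrite mulrC ler_wpM2l ?dotvv_ge0//.
by rewrite lerDl.
Qed.

Lemma dot_mulmx_ge_frob n (A : 'M[R]_n) v :
  - Num.sqrt (frob A) * dot v v <= dot v (A *m v).
Proof.
rewrite mulNr lerNl -dotNr; apply: (le_trans (ler_norm _)).
apply: (le_trans (dot_le_norm2 _ _)); rewrite norm2N dotvv expr2 mulrCA mulrC mulrA.
by rewrite [leRHS]mulrAC [leRHS]mulrC [leRHS]mulrA [leRHS]mulrC [leRHS]mulrC ler_wpM2r ?norm2_ge0// norm2_mulmx_frob.
Qed.

(** If w = M v were nonzero, moving from v along - w would make the form negative: with q the form
    at w, its value at (q + 1) v - |w|^2 w is - |w|^4 (q + 2). *)
Lemma semidef_kernel n (M : 'M[R]_n) (v : 'cV[R]_n) : M^T = M ->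
  (forall u, 0 <= dot u (M *m u)) -> dot v (M *m v) <= 0 -> M *m v = 0.
Proof.
move=> MT Mge Mv; apply/eqP; rewrite -dotvv_eq0; apply/negP => /negP w0.
set w := M *m v in w0 *; have {}w0 : 0 < dot w w by rewrite lt_neqAle eq_sym w0 dotvv_ge0.
have Mv0 : dot v (M *m v) = 0 by apply/eqP; rewrite eq_le Mv Mge.
pose q := dot w (M *m w); have q0 : 0 <= q by exact: Mge.
have := Mge ((q + 1) *: v - dot w w *: w).
rewrite mulmxBr -!scalemxAr !(dotBl, dotBr, dotZl, dotZr) Mv0 -/q -/w.
rewrite (dot_mulmxr M w v) MT -/w; set z := dot w w in w0 *; have := mulr_gt0 w0 w0; nra.
Qed.

Lemma eigenvalue_symm n (A : 'M[R]_n) (v : 'cV[R]_n) x :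
  A^T = A -> v != 0 -> A *m v = x *: v -> eigenvalue A x.
Proof.
move=> AT v0 Av; apply/eigenvalueP; exists v^T.
  by rewrite -[A]AT -trmx_mul Av linearZ.
by apply: contra_neq v0 => vT; rewrite -[v]trmxK vT trmx0.
Qed.

(** The largest t with A - t semidefinite replaces diagonalization. A - t cannot be definite, since
    [posdef_lower_bound] would allow a larger t; so its form is nonpositive at some nonzero u, and
    [semidef_kernel] makes u an eigenvector for t. *)
Lemma rayleigh_ge n (A : 'M[R]_n) lo : A^T = A ->
  (forall x, eigenvalue A x -> lo <= x) ->
  forall v, lo * dot v v <= dot v (A *m v).
Proof.
move=> AT Alo v; rewrite leNgt; apply/negP => vlo.
have v0 : v != 0 by apply: contraTneq vlo => ->; rewrite mulmx0 !dot0r mulr0 ltxx.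
have vv := dotvv_gt0 v0.
pose E := [set t : R | forall v, t * dot v v <= dot v (A *m v)].
have Ele t u : E t -> u != 0 -> t <= dot u (A *m u) / dot u u.
  by move=> Et u0; rewrite ler_pdivlMr ?dotvv_gt0.
have supE : has_sup E.
  split; first by exists (- Num.sqrt (frob A)) => u; exact: dot_mulmx_ge_frob.
  by exists (dot v (A *m v) / dot v v) => t Et; exact: Ele.
pose t := sup E.
have Et : E t.
  move=> u; have [->|u0] := eqVneq u 0; first by rewrite mulmx0 !dot0r mulr0.
  rewrite -ler_pdivlMr ?dotvv_gt0//; apply: ge_sup; first exact: supE.1.
  by move=> s Es; exact: Ele.
have tlo : t < lo.
  by apply: (le_lt_trans (Ele t v Et v0)); rewrite ltr_pdivrMr.
pose M := A - t%:M.
have MT : M^T = M by rewrite /M linearB/= tr_scalar_mx AT.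
have ME u : dot u (M *m u) = dot u (A *m u) - t * dot u u.
  by rewrite /M mulmxBl mul_scalar_mx dotBr dotZr.
have Mge u : 0 <= dot u (M *m u) by rewrite ME subr_ge0; exact: Et.
have [posM|] := pselect (posdef M).
  have [c c0 Mc] := posdef_lower_bound posM.
  have : E (t + c) by move=> u; rewrite mulrDl addrC -lerBrDr -ME; exact: Mc.
  move=> /(ub_le_sup supE.2); rewrite -/t gerDl leNgt c0//.
move=> /posdefE/not_andP[//|/existsNP[u /not_implyP[u0 /negP]]].
rewrite -leNgt => Mu; have := semidef_kernel MT Mge Mu.
rewrite /M mulmxBl mul_scalar_mx => /eqP; rewrite subr_eq0 => /eqP /(eigenvalue_symm AT u0).
by move=> /Alo; rewrite leNgt tlo.
Qed.

Lemma rayleigh_le n (A : 'M[R]_n) hi : A^T = A ->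
  (forall x, eigenvalue A x -> x <= hi) ->
  forall v, dot v (A *m v) <= hi * dot v v.
Proof.
move=> AT Ahi v; rewrite -lerN2 -dotNr -mulNmx -mulNr.
apply: rayleigh_ge => [|x /eigenvalueP[u uA u0]]; first by rewrite linearN/= AT.
rewrite lerNl; apply: Ahi; apply/eigenvalueP; exists u => //.
by rewrite scaleNr -uA mulmxN opprK.
Qed.

End PositiveDefinite.

(** * The factor A of the knockoff design *)

Section DesignFactor.
Context {R : realType}.
Variables (p : nat) (Omega0 : 'M[R]_p) (s : 'rV[R]_p) (lo hi lo2 : R).
Hypothesis lo0 : 0 < lo.
Hypothesis hi0 : 0 < hi.
Hypothesis lo20 : 0 < lo2.
Hypothesis Opos : posdef Omega0.
Hypothesis Oeig : forall x, eigenvalue Omega0 x -> lo <= x <= hi.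
Hypothesis Odiag : forall j, invmx Omega0 j j = 1.
Hypothesis s_ge0 : forall j, 0 <= s 0 j.
Hypothesis spos : posdef (invmx Omega0 - 2^-1 *: diag_mx s).
Hypothesis keig : forall x, eigenvalue (knockoff_cov s Omega0) x -> lo2 <= x.

Let S := diag_mx s.

Lemma posdef_unitmx n (A : 'M[R]_n) : posdef A -> A \in unitmx.
Proof.
move=> /posdefE[AT Ap]; rewrite -row_free_unit -kermx_eq0; apply/eqP/row_matrixP => i.
rewrite row0; apply: contrapT => /eqP ki0.
have : row i (kermx A) *m A = 0 by rewrite -row_mul mulmx_ker row0.
move=> /(congr1 trmx); rewrite trmx_mul AT trmx0 => kA.
have := Ap (row i (kermx A))^T; rewrite kA dot0r ltxx => H.
by have := H; move=> /(_ _) => {}H; suff : false by []; apply: H; rewrite trmx_eq0.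
Qed.

Let Ou : Omega0 \in unitmx. Proof. exact: posdef_unitmx. Qed.

Let OT : Omega0^T = Omega0. Proof. by case: Opos. Qed.

Let Sigma := invmx Omega0.

Let ST : Sigma^T = Sigma. Proof. by rewrite /Sigma trmx_inv OT. Qed.

Let Seig x : eigenvalue Sigma x -> hi^-1 <= x <= lo^-1.
Proof.
move=> /eigenvalueP[v vS v0].
have vE : v = x *: (v *m Omega0).
  by rewrite scalemxAl -vS /Sigma mulmxKV.
have x0 : x != 0 by apply: contra_neq v0 => x0; rewrite vE x0 scale0r.
have /Oeig/andP[lx xh] : eigenvalue Omega0 x^-1.
  by apply/eigenvalueP; exists v => //; rewrite {2}vE scalerA mulVf// scale1r.
have xp : 0 < x by rewrite -invr_gt0 (lt_le_trans lo0).
by rewrite invf_ple ?posrE// xh/= -[x]invrK lef_pV2// ?posrE ?invr_gt0.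
Qed.

Let Sge v : hi^-1 * dot v v <= dot v (Sigma *m v).
Proof. by apply: rayleigh_ge => // x /Seig/andP[]. Qed.

Let Sle v : dot v (Sigma *m v) <= lo^-1 * dot v v.
Proof. by apply: rayleigh_le => // x /Seig/andP[]. Qed.

Let norm_Omega0 u : norm2 (Omega0 *m u) <= hi * norm2 u.
Proof.
set w := Omega0 *m u; have [->|w0] := eqVneq w 0; first by rewrite norm20 mulr_ge0 ?norm2_ge0 ?ltW.
have nw : 0 < norm2 w.
  by rewrite lt_neqAle norm2_ge0 andbT eq_sym -(sqrf_eq0 (norm2 w)) -dotvv dotvv_eq0.
have := Sge w; rewrite {3}/w /Sigma mulKmx// ler_pdivrMl// dotvv expr2 => H.
rewrite -(ler_pM2r nw) (le_trans H)// -mulrA ler_wpM2l ?(ltW hi0)// mulrC.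
exact: le_trans (ler_norm _) (dot_le_norm2 _ _).
Qed.

(** The diagonal entry j of Sigma - S / 2 is 1 - s_j / 2, by the unit diagonal of Sigma. *)
Let s_le2 j : s 0 j <= 2.
Proof.
have /posdefE[_ /(_ (delta_mx j 0))] := spos.
have d0 : delta_mx j 0 != 0 :> 'cV[R]_p.
  by apply/eqP => /matrixP/(_ j 0); rewrite !mxE !eqxx => /eqP; rewrite oner_eq0.
move=> /(_ d0); rewrite -colE /dot -[delta_mx j 0]trmxK trmx_delta trmxK -rowE !mxE Odiag eqxx mulr1n; lra.
Qed.

Let mulS v i : (S *m v) i 0 = s 0 i * v i (0 : 'I_1).
Proof. by rewrite mul_diag_mx mxE. Qed.

Let norm_S v : norm2 (S *m v) <= 2 * norm2 v.
Proof.
rewrite ler_norm2_dotvv ?mulr_ge0 ?norm2_ge0// exprMn -dotvv !dotE mulr_sumr.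
apply: ler_sum => i _; rewrite mulS -!expr2 exprMn ler_wpM2r ?sqr_ge0//.
by rewrite ler_pXn2r// nnegrE.
Qed.

Let dot_S v : dot v (S *m v) <= 2 * dot v v.
Proof.
rewrite !dotE mulr_sumr; apply: ler_sum => i _; rewrite mulS.
have := sqr_ge0 (v i 0); have := s_le2 i; have := s_ge0 i; nra.
Qed.

Let kcov Omega v : dot v (knockoff_cov s Omega *m v) =
  2 * dot v (S *m v) - dot (S *m v) (Omega *m (S *m v)).
Proof.
rewrite /knockoff_cov mulmxBl -scalemxAl dotBr dotZr -!mulmxA (dot_mulmxr S (Omega *m (S *m v)) v) tr_diag_mx.
by [].
Qed.

Let kcov0 v : lo2 * dot v v <= dot v (knockoff_cov s Omega0 *m v).
Proof.
apply: rayleigh_ge => //.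
by rewrite /knockoff_cov linearB/= linearZ/= !trmx_mul OT tr_diag_mx mulmxA.
Qed.

Section Estimate.
Variable Omega : 'M[R]_p.
Hypothesis Omegapos : posdef Omega.
Hypothesis Onear : spectral_norm (Omega - Omega0) <= Num.min 1 (lo2 / 8).

Let near v : norm2 ((Omega - Omega0) *m v) <= Num.min 1 (lo2 / 8) * norm2 v.
Proof. by apply: (le_trans (norm2_mulmx_spectral _ _)); rewrite ler_wpM2r ?norm2_ge0. Qed.

(** Each side of the perturbation carries a factor S of norm at most 2, so the radius lo2 / 8 costs
    at most half of lo2. *)
Let kcov_ge v : lo2 / 2 * dot v v <= dot v (knockoff_cov s Omega *m v).
Proof.
have -> : dot v (knockoff_cov s Omega *m v) = dot v (knockoff_cov s Omega0 *m v) -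
    dot (S *m v) ((Omega - Omega0) *m (S *m v)).
  by rewrite !kcov mulmxBl dotBr; ring.
have := kcov0 v; set K := dot v (_ *m v) => H.
have : dot (S *m v) ((Omega - Omega0) *m (S *m v)) <= lo2 / 2 * dot v v.
  apply: (le_trans (ler_norm _)); apply: (le_trans (dot_le_norm2 _ _)).
  apply: (@le_trans _ _ (norm2 (S *m v) * (lo2 / 8 * norm2 (S *m v)))).
    rewrite ler_wpM2l ?norm2_ge0//; apply: (le_trans (near _)).
    by rewrite ler_wpM2r ?norm2_ge0// ge_min lexx orbT.
  have := norm_S v; have := norm2_ge0 (S *m v); have := norm2_ge0 v.
  rewrite dotvv; set a := norm2 v; set b := norm2 _ => a0 b0 ba.
  have : b ^+ 2 <= (2 * a) ^+ 2 by rewrite ler_pXn2r// nnegrE// mulr_ge0.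
  have := lo20; nra.
lra.
Qed.

Let kcov_le v : dot v (knockoff_cov s Omega *m v) <= 4 * dot v v.
Proof.
rewrite kcov; have := dot_S v.
have [->|w0] := eqVneq (S *m v) 0; first by rewrite dot0r dot0l; have := dotvv_ge0 v; lra.
by have /posdefE[_ /(_ _ w0)] := Omegapos; lra.
Qed.

Lemma knockoff_cov_possemidef : possemidef (knockoff_cov s Omega).
Proof.
have OT' : Omega^T = Omega by case: Omegapos.
split; first by rewrite /knockoff_cov linearB/= linearZ/= !trmx_mul OT' tr_diag_mx mulmxA.
move=> v; rewrite quadform_dot; apply: le_trans (kcov_ge v).
by rewrite mulr_ge0 ?dotvv_ge0// divr_ge0// ltW.
Qed.

(** The sum 1 + 2 hi + 2 bounds the norms of the identity, of Omega0 S and of (Omega - Omega0) S,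
    the latter because the radius is at most 1. *)
Let M := 2 * hi + 3.

Let NT := (1%:M - S *m Omega)^T.

Let norm_NT v : norm2 (NT *m v) <= M * norm2 v.
Proof.
have OT' : Omega^T = Omega by case: Omegapos.
have -> : NT *m v = v - Omega *m (S *m v).
  by rewrite /NT linearB/= trmx1 trmx_mul OT' tr_diag_mx mulmxBl mul1mx mulmxA.
apply: (le_trans (ler_norm2B _ _)).
have -> : Omega *m (S *m v) = Omega0 *m (S *m v) + (Omega - Omega0) *m (S *m v).
  by rewrite -mulmxDl addrC subrK.
have h1 := ler_norm2D (Omega0 *m (S *m v)) ((Omega - Omega0) *m (S *m v)).
have h2 := norm_Omega0 (S *m v).
have h3 : norm2 ((Omega - Omega0) *m (S *m v)) <= norm2 (S *m v).
  apply: (le_trans (near _)); rewrite ler_piMl ?norm2_ge0// ge_min lexx//.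
have h4 := norm_S v; rewrite /M; have := ler_wpM2l (ltW hi0) h4; lra.
Qed.

(** By [dot_design], |A b|^2 = q + k with |g|^2 <= hi q and |b2|^2 <= (2 / lo2) k, where b1 = g - NT
    b2; the constant comes from |b1|^2 + |b2|^2 <= 2 |g|^2 + (2 M^2 + 1) |b2|^2. *)
Definition design_lower : R := (2 * hi + (2 * M ^+ 2 + 1) * (2 / lo2))^-1.
Definition design_upper : R := 2 / lo + 2 * M ^+ 2 / lo + 4.

Variables (W B : 'M[R]_p).
Hypothesis Wu : W \in unitmx.
Hypothesis WS : W^T *m Sigma *m W = 1%:M.
Hypothesis BB : B^T *m B = knockoff_cov s Omega.

(** The left factor is [X W, Z], whose rows are white because W whitens Sigma; hence A^T A is the
    covariance of a row of [X, Xk]. *)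
Definition design_factor : 'M[R]_(p + p) := block_mx (invmx W) (invmx W *m NT) 0 B.

Lemma design_factorE m (X Z : 'M[R]_(m, p)) :
  row_mx X (X *m NT + Z *m B) = row_mx (X *m W) Z *m design_factor.
Proof. by rewrite /design_factor mul_row_block mulmx0 addr0 mulmxA !mulmxK. Qed.

Let dot_design b1 b2 : let g := b1 + NT *m b2 in
  dot (design_factor *m col_mx b1 b2) (design_factor *m col_mx b1 b2) =
  dot g (Sigma *m g) + dot b2 (knockoff_cov s Omega *m b2).
Proof.
move=> g; rewrite /design_factor mul_block_col mul0mx add0r dot_col_mx; congr (_ + _).
  rewrite -mulmxA -mulmxDr -/g.
  have SE : Sigma = (invmx W)^T *m invmx W.
    have := congr1 (fun A => (invmx W)^T *m A *m invmx W) WS.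
    by rewrite mulmx1 !mulmxA -trmx_mul mulmxV// trmx1 mul1mx mulmxK.
  by rewrite SE dot_mulmxl mulmxA.
by rewrite dot_mulmxl mulmxA BB.
Qed.

Let normsq_D n (u v : 'cV[R]_n) : dot (u + v) (u + v) <= 2 * dot u u + 2 * dot v v.
Proof.
have := dotvv_ge0 (u - v); rewrite !(dotBl, dotBr, dotDl, dotDr) (dotC v u); lra.
Qed.

Lemma design_factor_ge b : design_lower * dot b b <= dot (design_factor *m b) (design_factor *m b).
Proof.
rewrite -(vsubmxK b) dot_col_mx dot_design; set b1 := usubmx b; set b2 := dsubmx b.
set g := b1 + NT *m b2.
have C0 : 0 < 2 * hi + (2 * M ^+ 2 + 1) * (2 / lo2).
  by rewrite ltr_wpDr ?mulr_gt0// mulr_ge0 ?divr_ge0 ?(ltW lo20)// addr_ge0// mulr_ge0 ?sqr_ge0.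
rewrite /design_lower mulrC ler_pdivrMr//.
have h1 : dot b1 b1 <= 2 * dot g g + 2 * dot (NT *m b2) (NT *m b2).
  have -> : b1 = g - NT *m b2 by rewrite /g addrK.
  by apply: (le_trans (normsq_D _ _)); rewrite dotNl dotNr opprK.
have h2 : dot (NT *m b2) (NT *m b2) <= M ^+ 2 * dot b2 b2.
  rewrite dotvv [X in _ * X]dotvv -exprMn ler_pXn2r ?norm_NT// nnegrE ?norm2_ge0//.
  by rewrite (le_trans _ (norm_NT _)) ?norm2_ge0.
have h3 := Sge g; rewrite ler_pdivrMl// in h3.
have h4 := kcov_ge b2.
have h5 : dot b2 b2 <= 2 / lo2 * dot b2 (knockoff_cov s Omega *m b2).
  by rewrite mulrAC ler_pdivlMr//; lra.
move: h3 h5; set q := dot g (_ *m g); set k := dot b2 (_ *m b2); set bb := dot b2 b2 => h3 h5.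
have q0 : 0 <= q by apply: le_trans (Sge g); rewrite mulr_ge0 ?invr_ge0 ?dotvv_ge0// ltW.
have k0 : 0 <= k by apply: le_trans h4; rewrite mulr_ge0 ?dotvv_ge0// divr_ge0// ltW.
have bb0 : 0 <= bb by exact: dotvv_ge0.
have m0 : 0 <= 2 * M ^+ 2 + 1 by rewrite addr_ge0// mulr_ge0 ?sqr_ge0.
have h6 := ler_wpM2l m0 h5.
have l0 : 0 <= 2 / lo2 by rewrite divr_ge0// ltW.
have h7 : 0 <= hi * k by rewrite mulr_ge0// ltW.
have h8 : 0 <= (2 * M ^+ 2 + 1) * (2 / lo2) * q by rewrite mulr_ge0// mulr_ge0.
have -> : (q + k) * (2 * hi + (2 * M ^+ 2 + 1) * (2 / lo2)) = 2 * (hi * q) + 2 * (hi * k) +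
  (2 * M ^+ 2 + 1) * (2 / lo2) * q + (2 * M ^+ 2 + 1) * (2 / lo2 * k).
  by move: (M ^+ 2) (2 / lo2) => f e; ring.
have : dot b1 b1 + bb <= 2 * (hi * q) + (2 * M ^+ 2 + 1) * bb.
  rewrite -/bb in h2; move: h1 h2 h3; move: (dot (NT *m b2) (NT *m b2)) (M ^+ 2) (dot g g) (hi * q) (dot b1 b1).
  by move=> n f G z y h1 h2 h3; nra.
lra.
Qed.

Lemma design_factor_le b : dot (design_factor *m b) (design_factor *m b) <= design_upper * dot b b.
Proof.
rewrite -(vsubmxK b) dot_col_mx dot_design; set b1 := usubmx b; set b2 := dsubmx b.
set g := b1 + NT *m b2.
have h1 : dot g g <= 2 * dot b1 b1 + 2 * dot (NT *m b2) (NT *m b2) by exact: normsq_D.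
have h2 : dot (NT *m b2) (NT *m b2) <= M ^+ 2 * dot b2 b2.
  rewrite dotvv [X in _ * X]dotvv -exprMn ler_pXn2r ?norm_NT// nnegrE ?norm2_ge0//.
  by rewrite (le_trans _ (norm_NT _)) ?norm2_ge0.
have h3 := Sle g; have h4 := kcov_le b2.
have b10 := dotvv_ge0 b1; have b20 := dotvv_ge0 b2.
rewrite /design_upper; set f := M ^+ 2 in h2 *; have f0 : 0 <= f by exact: sqr_ge0.
have il : 0 <= lo^-1 by rewrite invr_ge0 ltW.
have h5 : dot g g <= 2 * dot b1 b1 + 2 * (f * dot b2 b2) by lra.
have h6 := ler_wpM2l il h5.
have h7 : 0 <= lo^-1 * dot b2 b2 by rewrite mulr_ge0.
have h8 : 0 <= lo^-1 * (f * dot b1 b1) by rewrite mulr_ge0// mulr_ge0.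
move: h3 h6 h7 h8; set e := lo^-1; nra.
Qed.

End Estimate.
End DesignFactor.

Section DesignConstants.
Context {R : realType}.

Lemma design_lower_gt0 (hi lo2 : R) : 0 < hi -> 0 < lo2 -> 0 < design_lower hi lo2.
Proof.
move=> hi0 lo20; rewrite invr_gt0 ltr_wpDr ?mulr_gt0// mulr_ge0 ?divr_ge0 ?(ltW lo20)//.
by rewrite addr_ge0// mulr_ge0 ?sqr_ge0.
Qed.

Lemma design_upper_ge0 (lo hi : R) : 0 < lo -> 0 <= design_upper lo hi.
Proof.
move=> /ltW lo0; rewrite /design_upper addr_ge0// addr_ge0// ?divr_ge0//.
by rewrite mulr_ge0// sqr_ge0.
Qed.

End DesignConstants.

(** * Proximal gradient iterates and the Lasso *)

Section SoftThreshold.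
Context {R : realType}.

(** Soft thresholding, the proximal map of t |.|, as a difference of positive parts: oddness and
    measurability are then immediate. *)
Definition soft (t x : R) : R := Num.max (x - t) 0 - Num.max (- x - t) 0.

Variable t : R.
Hypothesis t0 : 0 <= t.

Let cases x : [\/ t < x /\ soft t x = x - t, x < - t /\ soft t x = x + t |
  - t <= x <= t /\ soft t x = 0].
Proof.
have t0' := t0; rewrite /soft; have [tx|tx] := ltP t x.
  have h1 : 0 <= x - t by lra.
  have h2 : - x - t <= 0 by lra.
  by constructor 1; split=> //; rewrite (max_l h1) (max_r h2) subr0.
have h1 : x - t <= 0 by lra.
have [xt|xt] := ltP x (- t).
  have h2 : 0 <= - x - t by lra.
  by constructor 2; split=> //; rewrite (max_r h1) (max_l h2); lra.
have h2 : - x - t <= 0 by lra.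
by constructor 3; split=> //; rewrite (max_r h1) (max_r h2) subr0.
Qed.

Lemma soft_lipschitz x y : `|soft t x - soft t y| <= `|x - y|.
Proof.
have t0' := t0; have H : - `|x - y| <= x - y <= `|x - y| by rewrite -ler_norml.
rewrite ler_norml; move: H; set n := `|x - y| => H.
by have [[? ->]|[? ->]|[? ->]] := cases x; have [[? ->]|[? ->]|[? ->]] := cases y; lra.
Qed.

Lemma softN x : soft t (- x) = - soft t x.
Proof. by rewrite /soft opprK opprB. Qed.

Lemma soft0 : soft t 0 = 0.
Proof. by rewrite /soft oppr0 subrr. Qed.

(** x - soft t x is a subgradient of t |.| at soft t x. *)
Lemma soft_prox x v : (x - soft t x) * (v - soft t x) <= t * (`|v| - `|soft t x|).
Proof.
have t0' := t0; have H : - `|v| <= v <= `|v| by rewrite -ler_norml.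
move: H; set n := `|v| => /andP[H1 H2].
have [[h ->]|[h ->]|[h ->]] := cases x.
- by rewrite (ger0_norm (_ : 0 <= x - t)); [nra|lra].
- by rewrite (ler0_norm (_ : x + t <= 0)); [nra|lra].
- rewrite normr0; case/andP: h; nra.
Qed.

End SoftThreshold.

(** * Proximal gradient iterates: contraction, oddness, Lipschitz dependence on the design *)

Section Ista.
Context {R : realType}.
Variables (m k : nat) (M : {set 'I_k}).

Definition mask (b : 'cV[R]_k) : 'cV[R]_k := \col_i (if i \in M then b i 0 else 0).

Definition supported (b : 'cV[R]_k) : Prop := forall i, i \notin M -> b i 0 = 0.

Lemma mask_supported b : supported (mask b).
Proof. by move=> i /negbTE iM; rewrite mxE iM. Qed.

Lemma supportedB a b : supported a -> supported b -> supported (a - b).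
Proof. by move=> sa sb i iM; rewrite !mxE sa// sb// subrr. Qed.

Lemma supportedD a b : supported a -> supported b -> supported (a + b).
Proof. by move=> sa sb i iM; rewrite !mxE sa// sb// addr0. Qed.

Lemma dot_mask u v : supported v -> dot (mask u) v = dot u v.
Proof.
move=> sv; rewrite !dotE; apply: eq_bigr => i _; rewrite mxE.
by case: ifPn => // /sv ->; rewrite !mulr0.
Qed.

Lemma maskD a b : mask (a + b) = mask a + mask b.
Proof. by apply/colP => i; rewrite !mxE; case: ifP; rewrite ?addr0. Qed.

Lemma maskZ x a : mask (x *: a) = x *: mask a.
Proof. by apply/colP => i; rewrite !mxE; case: ifP; rewrite ?mulr0. Qed.

Lemma maskB a b : mask (a - b) = mask a - mask b.
Proof. by rewrite -scaleN1r maskD maskZ scaleN1r. Qed.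

Lemma mask_id b : supported b -> mask b = b.
Proof. by move=> sb; apply/colP => i; rewrite mxE; case: ifPn => // /sb. Qed.

Lemma norm2_mask_le a : norm2 (mask a) <= norm2 a.
Proof.
rewrite ler_norm2_dotvv ?norm2_ge0// -dotvv !dotE; apply: ler_sum => i _; rewrite mxE.
by case: ifP => // _; rewrite mulr0 -expr2 sqr_ge0.
Qed.

Definition gstep (eta : R) (H : 'M[R]_(m, k)) (e : 'cV[R]_m) (b : 'cV[R]_k) : 'cV[R]_k :=
  b - eta *: (H^T *m (H *m b - e)).

(** Splits the difference of two steps into a part that contracts b - b' and a part linear in the
    perturbation H - H'. *)
Lemma gstepB eta H H' e b b' : gstep eta H e b - gstep eta H' e b' =
  ((b - b') - eta *: (H^T *m (H *m (b - b')))) +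
  - eta *: (H^T *m ((H - H') *m b') + (H - H')^T *m (H' *m b' - e)).
Proof.
have -> : (H - H')^T = H^T - H'^T by rewrite linearB.
rewrite /gstep !(mulmxBr, mulmxBl).
move: (H^T *m (H *m b)) (H^T *m (H *m b')) (H^T *m (H' *m b')) (H'^T *m (H' *m b')).
move: (H^T *m e) (H'^T *m e) => v1 v2 v3 v4 v5 v6.
by apply/colP => i; rewrite !mxE; ring.
Qed.

(* Proximal gradient step for [|e - H b|_2^2 + (2 t / eta) |b|_1] restricted to
   vectors supported in [M]. *)
Definition ista eta t H e b : 'cV[R]_k := mask (map_mx (soft t) (gstep eta H e b)).

Lemma istaE eta t H e b i : ista eta t H e b i 0 =
  if i \in M then soft t (gstep eta H e b i 0) else 0.
Proof. by rewrite /ista !mxE. Qed.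

Lemma maskE b i : mask b i 0 = if i \in M then b i 0 else 0.
Proof. by rewrite mxE. Qed.

Let subE (a b : 'cV[R]_k) i : (a - b) i 0 = a i 0 - b i 0.
Proof. by rewrite !mxE. Qed.

Lemma ista_supported eta t H e b : supported (ista eta t H e b).
Proof. exact: mask_supported. Qed.

Lemma norm2_ista_le eta t H e b H' e' b' : 0 <= t ->
  norm2 (ista eta t H e b - ista eta t H' e' b') <=
  norm2 (mask (gstep eta H e b - gstep eta H' e' b')).
Proof.
move=> t0; rewrite ler_norm2_dotvv ?norm2_ge0// -dotvv !dotE; apply: ler_sum => i _.
rewrite maskE (subE (ista _ _ _ _ _)) (subE (gstep _ _ _ _)) !istaE -!expr2.
case: ifP => _; last by rewrite subrr.
rewrite -[leLHS]real_normK ?num_real// -[leRHS]real_normK ?num_real//.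
by rewrite ler_pXn2r// ?nnegrE// soft_lipschitz.
Qed.

(** The start at 0 is what makes the iterates odd in [H]. *)
Definition ista_iter eta t H e n := iter n (ista eta t H e) 0.

Lemma ista_iter_supported eta t H e n : supported (ista_iter eta t H e n).
Proof. by case: n => [i _|n]; [rewrite mxE|exact: ista_supported]. Qed.

Lemma ista_oddH eta t H e b : ista eta t (- H) e (- b) = - ista eta t H e b.
Proof.
have E : gstep eta (- H) e (- b) = - gstep eta H e b.
  rewrite /gstep linearN/= !mulNmx !mulmxN opprK !mulmxBr.
  by apply/colP => i; rewrite !mxE; ring.
apply/colP => i; rewrite istaE E [RHS]mxE istaE; case: ifP => _; last by rewrite oppr0.
by rewrite [X in soft _ X]mxE softN.
Qed.

Lemma ista_iter_oddH eta t H e n : ista_iter eta t (- H) e n = - ista_iter eta t H e n.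
Proof.
elim: n => [|n IH]; first by rewrite /ista_iter /= oppr0.
by rewrite /ista_iter !iterS -!/(ista_iter _ _ _ _ _) IH ista_oddH.
Qed.

Section Contraction.
Variables (c C : R) (c0 : 0 < c) (cC : c <= C) (t : R) (t0 : 0 <= t).
Let C0 : 0 < C. Proof. exact: lt_le_trans cC. Qed.
Let eta := C^-1.
Definition ista_rate : R := Num.sqrt (1 - c / C).
Let rho := ista_rate.

(** The restriction to supported vectors matters: with more columns than rows, no positive lower
    bound holds for all vectors. *)
Definition well_conditioned (H : 'M[R]_(m, k)) : Prop := forall b, supported b ->
  c * dot b b <= dot (H *m b) (H *m b) <= C * dot b b.

Let cC1 : 0 <= 1 - c / C.
Proof. by rewrite subr_ge0 ler_pdivrMr// mul1r. Qed.

Lemma ista_rate_ge0 : 0 <= ista_rate. Proof. exact: sqrtr_ge0. Qed.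

Lemma ista_rate_lt1 : ista_rate < 1.
Proof.
rewrite -[ltRHS]sqrtr1 ltr_sqrt//; have : 0 < c / C by rewrite divr_gt0.
lra.
Qed.

Let sC := Num.sqrt C.
Let sC0 : 0 <= sC. Proof. exact: sqrtr_ge0. Qed.
Let sC2 : sC ^+ 2 = C. Proof. by rewrite sqr_sqrtr// ltW. Qed.

Section Fixed.
Variable H : 'M[R]_(m, k).
Hypothesis wcH : well_conditioned H.

Lemma norm2_mulmx_supported b : supported b -> norm2 (H *m b) <= sC * norm2 b.
Proof.
move=> sb; rewrite ler_norm2_dotvv ?mulr_ge0 ?norm2_ge0// exprMn sC2 -dotvv.
by have /andP[] := wcH sb.
Qed.

(** Dual of [norm2_mulmx_supported]; the mask discards the coordinates on which [H] is not
    controlled. *)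
Lemma norm2_mask_trmx z : norm2 (mask (H^T *m z)) <= sC * norm2 z.
Proof.
set w := mask _; have [->|w0] := eqVneq w 0; first by rewrite norm20 mulr_ge0 ?norm2_ge0.
have nw : 0 < norm2 w.
  by rewrite lt_neqAle norm2_ge0 andbT eq_sym -(sqrf_eq0 (norm2 w)) -dotvv dotvv_eq0.
have sw : supported w by exact: mask_supported.
rewrite -(ler_pM2r nw) -expr2 -dotvv {1}/w dot_mask// dot_mulmxl trmxK dotC.
apply: (le_trans (ler_norm _)); apply: (le_trans (dot_le_norm2 _ _)).
by rewrite [leRHS]mulrAC ler_wpM2r ?norm2_ge0// norm2_mulmx_supported.
Qed.

(** With q = |H b|^2 and w the masked gradient, the square is |b|^2 - 2 eta q + eta^2 |w|^2. Since
    |w|^2 <= C q and eta = 1 / C, it is at most |b|^2 - q / C, hence at most (1 - c / C) |b|^2. *)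
Lemma norm2_contraction b : supported b ->
  norm2 (mask (b - eta *: (H^T *m (H *m b)))) <= rho * norm2 b.
Proof.
move=> sb; rewrite ler_norm2_dotvv ?mulr_ge0 ?norm2_ge0 ?ista_rate_ge0//.
rewrite exprMn sqr_sqrtr// -dotvv.
have -> : mask (b - eta *: (H^T *m (H *m b))) = b - eta *: mask (H^T *m (H *m b)).
  by rewrite maskB maskZ mask_id.
set w := mask _; set q := dot (H *m b) (H *m b).
have bw : dot b w = q by rewrite dotC dot_mask// dot_mulmxl trmxK.
have ww : dot w w <= C * q.
  rewrite dotvv /q [X in _ * X]dotvv -sC2 -exprMn ler_pXn2r ?nnegrE ?mulr_ge0 ?norm2_ge0//.
  exact: norm2_mask_trmx.
rewrite !(dotBl, dotBr, dotZl, dotZr) (dotC w b) bw.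
have : eta * (eta * dot w w) <= eta * q.
  by rewrite ler_wpM2l ?invr_ge0 ?(ltW C0)// /eta ler_pdivrMl.
have : c * dot b b * eta <= eta * q.
  by rewrite mulrC ler_wpM2l ?invr_ge0 ?(ltW C0)//; have /andP[] := wcH sb.
rewrite /eta mulrBl mul1r mulrAC; lra.
Qed.

Lemma ista_contraction e b b' : supported b -> supported b' ->
  norm2 (ista eta t H e b - ista eta t H e b') <= rho * norm2 (b - b').
Proof.
move=> sb sb'; apply: (le_trans (norm2_ista_le _ _ _ _ _ _ _ t0)).
rewrite (_ : gstep eta H e b - gstep eta H e b' =
   (b - b') - eta *: (H^T *m (H *m (b - b')))); last first.
  rewrite /gstep !mulmxBr !scalerBr; apply/colP => i; rewrite !mxE; ring.
by apply: norm2_contraction; exact: supportedB.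
Qed.

Variable e : 'cV[R]_m.

Lemma ista_at0 : norm2 (ista eta t H e 0) <= eta * sC * norm2 e.
Proof.
have -> : ista eta t H e 0 = ista eta t H e 0 - ista eta t H 0 0.
  rewrite [X in _ - X](_ : _ = 0) ?subr0//; apply/colP => i.
  by rewrite istaE /gstep mulmx0 subrr mulmx0 scaler0 subrr mxE soft0// if_same.
apply: (le_trans (norm2_ista_le _ _ _ _ _ _ _ t0)).
rewrite /gstep !mulmx0 !sub0r oppr0 mulmx0 scaler0 oppr0 subr0 mulmxN scalerN opprK.
rewrite maskZ norm2Z ger0_norm ?invr_ge0 ?(ltW C0)// -mulrA.
by rewrite ler_wpM2l ?invr_ge0 ?(ltW C0)// norm2_mask_trmx.
Qed.

Let u n := ista_iter eta t H e n.

Lemma ista_iter_step n : norm2 (u n.+1 - u n) <= rho ^+ n * (eta * sC * norm2 e).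
Proof.
elim: n => [|n IH].
  by rewrite mul1r /u /ista_iter /= subr0; exact: ista_at0.
rewrite exprS -mulrA; apply: le_trans (ler_wpM2l ista_rate_ge0 IH).
by apply: (@ista_contraction e (u n.+1) (u n)); exact: ista_iter_supported.
Qed.

(** The bound is the fixed point of x -> rho x + eta sC |e|. *)
Lemma ista_iter_bound n : norm2 (u n) <= eta * sC * norm2 e / (1 - rho).
Proof.
have r1 : 0 < 1 - rho by rewrite subr_gt0 ista_rate_lt1.
have B0 : 0 <= eta * sC * norm2 e by rewrite !mulr_ge0 ?norm2_ge0// invr_ge0 ltW.
elim: n => [|n IH]; first by rewrite /u /ista_iter /= norm20 divr_ge0// ltW.
have -> : u n.+1 = (ista eta t H e (u n) - ista eta t H e 0) + ista eta t H e 0.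
  by rewrite subrK.
apply: (le_trans (ler_norm2D _ _)).
have h1 : norm2 (ista eta t H e (u n) - ista eta t H e 0) <= rho * norm2 (u n).
  rewrite -[X in _ * norm2 X]subr0; apply: ista_contraction; last by move=> i _; rewrite mxE.
  exact: ista_iter_supported.
have h2 := ista_at0; have h3 := ler_wpM2l ista_rate_ge0 IH.
apply: (@le_trans _ _ (rho * (eta * sC * norm2 e / (1 - rho)) + eta * sC * norm2 e)).
  by apply: lerD h2; exact: le_trans h1 h3.
rewrite le_eqVlt; apply/orP; left; apply/eqP; field.
by rewrite gt_eqF.
Qed.

(* The last term measures how far [u n.+1] is from a fixed point of the step. *)
Lemma ista_variational n v : supported v ->
  2 * dot (e - H *m u n.+1) (H *m (v - u n.+1)) <=
  2 * t * C * (norm1 v - norm1 (u n.+1)) +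
  2 * (C * rho * norm2 (u n.+1 - u n)) * norm2 (v - u n.+1).
Proof.
move=> sv; set b := u n; set b' := u n.+1.
have sb : supported b by exact: ista_iter_supported.
have sb' : supported b' by exact: ista_iter_supported.
pose z := gstep eta H e b.
have prox : dot (z - b') (v - b') <= t * (norm1 v - norm1 b').
  rewrite dotE /norm1 -sumrB mulr_sumr; apply: ler_sum => i _.
  have [iM|iM] := boolP (i \in M); last by rewrite !subE sv// sb'// subrr mulr0 subrr mulr0.
  rewrite (subE z) (subE v) (_ : b' i 0 = soft t (z i 0)); first exact: soft_prox.
  by rewrite /b' /u /ista_iter iterS istaE iM.
have E : z - b' = eta *: (H^T *m (e - H *m b')) + ((b - b') - eta *: (H^T *m (H *m (b - b')))).
  rewrite /z /gstep !mulmxBr !scalerBr; apply/colP => i; rewrite !mxE; ring.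
rewrite E dotDl dotZl dot_mulmxl trmxK in prox.
have sd : supported (v - b') by exact: supportedB.
have cs : `|dot ((b - b') - eta *: (H^T *m (H *m (b - b')))) (v - b')| <=
    rho * norm2 (b' - b) * norm2 (v - b').
  rewrite -dot_mask//; apply: (le_trans (dot_le_norm2 _ _)); rewrite ler_wpM2r ?norm2_ge0//.
  by rewrite -(norm2N (b' - b)) opprB norm2_contraction//; exact: supportedB.
have {}cs : - dot ((b - b') - eta *: (H^T *m (H *m (b - b')))) (v - b') <=
    rho * norm2 (b' - b) * norm2 (v - b').
  by apply: le_trans cs; rewrite -normrN ler_norm.
set D1 := dot (e - _) _ in prox *; set D2 := dot _ (v - b') in prox cs.
have h : eta * D1 <= t * (norm1 v - norm1 b') + rho * norm2 (b' - b) * norm2 (v - b') by lra.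
have := ler_wpM2l (ltW C0) h; rewrite /eta mulVKf ?gt_eqF// => {}h.
have -> : 2 * t * C * (norm1 v - norm1 b') + 2 * (C * rho * norm2 (b' - b)) * norm2 (v - b') =
  2 * (C * (t * (norm1 v - norm1 b') + rho * norm2 (b' - b) * norm2 (v - b'))) by ring.
by rewrite ler_wpM2l.
Qed.

End Fixed.

(** The contraction sums the perturbations of all steps to a geometric series, so the constant does
    not depend on the number of steps. The 3 collects 2 |e| / (1 - rho) from the bound on the
    iterates and |e| <= |e| / (1 - rho). *)
Lemma ista_iter_lipschitz (H H' : 'M[R]_(m, k)) e ell n :
  well_conditioned H -> well_conditioned H' -> 0 <= ell ->
  (forall v, norm2 ((H - H') *m v) <= ell * norm2 v) ->
  norm2 (ista_iter eta t H e n - ista_iter eta t H' e n) <=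
  3 * ell * norm2 e / (C * (1 - rho) ^+ 2).
Proof.
move=> wc wc' ell0 ellH; set u := ista_iter eta t H e; set u' := ista_iter eta t H' e.
have r1 : 0 < 1 - rho by rewrite subr_gt0 ista_rate_lt1.
have r0 : 0 <= rho by exact: ista_rate_ge0.
have eta0 : 0 < eta by rewrite invr_gt0.
have ne := norm2_ge0 e.
pose Bd := eta * sC * norm2 e / (1 - rho).
have step k' : norm2 (u k'.+1 - u' k'.+1) <=
    rho * norm2 (u k' - u' k') + eta * ell * (2 * sC * Bd + norm2 e).
  have su : supported (u k') by exact: ista_iter_supported.
  have su' : supported (u' k') by exact: ista_iter_supported.
  have ub : norm2 (u' k') <= Bd by exact: ista_iter_bound.
  apply: (le_trans (norm2_ista_le _ _ _ _ _ _ _ t0)).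
  have -> : gstep eta H e (u k') - gstep eta H' e (u' k') =
    ((u k' - u' k') - eta *: (H^T *m (H *m (u k' - u' k')))) +
    - eta *: (H^T *m ((H - H') *m u' k') + (H - H')^T *m (H' *m u' k' - e)).
    exact: gstepB.
  rewrite maskD maskZ; apply: (le_trans (ler_norm2D _ _)); apply: lerD.
    by apply: norm2_contraction => //; exact: supportedB.
  rewrite norm2Z normrN ger0_norm ?(ltW eta0)// -mulrA ler_wpM2l ?(ltW eta0)// maskD.
  apply: (le_trans (ler_norm2D _ _)).
  have h1 : norm2 (mask (H^T *m ((H - H') *m u' k'))) <= sC * (ell * Bd).
    apply: (le_trans (norm2_mask_trmx wc _)); rewrite ler_wpM2l//.
    by apply: (le_trans (ellH _)); rewrite ler_wpM2l.
  have h2 : norm2 (mask ((H - H')^T *m (H' *m u' k' - e))) <= ell * (sC * Bd + norm2 e).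
    apply: (le_trans (norm2_mask_le _)); apply: (le_trans (norm2_trmx_mulmx ell0 ellH _)).
    rewrite ler_wpM2l//; apply: (le_trans (ler_norm2B _ _)); rewrite lerD2r.
    by apply: (le_trans (norm2_mulmx_supported wc' su')); rewrite ler_wpM2l.
  by apply: (le_trans (lerD h1 h2)); rewrite le_eqVlt; apply/orP; left; apply/eqP; ring.
pose G := eta * ell * (2 * sC * Bd + norm2 e).
have Bd0 : 0 <= Bd by rewrite divr_ge0 ?(ltW r1)// !mulr_ge0 ?(ltW eta0).
have G0 : 0 <= G.
  by apply: mulr_ge0; [exact: mulr_ge0 (ltW eta0) ell0|apply: addr_ge0 => //; exact: mulr_ge0 (mulr_ge0 _ sC0) Bd0].
have : norm2 (u n - u' n) <= G / (1 - rho).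
  elim: n => [|n IH]; first by rewrite subrr norm20 divr_ge0// ltW.
  apply: (le_trans (step n)); rewrite -/G.
  apply: (le_trans (lerD (ler_wpM2l r0 IH) (lexx _))).
  by rewrite le_eqVlt; apply/orP; left; apply/eqP; field; rewrite gt_eqF.
move=> /le_trans; apply.
rewrite /G; have -> : 2 * sC * Bd = 2 * norm2 e / (1 - rho).
  rewrite /Bd (_ : 2 * sC * (eta * sC * norm2 e / (1 - rho)) = (eta * sC ^+ 2) * (2 * norm2 e / (1 - rho))); last by ring.
  by rewrite sC2 /eta mulVf ?gt_eqF// mul1r.
have -> : 3 * ell * norm2 e / (C * (1 - rho) ^+ 2) =
    eta * ell * (3 * norm2 e / (1 - rho)) / (1 - rho).
  by rewrite /eta; field; rewrite !gt_eqF.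
rewrite ler_wpM2r ?invr_ge0 ?(ltW r1)// ler_wpM2l ?mulr_ge0 ?(ltW eta0)//.
rewrite -lerBrDl -mulrBl -mulrBl (_ : 3 - 2 = 1 :> R); last by ring.
by rewrite mul1r ler_pdivlMr// ler_piMr//; lra.
Qed.

End Contraction.
End Ista.

(** * First-order conditions of the Lasso *)

Section LassoComparison.
Context {R : realType}.

Lemma le_of_small (a b c : R) : (forall t, 0 < t <= 1 -> a <= b + t * c) -> a <= b.
Proof.
move=> H; rewrite leNgt; apply/negP => ba.
have d0 : 0 < 1 + `|c| + (a - b) by have := normr_ge0 c; lra.
have t0 : 0 < (a - b) / (1 + `|c| + (a - b)) by rewrite divr_gt0// subr_gt0.
have := H _ (_ : 0 < (a - b) / (1 + `|c| + (a - b)) <= 1).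
rewrite t0 ler_pdivrMr// => /(_ _)/wrap[].
  by have := normr_ge0 c; lra.
rewrite -lerBlDl mulrAC ler_pdivlMr//; have := ler_norm c; nra.
Qed.

Lemma ler_norm1D n (u v : 'cV[R]_n) : norm1 (u + v) <= norm1 u + norm1 v.
Proof.
by rewrite /norm1 -big_split; apply: ler_sum => i _; rewrite mxE ler_normD.
Qed.

Lemma norm1Z n a (v : 'cV[R]_n) : norm1 (a *: v) = `|a| * norm1 v.
Proof. by rewrite /norm1 mulr_sumr; apply: eq_bigr => i _; rewrite mxE normrM. Qed.

Lemma dot_subZ_sqr n (r w : 'cV[R]_n) t :
  dot (r - t *: w) (r - t *: w) = dot r r - 2 * t * dot r w + t ^+ 2 * dot w w.
Proof. by rewrite !(dotBl, dotBr, dotZl, dotZr) (dotC w r); ring. Qed.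

Definition knockoff_mask p (S : {set 'I_p}) : {set 'I_(p + p)} :=
  [set i | match fintype.split i with inl j => j \in S | inr j => j \in S end]%SET.

Lemma card_knockoff_mask p (S : {set 'I_p}) : #|knockoff_mask S| = (#|S| + #|S|)%N.
Proof.
rewrite -!sum1_card big_split_ord /=; congr (_ + _)%N; apply: eq_bigl => j.
  by rewrite inE; case: split_ordP => j' /eqP; rewrite ?eq_lshift ?eq_lrshift// => /eqP ->.
by rewrite inE; case: split_ordP => j' /eqP; rewrite ?eq_rshift ?eq_rlshift// => /eqP ->.
Qed.

Lemma lasso_feasible_supported p (S : {set 'I_p}) (b : 'cV[R]_(p + p)) :
  lasso_feasible S b <-> supported (knockoff_mask S) b.
Proof.
split=> [Fb i|sb j jS].
  rewrite inE; case: split_ordP => j -> jS; first by have [] := Fb _ jS.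
  by have [] := Fb _ jS.
split; apply: sb; rewrite inE; case: split_ordP => j' /eqP;
  rewrite ?eq_lshift ?eq_lrshift ?eq_rshift ?eq_rlshift// => /eqP <-//.
Qed.

(** Minimality against b + t (v - b), divided by t, in the limit t -> 0; convexity of the penalty
    supplies its right-hand side. *)
Lemma lasso_variational m p (lambda : R) (S : {set 'I_p}) (X Xk : 'M[R]_(m, p)) y b :
  0 <= lambda -> is_lasso lambda S X Xk y b ->
  forall v, lasso_feasible S v ->
  (m + m)%:R^-1 * (2 * dot (y - row_mx X Xk *m b) (row_mx X Xk *m (v - b))) <=
  lambda * (norm1 v - norm1 b).
Proof.
move=> l0 [Fb bmin] v Fv; set D := row_mx X Xk; set r := y - _; set w := D *m _.
set N := (_%:R^-1); have N0 : 0 <= N by rewrite invr_ge0.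
apply: (@le_of_small _ _ (N * dot w w)) => t /andP[t0 t1].
have Ft : lasso_feasible S (b + t *: (v - b)).
  by move=> j jS; have [h1 h2] := Fb _ jS; have [h3 h4] := Fv _ jS; rewrite !mxE h1 h2 h3 h4 subrr mulr0 addr0.
have := bmin _ Ft; rewrite /lasso_obj -/D -/N.
have -> : y - D *m (b + t *: (v - b)) = r - t *: w.
  by rewrite /r /w mulmxDr -scalemxAr opprD addrA.
rewrite -/r -!dotvv dot_subZ_sqr.
have : norm1 (b + t *: (v - b)) <= (1 - t) * norm1 b + t * norm1 v.
  have -> : b + t *: (v - b) = (1 - t) *: b + t *: v.
    by apply/colP => i; rewrite !mxE; ring.
  apply: (le_trans (ler_norm1D _ _)); rewrite !norm1Z !ger0_norm ?(ltW t0)//; lra.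
move=> /(ler_wpM2l l0) h1 h2.
have {}h2 : t * (N * (2 * dot r w)) <= t * (lambda * (norm1 v - norm1 b) + t * (N * dot w w)).
  move: h1 h2; set n1 := norm1 (_ + _); move: (dot r r) (dot r w) (dot w w) => a b' c; lra.
by rewrite ler_pM2l in h2.
Qed.

Lemma abs_shift_diff (x y z : R) : `|x + y| - `|y| - (`|x + z| - `|z|) <= 2 * `|z - y|.
Proof.
have : `|x + y| <= `|x + z| + `|z - y|.
  by rewrite -[`|z - y|]normrN opprB; apply: le_trans (ler_normD _ _); rewrite le_eqVlt; apply/orP; left; apply/eqP; congr `|_|; ring.
have : `|z| <= `|y| + `|z - y|.
  by apply: le_trans (ler_normD _ _); rewrite le_eqVlt; apply/orP; left; apply/eqP; congr `|_|; ring.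
lra.
Qed.

Lemma sum_norm_le_sqrt_card k (S : {set 'I_k}) (v : 'cV[R]_k) :
  \sum_(i in S) `|v i 0| <= Num.sqrt #|S|%:R * norm2 v.
Proof.
pose a : 'cV[R]_k := \col_i (i \in S)%:R; pose b : 'cV[R]_k := \col_i `|v i 0|.
have -> : \sum_(i in S) `|v i 0| = dot a b.
  rewrite dotE big_mkcond; apply: eq_bigr => i _; rewrite !mxE.
  by case: (i \in S); rewrite ?mul1r ?mul0r.
apply: (le_trans (ler_norm _)); apply: (le_trans (dot_le_norm2 _ _)).
rewrite le_eqVlt; apply/orP; left; apply/eqP; congr (_ * _).
  congr Num.sqrt; under eq_bigr do rewrite mxE.
  rewrite -sum1_card natr_sum [RHS]big_mkcond; apply: eq_bigr => i _.
  by case: (i \in S); rewrite ?expr1n ?expr0n.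
by congr Num.sqrt; apply: eq_bigr => i _; rewrite mxE real_normK ?num_real.
Qed.

(** The inequality of [b] is tested at bt + u and that of [u] at b - bt. In the sum the noise
    cancels and leaves |H d|^2 with d = b - bt - u; the l1 terms cancel off S0 and differ by at most
    2 |d_i| on it. No relation between lambda and the noise enters. *)
Lemma lasso_noise_comparison m k (M S0 : {set 'I_k}) (c lambda err : R)
    (H : 'M[R]_(m, k)) (e : 'cV[R]_m) (bt b u : 'cV[R]_k) :
  0 < c -> 0 <= lambda -> 0 <= err ->
  (forall d, supported M d -> c * dot d d <= dot (H *m d) (H *m d)) ->
  S0 \subset M -> (forall i, i \notin S0 -> bt i 0 = 0) ->
  supported M b -> supported M u ->
  (forall v, supported M v ->
     2 * dot (e - H *m (b - bt)) (H *m (v - b)) <= lambda * (norm1 v - norm1 b)) ->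
  (forall v, supported M v ->
     2 * dot (e - H *m u) (H *m (v - u)) <=
     lambda * (norm1 v - norm1 u) + 2 * err * norm2 (v - u)) ->
  norm2 (b - bt - u) <= (lambda * Num.sqrt #|S0|%:R + err) / c.
Proof.
move=> c0 l0 err0 Hc S0M bt0 sb su Vb Vu.
have sbt : supported M bt.
  by move=> i iM; apply: bt0; apply: contra iM => /(fintype.subsetP S0M).
set h := b - bt; set d := h - u.
have sh : supported M h by exact: supportedB.
have sd : supported M d by exact: supportedB.
have := Vb (bt + u) (supportedD sbt su); rewrite -/h.
have -> : bt + u - b = - d by apply/colP => i; rewrite !mxE; ring.
rewrite mulmxN dotNr => h1.
have h2 := Vu h sh; rewrite -/d in h2.
have hd : dot (H *m d) (H *m d) = dot (e - H *m u) (H *m d) - dot (e - H *m h) (H *m d).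
  rewrite -dotBl {1}/d mulmxBr; congr (dot _ _).
  by move: (H *m h) (H *m u) => x1 x2; apply/colP => i; rewrite !mxE; ring.
have bE : b = bt + h by rewrite /h addrC subrK.
have h3 : norm1 (bt + u) - norm1 u - (norm1 b - norm1 h) <= 2 * (Num.sqrt #|S0|%:R * norm2 d).
  apply: (@le_trans _ _ (2 * \sum_(i in S0) `|d i 0|)); last first.
    by rewrite ler_pM2l// sum_norm_le_sqrt_card.
  rewrite /norm1 -!sumrB mulr_sumr [leRHS]big_mkcond; apply: ler_sum => i _.
  have dE : d i 0 = h i 0 - u i 0 by rewrite /d !mxE.
  have bi : b i 0 = bt i 0 + h i 0 by rewrite {1}bE mxE.
  have ui : (bt + u) i 0 = bt i 0 + u i 0 by rewrite mxE.
  rewrite bi ui dE; case: ifPn => [_|/bt0 ->]; first exact: abs_shift_diff.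
  by rewrite !add0r !subrr.
have h4 := ler_wpM2l l0 h3.
have {}h4 : dot (H *m d) (H *m d) <= (lambda * Num.sqrt #|S0|%:R + err) * norm2 d.
  rewrite hd; move: h1 h2 h4; move: (norm1 _) (norm1 u) (norm1 h) (norm1 b) (dot _ _) (dot _ _) (norm2 d) (Num.sqrt _).
  move=> a1 a2 a3 a4 a5 a6 a7 a8 h1 h2 h4; lra.
have := Hc _ sd => h5; rewrite ler_pdivlMr//.
have nd := norm2_ge0 d; rewrite le_eqVlt in nd; case/orP: nd => [/eqP <-|nd].
  by rewrite mul0r addr_ge0// mulr_ge0.
rewrite -(ler_pM2r nd); apply: le_trans h4; apply: le_trans h5.
by rewrite dotvv expr2 le_eqVlt; apply/orP; left; apply/eqP; ring.
Qed.

End LassoComparison.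

(** * Knockoff selection *)

Section Selection.
Context {R : realType}.
Variables (p : nat) (q tau : R) (beta : 'cV[R]_p) (b : 'cV[R]_(p + p)).
Hypothesis tau0 : 0 < tau.
Hypothesis beta_large : forall j, j \in supp beta -> 4 * tau <= `|beta j 0|.

Let W := lcd_stat b.
Let h := b - col_mx beta 0.
Let s := #|supp beta|.
Let N := #|[set i | tau <= `|h i 0|]%SET|.

Hypothesis Ns : 1 + N%:R <= q * (s%:R - N%:R).

Let large := [set j | 2 * tau <= W j 0]%SET.

Let hl j : h (lshift p j) 0 = b (lshift p j) 0 - beta j 0.
Proof. by rewrite /h mxE [X in _ + X]mxE col_mxEu. Qed.

Let hr j : h (rshift p j) 0 = b (rshift p j) 0.
Proof. by rewrite /h mxE [X in _ + X]mxE col_mxEd mxE oppr0 addr0. Qed.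

Let WE j : W j 0 = `|b (lshift p j) 0| - `|b (rshift p j) 0|.
Proof. by rewrite mxE. Qed.

(** A signal whose statistic is below 2 tau has an error of at least tau at its original or at its
    knockoff coordinate: if the original one is accurate, it exceeds 3 tau, so the knockoff
    coefficient exceeds tau. The map [f] picks such a coordinate, injectively. *)
Lemma card_supp_large : (s <= #|large :&: supp beta| + N)%N.
Proof.
rewrite /s -(cardsID large (supp beta)) finset.setIC leq_add2l.
pose f (j : 'I_p) : 'I_(p + p) := if tau <= `|h (lshift p j) 0| then lshift p j else rshift p j.
have finj : injective f.
  move=> i j; rewrite /f; case: ifP => _; case: ifP => _ /eqP;
  by rewrite ?eq_lshift ?eq_rshift ?eq_lrshift ?eq_rlshift// => /eqP.
rewrite -(card_imset _ finj); apply: subset_leq_card; apply/fintype.subsetP => _ /imsetP[j + ->].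
rewrite finset.in_setD => /andP[jl jS].
have {jl} : W j 0 < 2 * tau by move: jl; rewrite finset.in_set -ltNge.
rewrite WE finset.in_set /f => jW; case: ifPn => //; rewrite -ltNge => hj; rewrite hr.
have := beta_large jS; rewrite hl in hj.
have := ler_normB (b (lshift p j) 0) (b (lshift p j) 0 - beta j 0).
rewrite (_ : _ - (_ - _) = beta j 0); last by ring.
lra.
Qed.

Lemma card_very_negative : (#|[set j | (W j 0 <= - (2 * tau))%R]%SET| <= N)%N.
Proof.
have rinj : injective (@rshift p p) by exact: rshift_inj.
rewrite -(card_imset _ rinj); apply: subset_leq_card; apply/fintype.subsetP => _ /imsetP[j + ->].
rewrite !inE WE hr; have := normr_ge0 (b (lshift p j) 0); have := tau0; lra.
Qed.

(** The threshold ranges over attained magnitudes only, so the ratio is tested at the smallest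
    statistic in [large] rather than at 2 tau. The indices above it are exactly [large], and the
    ratio is at most (1 + N) / (s - N). *)
Lemma knockoff_select_large : 0 <= q -> large \subset knockoff_select q W.
Proof.
move=> q0; have sN : N%:R < s%:R :> R.
  rewrite ltNge; apply/negP => sN.
  have : q * (s%:R - N%:R) <= 0 by rewrite mulr_ge0_le0// subr_le0.
  have : 0 <= N%:R :> R by []; have := Ns; lra.
have large0 : exists j, j \in large.
  apply/finset.set0Pn; rewrite -card_gt0.
  have := card_supp_large; rewrite ltr_nat in sN.
  have : (#|large :&: supp beta| <= #|large|)%N by rewrite subset_leq_card// finset.subsetIl.
  lia.
have [j0 j0l] := large0.
have [j jl jmin] : exists2 j, j \in large & forall i, i \in large -> W j 0 <= W i 0.
  by case: (arg_minP (fun j => W j 0) j0l) => j jl jmin; exists j.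
have Wj : 2 * tau <= W j 0 by rewrite inE in jl.
have Wj0 : 0 < W j 0 by apply: lt_le_trans Wj; rewrite mulr_gt0.
have jE : `|W j 0| = W j 0 by rewrite ger0_norm// ltW.
have thr : (knockoff_threshold q W <= (W j 0)%:E)%E.
  rewrite -[X in (_ <= X%:E)%E]jE /knockoff_threshold.
  apply: (@Order.TotalTheory.bigmin_le_cond _ _ _ +oo%E j).
  rewrite gt_eqF//= /fdr_ratio_le jE.
  have E : [set i | W j 0 <= W i 0]%SET = large.
    apply/finset.setP => i; rewrite !inE; apply/idP/idP; first exact: le_trans.
    by move=> il; apply: jmin; rewrite inE.
  rewrite E; have l0 : (0 < #|large|)%N by apply/card_gt0P; exists j.
  rewrite l0/= ler_pdivrMr ?ltr0n//.
  have h1 : (#|[set i | (W i 0 <= - W j 0)%R]%SET| <= N)%N.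
    apply: leq_trans card_very_negative; apply: subset_leq_card; apply/fintype.subsetP => i.
    by rewrite !inE => H; apply: (le_trans H); rewrite lerN2.
  have h2 : s%:R - N%:R <= #|large|%:R :> R.
    rewrite lerBlDr -natrD ler_nat; apply: leq_trans card_supp_large _.
    by rewrite leq_add2r subset_leq_card// finset.subsetIl.
  apply: (@le_trans _ _ (1 + N%:R)); first by rewrite lerD2l ler_nat.
  by apply: (le_trans Ns); rewrite ler_wpM2l.
apply/fintype.subsetP => i il; rewrite inE; apply: (le_trans thr).
by rewrite lee_fin jmin.
Qed.

Lemma tpp_ge : 0 <= q -> (0 < s)%N -> 1 - N%:R / s%:R <= tpp (R := R) (knockoff_select q W) (supp beta).
Proof.
move=> q0 s0; rewrite /tpp -/s ler_pdivlMr ?ltr0n// mulrBl mul1r divfK ?pnatr_eq0 -?lt0n//.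
rewrite lerBlDr -natrD ler_nat; apply: leq_trans card_supp_large _.
by rewrite leq_add2r subset_leq_card// finset.setSI// knockoff_select_large.
Qed.

End Selection.

Lemma tpp_le1 (R : realType) p (S S0 : {set 'I_p}) : tpp S S0 <= 1 :> R.
Proof.
rewrite /tpp; have [->|s0] := eqVneq #|S0| 0%N; first by rewrite invr0 mulr0.
by rewrite ler_pdivrMr ?ltr0n ?lt0n// mul1r ler_nat subset_leq_card// finset.subsetIr.
Qed.

Lemma tpp_ge0 (R : realType) p (S S0 : {set 'I_p}) : 0 <= tpp S S0 :> R.
Proof. by rewrite /tpp divr_ge0. Qed.

Lemma card_large_entries (R : realType) k (d : 'cV[R]_k) (tau : R) : 0 < tau ->
  #|[set i | tau <= `|d i 0|]%SET|%:R <= dot d d / tau ^+ 2.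
Proof.
move=> t0; rewrite ler_pdivlMr ?exprn_gt0// -sum1_card natr_sum mulr_suml dotE big_mkcond.
apply: ler_sum => i _; rewrite inE; case: ifPn => [ti|_]; last by rewrite -expr2 sqr_ge0.
by rewrite mul1r -expr2 -[leRHS]real_normK ?num_real// ler_pXn2r// ?nnegrE// ltW.
Qed.

(** * Random designs *)

Section RandomMatrixClosure.
Context {R : realType} {d : measure_display} {T : measurableType d}.

Lemma random_mx_cst m n (A : 'M[R]_(m, n)) : random_mx (fun _ : T => A).
Proof. by move=> i j; exact: measurable_cst. Qed.

Lemma random_mxD m n (X Y : T -> 'M[R]_(m, n)) :
  random_mx X -> random_mx Y -> random_mx (fun w => X w + Y w).
Proof.
by move=> mX mY i j; under eq_fun do rewrite mxE; exact: measurable_funD.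
Qed.

Lemma random_mxZ m n (f : T -> R) (X : T -> 'M[R]_(m, n)) :
  measurable_fun setT f -> random_mx X -> random_mx (fun w => f w *: X w).
Proof.
by move=> mf mX i j; under eq_fun do rewrite mxE; exact: measurable_funM.
Qed.

Lemma random_mxN m n (X : T -> 'M[R]_(m, n)) :
  random_mx X -> random_mx (fun w => - X w).
Proof.
move=> mX i j; under eq_fun do rewrite mxE.
exact: measurable_funN.
Qed.

Lemma random_mxB m n (X Y : T -> 'M[R]_(m, n)) :
  random_mx X -> random_mx Y -> random_mx (fun w => X w - Y w).
Proof. by move=> mX mY; apply: random_mxD => //; exact: random_mxN. Qed.

Lemma random_mx_mul m n k (X : T -> 'M[R]_(m, n)) (Y : T -> 'M[R]_(n, k)) :
  random_mx X -> random_mx Y -> random_mx (fun w => X w *m Y w).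
Proof.
move=> mX mY i j; under eq_fun do rewrite mxE.
apply: (@measurable_sum _ _ _ _ _ _ (fun l w => X w i l * Y w l j)) => l.
exact: measurable_funM.
Qed.

Lemma random_mx_tr m n (X : T -> 'M[R]_(m, n)) :
  random_mx X -> random_mx (fun w => (X w)^T).
Proof. by move=> mX i j; under eq_fun do rewrite mxE; exact: mX. Qed.

Lemma random_mx_map m n (f : R -> R) (X : T -> 'M[R]_(m, n)) :
  measurable_fun setT f -> random_mx X -> random_mx (fun w => map_mx f (X w)).
Proof.
by move=> mf mX i j; under eq_fun do rewrite mxE; exact: (measurableT_comp mf).
Qed.

Lemma random_mx_row m n1 n2 (X : T -> 'M[R]_(m, n1)) (Y : T -> 'M[R]_(m, n2)) :
  random_mx X -> random_mx Y -> random_mx (fun w => row_mx (X w) (Y w)).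
Proof.
move=> mX mY i j; under eq_fun do rewrite mxE; case: fintype.splitP => j' _.
  exact: mX.
exact: mY.
Qed.

Lemma random_mx_col m1 m2 n (X : T -> 'M[R]_(m1, n)) (Y : T -> 'M[R]_(m2, n)) :
  random_mx X -> random_mx Y -> random_mx (fun w => col_mx (X w) (Y w)).
Proof.
move=> mX mY i j; under eq_fun do rewrite mxE; case: fintype.splitP => j' _.
  exact: mX.
exact: mY.
Qed.

Lemma measurable_soft (t : R) : measurable_fun setT (soft t : R -> R).
Proof.
apply: measurable_funB; apply: measurable_maxr => //.
  exact: measurable_funB.
by apply: measurable_funB => //; exact: oppr_measurable.
Qed.

Lemma random_mx_mask k (M : T -> {set 'I_k}) (b : T -> 'cV[R]_k) :
  (forall i, measurable [set w | i \in M w]) -> random_mx b ->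
  random_mx (fun w => mask (M w) (b w)).
Proof.
move=> mM mb i j; under eq_fun do rewrite mxE.
apply: measurable_fun_if => //; last exact: measurable_funTS.
by apply: (measurable_fun_bool true); rewrite setTI (_ : _ @^-1` _ = [set w | i \in M w]).
Qed.

Lemma random_mx_ista_iter m k (M : T -> {set 'I_k}) (eta t : R) n
    (H : T -> 'M[R]_(m, k)) (e : T -> 'cV[R]_m) :
  (forall i, measurable [set w | i \in M w]) -> random_mx H -> random_mx e ->
  random_mx (fun w => ista_iter (M w) eta t (H w) (e w) n).
Proof.
move=> mM mH me; elim: n => [|n IH]; first exact: random_mx_cst.
rewrite /ista_iter; under eq_fun do rewrite iterS -/(ista_iter _ _ _ _ _ _).
apply: random_mx_mask => //; apply: random_mx_map; first exact: measurable_soft.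
apply: random_mxB => //; apply: random_mxZ => //; apply: random_mx_mul; first exact: random_mx_tr.
by apply: random_mxB => //; exact: random_mx_mul.
Qed.

Lemma measurable_forall (F : finType) (A : F -> set T) :
  (forall i, measurable (A i)) -> measurable [set w | forall i, A i w].
Proof.
move=> mA; rewrite (_ : [set _ | _] = \bigcap_(i in [set` [set: F]%SET]) A i); last first.
  by apply/seteqP; split=> w /= H i => [_|]; apply: H; rewrite ?finset.in_setT//= in_setT.
by apply: fin_bigcap_measurable => //; exact: finite_finset.
Qed.

Lemma measurable_exists (F : finType) (A : F -> set T) :
  (forall i, measurable (A i)) -> measurable [set w | exists i, A i w].
Proof.
move=> mA; rewrite (_ : [set _ | _] = \bigcup_(i in [set` [set: F]%SET]) A i); last first.
  by apply/seteqP; split=> w /= [i]; [exists i => //=; rewrite finset.in_setT|exists i].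
by apply: fin_bigcup_measurable => //; exact: finite_finset.
Qed.

Lemma union_bound (F : finType) (mu : {measure set T -> \bar R}) (A : F -> set T)
    (B : set T) (e : R) :
  measurable B -> (forall i, measurable (A i)) -> (forall w, B w -> exists i, A i w) ->
  (forall i, mu (A i) <= e%:E)%E -> (mu B <= (#|F|%:R * e)%:E)%E.
Proof.
move=> mB mA BA Ae.
apply: (@le_trans _ _ (mu (\big[setU/set0]_(i : F) A i))).
  apply: le_measure; rewrite ?inE//; first exact: bigsetU_measurable.
  by move=> w /BA[i Ai]; rewrite -bigcup_seq /=; exists i => //=; rewrite mem_index_enum.
apply: (@le_trans _ _ (\sum_(i : F) mu (A i))%E).
  have : forall r, (mu (\big[setU/set0]_(i <- r) A i) <= \sum_(i <- r) mu (A i))%E.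
    elim=> [|i r IH]; first by rewrite !big_nil measure0.
    rewrite !big_cons; have mr : measurable (\big[setU/set0]_(i <- r) A i).
      by apply: bigsetU_measurable => j _; exact: mA.
    by apply: le_trans; [exact: measureU2|rewrite leeD2l].
  exact.
apply: (@le_trans _ _ (\sum_(i : F) e%:E)%E); first by apply: lee_sum.
by rewrite sumEFin sumr_const mulr_natl.
Qed.

End RandomMatrixClosure.

Lemma trmxZ_mulmxZ (R : realType) m k (c : R) (M : 'M[R]_(m, k)) :
  (c *: M)^T *m (c *: M) = (c * c) *: (M^T *m M).
Proof.
have -> : (c *: M)^T = c *: M^T by apply/matrixP => i j; rewrite !mxE.
by rewrite -scalemxAl -scalemxAr scalerA.
Qed.

(** * Concentration and conditioning of the Gram matrix *)

Section GaussianDesign.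
Context {R : realType}.
Notation GR := (measurableTypeR R).
Notation gam := (normal_prob 0 1 : probability (measurableTypeR R) R).
Variables (m k : nat).

Definition white_mx (x : m.-tuple (k.-tuple GR)) : 'M[R]_(m, k) :=
  \matrix_(i, l) tnth (tnth x i) l.

Definition white_law : probability (m.-tuple (k.-tuple GR)) R := prodN (prodN gam k) m.

Lemma random_white_mx : random_mx white_mx.
Proof.
move=> i l; under eq_fun do rewrite mxE.
exact: (measurableT_comp (measurable_tnth l) (measurable_tnth i)).
Qed.

Definition design_of (V : 'M[R]_(m, k)) (A : 'M[R]_k) : 'M[R]_(m, k) :=
  (Num.sqrt (m + m)%:R)^-1 *: (V *m A).

(* [H] is normalized by the full sample size [m + m] although it has only [m]
   rows, hence the factor [1 / 2]. *)
Definition gram_close (delta : R) (A : 'M[R]_k) (H : 'M[R]_(m, k)) : Prop :=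
  forall z : 'I_k * 'I_k,
    `|(H^T *m H) z.1 z.2 - (A^T *m A) z.1 z.2 / 2| <= delta.

Lemma measurable_gram_close d (T : measurableType d) delta (A : T -> 'M[R]_k)
    (H : T -> 'M[R]_(m, k)) : random_mx A -> random_mx H ->
  measurable [set w | gram_close delta (A w) (H w)].
Proof.
move=> mA mH; apply: (measurable_forall (A := fun (z : 'I_k * 'I_k) w =>
  `|((H w)^T *m H w) z.1 z.2 - ((A w)^T *m A w) z.1 z.2 / 2| <= delta)) => z.
apply: measurable_set_le => //; apply: measurableT_comp => //.
apply: measurable_funB; first by apply: random_mx_mul => //; exact: random_mx_tr.
by apply: measurable_funM => //; apply: random_mx_mul => //; exact: random_mx_tr.
Qed.

Lemma lform_white_mx (A : 'M[R]_k) x i j :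
  lform (fun l => A l j) (tnth x i) = (white_mx x *m A) i j.
Proof. by rewrite /lform mxE; apply: eq_bigr => l _; rewrite mxE mulrC. Qed.

Variables (A : 'M[R]_k) (C : R).
Hypothesis C0 : 0 < C.
Hypothesis AC : forall b, dot (A *m b) (A *m b) <= C * dot b b.

Let S := 4 * C.

Let sgn (e : bool) : R := if e then 1 else -1.

(** Polarization: a Gram entry is a quarter of the difference of the squared forms attached to the
    sum and to the difference of two columns, which brings it within reach of the one-form bound
    [prodN_gram_deviation]. Their variances are at most 4 C. *)
Let comb (z : 'I_k * 'I_k) e l := A l z.1 + sgn e * A l z.2.

Let combE z e : \sum_l comb z e l ^+ 2 =
  (A^T *m A) z.1 z.1 + (A^T *m A) z.2 z.2 + 2 * sgn e * (A^T *m A) z.1 z.2.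
Proof.
rewrite !mxE mulr_sumr -!big_split; apply: eq_bigr => l _ /=; rewrite !mxE /comb.
by rewrite /sgn; case: e; ring.
Qed.

Let gram_delta i j : (A^T *m A) i j = dot (A *m delta_mx i 0) (A *m delta_mx j 0).
Proof. by rewrite -!colE dotE mxE; apply: eq_bigr => l _; rewrite !mxE. Qed.

Let dot_delta i j : dot (delta_mx i 0) (delta_mx j 0 : 'cV[R]_k) = (i == j)%:R.
Proof.
rewrite dotE (bigD1 j)//= !mxE !eqxx andbT big1 ?addr0 ?mulr1 1?eq_sym//.
by move=> l /negbTE lj; rewrite !mxE lj mulr0.
Qed.

Let comb_le z e : \sum_l comb z e l ^+ 2 <= S.
Proof.
rewrite combE !gram_delta.
have h (s : R) : s ^+ 2 = 1 -> dot (A *m delta_mx z.1 0) (A *m delta_mx z.1 0) +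
    dot (A *m delta_mx z.2 0) (A *m delta_mx z.2 0) +
    2 * s * dot (A *m delta_mx z.1 0) (A *m delta_mx z.2 0) <= S.
  move=> s2.
  have h1 := AC (delta_mx z.1 0); have h2 := AC (delta_mx z.2 0).
  rewrite !dot_delta !eqxx !mulr1 in h1 h2.
  have := dotvv_ge0 (A *m delta_mx z.1 0 - s *: (A *m delta_mx z.2 0)).
  rewrite dot_subZ_sqr s2 mul1r /S; have := AC (s *: delta_mx z.2 0 + delta_mx z.1 0); lra.
by apply: h; rewrite /sgn; case: e; rewrite ?sqrrN expr1n.
Qed.

(** The count is entries, times sum or difference of columns, times upper or lower deviation. *)
Lemma white_law_gram_fail delta : (0 < m)%N -> 0 < delta <= S ->
  (white_law [set x | ~ gram_close delta A (design_of (white_mx x) A)] <=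
   ((k * k * 4)%:R * expR (- (m%:R * delta ^+ 2 / (16 * S ^+ 2))))%:E)%E.
Proof.
move=> m0 /andP[d0 dS]; have mR : 0 < m%:R :> R by rewrite ltr0n.
pose Q (w : 'I_k * 'I_k * (bool * bool)) := [set x : m.-tuple (k.-tuple GR) |
  m%:R * delta <= sgn w.2.2 * \sum_(i < m) (lform (comb w.1 w.2.1) (tnth x i) ^+ 2 -
     \sum_l comb w.1 w.2.1 l ^+ 2)].
have card4 : #|{: 'I_k * 'I_k * (bool * bool)}| = (k * k * 4)%N.
  by rewrite !card_prod card_ord card_bool.
rewrite -card4; apply: (union_bound (A := Q)).
- rewrite (_ : [set x | _] = ~` [set x | gram_close delta A (design_of (white_mx x) A)])//.
  apply: measurableC; apply: measurable_gram_close; first exact: random_mx_cst.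
  apply: random_mxZ => //; apply: random_mx_mul; first exact: random_white_mx.
  exact: random_mx_cst.
- move=> w; apply: measurable_set_le => //; apply: measurable_funM => //.
  apply: (@measurable_sum _ _ _ _ _ _ (fun i (x : m.-tuple (k.-tuple GR)) => lform (comb w.1 w.2.1) (tnth x i) ^+ 2 -
     \sum_l comb w.1 w.2.1 l ^+ 2)) => i.
  apply: measurable_funB => //; apply: measurable_funX.
  by apply: (measurableT_comp (measurable_lform _)); exact: measurable_tnth.
- move=> x /existsNP[z /negP]; rewrite -ltNge => dz.
  apply: contrapT => /forallNP nQ.
  have Qle e s : sgn s * \sum_(i < m) (lform (comb z e) (tnth x i) ^+ 2 - \sum_l comb z e l ^+ 2) < m%:R * delta.
    by have /negP := nQ (z, (e, s)); rewrite /Q /= -ltNge.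
  pose q e := \sum_(i < m) (lform (comb z e) (tnth x i) ^+ 2 - \sum_l comb z e l ^+ 2).
  have E : ((design_of (white_mx x) A)^T *m design_of (white_mx x) A) z.1 z.2 -
      (A^T *m A) z.1 z.2 / 2 = (q true - q false) / (8 * m%:R).
    rewrite /design_of trmxZ_mulmxZ mxE -expr2 exprVn sqr_sqrtr//.
    have -> : q true - q false = 4 * (((white_mx x *m A)^T *m (white_mx x *m A)) z.1 z.2 - m%:R * (A^T *m A) z.1 z.2).
      rewrite /q -sumrB !combE.
      have L e i : lform (comb z e) (tnth x i) = (white_mx x *m A) i z.1 + sgn e * (white_mx x *m A) i z.2.
        rewrite -!lform_white_mx /lform mulr_sumr -big_split; apply: eq_bigr => l _.
        by rewrite /comb /=; ring.
      under eq_bigr do rewrite !L /sgn.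
      rewrite mulrBr [in RHS]mxE mulr_sumr.
      have -> : 4 * (m%:R * (A^T *m A) z.1 z.2) = \sum_(i < m) (4 * (A^T *m A) z.1 z.2).
        by rewrite sumr_const card_ord -[in RHS]mulr_natl; ring.
      rewrite -sumrB; apply: eq_bigr => i _; rewrite [(white_mx x *m A)^T _ _]mxE.
      by move: ((white_mx x *m A) i _) ((white_mx x *m A) i _) ((A^T *m A) _ _) ((A^T *m A) _ _) ((A^T *m A) _ _); intros; ring.
    rewrite natrD; move: mR; move: (m%:R : R) (_ z.1 z.2) ((A^T *m A) z.1 z.2) => a b g a0.
    by field; rewrite ?(gt_eqF a0) ?(gt_eqF (addr_gt0 a0 a0)).
  move: dz; rewrite E; apply/negP; rewrite -leNgt.
  rewrite ler_norml ler_pdivlMr ?mulr_gt0// ler_pdivrMr ?mulr_gt0//.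
  have := Qle true true; have := Qle true false; have := Qle false true; have := Qle false false.
  rewrite /sgn -/(q true) -/(q false); have := mulr_gt0 mR d0; lra.
- move=> w; apply: prodN_gram_deviation => //.
  + by rewrite mulr_gt0.
  + by rewrite (ltW d0).
  + by rewrite /sgn; case: ifP => _; rewrite ?normrN normr1.
Qed.

End GaussianDesign.

Section GramConditioning.
Context {R : realType}.

Lemma quadform_le_norm1 k (D : 'M[R]_k) (delta : R) (b : 'cV[R]_k) :
  (forall i j, `|D i j| <= delta) -> `|dot b (D *m b)| <= delta * norm1 b ^+ 2.
Proof.
move=> Dd; rewrite dotE; apply: (le_trans (ler_norm_sum _ _ _)).
rewrite [leRHS](_ : _ = norm1 b * (delta * norm1 b)); last by ring.
rewrite {1}/norm1 mulr_suml; apply: ler_sum => i _.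
rewrite normrM mxE.
rewrite ler_wpM2l//; apply: (le_trans (ler_norm_sum _ _ _)).
by rewrite /norm1 mulr_sumr; apply: ler_sum => j _; rewrite normrM ler_wpM2r.
Qed.

Lemma norm1_supported k (M : {set 'I_k}) (b : 'cV[R]_k) : supported M b ->
  norm1 b ^+ 2 <= #|M|%:R * dot b b.
Proof.
move=> sb; have -> : norm1 b = \sum_(i in M) `|b i 0|.
  rewrite /norm1 [RHS]big_mkcond; apply: eq_bigr => i _.
  by case: ifPn => // /sb ->; rewrite normr0.
rewrite dotvv -[X in X * _]sqr_sqrtr ?ler0n// -exprMn ler_pXn2r ?nnegrE//.
- exact: sum_norm_le_sqrt_card.
- by apply: sumr_ge0.
- by rewrite mulr_ge0 ?norm2_ge0.
Qed.

(** An entrywise error delta changes the form by at most delta |b|_1^2 <= delta #|M| |b|^2 <= (c /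
    4) |b|^2. The main term is |A b|^2 / 2, between (c / 2) |b|^2 and (C / 2) |b|^2, so c / 4 and C
    remain. *)
Lemma gram_well_conditioned m k (M : {set 'I_k}) (c C delta : R) (A : 'M[R]_k)
    (H : 'M[R]_(m, k)) :
  0 < c -> c <= C -> 0 <= delta ->
  (forall b, c * dot b b <= dot (A *m b) (A *m b) <= C * dot b b) ->
  delta * #|M|%:R <= c / 4 -> gram_close delta A H -> well_conditioned M (c / 4) C H.
Proof.
move=> c0 cC d0 AC dM G b sb.
pose D := H^T *m H - 2^-1 *: (A^T *m A).
have bb := dotvv_ge0 b.
have DE : dot b (D *m b) = dot (H *m b) (H *m b) - 2^-1 * dot (A *m b) (A *m b).
  by rewrite /D mulmxBl dotBr -scalemxAl dotZr -!mulmxA !dot_mulmxr !trmxK.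
have : `|dot b (D *m b)| <= c / 4 * dot b b.
  apply: (le_trans (@quadform_le_norm1 _ _ delta _ _)) => [i j|].
    by have := G (i, j); rewrite /D !mxE /= mulrC.
  apply: (le_trans (ler_wpM2l d0 (norm1_supported sb))).
  by rewrite mulrA ler_wpM2r.
rewrite DE ler_norml; have /andP[h1 h2] := AC b; move: h1 h2.
move: (dot (A *m b) _) (dot (H *m b) _) (dot b b) bb => x y z z0 h1 h2 /andP[h3 h4].
have : c * z <= C * z by rewrite ler_wpM2r.
by move=> h5; apply/andP; split; lra.
Qed.

End GramConditioning.

(** * Deviation of the pure-noise iterates *)

Section NullLassoDeviation.
Context {R : realType}.
Notation GR := (measurableTypeR R).
Variables (m k : nat) (M : {set 'I_k}) (A : 'M[R]_k) (c C delta t E : R) (e : 'cV[R]_m) (N : nat).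
Hypothesis m0 : (0 < m)%N.
Hypothesis c0 : 0 < c.
Hypothesis cC : c <= C.
Hypothesis AC : forall b, c * dot b b <= dot (A *m b) (A *m b) <= C * dot b b.
Hypothesis d0 : 0 < delta.
Hypothesis dM : delta * #|M|%:R <= c / 4.
Hypothesis dC : delta <= 4 * C.
Hypothesis t0 : 0 <= t.
Hypothesis E0 : 0 < E.
Hypothesis eE : norm2 e <= E.

Let C0 : 0 < C. Proof. exact: lt_le_trans cC. Qed.
Let n : R := (m + m)%:R.
Let n0 : 0 < n. Proof. by rewrite ltr0n addn_gt0 m0. Qed.

(* Lasso iterates for the response [e] alone, without signal.  They are odd in [V],
   so that they concentrate around [0]. *)
Definition null_iterate (V : 'M[R]_(m, k)) := ista_iter M C^-1 t (design_of V A) e N.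

(** [ista_iter_lipschitz] with |e| <= E, for designs at distance at most sqrt(C / n) times the
    distance of their white factors. *)
Definition null_lipschitz : R :=
  3 * (Num.sqrt C / Num.sqrt n) * E / (C * (1 - ista_rate (c / 4) C) ^+ 2).

Let c40 : 0 < c / 4. Proof. by rewrite divr_gt0. Qed.
Let c4C : c / 4 <= C. Proof. by apply: le_trans cC; rewrite ler_pdivrMr// ler_peMr ?(ltW c0)//; lra. Qed.

Let r1 : 0 < 1 - ista_rate (c / 4) C.
Proof. by rewrite subr_gt0 ista_rate_lt1. Qed.

Let L0 : 0 < null_lipschitz.
Proof.
rewrite /null_lipschitz divr_gt0// ?mulr_gt0 ?exprn_gt0// ?divr_gt0 ?sqrtr_gt0//.
by rewrite invr_gt0 sqrtr_gt0.
Qed.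

(** By oddness the sum is a difference of iterates for the designs of x and - y; the negated design
    has the same Gram matrix, so both are well conditioned. *)
Let null_odd (x y : m.-tuple (k.-tuple GR)) j (s : R) : `|s| = 1 ->
  gram_close delta A (design_of (white_mx x) A) ->
  gram_close delta A (design_of (white_mx y) A) ->
  s * null_iterate (white_mx x) j 0 + s * null_iterate (white_mx y) j 0 <=
  null_lipschitz * Num.sqrt (\sum_(i < m) \sum_(l < k)
       (tnth (tnth x i) l + tnth (tnth y i) l) ^+ 2).
Proof.
move=> s1 Gx Gy.
set F := Num.sqrt (\sum_(i < m) _).
pose ell := Num.sqrt C / Num.sqrt n * F.
have ell0 : 0 <= ell by rewrite mulr_ge0 ?sqrtr_ge0// divr_ge0 ?sqrtr_ge0.
have wcx := gram_well_conditioned c0 cC (ltW d0) AC dM Gx.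
have wcy : well_conditioned M (c / 4) C (- design_of (white_mx y) A).
  move=> b sb; rewrite mulNmx dotNl dotNr opprK.
  exact: (gram_well_conditioned c0 cC (ltW d0) AC dM Gy).
have hell v : norm2 ((design_of (white_mx x) A - - design_of (white_mx y) A) *m v) <= ell * norm2 v.
  rewrite opprK /design_of -scalerDr -mulmxDl -scalemxAl norm2Z -mulmxA.
  rewrite ger0_norm ?invr_ge0 ?sqrtr_ge0//.
  have -> : ell * norm2 v = (Num.sqrt n)^-1 * (F * (Num.sqrt C * norm2 v)) by rewrite /ell; ring.
  rewrite ler_wpM2l ?invr_ge0 ?sqrtr_ge0//.
  apply: (le_trans (norm2_mulmx_frob _ _)).
  have -> : Num.sqrt (frob (white_mx x + white_mx y)) = F.
    by congr Num.sqrt; apply: eq_bigr => i _; apply: eq_bigr => l _; rewrite !mxE.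
  rewrite ler_wpM2l ?sqrtr_ge0// ler_norm2_dotvv ?mulr_ge0 ?sqrtr_ge0//.
  by rewrite exprMn sqr_sqrtr ?(ltW C0)// -dotvv; have /andP[] := AC v.
have := ista_iter_lipschitz c40 c4C t0 e N wcx wcy ell0 hell.
rewrite ista_iter_oddH opprK -/(null_iterate _) -/(null_iterate _) => H.
have -> : s * null_iterate (white_mx x) j 0 + s * null_iterate (white_mx y) j 0 =
    s * (null_iterate (white_mx x) + null_iterate (white_mx y)) j 0.
  by rewrite [in RHS]mxE mulrDr.
apply: (le_trans (ler_norm _)); rewrite normrM s1 mul1r.
apply: le_trans (le_trans _ H) _; last first.
  have -> : null_lipschitz * F = 3 * ell * E / (C * (1 - ista_rate (c / 4) C) ^+ 2).
    by rewrite /null_lipschitz /ell; ring.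
  rewrite ler_wpM2r ?invr_ge0 ?mulr_ge0 ?sqr_ge0 ?(ltW C0) ?(ltW r1)//.
  by rewrite ler_wpM2l// mulr_ge0.
rewrite -[leLHS]ger0_norm// -sqrtr_sqr /norm2 ler_wsqrtr// real_normK ?num_real//.
by rewrite (bigD1 j)//= lerDl sumr_ge0// => i _; exact: sqr_ge0.
Qed.

Lemma random_null_iterate : random_mx (fun x : m.-tuple (k.-tuple GR) => null_iterate (white_mx x)).
Proof.
apply: random_mx_ista_iter; last exact: random_mx_cst.
  by move=> i; case: (boolP (i \in M)) => iM; [rewrite (_ : [set _ | _] = setT)//|rewrite (_ : [set _ | _] = set0)//];
   apply/seteqP; split => //= x; rewrite ?iM// (negbTE iM).
apply: random_mxZ => //; apply: random_mx_mul; [exact: random_white_mx|exact: random_mx_cst].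
Qed.

Lemma null_iterate_deviation (r : R) : 0 <= r ->
  (white_law (R := R) m k [set x | gram_close delta A (design_of (white_mx x) A) /\
      exists j, (r <= `|null_iterate (white_mx x) j 0|)%R] <=
   ((k * 2)%:R * expR (- (r ^+ 2 / (2 * null_lipschitz ^+ 2))))%:E)%E.
Proof.
move=> r0.
pose D := [set x : m.-tuple (k.-tuple GR) | gram_close delta A (design_of (white_mx x) A)].
have mD : measurable D.
  apply: measurable_gram_close; first exact: random_mx_cst.
  by apply: random_mxZ => //; apply: random_mx_mul; [exact: random_white_mx|exact: random_mx_cst].
pose s (b : bool) : R := if b then 1 else -1.
have s1 b : `|s b| = 1 by rewrite /s; case: b; rewrite ?normrN normr1.
pose f (w : 'I_k * bool) (x : m.-tuple (k.-tuple GR)) := s w.2 * null_iterate (white_mx x) w.1 0.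
have mf w : measurable_fun setT (f w).
  by apply: measurable_funM => //; exact: random_null_iterate.
have <- : #|{: 'I_k * bool}| = (k * 2)%N by rewrite card_prod card_ord card_bool.
apply: (union_bound (A := fun w => D `&` [set x | r <= f w x])).
- apply: measurableI => //; apply: (measurable_exists (A := fun j x => r <= `|null_iterate (white_mx x) j 0|)) => j.
  by apply: measurable_set_le => //; apply: measurableT_comp => //; exact: random_null_iterate.
- by move=> w; apply: measurableI => //; exact: measurable_set_le.
- move=> x [Dx [j]]; have [u0|u0] := leP 0 (null_iterate (white_mx x) j 0).
    by move=> rj; exists (j, true); split=> //=; rewrite /f /s mul1r -[leRHS]ger0_norm.
  by move=> rj; exists (j, false); split=> //=; rewrite /f /s mulN1r -ltr0_norm.
- move=> w; apply: prodN_odd_lipschitz_deviation => //.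
  by move=> x y Dx Dy; exact: null_odd.
Qed.

End NullLassoDeviation.

(** * Independence of the two folds *)

Section IndependenceGenerated.
Context {R : realType} {d : measure_display} {T : measurableType d}.
Variable P : probability T R.
Local Open Scope ereal_scope.

(** Dynkin's argument on one side only, the other event being fixed. *)
Lemma indep_generated (G : set (set T)) (B : set T) (c : R) :
  setI_closed G -> G `<=` measurable -> measurable B -> P B = c%:E ->
  (forall H, G H -> P (H `&` B) = P H * c%:E) ->
  forall A, <<s G >> A -> P (A `&` B) = P A * c%:E.
Proof.
move=> GI GM mB PB GB A.
have fP X : measurable X -> P X \is a fin_num by move=> mX; exact: fin_num_measure.
rewrite -(setI_closed_g_dynkin_g_sigma_algebra GI).
move=> /(_ [set A | measurable A /\ P (A `&` B) = P A * c%:E])[]//; split; last first.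
  by move=> H GH; split; [exact: GM|exact: GB].
split=> [|X [mX XB]|F tF FB].
- by split=> //; rewrite setTI probability_setT mul1e.
- split; first exact: measurableC.
  have -> : ~` X `&` B = B `\` X by rewrite setDE setIC.
  have -> : P (B `\` X) = P B - P (X `&` B).
    by rewrite [X `&` B]setIC; apply: measureD => //; rewrite -ge0_fin_numE// fP.
  rewrite XB PB probability_setC// -(fineK (fP _ mX)) -EFinM -!EFinB -EFinM.
  by rewrite mulrBl mul1r.
- have mF n : measurable (F n) by have [] := FB n.
  have mU : measurable (\bigcup_n F n) by exact: bigcup_measurable.
  split=> //; rewrite setI_bigcupl !measure_bigcup//.
  + have c0 : (0 <= c)%R by rewrite -lee_fin -PB measure_ge0.
    rewrite muleC -nneseriesZl//.
    by apply: eq_eseriesr => n _; rewrite muleC; have [] := FB n.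
  + by move=> n _; apply: measurableI.
  + exact: trivIset_setIr.
Qed.

End IndependenceGenerated.

Section RestrictedProduct.
Context {R : realType} {d d1 d2 : measure_display} {T : measurableType d}
  {T1 : measurableType d1} {T2 : measurableType d2}.
Variables (P : probability T R) (Q : probability T2 R) (f : T -> T1) (g : T -> T2).
Hypothesis mf : measurable_fun setT f.
Hypothesis mg : measurable_fun setT g.
Hypothesis fg : forall A B, measurable A -> measurable B ->
  P (f @^-1` A `&` g @^-1` B) = (P (f @^-1` A) * Q B)%E.

(* Conditionally on [f] the variable [g] still has law [Q]. *)
Lemma indep_conditional_bound (A : set T1) (S : set (T1 * T2)) (eta : R) :
  (0 <= eta)%R -> measurable A -> measurable S ->
  (forall x, A x -> (Q (xsection S x) <= eta%:E)%E) ->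
  (P (f @^-1` A `&` [set w | S (f w, g w)]) <= eta%:E * P (f @^-1` A))%E.
Proof.
move=> eta0 mA mS Seta.
have mpair : measurable_fun setT (fun w => (f w, g w)) by exact: measurable_fun_pair.
have fP X : measurable X -> measurable (f @^-1` X).
  by move=> mX; rewrite -[X in measurable X]setTI; exact: mf.
pose m1 := @image_measure _ _ _ _ _ P _ mf.
have m1T : (m1 setT < +oo)%E.
  by rewrite /m1 /image_measure /pushforward preimage_setT (le_lt_trans (probability_le1 _ _)) ?ltry.
pose Pf := finite_measure_of m1T.
have PE X : measurable X -> P ((fun w => (f w, g w)) @^-1` X) = (Pf \x Q)%E X.
  move=> mX; rewrite (@product_measure_unique _ _ T1 T2 R Pf Q (image_measure P mpair))// .
have mAS : measurable ((A `*` setT) `&` S) by apply: measurableI => //; exact: measurableX.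
have -> : f @^-1` A `&` [set w | S (f w, g w)] = (fun w => (f w, g w)) @^-1` ((A `*` setT) `&` S).
  by apply/seteqP; split => w /=; tauto.
rewrite PE// /product_measure1.
apply: (@le_trans _ _ (\int[Pf]_x (eta%:E * (\1_A x)%:E))%E).
  apply: ge0_le_integral => //.
  - exact: (measurable_fun_xsection Q).
  - by apply/measurable_EFinP; apply: measurable_funM => //; exact: measurable_indic.
  - move=> x _; rewrite /= indicE; case: (boolP (x \in A)) => [|xA].
      rewrite inE mule1 => Ax; apply: le_trans (Seta x Ax).
      apply: le_measure; rewrite ?inE; [exact: measurable_xsection|exact: measurable_xsection|].
      by move=> y; rewrite /xsection/= !inE => -[].
    rewrite mule0 (_ : xsection _ x = set0) ?measure0//; apply/seteqP; split=> // y.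
    by rewrite /xsection/= inE => -[[/= Ax _] _]; move: xA; rewrite notin_setE.
rewrite ge0_integralZl//; last by apply/measurable_EFinP; exact: measurable_indic.
by rewrite integral_indic// setIT.
Qed.

End RestrictedProduct.

Section SubSigmaAlgebras.
Context {R : realType} {d : measure_display} {T : measurableType d}.

(** The generating family of [sigma_mx], named so that [g_sigma_algebraType] turns measurability
    with respect to X into ordinary measurability. *)
Definition mx_base m n (X : T -> 'M[R]_(m, n)) : set (set T) :=
  [set A | exists i j, exists2 B : set R,
         measurable B & A = (fun w => X w i j) @^-1` B].

Lemma measurable_id_sub (G : set (set T)) : G `<=` measurable ->
  measurable_fun setT (id : T -> g_sigma_algebraType G).
Proof.
move=> GM _ A mA; rewrite setTI.
by apply: mA; split=> //; exact: sigma_algebra_measurable.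
Qed.

Lemma measurable_sub_type (G : set (set T)) (A : set T) : G `<=` measurable ->
  <<s G >> A -> measurable A.
Proof. by move=> GM; apply; split=> //; exact: sigma_algebra_measurable. Qed.

Lemma mx_base_measurable m n (X : T -> 'M[R]_(m, n)) : random_mx X ->
  mx_base X `<=` measurable.
Proof. by move=> mX _ [i [j [B mB ->]]]; rewrite -[X in measurable X]setTI; exact: mX. Qed.

Lemma random_mx_sub (G : set (set T)) m n (X : T -> 'M[R]_(m, n)) :
  mx_base X `<=` <<s G >> -> random_mx (X : g_sigma_algebraType G -> 'M[R]_(m, n)).
Proof. by move=> XG i j _ B mB; rewrite setTI; apply: XG; exists i, j, B. Qed.

Lemma random_mx_self m n (X : T -> 'M[R]_(m, n)) :
  random_mx (X : g_sigma_algebraType (mx_base X) -> 'M[R]_(m, n)).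
Proof. by apply: random_mx_sub; exact: sub_sigma_algebra. Qed.

Lemma sigma_mx_measurable m n (X : T -> 'M[R]_(m, n)) A : random_mx X ->
  sigma_mx X A -> measurable A.
Proof. by move=> mX; apply: measurable_sub_type; exact: mx_base_measurable. Qed.

Lemma sigma_mx_sub m n m' n' (X : T -> 'M[R]_(m, n)) (Y : T -> 'M[R]_(m', n')) :
  random_mx (Y : g_sigma_algebraType (mx_base X) -> 'M[R]_(m', n')) ->
  sigma_mx Y `<=` sigma_mx X.
Proof.
move=> mY; apply: smallest_sub; first exact: smallest_sigma_algebra.
by move=> _ [i [j [B mB ->]]]; have := mY i j measurableT B mB; rewrite setTI.
Qed.

End SubSigmaAlgebras.

Section TupleOfMatrix.
Context {R : realType}.
Notation GR := (measurableTypeR R).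

Definition tuple_of_mx m k (V : 'M[R]_(m, k)) : m.-tuple (k.-tuple GR) :=
  [tuple [tuple V i l | l < k] | i < m].

Lemma tnth_tuple_of_mx m k (V : 'M[R]_(m, k)) i l :
  tnth (tnth (tuple_of_mx V) i) l = V i l.
Proof. by rewrite !tnth_mktuple. Qed.

Lemma tuple_of_mxK m k (V : 'M[R]_(m, k)) : white_mx (tuple_of_mx V) = V.
Proof. by apply/matrixP => i l; rewrite mxE tnth_tuple_of_mx. Qed.

Lemma measurable_tuple_of_mx d (T : measurableType d) m k (V : T -> 'M[R]_(m, k)) :
  random_mx V -> measurable_fun setT (fun w => tuple_of_mx (V w)).
Proof.
move=> mV; apply/measurable_fun_tnthP => i; apply/measurable_fun_tnthP => l.
rewrite (_ : _ \o _ = fun w => V w i l); first exact: mV.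
by apply/funext => w /=; rewrite tnth_tuple_of_mx.
Qed.

End TupleOfMatrix.

Section WhiteRow.
Context {R : realType} {d : measure_display} {T : measurableType d}.
Variable P : probability T R.
Local Open Scope ereal_scope.

(** A linear form u of x W is the form W u of x, with variance |u|^2; invertibility of W keeps W u
    nonzero, where the normality hypothesis speaks. *)
Lemma centered_normal_white p (Sigma W : 'M[R]_p) (x : T -> 'rV[R]_p) (I : 'I_p -> set R) :
  random_mx x -> W \in unitmx -> W^T *m Sigma *m W = 1%:M ->
  centered_normal P Sigma x -> (forall l, measurable (I l)) ->
  P [set w | forall l, I l ((x w *m W)%R 0%R l)] = \prod_(l < p) normal_prob 0 1 (I l).
Proof.
move=> mx Wu WS Nx mI; apply: (white_independent (xi := fun l w => (x w *m W)%R 0%R l)) => //.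
  by move=> l; apply: random_mx_mul => //; exact: random_mx_cst.
move=> u u0 B mB; pose v : 'cV[R]_p := \col_l u l.
have v0 : v != 0%R.
  apply: contra_neq u0 => v0; apply/funext => l.
  by have := congr1 (fun M : 'cV[R]_p => M l 0%R) v0; rewrite !mxE.
have Wv0 : (W *m v)%R != 0%R.
  by apply: contra_neq v0 => Wv; rewrite -[v](mulKmx Wu) Wv mulmx0.
have := Nx _ Wv0 B mB.
have -> : ((W *m v)^T *m Sigma *m (W *m v))%R 0%R 0%R = (\sum_l u l ^+ 2)%R.
  rewrite quadform_dot dot_mulmxl !mulmxA WS mul1mx dotE.
  by apply: eq_bigr => l _; rewrite !mxE expr2.
move=> <-; congr (P (_ @^-1` B)); apply/funext => w; rewrite mulmxA [RHS]mxE.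
by apply: eq_bigr => l _; rewrite !mxE mulrC.
Qed.

End WhiteRow.

(** * The two folds for a fixed split *)

Section FoldIndependence.
Context {R : realType} {d : measure_display} {T : measurableType d}.
Variable P : probability T R.
Notation GR := (measurableTypeR R).
Notation gam := (normal_prob 0 1 : probability (measurableTypeR R) R).
Variables (m p : nat) (Sigma W : 'M[R]_p).
Variables (X : T -> 'M[R]_(m + m, p)) (eps : T -> 'cV[R]_(m + m))
  (pi : T -> 'S_(m + m)) (Z : T -> 'M[R]_(m, p)).
Hypothesis NX : iid_normal_rows P Sigma X.
Hypothesis NZ : iid_normal_rows P 1%:M Z.
Hypothesis meps : random_mx eps.
Hypothesis mpi : forall sg, measurable [set w | pi w = sg].
Hypothesis indep : independent_seq P [:: sigma_mx X; sigma_mx eps; sigma_fin pi; sigma_mx Z].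
Hypothesis Wu : W \in unitmx.
Hypothesis WS : W^T *m Sigma *m W = 1%:M.
Local Open Scope ereal_scope.

Lemma sigma_fin_measurable A : sigma_fin pi A -> measurable A.
Proof.
move=> [B ->]; rewrite (_ : [set w | pi w \in B] = \bigcup_(s in [set` B]) [set w | pi w = s]).
  by apply: fin_bigcup_measurable => // ; exact: finite_finset.
by apply/seteqP; split=> w /=; [move=> ?; exists (pi w)|move=> [s sB ->]].
Qed.

Lemma sigma_mxT m' n' (Y : T -> 'M[R]_(m', n')) : sigma_mx Y setT.
Proof. exact: (@measurableT _ (g_sigma_algebraType (mx_base Y))). Qed.

Lemma indep4 A B C D : sigma_mx X A -> sigma_mx eps B -> sigma_fin pi C -> sigma_mx Z D ->
  P (A `&` B `&` C `&` D) = P A * P B * P C * P D.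
Proof.
move=> XA eB pC ZD.
pose E : 'I_4 -> set T := fun i => nth set0 [:: A; B; C; D] i.
have := indep (J := [set: 'I_4]%SET) (E := E); rewrite /E.
move=> H; rewrite (_ : A `&` B `&` C `&` D = \bigcap_(i in [set` [set: 'I_4]%SET]) E i).
  rewrite H => [|i _].
    by under eq_bigl do rewrite finset.in_setT; rewrite !big_ord_recl big_ord0 /= mule1 !muleA.
  by case: i => -[|[|[|[|]]]].
apply/seteqP; split=> w /=.
  by move=> [[[? ?] ?] ?] [[|[|[|[|]]]]].
move=> H'; split; [split; [split|]|].
- by apply: (H' (@Ordinal 4 0 isT)); rewrite /= finset.in_setT.
- by apply: (H' (@Ordinal 4 1 isT)); rewrite /= finset.in_setT.
- by apply: (H' (@Ordinal 4 2 isT)); rewrite /= finset.in_setT.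
- by apply: (H' (@Ordinal 4 3 isT)); rewrite /= finset.in_setT.
Qed.

Lemma indep_rows k n (Y : T -> 'M[R]_(k, n)) (E : 'I_k -> set T) :
  mutually_independent P (fun i : 'I_k => sigma_mx (fun w => row i (Y w))) ->
  (forall i, sigma_mx (fun w => row i (Y w)) (E i)) ->
  P [set w | forall i, E i w] = \prod_(i < k) P (E i).
Proof.
move=> iY YE; have := iY [set: 'I_k]%SET E (fun i _ => YE i).
under [RHS]eq_bigl do rewrite finset.in_setT; move=> <-; congr (P _).
by apply/seteqP; split=> w /= H i => [_|]; apply: H; rewrite /= ?finset.in_setT.
Qed.

Definition second_white (sg : 'S_(m + m)) (w : T) : 'M[R]_(m, p + p) :=
  row_mx (fold2 sg (X w) *m W)%R (Z w).

Lemma second_whiteEl sg w i l : second_white sg w i (lshift p l) =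
  (row (sg (rshift m i)) (X w) *m W)%R 0%R l.
Proof.
rewrite /second_white row_mxEl !mxE; apply: eq_bigr => l' _.
by rewrite /fold2 !mxE.
Qed.

Lemma second_whiteEr sg w i l : second_white sg w i (rshift p l) = Z w i l.
Proof. by rewrite /second_white row_mxEr. Qed.

(** For a fixed permutation the two folds use disjoint sets of rows of X, so row independence and
    the independence of X, eps, pi and Z factorize both sides. *)
Lemma fold_white_box (sg : 'S_(m + m)) (C : 'I_m -> set T) A2 A3
    (I : 'I_m -> 'I_(p + p) -> set R) :
  (forall i, sigma_mx (fun w => row (sg (lshift m i)) (X w)) (C i)) ->
  sigma_mx eps A2 -> sigma_fin pi A3 -> (forall i l, measurable (I i l)) ->
  P ([set w | forall i, C i w] `&` A2 `&` A3 `&`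
     [set w | forall i l, I i l (second_white sg w i l)]) =
  P ([set w | forall i, C i w] `&` A2 `&` A3) *
  \prod_(i < m) \prod_(l < p + p) gam (I i l).
Proof.
move=> CX eA pA mI.
have [mX iX nX] := NX; have [mZ iZ nZ] := NZ.
pose D i := [set w | forall l : 'I_p, I i (lshift p l) ((row (sg (rshift m i)) (X w) *m W)%R 0%R l)].
pose F i := [set w | forall l : 'I_p, I i (rshift p l) ((row i (Z w) *m 1%:M)%R 0%R l)].
have box : [set w | forall i l, I i l (second_white sg w i l)] =
    [set w | forall i, D i w] `&` [set w | forall i, F i w].
  apply/seteqP; split=> w /=.
    move=> H; split=> i l; first by rewrite -second_whiteEl.
    by rewrite mulmx1 mxE -(second_whiteEr sg).
  move=> [HD HF] i l; rewrite -(splitK l); case: (fintype.split l) => l' /=.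
    by rewrite second_whiteEl; exact: HD.
  by rewrite second_whiteEr; have := HF i l'; rewrite /= mulmx1 mxE.
have DX i : sigma_mx (fun w => row (sg (rshift m i)) (X w)) (D i).
  apply: (@measurable_forall _ (g_sigma_algebraType (mx_base (fun w => row (sg (rshift m i)) (X w))))) => l.
  have mm : random_mx (fun w : g_sigma_algebraType (mx_base (fun w => row (sg (rshift m i)) (X w))) => row (sg (rshift m i)) (X w) *m W)%R.
    by apply: random_mx_mul; [exact: random_mx_self|exact: random_mx_cst].
  rewrite -[X in measurable X]setTI.
  exact: (mm 0%R l measurableT _ (mI i _)).
have FZ i : sigma_mx (fun w => row i (Z w)) (F i).
  apply: (@measurable_forall _ (g_sigma_algebraType (mx_base (fun w => row i (Z w))))) => l.
  have mm : random_mx (fun w : g_sigma_algebraType (mx_base (fun w => row i (Z w))) => row i (Z w) *m 1%:M)%R.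
    by apply: random_mx_mul; [exact: random_mx_self|exact: random_mx_cst].
  rewrite -[X in measurable X]setTI.
  exact: (mm 0%R l measurableT _ (mI i _)).
have PD i : P (D i) = \prod_(l < p) gam (I i (lshift p l)).
  by apply: (centered_normal_white (x := fun w => row (sg (rshift m i)) (X w)) _ Wu WS (nX _)) => // j l;
    under eq_fun do rewrite mxE; exact: mX.
have PF i : P (F i) = \prod_(l < p) gam (I i (rshift p l)).
  apply: (centered_normal_white (x := fun w => row i (Z w)) _ (unitmx1 _ _) _ (nZ _)) => //.
    by move=> j l; under eq_fun do rewrite mxE; exact: mZ.
  by rewrite trmx1 !mulmx1.
(* One event per row of X, indexed in the original order: a first-fold event or a second-fold event
   according to the position of the row in the split. *)
pose E (D' : 'I_m -> set T) r := match fintype.split (sg^-1%g r) with inl i => C i | inr i => D' i end.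
have rowX r A : sigma_mx (fun w => row r (X w)) A -> sigma_mx X A.
  by apply: sigma_mx_sub => i j; under eq_fun do rewrite mxE; exact: random_mx_self.
have allX (A : 'I_m -> set T) (f : 'I_m -> 'I_(m + m)) :
    (forall i, sigma_mx (fun w => row (f i) (X w)) (A i)) -> sigma_mx X [set w | forall i, A i w].
  move=> XA; apply: (@measurable_forall _ (g_sigma_algebraType (mx_base X))) => i.
  exact: rowX (XA i).
have CD D' : (forall i, sigma_mx (fun w => row (sg (rshift m i)) (X w)) (D' i)) ->
    P ([set w | forall i, C i w] `&` [set w | forall i, D' i w]) =
    \prod_(i < m) P (C i) * \prod_(i < m) P (D' i).
  move=> D'X; have -> : [set w | forall i, C i w] `&` [set w | forall i, D' i w] =
      [set w | forall r, E D' r w].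
    apply/seteqP; split=> w /=.
      by move=> [HC HD] r; rewrite /E; case: (fintype.split _).
    move=> H; split=> i.
      have := H (sg (lshift m i)); rewrite /E permK.
      by rewrite -[lshift m i]/(unsplit (inl i)) unsplitK.
    have := H (sg (rshift m i)); rewrite /E permK.
    by rewrite -[rshift m i]/(unsplit (inr i)) unsplitK.
  rewrite (indep_rows (Y := X))//; last first.
    move=> r; rewrite /E; case: fintype.splitP => i ri.
      have -> : r = sg (lshift m i) by apply: (perm_inj (s := sg^-1%g)); rewrite permK; exact: val_inj.
      exact: CX.
    have -> : r = sg (rshift m i) by apply: (perm_inj (s := sg^-1%g)); rewrite permK; exact: val_inj.
    exact: D'X.
  rewrite (reindex_inj (@perm_inj _ sg)) big_split_ord /=; congr (_ * _).
    apply: eq_bigr => i _; rewrite /E permK.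
    by rewrite -[lshift m i]/(unsplit (inl i)) unsplitK.
  apply: eq_bigr => i _; rewrite /E permK.
  by rewrite -[rshift m i]/(unsplit (inr i)) unsplitK.
set XC := [set w | forall i, C i w]; set XD := [set w | forall i, D i w].
set ZF := [set w | forall i, F i w] in box *.
have ZZF : sigma_mx Z ZF.
  apply: (@measurable_forall _ (g_sigma_algebraType (mx_base Z))) => i.
  by apply: (sigma_mx_sub _ (FZ i)) => i' j; under eq_fun do rewrite mxE; exact: random_mx_self.
have XXC : sigma_mx X XC by exact: allX CX.
have XXD : sigma_mx X XD by exact: allX DX.
have XCT : P XC = \prod_(i < m) P (C i).
  have hT i : sigma_mx (fun w => row (sg (rshift m i)) (X w)) setT by exact: sigma_mxT.
  have := CD (fun=> setT) hT.
  rewrite (_ : [set w | 'I_m -> setT w] = setT); last by apply/seteqP; split.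
  rewrite setIT => ->; rewrite [X in _ * X]big1 ?mule1// => i _; exact: probability_setT.
have -> : P (XC `&` A2 `&` A3) = P XC * P A2 * P A3.
  have ZT : sigma_mx Z setT by exact: sigma_mxT.
  have := indep4 XXC eA pA ZT.
  by rewrite setIT [P setT]probability_setT mule1.
rewrite box; have -> : XC `&` A2 `&` A3 `&` (XD `&` ZF) = (XC `&` XD) `&` A2 `&` A3 `&` ZF.
  by apply/seteqP; split=> w /=; tauto.
rewrite indep4//; last exact: (@measurableI _ (g_sigma_algebraType (mx_base X))).
rewrite CD// XCT (indep_rows (Y := Z))//.
rewrite (eq_bigr _ (fun i _ => PD i)) (eq_bigr _ (fun i _ => PF i)).
have -> : \prod_(i < m) \prod_(l < p + p) gam (I i l) =
    (\prod_(i < m) \prod_(l < p) gam (I i (lshift p l))) *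
    (\prod_(i < m) \prod_(l < p) gam (I i (rshift p l))).
  rewrite -big_split; apply: eq_bigr => i _; by rewrite big_split_ord.
set c1 := \prod_(i < m) P (C i); set c2 := \prod_(i < m) _; set c3 := \prod_(i < m) _.
by rewrite -!muleA; congr (_ * _); rewrite [RHS]muleCA [in RHS]muleCA !muleA [c2 * _]muleC -!muleA; congr (_ * _); rewrite !muleA [c2 * _]muleC.
Qed.

End FoldIndependence.

Section RestrictionToSplit.
Context {R : realType} {d : measure_display} {T : measurableType d}.

Lemma g_sigma_restrict (G base : set (set T)) (F : set T) :
  @measurable _ (g_sigma_algebraType G) F ->
  (forall A, base A -> @measurable _ (g_sigma_algebraType G) (A `&` F)) ->
  forall A, <<s base >> A -> @measurable _ (g_sigma_algebraType G) (A `&` F).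
Proof.
move=> mF Hbase A; apply: (@smallest_sub _ (sigma_algebra setT) base
  [set A | @measurable _ (g_sigma_algebraType G) (A `&` F)]) => //.
split=> [|A' /= mA|Fn mFn /=].
- by rewrite /= set0I; exact: measurable0.
- rewrite (_ : _ `&` _ = F `\` (A' `&` F)); first exact: measurableD.
  by apply/seteqP; split=> w /=; tauto.
- rewrite setI_bigcupl; apply: (@bigcup_measurable _ (g_sigma_algebraType G)) => k _.
  exact: mFn.
Qed.

(** On the event pi = sg the randomly chosen fold is a deterministic selection of rows, so its
    events have a trace generated by these rows alone. *)
Lemma fold1_restrict m p (beta : 'cV[R]_p) (X : T -> 'M[R]_(m + m, p))
    (eps : T -> 'cV[R]_(m + m)) (pi : T -> 'S_(m + m)) (G : set (set T)) sg A :
  @measurable _ (g_sigma_algebraType G) [set w | pi w = sg] ->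
  random_mx ((fun w => fold1 sg (X w)) : g_sigma_algebraType G -> _) ->
  random_mx ((fun w => fold1 sg (eps w)) : g_sigma_algebraType G -> _) ->
  sigma_mx (fun w => fold1 (pi w) (row_mx (X w) (X w *m beta + eps w))) A ->
  @measurable _ (g_sigma_algebraType G) (A `&` [set w | pi w = sg]).
Proof.
move=> mF mX meps; apply: g_sigma_restrict => // _ [i [j [B mB ->]]] /=.
have mY : random_mx ((fun w => row_mx (fold1 sg (X w)) (fold1 sg (X w) *m beta + fold1 sg (eps w))) : g_sigma_algebraType G -> _).
  by apply: random_mx_row => //; apply: random_mxD => //; apply: random_mx_mul => //; exact: random_mx_cst.
rewrite (_ : _ `&` _ = (fun w => row_mx (fold1 sg (X w)) (fold1 sg (X w) *m beta + fold1 sg (eps w)) i j) @^-1` B `&` [set w | pi w = sg]).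
  apply: measurableI => //; rewrite -[X in measurable X]setTI; exact: (mY i j measurableT _ mB).
have E w : row_mx (fold1 sg (X w)) (fold1 sg (X w) *m beta + fold1 sg (eps w)) =
   fold1 sg (row_mx (X w) (X w *m beta + eps w)).
  apply/matrixP => i' j'; rewrite [RHS]mxE; rewrite -(splitK j'); case: (fintype.split j') => l /=.
    by rewrite !row_mxEl mxE.
  by rewrite !row_mxEr !mxE; congr (_ + _); apply: eq_bigr => l' _; rewrite mxE.
by apply/seteqP; split=> w /= [H ws]; split=> //; move: H; rewrite E ws.
Qed.

Lemma fold1_base_measurable m p (beta : 'cV[R]_p) (X : T -> 'M[R]_(m + m, p))
    (eps : T -> 'cV[R]_(m + m)) (pi : T -> 'S_(m + m)) :
  random_mx X -> random_mx eps -> (forall sg, measurable [set w | pi w = sg]) ->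
  mx_base (fun w => fold1 (pi w) (row_mx (X w) (X w *m beta + eps w))) `<=` measurable.
Proof.
move=> mX meps mpi _ [i [j [B mB ->]]].
rewrite (_ : _ @^-1` B = \bigcup_(s in [set` [set: 'S_(m + m)]%SET])
   ((fun w => fold1 s (row_mx (X w) (X w *m beta + eps w)) i j) @^-1` B `&` [set w | pi w = s])).
  apply: fin_bigcup_measurable => [|s _]; first exact: finite_finset.
  apply: measurableI => //; rewrite -[X in measurable X]setTI.
  under eq_fun do rewrite mxE.
  have mY : random_mx (fun w => row_mx (X w) (X w *m beta + eps w)).
    by apply: random_mx_row => //; apply: random_mxD => //; apply: random_mx_mul => //; exact: random_mx_cst.
  exact: (mY _ _ measurableT _ mB).
by apply/seteqP; split=> w /=; [move=> ?; exists (pi w); rewrite /= ?finset.in_setT|by move=> [s _] [H ws]; move: H; rewrite -ws].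
Qed.

Lemma sigma_mxI k n (Y : T -> 'M[R]_(k, n)) A B :
  sigma_mx Y A -> sigma_mx Y B -> sigma_mx Y (A `&` B).
Proof. exact: (@measurableI _ (g_sigma_algebraType (mx_base Y))). Qed.

Lemma sigma_finI (F : finType) (pi : T -> F) A B :
  sigma_fin pi A -> sigma_fin pi B -> sigma_fin pi (A `&` B).
Proof.
move=> [A' ->] [B' ->]; exists (A' :&: B')%SET; apply/seteqP; split=> w /=; rewrite finset.in_setI.
  by move=> [-> ->].
by move=> /andP[].
Qed.

Lemma sigma_finT (F : finType) (pi : T -> F) : sigma_fin pi setT.
Proof. by exists [set: _]%SET; apply/seteqP; split=> w //= _; rewrite finset.in_setT. Qed.

Lemma measure_split_fin (P : {measure set T -> \bar R}) (F : finType) (pi : T -> F) S :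
  (forall x, measurable [set w | pi w = x]) -> measurable S ->
  (P S = \sum_(x : F) P (S `&` [set w | pi w = x]))%E.
Proof.
move=> mpi mS; rewrite -[in LHS](setIT S).
have -> : S `&` setT = \big[setU/set0]_(s : F) (S `&` [set w | pi w = s]).
  rewrite -bigcup_seq; apply/seteqP; split=> w /=; last by move=> [s _ []].
  by move=> [Sw _]; exists (pi w) => //=; rewrite mem_index_enum.
have : forall r : seq F, uniq r ->
    (P (\big[setU/set0]_(s <- r) (S `&` [set w | pi w = s])) =
    \sum_(s <- r) P (S `&` [set w | pi w = s]))%E.
  elim=> [|s r IH] /=; first by rewrite !big_nil measure0.
  move=> /andP[sr ur]; rewrite !big_cons -IH//; apply: measureU.
  - exact: measurableI.
  - by apply: bigsetU_measurable => s' _; exact: measurableI.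
  - apply/seteqP; split=> w //=; rewrite -bigcup_seq => -[[_ ws] [s' /= s'r [_ ws']]].
    by move: sr; rewrite -ws ws' s'r.
by apply; exact: index_enum_uniq.
Qed.

End RestrictionToSplit.

(** * The two folds for the random split *)

Section FirstSecondFold.
Context {R : realType} {d : measure_display} {T : measurableType d}.
Variable P : probability T R.
Notation GR := (measurableTypeR R).
Notation gam := (normal_prob 0 1 : probability (measurableTypeR R) R).
Variables (m p : nat) (Sigma W : 'M[R]_p) (beta : 'cV[R]_p).
Variables (X : T -> 'M[R]_(m + m, p)) (eps : T -> 'cV[R]_(m + m))
  (pi : T -> 'S_(m + m)) (Z : T -> 'M[R]_(m, p)).
Hypothesis NX : iid_normal_rows P Sigma X.
Hypothesis NZ : iid_normal_rows P 1%:M Z.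
Hypothesis meps : random_mx eps.
Hypothesis mpi : forall sg, measurable [set w | pi w = sg].
Hypothesis indep : independent_seq P [:: sigma_mx X; sigma_mx eps; sigma_fin pi; sigma_mx Z].
Hypothesis Wu : W \in unitmx.
Hypothesis WS : W^T *m Sigma *m W = 1%:M.
Local Open Scope ereal_scope.

Let mX : random_mx X. Proof. by case: NX. Qed.
Let mZ : random_mx Z. Proof. by case: NZ. Qed.

(** A pi-system for a fixed split: first-fold rows of X, the whole noise, and the split itself. The
    whole noise is included because the design deviation is taken with the noise frozen. *)
Definition fold_base (sg : 'S_(m + m)) : set (set T) :=
  [set H | exists C A2 A3, [/\ forall i : 'I_m, sigma_mx (fun w => row (sg (lshift m i)) (X w)) (C i),
     sigma_mx eps A2, sigma_fin pi A3 &
     H = [set w | forall i, C i w] `&` A2 `&` A3] ].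

Let row_measurable i A : sigma_mx (fun w => row i (X w)) A -> measurable A.
Proof. by apply: sigma_mx_measurable => j l; under eq_fun do rewrite mxE; exact: mX. Qed.

Let base_measurable sg : fold_base sg `<=` measurable.
Proof.
move=> _ [C [A2 [A3 [CX eA pA ->]]]]; apply: measurableI; first apply: measurableI.
- by apply: measurable_forall => i; exact: row_measurable (CX i).
- exact: sigma_mx_measurable eA.
- exact: sigma_fin_measurable pA.
Qed.

Let base_setI sg : setI_closed (fold_base sg).
Proof.
move=> _ _ [C [A2 [A3 [CX eA pA ->]]]] [C' [A2' [A3' [CX' eA' pA' ->]]]].
exists (fun i => C i `&` C' i), (A2 `&` A2'), (A3 `&` A3'); split.
- by move=> i; exact: sigma_mxI.
- exact: sigma_mxI.
- exact: sigma_finI.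
apply/seteqP; split=> w /=; first by move=> [[[? ?] ?] [[? ?] ?]].
move=> [[CC [? ?]] [? ?]].
by split; split=> //; split=> // i; have [] := CC i.
Qed.

Let mwhite sg : random_mx (second_white W X Z sg).
Proof.
apply: random_mx_row => //; apply: random_mx_mul; last exact: random_mx_cst.
by move=> i j; under eq_fun do rewrite mxE; exact: mX.
Qed.

Let xi sg w := tuple_of_mx (second_white W X Z sg w).

Let mxi sg : measurable_fun setT (xi sg).
Proof. exact: measurable_tuple_of_mx. Qed.

Let pre_xi sg B : measurable B -> measurable (xi sg @^-1` B).
Proof. by move=> mB; rewrite -[X in measurable X]setTI; exact: mxi. Qed.

(** The law of [xi sg] restricted to [H] and P(H) times the white law agree on boxes of boxes;
    [prodN_unique] extends this to all measurable sets. *)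
Lemma fold_base_indep sg H B : fold_base sg H -> measurable B ->
  P (H `&` xi sg @^-1` B) = P H * white_law m (p + p) B.
Proof.
move=> bH mB; have mH := base_measurable bH.
pose mu := @image_measure _ _ _ _ _ (mrestr P mH) _ (mxi sg).
have -> : P (H `&` xi sg @^-1` B) = mu B.
  by rewrite /mu /image_measure /pushforward /mrestr/= setIC.
have fPH : P H \is a fin_num by exact: fin_num_measure.
rewrite -(fineK fPH).
have mGR : @measurable _ GR = <<s @measurable _ GR >>.
  by rewrite sigma_algebra_id//; exact: sigma_algebra_measurable.
apply: (@prodN_unique R _ _ (prodN gam (p + p)) m (boxes (@measurable _ GR) (n:=(p + p)%N)) (fine (P H))
  (@image_measure _ _ _ _ _ (mrestr P mH) _ (mxi sg))) => //.
- exact: boxesT.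
- by apply: setI_closed_boxes => A' B'; exact: measurableI.
- exact: measurable_boxes.
- exact: fine_ge0.
move=> E bE.
have /choice[I HI] : forall i, exists I, (forall l, @measurable _ GR (I l)) /\
    E i = [set t | forall l, I l (tnth t l)].
  by move=> i; have [I mI EI] := bE i; exists I.
have mI i l : measurable (I i l) by have [] := HI i.
have EI i : E i = [set t | forall l, I i l (tnth t l)] by have [] := HI i.
under [in RHS]eq_bigr do rewrite EI prodN_box//.
rewrite (fineK fPH) /image_measure /pushforward /mrestr/=.
transitivity (P (H `&` xi sg @^-1` [set t | forall i, E i (tnth t i)])); first by rewrite setIC.
case: (bH) => C [A2 [A3 [CX eA pA HE]]].
rewrite HE -(fold_white_box NX NZ indep Wu WS CX eA pA mI); congr (P (_ `&` _)).
apply/seteqP; split=> w /= H' i; last first.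
  by rewrite EI /= => l; rewrite tnth_tuple_of_mx.
by move=> l; have := H' i; rewrite EI => /(_ l); rewrite tnth_tuple_of_mx.
Qed.

Lemma fold_sigma_indep sg A B : <<s fold_base sg >> A -> measurable B ->
  P (A `&` xi sg @^-1` B) = P A * white_law m (p + p) B.
Proof.
move=> sA mB.
have fB : white_law m (p + p) B \is a fin_num by exact: fin_num_measure.
rewrite -(fineK fB); apply: (indep_generated (base_setI (sg := sg))) sA => //.
- exact: pre_xi.
- rewrite (fineK fB); have := @fold_base_indep sg setT B.
  rewrite setTI [P setT]probability_setT mul1e; apply=> //.
  exists (fun=> setT), setT, setT; split=> //.
  + by move=> i; exact: sigma_mxT.
  + exact: sigma_mxT.
  + exact: sigma_finT.
  + by rewrite !setIT; apply/seteqP.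
- by move=> H bH; rewrite (fineK fB); exact: fold_base_indep.
Qed.

(* Everything a fold-one computation may depend on, together with the noise and
   the split. *)
Definition first_base : set (set T) :=
  mx_base (fun w => fold1 (pi w) (row_mx (X w) (X w *m beta + eps w)%R)) `|`
  mx_base eps `|` sigma_fin pi.

Lemma first_base_fold sg A : <<s first_base >> A ->
  <<s fold_base sg >> (A `&` [set w | pi w = sg]).
Proof.
pose TG := g_sigma_algebraType (fold_base sg).
have mF : @measurable _ TG [set w | pi w = sg].
  apply: sub_sigma_algebra; exists (fun=> setT), setT, [set w | pi w = sg]; split.
  - by move=> i; exact: sigma_mxT.
  - exact: sigma_mxT.
  - by exists [set sg]%SET; apply/seteqP; split=> w /=; rewrite finset.in_set1 => /eqP.
  - by apply/seteqP; split=> w /= => [?|[]].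
have mpiG A' : sigma_fin pi A' -> @measurable _ TG A'.
  move=> pA; apply: sub_sigma_algebra; exists (fun=> setT), setT, A'; split=> //.
  - by move=> i; exact: sigma_mxT.
  - exact: sigma_mxT.
  - by apply/seteqP; split=> w /= => [?|[]].
have meG : random_mx (eps : TG -> _).
  apply: random_mx_sub => A' bA; apply: sub_sigma_algebra; exists (fun=> setT), A', setT; split=> //.
  - by move=> i; exact: sigma_mxT.
  - exact: sub_sigma_algebra.
  - exact: sigma_finT.
  - by apply/seteqP; split=> w /= => [?|[[]]].
have mXG : random_mx ((fun w => fold1 sg (X w)) : TG -> _).
  apply: random_mx_sub => _ [i [j [B mB ->]]]; apply: sub_sigma_algebra.
  exists (fun i' => if i' == i then (fun w => X w (sg (lshift m i)) j) @^-1` B else setT), setT, setT; split=> //.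
  - move=> i'; case: eqP => [->|_]; last exact: sigma_mxT.
    by apply: sub_sigma_algebra; exists 0%R, j, B => //; apply/seteqP; split=> w /=; rewrite mxE.
  - exact: sigma_mxT.
  - exact: sigma_finT.
  - apply/seteqP; split=> w /=.
      by rewrite mxE => Bw; split=> //; split=> // i'; case: ifP.
    by move=> [[/(_ i)]]; rewrite eqxx mxE.
apply: g_sigma_restrict => // A' [[|]|].
- move=> bA; apply: (fold1_restrict (beta := beta) (X := X) (eps := eps)) => //.
    by move=> i' j'; under eq_fun do rewrite mxE; exact: meG.
  exact: sub_sigma_algebra.
- move=> bA; apply: measurableI => //.
  have [i [j [B mB ->]]] := bA; rewrite -[X in measurable X]setTI; exact: (meG i j measurableT _ mB).
- by move=> pA; apply: measurableI => //; exact: mpiG.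
Qed.

Lemma first_base_measurable : first_base `<=` measurable.
Proof.
move=> A [[|]|]; last exact: sigma_fin_measurable.
  exact: (fold1_base_measurable mX meps mpi).
by move=> [i [j [B mB ->]]]; rewrite -[X in measurable X]setTI; exact: meps.
Qed.

Definition white_second_fold w := tuple_of_mx (second_white W X Z (pi w) w).

Let split_preimage B : white_second_fold @^-1` B =
  \bigcup_(s in [set` [set: 'S_(m + m)]%SET]) (xi s @^-1` B `&` [set w | pi w = s]).
Proof.
by apply/seteqP; split=> w /=; [move=> ?; exists (pi w); rewrite /= ?finset.in_setT|by move=> [s _] [H ws]; move: H; rewrite -ws].
Qed.

Lemma measurable_white_second_fold : measurable_fun setT white_second_fold.
Proof.
move=> _ B mB; rewrite setTI split_preimage.
apply: fin_bigcup_measurable => [|s _]; first exact: finite_finset.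
by apply: measurableI => //; exact: pre_xi.
Qed.

(** The random split is removed by summing over its values; on each of them the statement is
    [fold_sigma_indep]. *)
Lemma first_second_indep A B : <<s first_base >> A -> measurable B ->
  P (A `&` white_second_fold @^-1` B) = P A * white_law m (p + p) B.
Proof.
move=> sA mB; have mA : measurable A by apply: measurable_sub_type sA; exact: first_base_measurable.
have mW : measurable (white_second_fold @^-1` B).
  by rewrite -[X in measurable X]setTI; exact: measurable_white_second_fold.
rewrite (measure_split_fin _ mpi (measurableI _ _ mA mW)).
rewrite [in RHS](measure_split_fin _ mpi mA) ge0_sume_distrl//.
apply: eq_bigr => s _; rewrite -(fold_sigma_indep (first_base_fold (sg := s) sA) mB); congr (P _).
by apply/seteqP; split=> w /=; rewrite /white_second_fold; [move=> [[? H] <-]|move=> [[? <-] H]].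
Qed.

End FirstSecondFold.

(** * Noise of the second fold, given a first-fold event *)

Section SecondMoment.
Context {R : realType} {d : measure_display} {T : measurableType d}.
Variable P : probability T R.
Local Open Scope ereal_scope.

(** The tail of x^2 at t is at most 2 exp(- t / kappa^2), which is 2 kappa^2 times the exponential
    density of rate 1 / kappa^2. *)
Lemma sub_gaussian_second_moment (kappa : R) (x : T -> R) : (0 < kappa)%R ->
  measurable_fun setT x -> sub_gaussian P kappa x ->
  \int[P]_w (x w ^+ 2)%:E <= (2 * kappa ^+ 2)%:E.
Proof.
move=> k0 mx sg; have k20 : (0 < kappa ^+ 2)%R by rewrite exprn_gt0.
have mx2 : measurable_fun setT (fun w => x w ^+ 2)%R by exact: measurable_funX.
pose X2 : {RV P >-> R} := mfun_Sub (mem_set mx2).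
have X2E w : X2 w = (x w ^+ 2)%R by [].
have X20 w : (0 <= X2 w)%R by rewrite X2E sqr_ge0.
have := ge0_expectation_ccdf X20; rewrite expectation_def => E.
rewrite [X in X <= _](_ : _ = \int[P]_w (X2 w)%:E)// E.
pose r := ((kappa ^+ 2)^-1)%R; have r0 : (0 < r)%R by rewrite invr_gt0.
apply: (@le_trans _ _ (\int[@lebesgue_measure R]_(t in `[0%R, +oo[) ((2 * kappa ^+ 2)%:E * (exponential_pdf r t)%:E))).
  apply: ge0_le_integral => //.
  - exact: measurable_funTS (ccdf_measurable _).
  - apply: measurable_funTS; apply/measurable_EFinP; apply: measurable_funM => //.
    exact: measurable_exponential_pdf.
  move=> t; rewrite /= in_itv/= andbT => t0.
  rewrite exponential_pdfE// -EFinM.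
  have -> : (2 * kappa ^+ 2 * (r * expR (- r * t)) = 2 * expR (- (Num.sqrt t ^+ 2 / kappa ^+ 2)))%R.
    rewrite sqr_sqrtr// /r mulNr [(kappa ^- 2 * t)%R]mulrC; field.
    by rewrite gt_eqF.
  apply: le_trans (sg _ (sqrtr_ge0 t)).
  rewrite /ccdf /distribution /pushforward; apply: le_measure; rewrite ?inE.
  - have -> : X2 @^-1` `]t, +oo[ = [set w | (t < X2 w)%R].
      by apply/seteqP; split=> w /=; rewrite in_itv/= andbT.
    exact: measurable_set_lt.
  - by apply: measurable_set_le => //; exact: measurableT_comp.
  move=> w /=; rewrite in_itv/= andbT => tx.
  by rewrite -sqrtr_sqr ler_wsqrtr// ltW.
rewrite ge0_integralZl//; last 3 first.
- by apply: measurable_funTS; apply/measurable_EFinP; exact: measurable_exponential_pdf.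
- by move=> t _; rewrite lee_fin exponential_pdf_ge0 ?ltW.
- by rewrite lee_fin mulr_ge0// ltW.
rewrite -[X in _ <= X]mule1 lee_pmul2l//; last by rewrite lte_fin mulr_gt0.
rewrite -(integral_exponential_pdf r0); apply: ge0_subset_integral => //.
  by apply/measurable_EFinP; exact: measurable_exponential_pdf.
by move=> t _; rewrite lee_fin exponential_pdf_ge0 ?ltW.
Qed.

End SecondMoment.

Section IndependentSecondMoment.
Context {R : realType} {d : measure_display} {T : measurableType d}.
Variable P : probability T R.
Notation GR := (measurableTypeR R).
Local Open Scope ereal_scope.

Lemma indep_second_moment (H : set T) (x : T -> R) (M : R) :
  measurable H -> measurable_fun setT x ->
  (forall B : set R, measurable B -> P (H `&` x @^-1` B) = P H * P (x @^-1` B)) ->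
  \int[P]_w (x w ^+ 2)%:E <= M%:E ->
  \int[P]_(w in H) (x w ^+ 2)%:E <= M%:E * P H.
Proof.
move=> mH mx Hx xM.
have fPH : P H \is a fin_num by exact: fin_num_measure.
have PH0 : (0 <= fine (P H))%R by exact: fine_ge0.
have mI : measurable_fun setT (fun w => (\1_H w)%:E : \bar R).
  by apply/measurable_EFinP; exact: measurable_indic.
have I0 w : 0 <= (\1_H w)%:E :> \bar R by rewrite lee_fin.
have msq : measurable_fun setT (fun y : GR => (y ^+ 2)%:E : \bar R).
  by apply/measurable_EFinP; exact: measurable_funX.
have sq0 (y : GR) : 0 <= (y ^+ 2)%:E :> \bar R by rewrite lee_fin sqr_ge0.
have -> : \int[P]_(w in H) (x w ^+ 2)%:E =
    \int[@image_measure _ _ _ _ GR (density_measure P mI I0) _ mx]_y (y ^+ 2)%:E.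
  rewrite ge0_integral_image_measure// ge0_integral_density//; last first.
    by apply/measurable_EFinP; exact: measurable_funX.
  rewrite [LHS]integral_mkcond; apply: eq_integral => w _; rewrite patchE indicE.
  by case: (_ \in _); rewrite ?mule1 ?mule0.
have -> : \int[@image_measure _ _ _ _ GR (density_measure P mI I0) _ mx]_y (y ^+ 2)%:E =
    \int[mscale (NngNum PH0) (@image_measure _ _ _ _ GR P _ mx)]_y (y ^+ 2)%:E.
  apply: eq_measure_integral => B mB _.
  rewrite /= /mscale /= /image_measure /pushforward /density_measure.
  have mxB : measurable (x @^-1` B) by rewrite -[X in measurable X]setTI; exact: mx.
  by have := Hx B mB; rewrite (fineK fPH) => <-; rewrite integral_indic.
rewrite ge0_integral_mscale//= ge0_integral_image_measure// (fineK fPH) muleC.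
by rewrite lee_wpmul2r.
Qed.

End IndependentSecondMoment.

Section NoiseIndependence.
Context {R : realType} {d : measure_display} {T : measurableType d}.
Variable P : probability T R.
Notation GR := (measurableTypeR R).
Variables (m p : nat) (beta : 'cV[R]_p).
Variables (X : T -> 'M[R]_(m + m, p)) (eps : T -> 'cV[R]_(m + m))
  (pi : T -> 'S_(m + m)) (Z : T -> 'M[R]_(m, p)).
Hypothesis mX : random_mx X.
Hypothesis iideps : iid_components P eps.
Hypothesis mpi : forall sg, measurable [set w | pi w = sg].
Hypothesis indep : independent_seq P [:: sigma_mx X; sigma_mx eps; sigma_fin pi; sigma_mx Z].
Local Open Scope ereal_scope.

Let meps : random_mx eps. Proof. by case: iideps. Qed.
Let ieps : mutually_independent P (fun i : 'I_(m + m) => sigma_mx (fun w => row i (eps w))).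
Proof. by case: iideps. Qed.

(** Counterpart of [fold_base] with X and eps exchanged: it contains the traces of first-fold
    events, and each second-fold noise entry is independent of it. *)
Definition noise_base (sg : 'S_(m + m)) : set (set T) :=
  [set H | exists C A1 A3, [/\ forall i : 'I_m, sigma_mx (fun w => row (sg (lshift m i)) (eps w)) (C i),
     sigma_mx X A1, sigma_fin pi A3 &
     H = A1 `&` [set w | forall i, C i w] `&` A3] ].

Let row_measurable i A : sigma_mx (fun w => row i (eps w)) A -> measurable A.
Proof. by apply: sigma_mx_measurable => j l; under eq_fun do rewrite mxE; exact: meps. Qed.

Let base_measurable sg : noise_base sg `<=` measurable.
Proof.
move=> _ [C [A1 [A3 [CX eA pA ->]]]]; apply: measurableI; first apply: measurableI.
- exact: sigma_mx_measurable eA.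
- by apply: measurable_forall => i; exact: row_measurable (CX i).
- exact: (sigma_fin_measurable mpi).
Qed.

Let base_setI sg : setI_closed (noise_base sg).
Proof.
move=> _ _ [C [A1 [A3 [CX eA pA ->]]]] [C' [A1' [A3' [CX' eA' pA' ->]]]].
exists (fun i => C i `&` C' i), (A1 `&` A1'), (A3 `&` A3'); split.
- by move=> i; exact: sigma_mxI.
- exact: sigma_mxI.
- exact: sigma_finI.
apply/seteqP; split=> w /=; first by move=> [[[? ?] ?] [[? ?] ?]].
move=> [[[? ?] CC] [? ?]].
by split; split=> //; split=> // i; have [] := CC i.
Qed.

Let rowe r A : sigma_mx (fun w => row r (eps w)) A -> sigma_mx eps A.
Proof. by apply: sigma_mx_sub => i j; under eq_fun do rewrite mxE; exact: random_mx_self. Qed.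

Let base_indep sg i H B : noise_base sg H -> measurable B ->
  P (H `&` (fun w => eps w (sg (rshift m i)) 0%R) @^-1` B) =
  P H * P ((fun w => eps w (sg (rshift m i)) 0%R) @^-1` B).
Proof.
move=> [C [A1 [A3 [CX XA pA ->]]]] mB.
set r := sg (rshift m i); set D := _ @^-1` B.
have eD : sigma_mx (fun w => row r (eps w)) D.
  by apply: sub_sigma_algebra; exists 0%R, 0%R, B => //; apply/seteqP; split=> w /=; rewrite mxE.
set EC := [set w | forall i, C i w].
have eEC : sigma_mx eps EC.
  apply: (@measurable_forall _ (g_sigma_algebraType (mx_base eps))) => i'.
  exact: rowe (CX i').
have ZT : sigma_mx Z setT by exact: sigma_mxT.
have -> : P (A1 `&` EC `&` A3) = P A1 * P EC * P A3.
  by have := indep4 indep XA eEC pA ZT; rewrite setIT [P setT]probability_setT mule1.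
have -> : P (A1 `&` EC `&` A3 `&` D) = P A1 * P (EC `&` D) * P A3.
  have eECD : sigma_mx eps (EC `&` D) by apply: sigma_mxI => //; exact: rowe eD.
  have := indep4 indep XA eECD pA ZT; rewrite setIT [P setT]probability_setT mule1 => <-.
  by congr (P _); apply/seteqP; split=> w /=; tauto.
suff -> : P (EC `&` D) = P EC * P D by rewrite -!muleA; do 2 congr (_ * _); rewrite muleC.
(* One event per noise entry; among the second-fold entries only the i-th is constrained. *)
pose E (D' : set T) r' := match fintype.split (sg^-1%g r') with inl i => C i | inr i' => if i' == i then D' else setT end.
have EE D' : sigma_mx (fun w => row r (eps w)) D' ->
    P (EC `&` D') = (\prod_(i < m) P (C i)) * P D'.
  move=> eD'; have -> : EC `&` D' = [set w | forall r', E D' r' w].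
    apply/seteqP; split=> w /=.
      by move=> [HC HD] r'; rewrite /E; case: (fintype.split _) => // i'; case: ifP.
    move=> HE; split=> [i'|].
      have := HE (sg (lshift m i')); rewrite /E permK.
      by rewrite -[lshift m i']/(unsplit (inl i')) unsplitK.
    have := HE r; rewrite /E /r permK.
    by rewrite -[rshift m i]/(unsplit (inr i)) unsplitK eqxx.
  rewrite (indep_rows (Y := eps))//; last first.
    move=> r'; rewrite /E; case: fintype.splitP => i' ri.
      have -> : r' = sg (lshift m i') by apply: (perm_inj (s := sg^-1%g)); rewrite permK; exact: val_inj.
      exact: CX.
    have -> : r' = sg (rshift m i') by apply: (perm_inj (s := sg^-1%g)); rewrite permK; exact: val_inj.
    by case: eqP => [->//|_]; exact: sigma_mxT.
  rewrite (reindex_inj (@perm_inj _ sg)) big_split_ord /=; congr (_ * _).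
    apply: eq_bigr => i' _; rewrite /E permK.
    by rewrite -[lshift m i']/(unsplit (inl i')) unsplitK.
  rewrite (bigD1 i)//= big1 ?mule1; last first.
    move=> i' ii; rewrite /E permK -[rshift m i']/(unsplit (inr i')) unsplitK (negbTE ii).
    exact: probability_setT.
  by rewrite /E permK -[rshift m i]/(unsplit (inr i)) unsplitK eqxx.
rewrite EE//; congr (_ * _).
have rT : sigma_mx (fun w => row r (eps w)) setT by exact: sigma_mxT.
by have := EE _ rT; rewrite setIT [P setT]probability_setT mule1.
Qed.

Let noise_indep sg i A B : <<s noise_base sg >> A -> measurable B ->
  P (A `&` (fun w => eps w (sg (rshift m i)) 0%R) @^-1` B) =
  P A * P ((fun w => eps w (sg (rshift m i)) 0%R) @^-1` B).
Proof.
move=> sA mB; set D := _ @^-1` B.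
have mD : measurable D by rewrite -[X in measurable X]setTI; exact: meps.
have fD : P D \is a fin_num by exact: fin_num_measure.
rewrite -[in RHS](fineK fD); apply: (indep_generated (base_setI (sg := sg))) sA => //.
- by rewrite fineK.
- by move=> H bH; rewrite (fineK fD); exact: base_indep.
Qed.

Let fold1_noise_base sg A :
  sigma_mx (fun w => fold1 (pi w) (row_mx (X w) (X w *m beta + eps w)%R)) A ->
  <<s noise_base sg >> (A `&` [set w | pi w = sg]).
Proof.
apply: fold1_restrict.
- apply: sub_sigma_algebra; exists (fun=> setT), setT, [set w | pi w = sg]; split.
  + by move=> i; exact: sigma_mxT.
  + exact: sigma_mxT.
  + by exists [set sg]%SET; apply/seteqP; split=> w /=; rewrite finset.in_set1 => /eqP.
  + by apply/seteqP; split=> w /= => [?|[]].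
- apply: random_mx_sub => _ [i [j [B mB ->]]]; apply: sub_sigma_algebra.
  exists (fun=> setT), ((fun w => X w (sg (lshift m i)) j) @^-1` B), setT; split.
  + by move=> i'; exact: sigma_mxT.
  + by apply: sub_sigma_algebra; exists (sg (lshift m i)), j, B.
  + exact: sigma_finT.
  + by apply/seteqP; split=> w /=; rewrite mxE; [|move=> [[]]].
- apply: random_mx_sub => _ [i [j [B mB ->]]]; apply: sub_sigma_algebra.
  exists (fun i' => if i' == i then (fun w => eps w (sg (lshift m i)) j) @^-1` B else setT), setT, setT; split=> //.
  + move=> i'; case: eqP => [->|_]; last exact: sigma_mxT.
    by apply: sub_sigma_algebra; exists 0%R, j, B => //; apply/seteqP; split=> w /=; rewrite mxE.
  + exact: sigma_mxT.
  + exact: sigma_finT.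
  + apply/seteqP; split=> w /=.
      by rewrite mxE => Bw; split=> //; split=> // i'; case: ifP.
    by move=> [[_ /(_ i)]]; rewrite eqxx mxE.
Qed.

(** Markov's inequality on [A], one value of the split at a time. Independence yields the factor
    P(A), essential since the conditioning event may be rare. *)
Lemma second_fold_noise_tail (kappa t : R) A : (0 < kappa)%R -> (0 < t)%R ->
  (forall i, sub_gaussian P kappa (fun w => eps w i 0%R)) ->
  sigma_mx (fun w => fold1 (pi w) (row_mx (X w) (X w *m beta + eps w)%R)) A ->
  P (A `&` [set w | (t < norm2 (fold2 (pi w) (eps w)) ^+ 2)%R]) <=
  (m%:R * (2 * kappa ^+ 2) / t)%:E * P A.
Proof.
move=> k0 t0 sg sA.
have mY : mx_base (fun w => fold1 (pi w) (row_mx (X w) (X w *m beta + eps w)%R)) `<=` measurable.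
  exact: fold1_base_measurable.
have mA : measurable A by exact: measurable_sub_type sA.
have me2 sg' : random_mx (fun w => fold2 sg' (eps w)).
  by move=> i j; under eq_fun do rewrite mxE; exact: meps.
have mn2 sg' : measurable_fun setT (fun w => norm2 (fold2 sg' (eps w)) ^+ 2)%R.
  have -> : (fun w => norm2 (fold2 sg' (eps w)) ^+ 2)%R = (fun w => \sum_i fold2 sg' (eps w) i 0 ^+ 2)%R.
    by apply/funext => w; rewrite -dotvv dotE; apply: eq_bigr => i _; rewrite expr2.
  apply: (@measurable_sum _ _ _ _ _ _ (fun i w => fold2 sg' (eps w) i 0 ^+ 2)%R) => i.
  by apply: measurable_funX; exact: me2.
set c := (_ / t)%R.
have H sg' : P (A `&` [set w | (t < norm2 (fold2 (pi w) (eps w)) ^+ 2)%R] `&` [set w | pi w = sg']) <=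
    c%:E * P (A `&` [set w | pi w = sg']).
  set H := A `&` [set w | pi w = sg']; set f := (fun w => norm2 (fold2 sg' (eps w)) ^+ 2)%R.
  have mH : measurable H by exact: measurableI.
  have -> : A `&` [set w | (t < norm2 (fold2 (pi w) (eps w)) ^+ 2)%R] `&` [set w | pi w = sg'] =
      H `&` [set w | (t < f w)%R].
    by apply/seteqP; split=> w /=; [move=> [[? +] ws]|move=> [[? ws] +]]; rewrite /f -?ws /H /= ?ws.
  have mG : measurable (H `&` [set w | (t < f w)%R]) by apply: measurableI => //; apply: measurable_set_lt => //; exact: mn2.
  have f0 w : 0 <= (f w)%:E by rewrite lee_fin sqr_ge0.
  have mfE : measurable_fun setT (fun w => (f w)%:E) by apply/measurable_EFinP; exact: mn2.
  have h1 : t%:E * P (H `&` [set w | (t < f w)%R]) <= \int[P]_(w in H) (f w)%:E.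
    rewrite -integral_cst//; apply: (@le_trans _ _ (\int[P]_(w in H `&` [set w | (t < f w)%R]) (f w)%:E)).
      apply: ge0_le_integral => //.
      - by move=> w _; rewrite lee_fin ltW.
      - exact: measurable_funTS.
      - by move=> w [_ /= tf]; rewrite lee_fin ltW.
    apply: ge0_subset_integral => //; exact: measurable_funTS.
  have h2 : \int[P]_(w in H) (f w)%:E <= (m%:R * (2 * kappa ^+ 2))%:E * P H.
    have -> : \int[P]_(w in H) (f w)%:E = \int[P]_(w in H) \sum_(i < m) (eps w (sg' (rshift m i)) 0 ^+ 2)%:E.
      apply: eq_integral => w _; rewrite sumEFin /f -dotvv dotE; congr EFin.
      by apply: eq_bigr => i _; rewrite mxE expr2.
    rewrite ge0_integral_sum//; last 2 first.
    - by move=> i; apply: measurable_funTS; apply/measurable_EFinP; apply: measurable_funX; exact: meps.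
    - by move=> i w _; rewrite lee_fin sqr_ge0.
    apply: (@le_trans _ _ (\sum_(i < m) (2 * kappa ^+ 2)%:E * P H)).
      apply: lee_sum => i _; apply: indep_second_moment => //.
      - by move=> B mB; apply: noise_indep => //; exact: fold1_noise_base.
      - by apply: sub_gaussian_second_moment => //; exact: meps.
    rewrite -ge0_sume_distrl; last by move=> i _; rewrite lee_fin mulr_ge0// sqr_ge0.
    by rewrite sumEFin sumr_const card_ord -[(_ *+ m)%R]mulr_natl.
  have fP S : measurable S -> P S \is a fin_num by move=> mS; exact: fin_num_measure.
  have := le_trans h1 h2; rewrite -(fineK (fP _ mH)) -(fineK (fP _ mG)) -!EFinM !lee_fin /c => h.
  by rewrite [leRHS]mulrAC ler_pdivlMr// mulrC.
have mtail : measurable [set w | (t < norm2 (fold2 (pi w) (eps w)) ^+ 2)%R].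
  rewrite (_ : [set w | _] = \bigcup_(s in [set` [set: 'S_(m + m)]%SET])
     ([set w | (t < norm2 (fold2 s (eps w)) ^+ 2)%R] `&` [set w | pi w = s])).
    apply: fin_bigcup_measurable => [|s _]; first exact: finite_finset.
    by apply: measurableI => //; apply: measurable_set_lt => //; exact: mn2.
  by apply/seteqP; split=> w /=; [move=> ?; exists (pi w); rewrite /= ?finset.in_setT|by move=> [s _] [+ ws]; rewrite ws].
rewrite (measure_split_fin _ mpi (measurableI _ _ mA mtail)) [in leRHS](measure_split_fin _ mpi mA).
rewrite ge0_sume_distrr//.
by apply: lee_sum => s _; exact: H.
Qed.

End NoiseIndependence.

(** * Measurability of the precision neighbourhood *)

Section RationalVectors.
Context {R : realType}.

Definition rat_cV n (v : 'cV[rat]_n) : 'cV[R]_n := map_mx ratr v.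

(** Density of rational vectors; it reduces matrix inequalities to countably many scalar conditions,
    hence to measurable ones. *)
Lemma quadform_rat_ge0 n (B : 'M[R]_n) :
  (forall v : 'cV[rat]_n, 0 <= dot (rat_cV v) (B *m rat_cV v)) ->
  forall v, 0 <= dot v (B *m v).
Proof.
move=> Brat v; pose K := Num.sqrt (frob B); pose r : R := Num.sqrt n%:R.
have K0 : 0 <= K by exact: sqrtr_ge0.
apply: (@le_of_small _ _ _ (2 * K * norm2 v * r + K * r ^+ 2)) => t /andP[t0 t1].
have /choice[u Hu] : forall i : 'I_n, exists a : rat, v i 0 < ratr a < v i 0 + t.
  move=> i; have vt : v i 0 < v i 0 + t by rewrite ltrDl.
  by have [a] := rat_in_itvoo vt; rewrite in_itv/= => ?; exists a.
pose w : 'cV[rat]_n := \col_i u i; pose h := rat_cV w - v.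
have hi i : h i 0 = ratr (u i) - v i 0 by rewrite !mxE.
have nh : norm2 h <= t * r.
  rewrite ler_norm2_dotvv ?mulr_ge0 ?sqrtr_ge0 ?(ltW t0)// exprMn sqr_sqrtr// dotE.
  have -> : t ^+ 2 * n%:R = \sum_(i < n) t ^+ 2 by rewrite sumr_const card_ord -[RHS]mulr_natr.
  apply: ler_sum => i _; rewrite hi -expr2; have /andP[h1 h2] := Hu i.
  by rewrite ler_pXn2r// ?nnegrE; lra.
have wE : rat_cV w = v + h by rewrite /h addrC subrK.
have := Brat w; rewrite wE mulmxDr (dotDl _ v h) !(dotDr _ (B *m v)) => H.
have b (x y : 'cV[R]_n) : dot x (B *m y) <= K * (norm2 x * norm2 y).
  apply: (le_trans (ler_norm _)); apply: (le_trans (dot_le_norm2 _ _)).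
  by rewrite [leRHS]mulrCA ler_wpM2l ?norm2_ge0// norm2_mulmx_frob.
have h1 := b v h; have h2 := b h v; have h3 := b h h.
have nv := norm2_ge0 v; have nh0 := norm2_ge0 h.
have r0 : 0 <= r by exact: sqrtr_ge0.
have h4 : K * (norm2 v * norm2 h) <= K * (norm2 v * (t * r)) by rewrite !ler_wpM2l.
have h5 : K * (norm2 h * norm2 h) <= K * (t * r ^+ 2).
  rewrite ler_wpM2l//; apply: (@le_trans _ _ ((t * r) * (t * r))); first by rewrite ler_pM.
  rewrite (_ : t * r * (t * r) = t * (t * r ^+ 2)); last by ring.
  by rewrite ler_piMl// mulr_ge0 ?sqr_ge0 ?ltW.
have -> : t * (2 * K * norm2 v * r + K * r ^+ 2) = 2 * (K * (norm2 v * (t * r))) + K * (t * r ^+ 2) by ring.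
rewrite (mulrC (norm2 h) (norm2 v)) in h2; lra.
Qed.

(** Strict positivity on rational vectors would not pass to the limit; a uniform margin 1 / (k + 1)
    does, and [posdef_lower_bound] provides it. *)
Lemma posdef_ratP n (A : 'M[R]_n) : posdef A <-> A^T = A /\
  exists k : nat, forall v : 'cV[rat]_n,
    k.+1%:R^-1 * dot (rat_cV v) (rat_cV v) <= dot (rat_cV v) (A *m rat_cV v).
Proof.
split=> [pA|[AT [k Hk]]].
  split; first by case: pA.
  have [c c0 Ac] := posdef_lower_bound pA.
  have [k _ /(_ k (leqnn k))/= kc] := near_infty_natSinv_lt (PosNum c0).
  by exists k => v; apply: le_trans (Ac _); rewrite ler_wpM2r ?dotvv_ge0// ltW.
apply/posdefE; split=> // v v0.
have := @quadform_rat_ge0 _ (A - k.+1%:R^-1%:M) _ v.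
rewrite mulmxBl mul_scalar_mx dotBr dotZr => H.
have : 0 <= dot v (A *m v) - k.+1%:R^-1 * dot v v.
  by apply: H => u; rewrite mulmxBl mul_scalar_mx dotBr dotZr subr_ge0.
by rewrite subr_ge0; apply: lt_le_trans; rewrite mulr_gt0 ?invr_gt0// dotvv_gt0.
Qed.

Lemma spectral_norm_ratP m n (A : 'M[R]_(m, n)) r : 0 <= r ->
  (spectral_norm A <= r <-> forall v : 'cV[rat]_n,
    dot (A *m rat_cV v) (A *m rat_cV v) <= r ^+ 2 * dot (rat_cV v) (rat_cV v)).
Proof.
move=> r0; split=> [Ar v|H].
  have := norm2_mulmx_spectral A (rat_cV v) => h.
  rewrite !dotvv -exprMn ler_pXn2r// ?nnegrE ?mulr_ge0 ?norm2_ge0//.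
  by apply: (le_trans h); rewrite ler_wpM2r ?norm2_ge0.
have [//|] : spectral_norm A <= r \/ r < 0; last by rewrite ltNge r0.
apply: spectral_norm_le => v; rewrite ler_norm2_dotvv ?mulr_ge0 ?norm2_ge0// exprMn -dotvv.
have E u : dot u (((r ^+ 2)%:M - A^T *m A) *m u) = r ^+ 2 * dot u u - dot (A *m u) (A *m u).
  by rewrite mulmxBl mul_scalar_mx dotBr dotZr -mulmxA (dot_mulmxr A^T) trmxK.
by rewrite -subr_ge0 -E; apply: quadform_rat_ge0 => u; rewrite E subr_ge0.
Qed.

Lemma spectral_norm_ge0 m n (A : 'M[R]_(m, n)) : 0 <= spectral_norm A.
Proof.
have [_ H] := spectral_norm_has_sup A.
by apply: (ub_le_sup H); exists 0; rewrite /= ?norm20 ?mulmx0 ?norm20.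
Qed.

End RationalVectors.

Section PrecisionMeasurable.
Context {R : realType} {d : measure_display} {T : measurableType d}.

Lemma measurable_forall_countable (I : countType) (A : I -> set T) :
  (forall i, measurable (A i)) -> measurable [set w | forall i, A i w].
Proof.
move=> mA; rewrite (_ : [set w | _] = \bigcap_(n : nat) (if unpickle n is Some i then A i else setT)).
  by apply: bigcapT_measurable => n; case: (unpickle n).
apply/seteqP; split=> w /=.
  by move=> H n _; case: (unpickle n) => [i|//]; exact: H.
by move=> H i; have := H (pickle i) Logic.I; rewrite pickleK.
Qed.

Lemma measurable_dot n (u v : T -> 'cV[R]_n) : random_mx u -> random_mx v ->
  measurable_fun setT (fun w => dot (u w) (v w)).
Proof.
move=> mu mv; under eq_fun do rewrite dotE.
by apply: (@measurable_sum _ _ _ _ _ _ (fun i w => u w i 0 * v w i 0)) => i; exact: measurable_funM.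
Qed.

Lemma measurable_precision_nbhd p (Omega0 : 'M[R]_p) L r (Omega : T -> 'M[R]_p) :
  random_mx Omega -> measurable [set w | precision_nbhd Omega0 L r (Omega w)].
Proof.
move=> mO.
have [r0|r0] := leP 0 r; last first.
  rewrite (_ : [set w | _] = set0)//; apply/seteqP; split=> // w [_ _].
  by move=> /(le_trans (spectral_norm_ge0 _)); rewrite leNgt r0.
have mOv (v : 'cV[R]_p) : random_mx (fun w => Omega w *m v).
  by apply: random_mx_mul => //; exact: random_mx_cst.
have mDv (v : 'cV[R]_p) : random_mx (fun w => (Omega w - Omega0) *m v).
  by apply: random_mx_mul; [apply: random_mxB => //; exact: random_mx_cst|exact: random_mx_cst].
pose P1 := [set w | forall z : 'I_p * 'I_p, Omega w z.1 z.2 = Omega w z.2 z.1].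
pose P2 := \bigcup_k [set w | forall v : 'cV[rat]_p,
    k.+1%:R^-1 * dot (rat_cV v) (rat_cV v) <= dot (rat_cV v) (Omega w *m rat_cV v :> 'cV[R]_p)].
(* Sparsity as a finite union over the possible supports of a row. *)
pose P3 := [set w | forall i, exists J : {set 'I_p}, (#|J| <= L)%N /\ forall j : 'I_p, j \notin J -> Omega w i j = 0].
pose P4 := [set w | forall v : 'cV[rat]_p,
    dot ((Omega w - Omega0) *m rat_cV v) ((Omega w - Omega0) *m rat_cV v) <= r ^+ 2 * dot (rat_cV v) (rat_cV v)].
have meq (f g : T -> R) : measurable_fun setT f -> measurable_fun setT g -> measurable [set w | f w = g w].
  move=> mf mg; rewrite (_ : [set w | _] = [set w | f w <= g w] `&` [set w | g w <= f w]).
    by apply: measurableI; exact: measurable_set_le.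
  by apply/seteqP; split=> w /=; [move=> ->|move=> [h1 h2]; apply/eqP; rewrite eq_le h1 h2].
have -> : [set w | precision_nbhd Omega0 L r (Omega w)] = P1 `&` P2 `&` P3 `&` P4.
  apply/seteqP; split=> w /=.
    move=> [/posdef_ratP[OT [k Hk]] sp nr]; split; last exact/spectral_norm_ratP.
    split; first by split; [move=> z; rewrite -{1}OT mxE|exists k].
    move=> i; exists [set j | Omega w i j != 0]%SET; split; first exact: sp.
    by move=> j; rewrite inE negbK => /eqP.
  move=> [[[h1 [k _ h2]] h3] h4]; split; last exact/spectral_norm_ratP.
    apply/posdef_ratP; split; last by exists k.
    by apply/matrixP => i j; rewrite mxE (h1 (j, i)).
  move=> i; have [J [JL HJ]] := h3 i; apply: leq_trans JL; apply: subset_leq_card.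
  by apply/fintype.subsetP => j; rewrite inE; apply: contraR => /HJ ->.
apply: measurableI; first apply: measurableI; first apply: measurableI.
- by apply: measurable_forall => z; apply: meq; exact: mO.
- apply: bigcup_measurable => k _; apply: measurable_forall_countable => v.
  by apply: measurable_set_le => //; apply: measurable_dot => //; exact: random_mx_cst.
- apply: measurable_forall => i; apply: measurable_exists => J.
  rewrite -[X in measurable X]/[set w | (#|J| <= L)%N /\ forall j : 'I_p, j \notin J -> Omega w i j = 0].
  have [JL|JL] := leqP #|J| L; last by rewrite (_ : [set w | _] = set0)//; apply/seteqP; split=> // w [].
  rewrite (_ : [set w | _] = [set w | forall j : 'I_p, j \notin J -> Omega w i j = 0]); last first.
    by apply/seteqP; split=> w /=; [case|].
  apply: measurable_forall => j.
  rewrite -[X in measurable X]/[set w | j \notin J -> Omega w i j = 0].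
  have [jJ|jJ] := boolP (j \in J).
    by rewrite (_ : [set w | _] = setT)//; apply/seteqP; split.
  rewrite (_ : [set w | _] = [set w | Omega w i j = 0]); first by apply: meq => //; exact: mO.
  by apply/seteqP; split=> w /=; [apply|].
- apply: measurable_forall_countable => v; apply: measurable_set_le => //.
  by apply: measurable_dot.
Qed.

End PrecisionMeasurable.

(** * Power at a fixed sample size *)

Section GoodPoint.
Context {R : realType}.
Variables (m p : nat) (q tau lambda c C delta E : R) (beta : 'cV[R]_p) (S : {set 'I_p}).
Variables (X2 Xk : 'M[R]_(m, p)) (V : 'M[R]_(m, p + p)) (A : 'M[R]_(p + p)).
Variables (eps2 : 'cV[R]_m) (b : 'cV[R]_(p + p)) (N : nat).
Hypothesis m0 : (0 < m)%N.
Hypothesis q0 : 0 <= q.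
Hypothesis tau0 : 0 < tau.
Hypothesis l0 : 0 < lambda.
Hypothesis c0 : 0 < c.
Hypothesis cC : c <= C.
Hypothesis d0 : 0 < delta.
Hypothesis DE : row_mx X2 Xk = V *m A.
Hypothesis AC : forall v, c * dot v v <= dot (A *m v) (A *m v) <= C * dot v v.
Hypothesis dS : delta * (#|S| + #|S|)%:R <= c / 4.
Hypothesis G : gram_close delta A (design_of V A).
Hypothesis supS : supp beta \subset S.
Hypothesis s0 : (0 < #|supp beta|)%N.
Hypothesis lassob : is_lasso lambda S X2 Xk (X2 *m beta + eps2) b.
Hypothesis beta_large : forall j, j \in supp beta -> 4 * tau <= `|beta j 0|.

Let n : R := (m + m)%:R.
Let n0 : 0 < n. Proof. by rewrite ltr0n addn_gt0 m0. Qed.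
Let M := knockoff_mask S.
(** A proximal step of length 1 / C with threshold t corresponds to the penalty 2 t C, here
    lambda. *)
Let t := lambda / (2 * C).
Definition scaled_noise : 'cV[R]_m := (Num.sqrt n)^-1 *: eps2.
Let e := scaled_noise.
Let H := design_of V A.
Let C0 : 0 < C. Proof. exact: lt_le_trans cC. Qed.

Definition null_reference : 'cV[R]_(p + p) := null_iterate M A C t e N.+1 V.

Hypothesis eE : norm2 e <= E.
Hypothesis iterN : ista_rate (c / 4) C ^+ N * (Num.sqrt C * E) <= lambda.
Hypothesis null_small : forall j, `|null_reference j 0| < tau / 2.

(** Proportion of bad coordinates relative to s: (8 lambda sqrt(s) / c)^2 / (tau / 2)^2 divided by
    s, the Chebyshev count of entries of b - beta - u above tau / 2. *)
Let delta0 := 256 * lambda ^+ 2 / (c ^+ 2 * tau ^+ 2).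
Hypothesis slack : 1 + delta0 * #|supp beta|%:R <= q * ((1 - delta0) * #|supp beta|%:R).

Let u := null_reference.
Let bt : 'cV[R]_(p + p) := col_mx beta 0.

Let HE : H = (Num.sqrt n)^-1 *: row_mx X2 Xk. Proof. by rewrite DE. Qed.

Let c40 : 0 < c / 4. Proof. by rewrite divr_gt0. Qed.
Let c4C : c / 4 <= C. Proof. by apply: le_trans cC; rewrite ler_pdivrMr// ler_peMr ?(ltW c0)//; lra. Qed.

Let wc : well_conditioned M (c / 4) C H.
Proof. by apply: (gram_well_conditioned c0 cC (ltW d0) AC) G; rewrite card_knockoff_mask. Qed.

Let S0 : {set 'I_(p + p)} := [set lshift p j | j in supp beta]%SET.

Let cardS0 : #|S0| = #|supp beta|.
Proof. by rewrite card_imset//; exact: lshift_inj. Qed.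

Let err := C * ista_rate (c / 4) C * norm2 (ista_iter M C^-1 t H e N.+1 - ista_iter M C^-1 t H e N).

Let t0 : 0 <= t. Proof. by rewrite divr_ge0 ?mulr_ge0 ?ltW. Qed.

(** The fixed-point defect decays like rho^N, and [iterN] chooses N so as to bring it below the
    penalty. *)
Let err_le : err <= lambda.
Proof.
have r0 : 0 <= ista_rate (c / 4) C by exact: ista_rate_ge0.
have r1 : ista_rate (c / 4) C <= 1 by exact/ltW/ista_rate_lt1.
have := ista_iter_step c40 c4C t0 wc e N.
rewrite /err; set d := norm2 _; set rho := ista_rate _ _ in r0 r1 *; set sC := Num.sqrt C => hd.
have sC0 : 0 <= sC by exact: sqrtr_ge0.
have h1 : C * d <= rho ^+ N * (sC * norm2 e).
  apply: (le_trans (ler_wpM2l (ltW C0) hd)); rewrite le_eqVlt; apply/orP; left; apply/eqP.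
  by field; rewrite gt_eqF.
have h2 : rho ^+ N * (sC * norm2 e) <= rho ^+ N * (sC * E).
  by rewrite ler_wpM2l ?exprn_ge0// ler_wpM2l.
rewrite mulrAC; apply: (@le_trans _ _ (C * d)); last by apply: (le_trans h1); apply: (le_trans h2).
by rewrite ler_piMr// mulr_ge0 ?norm2_ge0// ltW.
Qed.

(** [lasso_noise_comparison] with conditioning c / 4; since s >= 1, the defect, at most lambda, at
    most doubles the main term. *)
Let Delta_le : norm2 (b - bt - u) <= 8 * lambda * Num.sqrt #|supp beta|%:R / c.
Proof.
have sqs : 1 <= Num.sqrt #|supp beta|%:R :> R.
  by rewrite -[leLHS]sqrtr1 ler_wsqrtr// ler1n.
apply: (@le_trans _ _ ((lambda * Num.sqrt #|S0|%:R + err) / (c / 4))); last first.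
  rewrite cardS0 ler_pdivrMr//.
  have -> : 8 * lambda * Num.sqrt #|supp beta|%:R / c * (c / 4) = 2 * (lambda * Num.sqrt #|supp beta|%:R).
    by field; rewrite gt_eqF.
  have := err_le; have : lambda * 1 <= lambda * Num.sqrt #|supp beta|%:R by apply: ler_wpM2l => //; exact: ltW.
  lra.
have [Fb _] := lassob.
apply: (lasso_noise_comparison (M := M) (H := H) (e := e)) => //.
- exact: ltW.
- by rewrite /err !mulr_ge0 ?norm2_ge0 ?ista_rate_ge0// ltW.
- by move=> d sd; have /andP[] := wc sd.
- apply/fintype.subsetP => _ /imsetP[j jS ->]; rewrite inE.
  by rewrite -[lshift p j]/(unsplit (inl j)) unsplitK (fintype.subsetP supS).
- move=> i; rewrite /bt -(splitK i); case: (fintype.split i) => j /=.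
    rewrite (mem_imset _ _ (@lshift_inj _ _)) col_mxEu inE negbK => /eqP//.
  by rewrite col_mxEd mxE.
- exact/lasso_feasible_supported.
- exact: ista_iter_supported.
- move=> v /lasso_feasible_supported Fv.
  have := lasso_variational (ltW l0) lassob Fv.
  have -> : e - H *m (b - bt) = (Num.sqrt n)^-1 *: (X2 *m beta + eps2 - row_mx X2 Xk *m b).
    rewrite HE /e /scaled_noise -scalemxAl -scalerBr; congr (_ *: _).
    rewrite mulmxBr /bt mul_row_col mulmx0 addr0 opprB addrA; congr (_ - _).
    by rewrite addrC.
  rewrite HE -scalemxAl dotZl dotZr => h.
  apply: le_trans h; rewrite le_eqVlt; apply/orP; left; apply/eqP.
  have -> : (m + m)%:R^-1 = (Num.sqrt n)^-1 * (Num.sqrt n)^-1 :> R by rewrite -expr2 exprVn sqr_sqrtr// ltW.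
  by ring.
- move=> v sv; have := ista_variational c40 c4C t0 wc e N sv.
  rewrite -/err (_ : 2 * t * C = lambda); first exact.
  by rewrite /t; field; rewrite gt_eqF.
Qed.

(** As |u_i| < tau / 2, an entry of b - beta of size tau forces an entry of b - beta - u of size tau
    / 2; few of these exist by [Delta_le]. *)
Lemma good_point_tpp : 1 - delta0 <= tpp (R := R) (knockoff_select q (lcd_stat b)) (supp beta).
Proof.
have sR : 0 < #|supp beta|%:R :> R by rewrite ltr0n.
pose Nb := #|[set i | tau <= `|(b - bt) i 0|]%SET|.
have NbN : Nb%:R <= delta0 * #|supp beta|%:R.
  apply: (@le_trans _ _ (dot (b - bt - u) (b - bt - u) / (tau / 2) ^+ 2)).
    apply: le_trans (card_large_entries _ _); last by rewrite divr_gt0.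
    rewrite ler_nat; apply: subset_leq_card; apply/fintype.subsetP => i; rewrite !inE => ti.
    have -> : (b - bt - u) i 0 = (b - bt) i 0 - u i 0 by rewrite mxE [X in _ + X]mxE.
    have := null_small i; rewrite -/u; have := ler_normB ((b - bt) i 0 - u i 0) (- u i 0).
    by rewrite opprK subrK normrN; lra.
  rewrite ler_pdivrMr ?exprn_gt0 ?divr_gt0// dotvv.
  have -> : delta0 * #|supp beta|%:R * (tau / 2) ^+ 2 = (8 * lambda * Num.sqrt #|supp beta|%:R / c) ^+ 2.
    have -> : (8 * lambda * Num.sqrt #|supp beta|%:R / c) ^+ 2 =
      (8 * lambda / c) ^+ 2 * Num.sqrt #|supp beta|%:R ^+ 2 by ring.
    by rewrite sqr_sqrtr// /delta0; field; rewrite !gt_eqF.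
  rewrite ler_pXn2r ?nnegrE ?norm2_ge0//.
  by rewrite divr_ge0 ?mulr_ge0 ?sqrtr_ge0 ?ltW// ltW.
have := @tpp_ge R p q tau beta b tau0 beta_large.
rewrite -/bt -/Nb => H'; apply: le_trans (H' _ q0 s0).
  rewrite lerD2l lerN2 ler_pdivrMr//.
apply: (le_trans _ (le_trans slack _)); first by rewrite lerD2l.
by rewrite ler_wpM2l//; lra.
Qed.

End GoodPoint.

(** * Measurability of the selected set and of the bad designs *)

Section RandomSelection.
Context {R : realType} {d : measure_display} {T : measurableType d}.

Lemma measurable_bool_natr (b : T -> bool) : measurable [set w | b w] ->
  measurable_fun setT (fun w => (b w)%:R : R).
Proof.
move=> mb; rewrite (_ : (fun w => (b w)%:R : R) = (fun w => if b w then 1 else 0)); last first.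
  by apply/funext => w; case: (b w).
apply: measurable_fun_if => //.
by apply: (measurable_fun_bool true); rewrite setTI (_ : _ @^-1` _ = [set w | b w]).
Qed.

Lemma measurable_card (I : finType) (S : T -> {set I}) :
  (forall i, measurable [set w | i \in S w]) ->
  measurable_fun setT (fun w => #|S w|%:R : R).
Proof.
move=> mS; rewrite (_ : (fun w => _) = (fun w => \sum_i (i \in S w)%:R)).
  apply: (@measurable_sum _ _ _ _ _ _ (fun i w => (i \in S w)%:R)) => i.
  exact: measurable_bool_natr.
apply/funext => w; by rewrite -natr_sum -sum1_card big_mkcond.
Qed.

Lemma measurable_tpp p (S : T -> {set 'I_p}) (S0 : {set 'I_p}) :
  (forall i, measurable [set w | i \in S w]) ->
  measurable_fun setT (fun w => tpp (S w) S0 : R).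
Proof.
move=> mS; apply: measurable_funM => //; apply: measurable_card => i.
have [iS|iS] := boolP (i \in S0).
  rewrite (_ : [set w | _] = [set w | i \in S w])//.
  by apply/seteqP; split=> w /=; rewrite finset.in_setI iS andbT.
rewrite (_ : [set w | _] = set0)//.
by apply/seteqP; split=> w //=; rewrite finset.in_setI (negbTE iS) andbF.
Qed.

Lemma measurable_fdr_ratio_le p q (W : T -> 'cV[R]_p) (t : T -> R) :
  random_mx W -> measurable_fun setT t ->
  measurable [set w | fdr_ratio_le q (W w) (t w)].
Proof.
move=> mW mt.
have m1 : measurable_fun setT (fun w => #|[set j | (t w <= W w j 0)%R]%SET|%:R : R).
  apply: measurable_card => i; under eq_set do rewrite inE.
  by apply: measurable_set_le => //; exact: mW.
have m2 : measurable_fun setT (fun w => #|[set j | (W w j 0 <= - t w)%R]%SET|%:R : R).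
  apply: measurable_card => i; under eq_set do rewrite inE.
  by apply: measurable_set_le; [exact: mW|exact: measurable_funN].
rewrite (_ : [set w | _] = [set w | (0 < #|[set j | (t w <= W w j 0)%R]%SET|%:R :> R)%R] `&`
   [set w | (1 + #|[set j | (W w j 0 <= - t w)%R]%SET|%:R <= q * #|[set j | (t w <= W w j 0)%R]%SET|%:R)%R]).
  apply: measurableI; first exact: measurable_set_lt.
  by apply: measurable_set_le => //; [exact: measurable_funD|exact: measurable_funM].
apply/seteqP; split=> w /=; rewrite /fdr_ratio_le.
  by move=> /andP[h]; rewrite ltr0n h ler_pdivrMr ?ltr0n.
by move=> [h]; rewrite ltr0n in h; rewrite h/= ler_pdivrMr ?ltr0n.
Qed.

(** Selection as a finite existential over candidate thresholds, a form in which measurability is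
    visible. *)
Lemma knockoff_selectP p q (W : 'cV[R]_p) j :
  reflect (exists i, [/\ W i 0 != 0, fdr_ratio_le q W `|W i 0| & `|W i 0| <= W j 0])
    (j \in knockoff_select q W).
Proof.
rewrite inE; apply: (iffP idP) => [|[i [i0 fi ij]]]; last first.
  apply: (@le_trans _ _ (`|W i 0|)%:E); last by rewrite lee_fin.
  by apply: (@Order.TotalTheory.bigmin_le_cond _ _ _ +oo%E i); rewrite i0.
rewrite leNgt => jl; apply: contrapT => H; move/negP: jl; apply.
apply/bigmin_gtP; split=> [|i /andP[i0 fi]]; first exact: ltry.
by rewrite lte_fin ltNge; apply/negP => ij; apply: H; exists i.
Qed.

Lemma measurable_knockoff_select p q (W : T -> 'cV[R]_p) j : random_mx W ->
  measurable [set w | j \in knockoff_select q (W w)].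
Proof.
move=> mW; pose S i := [set w | W w i 0 != 0] `&`
  [set w | fdr_ratio_le q (W w) `|W w i 0|] `&` [set w | `|W w i 0| <= W w j 0].
have mabs i : measurable_fun setT (fun w => `|W w i 0|).
  by apply: measurableT_comp => //; exact: mW.
rewrite (_ : [set w | _] = [set w | exists i, S i w]).
  apply: measurable_exists => i; apply: measurableI; first apply: measurableI.
  - rewrite (_ : [set w | _] = [set w | 0 < `|W w i 0|]); first exact: measurable_set_lt.
    by apply/seteqP; split=> w /=; rewrite normr_gt0.
  - exact: measurable_fdr_ratio_le.
  - by apply: measurable_set_le => //; exact: mW.
apply/seteqP; split=> w /=; first by move=> /knockoff_selectP[i [? ? ?]]; exists i.
by move=> [i [[? ?] ?]]; apply/knockoff_selectP; exists i.
Qed.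

Lemma random_lcd_stat p (b : T -> 'cV[R]_(p + p)) : random_mx b ->
  random_mx (fun w => lcd_stat (b w)).
Proof.
move=> mb i j; under eq_fun do rewrite mxE.
by apply: measurable_funB; apply: measurableT_comp => //; exact: mb.
Qed.

End RandomSelection.

Section BadDesign.
Context {R : realType} {d : measure_display} {T : measurableType d}.
Notation GR := (measurableTypeR R).
Variables (m k : nat) (A : T -> 'M[R]_k) (M : T -> {set 'I_k}) (e : T -> 'cV[R]_m).
Variables (C delta t r : R) (N : nat).

(** A subset of a product space: the first component fixes A, the reduced model and the noise, and
    the sections in the white component are bounded uniformly, as [indep_conditional_bound]
    requires. *)
Definition bad_design : set (T * m.-tuple (k.-tuple GR)) :=
  [set z | ~ (gram_close delta (A z.1) (design_of (white_mx z.2) (A z.1)) /\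
    forall j, `|null_iterate (M z.1) (A z.1) C t (e z.1) N (white_mx z.2) j 0| < r)].

Lemma measurable_bad_design : random_mx A -> random_mx e ->
  (forall i, measurable [set w | i \in M w]) -> measurable bad_design.
Proof.
move=> mA me mM; pose D := (T * m.-tuple (k.-tuple GR))%type.
have mA' : random_mx (fun z : D => A z.1) by move=> i j; exact: measurableT_comp (mA i j) measurable_fst.
have me' : random_mx (fun z : D => e z.1) by move=> i j; exact: measurableT_comp (me i j) measurable_fst.
have mM' i : measurable [set z : D | i \in M z.1].
  rewrite (_ : [set z | _] = [set w | i \in M w] `*` setT); first exact: measurableX.
  by apply/seteqP; split=> z //= -[].
have mH : random_mx (fun z : D => design_of (white_mx z.2) (A z.1)).
  apply: random_mxZ => //; apply: random_mx_mul => //.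
  by move=> i j; exact: measurableT_comp (random_white_mx i j) measurable_snd.
have mu : random_mx (fun z : D => null_iterate (M z.1) (A z.1) C t (e z.1) N (white_mx z.2)).
  exact: random_mx_ista_iter.
apply: measurableC; apply: measurableI; first exact: measurable_gram_close.
apply: measurable_forall => j; apply: measurable_set_lt => //.
by apply: measurableT_comp => //; exact: mu.
Qed.

Lemma bad_design_section c E x : (0 < m)%N -> 0 < c -> c <= C ->
  random_mx A -> random_mx e -> (forall i, measurable [set w | i \in M w]) ->
  (forall b, c * dot b b <= dot (A x *m b) (A x *m b) <= C * dot b b) ->
  0 < delta <= 4 * C -> delta * #|M x|%:R <= c / 4 -> 0 <= t -> 0 < E -> 0 <= r ->
  norm2 (e x) <= E ->
  (white_law m k (xsection bad_design x) <=
   ((k * k * 4)%:R * expR (- (m%:R * delta ^+ 2 / (16 * (4 * C) ^+ 2))) +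
    (k * 2)%:R * expR (- (r ^+ 2 / (2 * null_lipschitz m c C E ^+ 2))))%:E)%E.
Proof.
move=> m0 c0 cC mA me mM AC d0 dM t0 E0 r0 eE.
have C0 : 0 < C by exact: lt_le_trans cC.
have AC' b : dot (A x *m b) (A x *m b) <= C * dot b b by have /andP[] := AC b.
have dd : 0 < delta by have /andP[] := d0.
rewrite EFinD; have h1 := white_law_gram_fail C0 AC' m0 d0.
have h2 := null_iterate_deviation N m0 c0 cC AC dd dM t0 E0 eE r0.
apply: le_trans (leeD h1 h2).
set S1 := [set y | ~ _]; set S2 := [set y | _ /\ _].
have mH : random_mx (fun y : m.-tuple (k.-tuple GR) => design_of (white_mx y) (A x)).
  apply: random_mxZ => //; apply: random_mx_mul; [exact: random_white_mx|exact: random_mx_cst].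
have mG : measurable [set y : m.-tuple (k.-tuple GR) | gram_close delta (A x) (design_of (white_mx y) (A x))].
  by apply: measurable_gram_close => //; exact: random_mx_cst.
have mS1 : measurable S1 by exact: measurableC mG.
have mS2 : measurable S2.
  apply: measurableI => //; apply: measurable_exists => j; apply: measurable_set_le => //.
  have mu : random_mx (fun y : m.-tuple (k.-tuple GR) => null_iterate (M x) (A x) C t (e x) N (white_mx y)).
    exact: random_null_iterate.
  by apply: measurableT_comp => //; exact: mu.
apply: (@le_trans _ _ (white_law m k (S1 `|` S2))); last exact: measureU2.
apply: le_measure; rewrite ?inE.
- by apply: measurable_xsection; exact: measurable_bad_design.
- exact: measurableU.
move=> y /xsectionP /= H; have [g|g] := pselect (gram_close delta (A x) (design_of (white_mx y) (A x))); last by left.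
right; split=> //; apply: contrapT => ne; apply: H; split=> // j.
by rewrite ltNge; apply/negP => rj; apply: ne; exists j.
Qed.

End BadDesign.

Section FoldMeasurability.
Context {R : realType} {d : measure_display} {T : measurableType d}.

Lemma random_fold2 m k (pi : T -> 'S_(m + m)) (e : T -> 'M[R]_(m + m, k)) :
  random_mx e -> (forall sg, measurable [set w | pi w = sg]) ->
  random_mx (fun w => fold2 (pi w) (e w)).
Proof.
move=> me mpi i j _ B mB; rewrite setTI.
rewrite (_ : _ @^-1` B = \bigcup_(s in [set` [set: 'S_(m + m)]%SET])
   ((fun w => fold2 s (e w) i j) @^-1` B `&` [set w | pi w = s])).
  apply: fin_bigcup_measurable => [|s _]; first exact: finite_finset.
  apply: measurableI => //; rewrite -[X in measurable X]setTI.
  under eq_fun do rewrite mxE; exact: me.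
by apply/seteqP; split=> w /=; [move=> ?; exists (pi w); rewrite /= ?finset.in_setT|by move=> [s _] [H ws]; move: H; rewrite -ws].
Qed.

Lemma random_design_factor p (s : 'rV[R]_p) (W : 'M[R]_p) (Om BO : T -> 'M[R]_p) :
  random_mx Om -> random_mx BO ->
  random_mx (fun w => design_factor s (Om w) W (BO w)).
Proof.
move=> mOm mBO; apply: random_mx_col; apply: random_mx_row => //; try exact: random_mx_cst.
apply: random_mx_mul; first exact: random_mx_cst.
apply: random_mx_tr; apply: random_mxB; first exact: random_mx_cst.
by apply: random_mx_mul => //; exact: random_mx_cst.
Qed.

End FoldMeasurability.

(** * Lower bound on the conditional power at a fixed n *)

Section FiniteSample.
Context {R : realType} {d : measure_display} {T : measurableType d}.
Variable P : probability T R.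
Variables (m p K L N : nat) (q lambda tau lo hi lo2 kappa delta E r : R).
Variables (beta : 'cV[R]_p) (Omega0 : 'M[R]_p) (s : 'rV[R]_p) (B : 'M[R]_p -> 'M[R]_p).
Variables (X : T -> 'M[R]_(m + m, p)) (eps : T -> 'cV[R]_(m + m))
  (pi : T -> 'S_(m + m)) (Z : T -> 'M[R]_(m, p)).
Variables (Omegahat : T -> 'M[R]_p) (Stilde : T -> {set 'I_p}) (bhat : T -> 'cV[R]_(p + p)).

Let Y w := X w *m beta + eps w.
Let first_fold w := fold1 (pi w) (row_mx (X w) (Y w)).
Let c := design_lower hi lo2.
Let C := design_upper lo hi + design_lower hi lo2.
Let delta0 := 256 * lambda ^+ 2 / (c ^+ 2 * tau ^+ 2).

Hypothesis m0 : (0 < m)%N.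
Hypothesis q0 : 0 <= q.
Hypothesis tau0 : 0 < tau.
Hypothesis lambda0 : 0 < lambda.
Hypothesis lo0 : 0 < lo.
Hypothesis hi0 : 0 < hi.
Hypothesis lo20 : 0 < lo2.
Hypothesis kappa0 : 0 < kappa.
Hypothesis E0 : 0 < E.
Hypothesis Opos : posdef Omega0.
Hypothesis Oeig : forall x, eigenvalue Omega0 x -> lo <= x <= hi.
Hypothesis Odiag : forall j, invmx Omega0 j j = 1.
Hypothesis s_ge0 : forall j, 0 <= s 0 j.
Hypothesis spos : posdef (invmx Omega0 - 2^-1 *: diag_mx s).
Hypothesis keig : forall x, eigenvalue (knockoff_cov s Omega0) x -> lo2 <= x.
Hypothesis NX : iid_normal_rows P (invmx Omega0) X.
Hypothesis NZ : iid_normal_rows P 1%:M Z.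
Hypothesis ieps : iid_components P eps.
Hypothesis seps : forall i, sub_gaussian P kappa (fun w => eps w i 0).
Hypothesis mpi : forall sg, measurable [set w | pi w = sg].
Hypothesis indep : independent_seq P [:: sigma_mx X; sigma_mx eps; sigma_fin pi; sigma_mx Z].
Hypothesis OmegahatY : sigma_mx Omegahat `<=` sigma_mx first_fold.
Hypothesis BY : sigma_mx (fun w => B (Omegahat w)) `<=` sigma_mx first_fold.
Hypothesis StildeY : sigma_fin Stilde `<=` sigma_mx first_fold.
Hypothesis StildeK : forall w, (#|Stilde w| <= K)%N.
Hypothesis Bvalid : valid_construction s B.
Hypothesis mbhat : random_mx bhat.
Hypothesis lassob : forall w, is_lasso lambda (Stilde w) (fold2 (pi w) (X w))
  (knockoff s B (Omegahat w) (fold2 (pi w) (X w)) (Z w)) (fold2 (pi w) (Y w)) (bhat w).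
Hypothesis supp0 : (0 < #|supp beta|)%N.
Hypothesis beta_large : forall j, j \in supp beta -> 4 * tau <= `|beta j 0|.
Hypothesis delta_bound : 0 < delta <= 4 * C.
Hypothesis deltaK : delta * (K + K)%:R <= c / 4.
Hypothesis rsmall : r <= Num.min 1 (lo2 / 8).
Hypothesis iterN : ista_rate (c / 4) C ^+ N * (Num.sqrt C * E) <= lambda.
Hypothesis slack : 1 + delta0 * #|supp beta|%:R <= q * ((1 - delta0) * #|supp beta|%:R).

Let k := (p + p)%N.
Let E1 := [set w | supp beta \subset Stilde w].
Let near := [set w | precision_nbhd Omega0 L r (Omegahat w)].
Hypothesis PE1 : (0 < P E1)%E.

Definition design_failure : R :=
  (k * k * 4)%:R * expR (- (m%:R * delta ^+ 2 / (16 * (4 * C) ^+ 2))) +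
  (k * 2)%:R * expR (- ((tau / 2) ^+ 2 / (2 * null_lipschitz m c C E ^+ 2))).

Let G := first_base beta X eps pi.
(** The sample space with only the information frozen while the white second fold varies: first
    fold, noise and split. *)
Let TG := g_sigma_algebraType G.
Let mX : random_mx X. Proof. by case: NX. Qed.
Let meps : random_mx eps. Proof. by case: ieps. Qed.

Let GM : G `<=` measurable. Proof. exact: (first_base_measurable NX meps mpi). Qed.

Let first_fold_G : sigma_mx first_fold `<=` <<s G >>.
Proof.
apply: smallest_sub; first exact: smallest_sigma_algebra.
by move=> A bA; apply: sub_sigma_algebra; left; left.
Qed.

Let random_first n1 n2 (V : T -> 'M[R]_(n1, n2)) :
  sigma_mx V `<=` sigma_mx first_fold -> random_mx (V : TG -> _).
Proof.
move=> VY; apply: random_mx_sub => A bA; apply: first_fold_G; apply: VY.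
exact: sub_sigma_algebra.
Qed.

Let mpiG sg : @measurable _ TG [set w | pi w = sg].
Proof.
apply: sub_sigma_algebra; right; exists [set sg]%SET.
by apply/seteqP; split=> w /=; rewrite finset.in_set1 => /eqP.
Qed.

Let mepsG : random_mx (eps : TG -> _).
Proof. by apply: random_mx_sub => A bA; apply: sub_sigma_algebra; left; right. Qed.

Let mStilde (Q : {set 'I_p} -> bool) : sigma_mx first_fold [set w | Q (Stilde w)].
Proof.
apply: StildeY; exists [set A | Q A]%SET.
by apply/seteqP; split=> w /=; rewrite finset.in_set.
Qed.

Let scaled w := scaled_noise (fold2 (pi w) (eps w)).

Let mscaled : random_mx (scaled : TG -> _).
Proof. by apply: random_mxZ => //; exact: random_fold2. Qed.

Let fP A : measurable A -> P A \is a fin_num.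
Proof. by move=> mA; exact: fin_num_measure. Qed.

Let n0 : 0 < (m + m)%:R :> R. Proof. by rewrite ltr0n addn_gt0 m0. Qed.

Let c0 : 0 < c. Proof. exact: design_lower_gt0. Qed.

Let cC : c <= C. Proof. by rewrite lerDr; exact: design_upper_ge0. Qed.

Let C0 : 0 < C. Proof. exact: lt_le_trans cC. Qed.

Let slack1 : 0 < 1 - delta0.
Proof.
have s0 : 0 < #|supp beta|%:R :> R by rewrite ltr0n.
have d0 : 0 <= delta0 by rewrite /delta0; apply: divr_ge0; apply: mulr_ge0; rewrite ?sqr_ge0.
rewrite ltNge; apply/negP => d1.
have : q * ((1 - delta0) * #|supp beta|%:R) <= 0 by rewrite mulr_ge0_le0// mulr_le0_ge0// ltW.
have : 0 <= delta0 * #|supp beta|%:R by rewrite mulr_ge0.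
by have := slack; lra.
Qed.

Let mE1 : measurable E1.
Proof. by apply: (measurable_sub_type GM); apply: first_fold_G; exact: (mStilde (fun S => supp beta \subset S)). Qed.

Let mnearG : @measurable _ TG near.
Proof. by apply: measurable_precision_nbhd; exact: random_first. Qed.

Let quiet := [set w | norm2 (scaled w) <= E].

Let quietE w : norm2 (scaled w) <= E <-> norm2 (fold2 (pi w) (eps w)) ^+ 2 <= E ^+ 2 * (m + m)%:R.
Proof.
rewrite ler_norm2_dotvv ?(ltW E0)// dotvv /scaled /scaled_noise -dotvv dotZl dotZr dotvv mulrA.
rewrite -invfM -expr2 sqr_sqrtr ?ler0n// mulrC ler_pdivrMr//.
Qed.

Let tpp_hat w : R := tpp (knockoff_select q (lcd_stat (bhat w))) (supp beta).

(** Inside E1 and [near], the complement of the good event is loud noise or a bad design. The first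
    is bounded by the noise tail given E1, the second by independence given [A0]; both losses are
    multiples of P(E1). *)
Let good_bound : exists2 good : set T, measurable good /\ good `<=` E1 `&` [set w | 1 - delta0 <= tpp_hat w] &
  (P (near `&` E1) <= P good + (kappa ^+ 2 / E ^+ 2 + design_failure)%:E * P E1)%E.
Proof.
have [W Wu WS] : exists2 W, W \in unitmx & W^T *m invmx Omega0 *m W = 1%:M.
  apply: posdef_whitening; have /posdefE[OT Op] := Opos.
  have Ou := posdef_unitmx Opos.
  apply/posdefE; split=> [|v v0]; first by rewrite trmx_inv OT.
  have v'0 : invmx Omega0 *m v != 0.
    by apply: contra_neq v0 => v0; rewrite -[v](mulKVmx Ou) v0 mulmx0.
  have := Op _ v'0; rewrite mulKVmx// dotC.
  by [].
pose A w := design_factor s (Omegahat w) W (B (Omegahat w)).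
pose M w := knockoff_mask (Stilde w).
pose bad := bad_design (A : TG -> _) M scaled C delta (lambda / (2 * C)) (tau / 2) N.+1.
have mA : random_mx (A : TG -> _) by apply: random_design_factor; exact: random_first.
have mM i : @measurable _ TG [set w | i \in M w].
  have -> : [set w | i \in M w] = [set w | i \in knockoff_mask (Stilde w)] by [].
  by apply: first_fold_G; exact: (mStilde (fun S => i \in knockoff_mask S)).
have mbad : measurable bad by exact: measurable_bad_design.
(* Measurable for [TG], hence independent of the white second fold although [quiet] involves
   second-fold noise. *)
pose A0 := E1 `&` near `&` quiet.
have mA0 : @measurable _ TG A0.
  apply: measurableI; first apply: measurableI => //.
    by apply: first_fold_G; exact: (mStilde (fun S => supp beta \subset S)).
  have -> : quiet = [set w | dot (scaled w) (scaled w) <= E ^+ 2].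
    by apply/seteqP; split=> w; rewrite /quiet/= ler_norm2_dotvv// ltW.
  by apply: measurable_set_le => //; exact: measurable_dot.
have AC w : near w -> forall b, c * dot b b <= dot (A w *m b) (A w *m b) <= C * dot b b.
  move=> [Op _ Or] b; have Or' := le_trans Or rsmall.
  have BB := Bvalid (knockoff_cov_possemidef lo20 Opos Odiag s_ge0 spos keig Op Or').
  rewrite (design_factor_ge lo0 hi0 lo20 Opos Oeig Odiag s_ge0 spos keig Op Or' Wu WS BB)/=.
  apply: (le_trans (design_factor_le lo0 hi0 Opos Oeig Odiag s_ge0 spos Op Or' Wu WS BB b)).
  by rewrite ler_wpM2r ?dotvv_ge0// lerDl ltW.
pose xi := white_second_fold W X pi Z.
have mxi : measurable_fun setT xi by exact: (measurable_white_second_fold W NX NZ mpi).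
have mid : measurable_fun setT (id : T -> TG) by exact: measurable_id_sub.
have ind A' B' : measurable (A' : set TG) -> measurable B' ->
    P ((id : T -> TG) @^-1` A' `&` xi @^-1` B') = (P ((id : T -> TG) @^-1` A') * white_law m k B')%E.
  move=> sA mB; exact: (first_second_indep (beta := beta) NX NZ meps mpi indep Wu WS (A := A') (B := B') sA mB).
have eta0 : 0 <= design_failure by rewrite addr_ge0// mulr_ge0// expR_ge0.
have badP := indep_conditional_bound mid mxi ind eta0 mA0 mbad.
have {}badP : (P (A0 `&` [set w | bad (w, xi w)]) <= design_failure%:E * P A0)%E.
  apply: badP => x [[xE xn] xq].
  rewrite /design_failure /bad; apply: bad_design_section => //.
  - exact: AC.
  - rewrite card_knockoff_mask; apply: le_trans deltaK.
    by rewrite ler_wpM2l ?ler_nat ?leq_add//; have /andP[/ltW] := delta_bound.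
  - by rewrite divr_ge0 ?mulr_ge0// ltW.
  - by rewrite divr_ge0// ltW.
have mA0' : measurable A0 by exact: (measurable_sub_type GM).
have mbad' : measurable [set w | bad (w, xi w)].
  have mp : measurable_fun setT (fun w => ((id : T -> TG) w, xi w)) by exact: (measurable_fun_pair mid mxi).
  by rewrite -[X in measurable X]setTI; exact: (mp measurableT _ mbad).
exists (A0 `\` [set w | bad (w, xi w)]).
  split; first exact: measurableD.
  move=> w [[[wE wn] wq] wbad]; split=> //.
  have [g nul] : gram_close delta (A w) (design_of (second_white W X Z (pi w) w) (A w)) /\
     forall j, `|null_reference lambda C (Stilde w) (second_white W X Z (pi w) w) (A w) (fold2 (pi w) (eps w)) N j 0| < tau / 2.
    apply: contrapT => H; apply: wbad; move: H; rewrite /bad /bad_design /xi /white_second_fold/= tuple_of_mxK.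
    exact.
  have [Op _ Or] := wn; have Or' := le_trans Or rsmall.
  have [d1 d2] := andP delta_bound.
  rewrite /= /tpp_hat /delta0.
  apply: (good_point_tpp (C := C) (delta := delta) (E := E) (S := Stilde w) (A := A w)
    (V := second_white W X Z (pi w) w) (X2 := fold2 (pi w) (X w))
    (Xk := knockoff s B (Omegahat w) (fold2 (pi w) (X w)) (Z w))
    (eps2 := fold2 (pi w) (eps w)) (N := N)) => //.
  - by rewrite /knockoff (design_factorE _ _ _ Wu).
  - exact: AC.
  - apply: le_trans deltaK.
    by rewrite ler_wpM2l ?ler_nat ?leq_add// ltW.
  - have -> : fold2 (pi w) (X w) *m beta + fold2 (pi w) (eps w) = fold2 (pi w) (Y w).
      by apply/matrixP => i j; rewrite !mxE; congr (_ + _); apply: eq_bigr => l _; rewrite mxE.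
    exact: lassob.
have mtail : measurable [set w | (E ^+ 2 * (m + m)%:R < norm2 (fold2 (pi w) (eps w)) ^+ 2)%R].
  apply: measurable_set_lt => //.
  have := measurable_dot (random_fold2 meps mpi) (random_fold2 meps mpi).
  by under eq_fun do rewrite dotvv.
have mnear : measurable near by exact: (measurable_sub_type GM).
apply: (@le_trans _ _ (P (A0 `\` [set w | bad (w, xi w)]) +
   (P (E1 `&` [set w | (E ^+ 2 * (m + m)%:R < norm2 (fold2 (pi w) (eps w)) ^+ 2)%R]) +
    P (A0 `&` [set w | bad (w, xi w)])))%E).
  set S1 := A0 `\` _; set S2 := E1 `&` _; set S3 := A0 `&` _.
  have mS1 : measurable S1 by exact: measurableD.
  have mS2 : measurable S2 by exact: measurableI.
  have mS3 : measurable S3 by exact: measurableI.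
  have h1 := measureU2 P mS1 (measurableU _ _ mS2 mS3).
  have h2 := measureU2 P mS2 mS3.
  apply: (le_trans _ (leeD (lexx (P S1)) h2)); apply: (le_trans _ h1).
  apply: le_measure; rewrite ?inE; [exact: measurableI|by apply: measurableU => //; exact: measurableU|].
  move=> w [wn wE]; have [wq|wq] := pselect (quiet w).
    have [wb|wb] := pselect (bad (w, xi w)); last by left; split.
    by right; right; split.
  right; left; split=> //=; rewrite ltNge; apply/negP => h; apply: wq.
  by apply/quietE.
apply: leeD => //; rewrite EFinD ge0_muleDl ?lee_fin ?divr_ge0 ?sqr_ge0//; apply: leeD.
  have t0 : 0 < E ^+ 2 * (m + m)%:R by rewrite mulr_gt0 ?exprn_gt0.
  have := second_fold_noise_tail mX ieps mpi indep kappa0 t0 seps (mStilde (fun S => supp beta \subset S)).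
  move/le_trans; apply; rewrite le_eqVlt; apply/orP; left; apply/eqP; congr (_%:E * _)%E.
  have m0' : 0 < m%:R :> R by rewrite ltr0n.
  by rewrite natrD; field; rewrite !gt_eqF//= addr_gt0.
apply: (le_trans badP); apply: lee_wpmul2l; first by rewrite lee_fin.
by apply: le_measure; rewrite ?inE// => w [[]].
Qed.

Let mtpp : measurable_fun setT tpp_hat.
Proof.
apply: measurable_tpp => j; apply: measurable_knockoff_select.
exact: random_lcd_stat.
Qed.

Let PE1' : 0 < fine (P E1).
Proof. by rewrite fine_gt0// PE1 ltey_eq fP. Qed.

Let int_tpp : (\int[P]_(w in E1) (tpp_hat w)%:E \is a fin_num)%E /\
  ((\int[P]_(w in E1) (tpp_hat w)%:E <= P E1)%E).
Proof.
have h0 : (0 <= \int[P]_(w in E1) (tpp_hat w)%:E)%E.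
  by apply: integral_ge0 => w _; rewrite lee_fin tpp_ge0.
have h1 : (\int[P]_(w in E1) (tpp_hat w)%:E <= P E1)%E.
  rewrite -[leRHS]mul1e -integral_cst//; apply: ge0_le_integral => //.
  - by move=> w _; rewrite lee_fin tpp_ge0.
  - by apply/measurable_EFinP; exact: measurable_funTS.
  - by move=> w _; rewrite lee_fin tpp_le1.
by split=> //; rewrite ge0_fin_numE// (le_lt_trans h1)// ltey_eq fP.
Qed.

Lemma cond_expect_tpp_le1 : cond_expect P E1 tpp_hat <= 1.
Proof.
rewrite /cond_expect ler_pdivrMr// mul1r /Rintegral.
by have [h1 h2] := int_tpp; apply: fine_le => //; exact: fP.
Qed.

Lemma cond_expect_tpp_ge :
  (1 - delta0) * (cond_prob P E1 near - kappa ^+ 2 / E ^+ 2 - design_failure)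
  <= cond_expect P E1 tpp_hat.
Proof.
have [good [mgood goodE] goodP] := good_bound.
have mnear : measurable near by exact: (measurable_sub_type GM).
have [h1 h2] := int_tpp.
have lower : (((1 - delta0)%:E * P good) <= \int[P]_(w in E1) (tpp_hat w)%:E)%E.
  rewrite -integral_cst//; apply: (@le_trans _ _ (\int[P]_(w in good) (tpp_hat w)%:E)%E).
    apply: ge0_le_integral => //.
    - by move=> w _; rewrite /= lee_fin ltW.
    - by apply/measurable_EFinP; exact: measurable_funTS.
    - by move=> w gw; rewrite lee_fin; have [] := goodE _ gw.
  apply: ge0_subset_integral => //.
  - by apply/measurable_EFinP; exact: measurable_funTS.
  - by move=> w _; rewrite lee_fin tpp_ge0.
  - by move=> w /goodE[].
have fgood := fP mgood; have fE1 := fP mE1.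
have fnear : P (near `&` E1) \is a fin_num by apply: fP; exact: measurableI.
rewrite /cond_expect /Rintegral /cond_prob ler_pdivlMr//.
have {lower} : (1 - delta0) * fine (P good) <= fine (\int[P]_(w in E1) (tpp_hat w)%:E)%E.
  by rewrite -lee_fin EFinM !fineK.
apply: le_trans; rewrite -mulrA ler_wpM2l ?(ltW slack1)//.
move: goodP; rewrite -(fineK fnear) -(fineK fgood) -(fineK fE1) -EFinM -EFinD lee_fin fineK//.
have -> : (fine (P (near `&` E1)) / fine (P E1) - kappa ^+ 2 / E ^+ 2 - design_failure) * fine (P E1) =
  fine (P (near `&` E1)) - (kappa ^+ 2 / E ^+ 2 + design_failure) * fine (P E1).
  move: design_failure => x1; rewrite !mulrBl divfK ?gt_eqF// mulrDl.
  by rewrite opprD addrA.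
by rewrite !fineK//; lra.
Qed.

End FiniteSample.

(** * Asymptotics *)

Section Asymptotics.
Context {R : realType}.

Lemma expR_ln_le (j p : nat) (x : R) : (0 < p)%N -> j%:R * ln p%:R <= x ->
  expR (- x) <= (p%:R ^+ j)^-1.
Proof.
move=> p0 jx; rewrite expRN lef_pV2 ?posrE ?expR_gt0 ?exprn_gt0 ?ltr0n//.
by apply: le_trans (_ : expR (j%:R * ln p%:R) <= _); rewrite ?ler_expR// expRM_natl lnK// posrE ltr0n.
Qed.

Lemma expr_lt_exists (rho Q y : R) : 0 <= rho < 1 -> 0 < y ->
  exists N : nat, rho ^+ N * Q <= y.
Proof.
move=> /andP[r0 r1] y0; have rn : `|rho| < 1 by rewrite ger0_norm.
have h : (fun N => rho ^+ N * Q) @ \oo --> 0.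
  by rewrite -[0](mul0r Q); apply: cvgM; [exact: cvg_expr|exact: cvg_cst].
have [N _ HN] := cvgr_le _ h _ y0.
by exists N; exact: (HN N (leqnn N)).
Qed.

Lemma cvg_powRN (p : nat -> nat) (c : R) : 0 < c -> p @ \oo --> \oo ->
  (p m)%:R `^ (- c) @[m --> \oo] --> (0 : R).
Proof.
move=> c0 poo.
have h : ((p m)%:R `^ c : R) @[m --> \oo] --> +oo.
  apply/cvgryPge => A; pose A' := Num.max A 0.
  have [n An] : exists n : nat, A' `^ c^-1 <= n%:R.
    exists (Num.bound (A' `^ c^-1)); apply/ltW.
    by apply: archi_boundP; exact: powR_ge0.
  have /cvgnyPge/(_ n) := poo; apply: filterS => m nm.
  apply: (@le_trans _ _ ((A' `^ c^-1) `^ c)).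
    by rewrite -powRrM mulVf ?gt_eqF// powRr1 ?le_max ?lexx ?orbT.
  apply: ge0_ler_powR; rewrite ?nnegrE ?powR_ge0 ?(ltW c0)//.
  by apply: (le_trans An); rewrite ler_nat.
under eq_fun do rewrite powRN.
apply/gtr0_cvgV0 => //; have /cvgryPge/(_ 1) := h; apply: filterS => m.
by apply: lt_le_trans.
Qed.

Lemma cvg_natV (p : nat -> nat) : p @ \oo --> \oo ->
  (p m)%:R^-1 @[m --> \oo] --> (0 : R).
Proof.
move=> poo; apply/gtr0_cvgV0.
  by have /cvgnyPge/(_ 1%N) := poo; apply: filterS => m; rewrite ltr0n.
apply/cvgryPge => A; have /cvgnyPge/(_ (Num.bound `|A|)) := poo; apply: filterS => m Am.
apply: (le_trans (ler_norm _)); apply: (le_trans (ltW (archi_boundP _))) => //.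
by rewrite ler_nat.
Qed.

(** With k = 2 p, the Gram term has the factor 16 p^2 and needs an exponential below p^-3; the
    choice delta = c / (8 K) gives this once K^2 log p / n is small. The null term has the factor 4
    p and needs p^-2; its exponent is a constant times kap log p, so kap large suffices. *)
Lemma design_failure_le (m p K : nat) (lo hi lo2 kap : R) :
  let c := design_lower hi lo2 in
  let C := design_upper lo hi + design_lower hi lo2 in
  let l := Num.sqrt (ln p%:R / (m + m)%:R) in
  (0 < m)%N -> (1 < p)%N -> (0 < K)%N -> 0 < kap -> 0 < c -> c <= C ->
  (K%:R * l) ^+ 2 <= c ^+ 2 / (6 * 8 ^+ 2 * (16 * (4 * C) ^+ 2)) ->
  2 * (2 * 9 * 8 ^+ 2) / (C * (1 - ista_rate (c / 4) C) ^+ 4) <= kap ->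
  design_failure m p (kap * l / 4) lo hi lo2 (c / (8 * K%:R)) (Num.sqrt kap) <= 20 * p%:R^-1.
Proof.
move=> c C l m0 p1 K0 kap0 c0 cC small large.
have C0 : 0 < C by exact: lt_le_trans cC.
have p0 : 0 < p%:R :> R by rewrite ltr0n ltnW.
have p_ge1 : 1 <= p%:R :> R by rewrite ler1n ltnW.
have n0 : 0 < m%:R :> R by rewrite ltr0n.
have K0' : 0 < K%:R :> R by rewrite ltr0n.
have L0 : 0 < ln p%:R :> R by apply: ln_gt0; rewrite ltr1n.
have l2 : l ^+ 2 = ln p%:R / (m + m)%:R by rewrite sqr_sqrtr// divr_ge0// ltW.
have r1 : 0 < 1 - ista_rate (c / 4) C.
  rewrite subr_gt0 ista_rate_lt1 ?divr_gt0//.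
  by apply: le_trans cC; rewrite ler_pdivrMr// ler_peMr ?(ltW c0)//; lra.
set rho := 1 - _ in r1 large.
rewrite /design_failure -/c -/C.
have -> : 20 * p%:R^-1 = 16 * p%:R^-1 + 4 * p%:R^-1 :> R by rewrite -mulrDl; congr (_ * _); ring.
apply: lerD.
  have h : expR (- (m%:R * (c / (8 * K%:R)) ^+ 2 / (16 * (4 * C) ^+ 2))) <= (p%:R ^+ 3)^-1 :> R.
    apply: expR_ln_le; first exact: ltnW.
    rewrite exprMn l2 natrD in small.
    have D0 : 0 < 16 * (4 * C) ^+ 2 by rewrite mulr_gt0 ?exprn_gt0 ?mulr_gt0.
    move: (16 * (4 * C) ^+ 2) D0 small => D D0 small.
    have e0 : 0 < 6 * 8 ^+ 2 * D by rewrite !mulr_gt0 ?exprn_gt0.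
    have nn : 0 < m%:R + m%:R :> R by rewrite addr_gt0.
    rewrite (ler_pdivlMr _ _ e0) in small.
    have -> : m%:R * (c / (8 * K%:R)) ^+ 2 / D = c ^+ 2 * (m%:R / (K%:R ^+ 2 * (8 ^+ 2 * D))).
      by field; rewrite !gt_eqF.
    apply: le_trans (ler_wpM2r _ small); last first.
      by rewrite divr_ge0 ?mulr_ge0 ?sqr_ge0 ?exprn_ge0 ?ltW.
    rewrite le_eqVlt; apply/orP; left; apply/eqP.
    by field; rewrite !gt_eqF.
  apply: (le_trans (ler_wpM2l _ h)) => //.
  rewrite !natrM natrD le_eqVlt; apply/orP; left; apply/eqP.
  by field; rewrite gt_eqF.
have h : expR (- ((kap * l / 4 / 2) ^+ 2 / (2 * null_lipschitz m c C (Num.sqrt kap) ^+ 2))) <= (p%:R ^+ 2)^-1 :> R.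
  apply: expR_ln_le; first exact: ltnW.
  have -> : null_lipschitz m c C (Num.sqrt kap) ^+ 2 = 9 * kap / ((m + m)%:R * C * rho ^+ 4).
    rewrite /null_lipschitz -/rho !(exprMn, exprVn) sqr_sqrtr ?(ltW C0)// sqr_sqrtr// sqr_sqrtr ?(ltW kap0)//.
    rewrite natrD; field.
    by rewrite !gt_eqF//= addr_gt0.
  have -> : (kap * l / 4 / 2) ^+ 2 = kap ^+ 2 * (ln p%:R / (m + m)%:R) / 8 ^+ 2.
    by rewrite -l2; field.
  have -> : kap ^+ 2 * (ln p%:R / (m + m)%:R) / 8 ^+ 2 / (2 * (9 * kap / ((m + m)%:R * C * rho ^+ 4))) =
     kap * (C * rho ^+ 4) / (2 * 9 * 8 ^+ 2) * ln p%:R :> R.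
    rewrite natrD; field.
    by rewrite !gt_eqF//= addr_gt0.
  rewrite ler_wpM2r ?(ltW L0)//.
  move: large; rewrite ler_pdivrMr; last by rewrite mulr_gt0 ?exprn_gt0.
  move: (kap * _) => u uu; rewrite ler_pdivlMr; last by rewrite !mulr_gt0 ?exprn_gt0.
  by apply: le_trans uu; rewrite le_eqVlt; apply/orP; left; apply/eqP; ring.
apply: (le_trans (ler_wpM2l _ h)) => //.
rewrite !natrM natrD le_eqVlt; apply/orP; left; apply/eqP.
by field; rewrite gt_eqF.
Qed.

End Asymptotics.

Theorem theorem3 (R : realType)
  (* constants *)
  (q c c2 C2 C3 kappa : R)
  (* dimensions and deterministic parameters; the sample size is n = m + m *)
  (p K L L' : nat -> nat) (a lambda : nat -> R)
  (beta0 : forall m, 'cV[R]_(p m)) (Omega0 : forall m, 'M[R]_(p m))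
  (svec : forall m, 'rV[R]_(p m))
  (B : forall m, 'M[R]_(p m) -> 'M[R]_(p m))
  (* probability spaces, data, random split, knockoff noise *)
  (d : nat -> measure_display) (T : forall m, measurableType (d m))
  (P : forall m, probability (T m) R)
  (X : forall m, T m -> 'M[R]_(m + m, p m))
  (eps : forall m, T m -> 'cV[R]_(m + m))
  (y : forall m, T m -> 'cV[R]_(m + m))
  (pi : forall m, T m -> 'S_(m + m))
  (Z : forall m, T m -> 'M[R]_(m, p m))
  (* output of the first fold, knockoff matrix, Lasso solution *)
  (Omegahat : forall m, T m -> 'M[R]_(p m))
  (Stilde : forall m, T m -> {set 'I_(p m)})
  (Xhat : forall m, T m -> 'M[R]_(m, p m))
  (bhat : forall m, T m -> 'cV[R]_(p m + p m)) :
  (* linear model with Gaussian design *)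
  0 < q -> q < 1 ->
  p @ \oo --> \oo ->
  (forall m, posdef (Omega0 m)) ->
  (forall m j, invmx (Omega0 m) j j = 1) ->
  (forall m, iid_normal_rows (P m) (invmx (Omega0 m)) (@X m)) ->
  (forall m w, y m w = X m w *m beta0 m + eps m w) ->
  (* random split and fresh knockoff noise *)
  (forall m, uniform_fin (P m) (@pi m)) ->
  (forall m, iid_normal_rows (P m) 1%:M (@Z m)) ->
  (forall m, independent_seq (P m)
     [:: sigma_mx (@X m); sigma_mx (@eps m); sigma_fin (@pi m);
         sigma_mx (@Z m)]) ->
  (* the vector s *)
  (forall m j, 0 <= svec m 0 j) ->
  (forall m, posdef (invmx (Omega0 m) - 2^-1 *: diag_mx (svec m))) ->
  (* RANK: Omegahat and Stilde are computed from the first fold *)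
  (forall m, sigma_mx (@Omegahat m) `<=`
     sigma_mx (fun w => fold1 (pi m w) (row_mx (X m w) (y m w)))) ->
  (forall m, sigma_fin (@Stilde m) `<=`
     sigma_mx (fun w => fold1 (pi m w) (row_mx (X m w) (y m w)))) ->
  (forall m, (0 < K m)%N) -> K @ \oo --> \oo ->
  (forall m w, (#|Stilde m w| <= K m)%N) ->
  (* RANK: knockoffs and Lasso on the second fold *)
  (forall m, valid_construction (svec m) (@B m)) ->
  (forall m, sigma_mx (fun w => B m (Omegahat m w)) `<=`
     sigma_mx (fun w => fold1 (pi m w) (row_mx (X m w) (y m w)))) ->
  (forall m w, Xhat m w =
     knockoff (svec m) (@B m) (Omegahat m w) (fold2 (pi m w) (X m w))
       (Z m w)) ->
  (forall m, random_mx (@bhat m)) ->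
  (forall m w, is_lasso (lambda m) (Stilde m w) (fold2 (pi m w) (X m w))
     (Xhat m w) (fold2 (pi m w) (y m w)) (bhat m w)) ->
  (* the conditioning event *)
  (\forall m \near \oo,
     (0 < P m [set w | supp (beta0 m) \subset Stilde m w])%E) ->
  (* no ties, with asymptotic probability one *)
  (exists2 N : forall m, set (T m), forall m, measurable (N m) &
     cond_prob (P m) [set w | supp (beta0 m) \subset Stilde m w] (N m)
       @[m --> \oo] --> (1 : R) /\
     forall m w, N m w ->
       forall (Omega : 'M[R]_(p m)) (S : {set 'I_(p m)})
         (b : 'cV[R]_(p m + p m)),
       precision_nbhd (Omega0 m) (L' m) (C2 * a m) Omega ->
       (#|S| <= K m)%N ->
       is_lasso (lambda m) S (fold2 (pi m w) (X m w))
         (knockoff (svec m) (@B m) Omega (fold2 (pi m w) (X m w)) (Z m w))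
         (fold2 (pi m w) (y m w)) b ->
       no_ties (lcd_stat b) /\ no_ties b) ->
  (* (i) *)
  0 < kappa ->
  (forall m, iid_components (P m) (@eps m)) ->
  (forall m i, sub_gaussian (P m) kappa (fun w => eps m w i 0)) ->
  (* (ii) *)
  (forall m, (0 < #|supp (beta0 m)|)%N) ->
  Num.sqrt ((m + m)%:R / ln ((p m)%:R : R)) *
    inf [set `|beta0 m j 0| | j in [set` supp (beta0 m)]]
    @[m --> \oo] --> +oo ->
  (* (iii) *)
  L @ \oo --> \oo ->
  (forall m, row_sparse (L m) (Omega0 m)) ->
  (exists lo hi : R, 0 < lo /\
     forall m x, eigenvalue (Omega0 m) x -> lo <= x <= hi) ->
  (* (iv) *)
  0 < c2 -> 0 < C2 -> a m @[m --> \oo] --> (0 : R) ->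
  (forall m, (0 < L' m)%N) -> L' @ \oo --> \oo ->
  (exists M : R, \forall m \near \oo,
     1 - cond_prob (P m) [set w | supp (beta0 m) \subset Stilde m w]
           [set w | precision_nbhd (Omega0 m) (L' m) (C2 * a m) (Omegahat m w)]
     <= M * (p m)%:R `^ (- c2)) ->
  (* (v) *)
  (exists2 lo : R, 0 < lo &
     forall m x, eigenvalue (knockoff_cov (svec m) (Omega0 m)) x -> lo <= x) ->
  (* (vi) *)
  (forall m, (q * #|supp (beta0 m)|%:R)^-1 < c) -> c < 1 ->
  (exists2 H : forall m, {set 'I_(p m)},
     forall M : R, \forall m \near \oo, forall j, j \in H m ->
       M <= `|beta0 m j 0| /
            Num.sqrt (#|supp (beta0 m)|%:R * (m + m)%:R^-1 * ln (p m)%:R) &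
     forall m, c * #|supp (beta0 m)|%:R <= #|H m|%:R) ->
  (* (vii) *)
  0 < C3 ->
  (forall m, lambda m = C3 * Num.sqrt (ln (p m)%:R / (m + m)%:R)) ->
  (* rates *)
  (Num.sqrt (L m + L' m)%:R + Num.sqrt (K m)%:R) * a m
    @[m --> \oo] --> (0 : R) ->
  #|supp (beta0 m)|%:R *
    (a m + (K m + L' m)%:R * Num.sqrt ((m + m)%:R^-1 * ln (p m)%:R))
    @[m --> \oo] --> (0 : R) ->
  (* asymptotic power one *)
  cond_expect (P m) [set w | supp (beta0 m) \subset Stilde m w]
    (fun w => tpp (knockoff_select q (lcd_stat (bhat m w))) (supp (beta0 m)))
    @[m --> \oo] --> (1 : R).
Proof.
move=> q0 q1 poo Opos Odiag NX yE upi NZ indep s_ge0 spos OhatY StildeY K0 _ StildeK Bvalid BY XhatE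
  mbhat lassob PE _ kappa0 ieps seps supp0 kapoo _ _ [lo [hi [lo0 Oeig]]] c20 C20 a0 _ _ [M nearP]
  [lo2 lo20 keig] qc c1 _ C30 lambdaE _ rate.
have {}yE m : y m = fun w => X m w *m beta0 m + eps m w by apply/funext => w; exact: yE.
(* The maximum with 1 makes the upper eigenvalue bound positive, as the design bounds require. *)
pose hi' := Num.max hi 1.
have hi0 : 0 < hi' by rewrite lt_max ltr01 orbT.
have {}Oeig m x : eigenvalue (Omega0 m) x -> lo <= x <= hi'.
  by move=> /Oeig/andP[-> xh]; rewrite le_max xh.
pose cl := design_lower hi' lo2; pose C := design_upper lo hi' + cl.
have cl0 : 0 < cl by exact: design_lower_gt0.
have clC : cl <= C by rewrite lerDr; exact: design_upper_ge0.
have C0 : 0 < C by exact: lt_le_trans clC.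
have r1 : 0 <= ista_rate (cl / 4) C < 1.
  rewrite ista_rate_ge0 ista_rate_lt1 ?divr_gt0//.
  by apply: le_trans clC; rewrite ler_pdivrMr// ler_peMr ?(ltW cl0)//; lra.
pose l m : R := Num.sqrt (ln ((p m)%:R : R) / (m + m)%:R).
(* The minimal signal is kap l. It is used with tau = kap l / 4 and noise cut E = sqrt(kap), so that
   tau^2 n / E^2 is of order kap log p. *)
pose kap m : R := Num.sqrt ((m + m)%:R / ln ((p m)%:R : R)) *
  inf [set `|beta0 m j 0| | j in [set` supp (beta0 m)]].
have {}kapoo : kap m @[m --> \oo] --> +oo by [].
(* For tau = kap l / 4 and lambda = C3 l, the proportion of bad coordinates is D / kap^2: the factor
   l cancels. *)
pose D := 256 * (4 * C3 / cl) ^+ 2.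
have D0 : 0 <= D by rewrite mulr_ge0 ?sqr_ge0.
pose E1 m := [set w | supp (beta0 m) \subset Stilde m w].
pose g m : R := (1 - D * (kap m)^-1 ^+ 2) *
  (1 - M * (p m)%:R `^ (- c2) - kappa ^+ 2 * (kap m)^-1 - 20 * (p m)%:R^-1).
have kapV : (kap m)^-1 @[m --> \oo] --> (0 : R).
  by apply/gtr0_cvgV0 => //; have /cvgryPge/(_ 1) := kapoo; apply: filterS => m; exact: lt_le_trans.
have g1 : g m @[m --> \oo] --> (1 : R).
  rewrite -[X in _ --> X](_ : (1 - D * 0 ^+ 2) * (1 - M * 0 - kappa ^+ 2 * 0 - 20 * 0) = 1); last first.
    by rewrite !mulr0 !subr0 expr0n/= mulr0 subr0 mulr1.
  apply: cvgM.
    apply: cvgB; [exact: cvg_cst|apply: cvgM; [exact: cvg_cst|]].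
    by under eq_fun do rewrite expr2; rewrite expr2; exact: cvgM.
  apply: cvgB; last by apply: cvgM; [exact: cvg_cst|exact: cvg_natV].
  apply: cvgB; last by apply: cvgM; [exact: cvg_cst|].
  by apply: cvgB; [exact: cvg_cst|apply: cvgM; [exact: cvg_cst|exact: cvg_powRN]].
(* From the second rate: s >= 1 allows dropping the factor s, then a -> 0 is subtracted and L' >= 0
   dropped. *)
have Kl : (K m)%:R * l m @[m --> \oo] --> (0 : R).
  have h : (a m + (K m + L' m)%:R * l m) @[m --> \oo] --> (0 : R).
    apply/cvgr0Pnorm_le => e e0; move/cvgr0Pnorm_le: (rate) => /(_ e e0); apply: filterS => m.
    apply: le_trans; rewrite [(_^-1 * ln _)]mulrC -/(l m) normrM normr_nat ler_peMl//.
    by rewrite ler1n.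
  have h2 : ((K m + L' m)%:R * l m) @[m --> \oo] --> (0 : R).
    have -> : (fun m => (K m + L' m)%:R * l m) = (fun m => a m + (K m + L' m)%:R * l m - a m).
      by apply/funext => m; rewrite addrAC subrr add0r.
    by rewrite -(subr0 0); exact: cvgB h a0.
  apply: (squeeze_cvgr _ (cvg_cst 0) h2); apply: nearW => m.
  by rewrite mulr_ge0 ?sqrtr_ge0//= ler_wpM2r ?sqrtr_ge0// ler_nat leq_addr.
apply: (squeeze_cvgr (f := g) (h := fun=> 1 : R) _ g1 (cvg_cst _)).
have bnd : 0 < cl ^+ 2 / (6 * 8 ^+ 2 * (16 * (4 * C) ^+ 2)).
  by rewrite divr_gt0 ?exprn_gt0// !mulr_gt0 ?exprn_gt0 ?mulr_gt0.
have small : \forall m \near \oo, ((K m)%:R * l m) ^+ 2 <= cl ^+ 2 / (6 * 8 ^+ 2 * (16 * (4 * C) ^+ 2)).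
  apply: (cvgr_le _ _ _ bnd); rewrite -(mulr0 (0 : R)); under eq_fun do rewrite expr2.
  exact: cvgM.
have near_r : \forall m \near \oo, C2 * a m <= Num.min 1 (lo2 / 8).
  apply: (cvgr_le 0); first by rewrite -(mulr0 C2); apply: cvgM => //; exact: cvg_cst.
  by rewrite lt_min ltr01 divr_gt0.
have /cvgryPge/(_ 1) := kapoo => kap_ge1.
have /cvgryPge/(_ (2 * (2 * 9 * 8 ^+ 2) / (C * (1 - ista_rate (cl / 4) C) ^+ 4))) := kapoo => kap_large.
have /cvgryPge/(_ (D * (1 + q) / (q * (1 - c)))) := kapoo => kap_slack.
have /cvgnyPge/(_ 2%N) := poo => p2.
near=> m.
have m0 : (0 < m)%N by near: m; exact: nbhs_infty_gt.
have p1 : (1 < p m)%N by near: m.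
have k1 : 1 <= kap m by near: m.
have k0 : 0 < kap m by exact: lt_le_trans k1.
have n0 : 0 < (m + m)%:R :> R by rewrite ltr0n addn_gt0 m0.
have L0 : 0 < ln (p m)%:R :> R by apply: ln_gt0; rewrite ltr1n.
have l0 : 0 < l m by rewrite sqrtr_gt0 divr_gt0.
have lam0 : 0 < lambda m by rewrite lambdaE mulr_gt0.
have PEm : (0 < P m (E1 m))%E by near: m.
have mpi sg : measurable [set w | pi m w = sg] by have [] := upi m sg.
have beta_large j : j \in supp (beta0 m) -> 4 * (kap m * l m / 4) <= `|beta0 m j 0|.
  move=> jS; have -> : 4 * (kap m * l m / 4) = kap m * l m by field.
  rewrite /kap mulrAC /l -sqrtrM; last by rewrite divr_ge0// ltW.
  rewrite mulrA divfK ?gt_eqF// divff ?gt_eqF// sqrtr1 mul1r.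
  by apply: ge_inf; [exists 0 => _ [i _ <-]|exists j].
have s0 : 0 < #|supp (beta0 m)|%:R :> R by rewrite ltr0n.
(* The number of iterations may grow with m at any speed, all deviation bounds being uniform in
   it. *)
have [N HN] := expr_lt_exists (Num.sqrt C * Num.sqrt (kap m)) r1 lam0.
have delta0E : 256 * lambda m ^+ 2 / (cl ^+ 2 * (kap m * l m / 4) ^+ 2) = D * (kap m)^-1 ^+ 2.
  by rewrite /D lambdaE -/(l m); field; rewrite !gt_eqF.
(* The lower bound on c gives 1 <= c q s, which pays for the added 1 in the knockoff ratio; the
   remaining q (1 - c) s absorbs the errors (1 + q) D s / kap^2 for kap large. *)
have slack : 1 + D * (kap m)^-1 ^+ 2 * #|supp (beta0 m)|%:R <=
    q * ((1 - D * (kap m)^-1 ^+ 2) * #|supp (beta0 m)|%:R).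
  have h1 : 1 <= c * (q * #|supp (beta0 m)|%:R).
    by rewrite -ler_pdivrMr ?mulr_gt0// div1r; exact: ltW.
  have h2 : D * (kap m)^-1 ^+ 2 * (1 + q) <= q * (1 - c).
    have qc0 : 0 < q * (1 - c) by rewrite mulr_gt0 ?subr_gt0.
    have : D * (1 + q) / (q * (1 - c)) <= kap m by near: m.
    rewrite ler_pdivrMr// => h; rewrite exprVn mulrAC ler_pdivrMr ?exprn_gt0//.
    by apply: (le_trans h); rewrite mulrC ler_wpM2l ?(ltW qc0)// expr2 ler_peMr ?(ltW k0).
  have := ler_wpM2r (ltW s0) h2; move: (D * _) => x; lra.
have BYm := BY m; have OhatYm := OhatY m; have StildeYm := StildeY m.
rewrite yE in BYm OhatYm StildeYm.
apply/andP; split; last first.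
  exact: (cond_expect_tpp_le1 q (NX m) (ieps m) mpi StildeYm (mbhat m) PEm).
have delta_bound : 0 < cl / (8 * (K m)%:R) <= 4 * C.
  have K1 : 1 <= (K m)%:R :> R by rewrite ler1n.
  rewrite divr_gt0 ?mulr_gt0 ?ltr0n//= ler_pdivrMr ?mulr_gt0 ?ltr0n//.
  apply: (le_trans clC); have : C * 1 <= C * (K m)%:R by rewrite ler_wpM2l// ltW.
  by lra.
have deltaK : cl / (8 * (K m)%:R) * (K m + K m)%:R <= cl / 4.
  by rewrite natrD le_eqVlt; apply/orP; left; apply/eqP; field; rewrite gt_eqF ?ltr0n.
have tau0 : 0 < kap m * l m / 4 by apply: divr_gt0 => //; exact: mulr_gt0.
have skap : 0 < Num.sqrt (kap m) by rewrite sqrtr_gt0.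
have lassom w : is_lasso (lambda m) (Stilde m w) (fold2 (pi m w) (X m w))
    (knockoff (svec m) (@B m) (Omegahat m w) (fold2 (pi m w) (X m w)) (Z m w))
    (fold2 (pi m w) (X m w *m beta0 m + eps m w)) (bhat m w).
  by rewrite -XhatE; have := lassob m w; rewrite yE.
have near_rm : C2 * a m <= Num.min 1 (lo2 / 8) by near: m.
have slack' := slack; rewrite -delta0E in slack'.
have := cond_expect_tpp_ge (L' m) m0 (ltW q0) tau0 lam0 lo0 hi0 lo20 kappa0 skap (Opos m)
  (Oeig m) (Odiag m) (s_ge0 m) (spos m) (keig m) (NX m) (NZ m) (ieps m) (seps m) mpi (indep m)
  OhatYm BYm StildeYm (StildeK m) (Bvalid m) (mbhat m) lassom (supp0 m) beta_large delta_bound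
  deltaK near_rm HN slack' PEm.
apply: le_trans; rewrite -/cl delta0E /g ler_wpM2l//.
  have x0 : 0 <= D * (kap m)^-1 ^+ 2 * #|supp (beta0 m)|%:R by apply: mulr_ge0 => //; apply: mulr_ge0 => //; exact: sqr_ge0.
  rewrite leNgt; apply/negP => x1.
  have : q * ((1 - D * (kap m)^-1 ^+ 2) * #|supp (beta0 m)|%:R) <= 0.
    by rewrite mulr_ge0_le0 ?(ltW q0)// mulr_le0_ge0// ltW.
  by move: slack x0; lra.
rewrite sqr_sqrtr ?(ltW k0)//; apply: lerB; first apply: lerB => //.
  have : 1 - cond_prob (P m) (E1 m) [set w | precision_nbhd (Omega0 m) (L' m) (C2 * a m) (Omegahat m w)]
     <= M * (p m)%:R `^ (- c2) by near: m.
  lra.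
apply: design_failure_le => //.
- by near: m.
- by near: m.
Unshelve. all: by end_near.
Qed.
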